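(* Let $k\ge 3$ and let $\mathbf{a}$ be a billiard sequence. For an anticlockwise-labeled right-angled hyperbolic $2k$-gon $P$, let $L_{\mathrm{avg}}(\mathbf{a},P)$ denote the average of the hyperbolic lengths of the closed billiard trajectories in $\gamma_{\mathbf{a},P}$, the family of all closed billiard trajectories in $P$ that are cyclically related to the billiard sequence $\mathbf{a}$. Then, as a function of $P$ ranging over right-angled hyperbolic $2k$-gons, $L_{\mathrm{avg}}(\mathbf{a},P)$ is uniquely minimised by the regular right-angled $2k$-gon $P_0$: $L_{\mathrm{avg}}(\mathbf{a},P_0)\le L_{\mathrm{avg}}(\mathbf{a},P)$ for every such $P$, with equality only if $P$ is isometric to $P_0$.
   Context: All polygons lie in the hyperbolic plane (Poincaré disc). A billiard trajectory in a polygon $P$ is a piecewise geodesic path in $P$ whose vertices lie on edges of $P$ and which, at each such vertex, makes equal angles with that edge on both sides (angle of incidence equals angle of reflection). It is closed if it returns to its starting point with the same direction after finite time. If the sides of $P$ are labeled $1,\dots,2k$ in anticlockwise order, the billiard sequence of a closed billiard trajectory $\gamma$ is the cyclic list $(a_0,\dots,a_{n-1})$ of labels of the sides successively hit by $\gamma$; in hyperbolic geometry a billiard sequence determines the closed billiard trajectory uniquely. Two closed billiard trajectories are cyclically related if there are two anticlockwise labelings of $P$ (i.e. labelings differing by a cyclic shift) with respect to which they have the same billiard sequence. $\gamma_{\mathbf{a},P}$ denotes the finite collection of all closed billiard trajectories in $P$ which have billiard sequence $\mathbf{a}$ with respect to some anticlockwise labeling of $P$. A right-angled polygon is one all of whose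 interior angles equal $\pi/2$; the regular right-angled $2k$-gon is the one with all sides of equal length. *)

(* Defs.v *)
From Stdlib Require Import Reals Lra Lia List.
Open Scope R_scope.

(** Points of the plane R^2; the Poincare disc is the open unit disc. *)
Definition point := (R * R)%type.
Definition nsq (z : point) : R := fst z ^ 2 + snd z ^ 2.
Definition in_disc (z : point) : Prop := nsq z < 1.

(** Auxiliary: the standard isometric lift of the disc to the hyperboloid
    { x | -x0^2 + x1^2 + x2^2 = -1, x0 > 0 } in Minkowski space R^{2,1}. *)
Definition vec3 := (R * R * R)%type.
Definition lift (z : point) : vec3 :=
  let s := nsq z in ((1 + s) / (1 - s), 2 * fst z / (1 - s), 2 * snd z / (1 - s)).
Definition mink (u v : vec3) : R :=
  let '(u0, u1, u2) := u in let '(v0, v1, v2) := v in - u0 * v0 + u1 * v1 + u2 * v2.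
Definition vadd (u v : vec3) : vec3 :=
  let '(u0, u1, u2) := u in let '(v0, v1, v2) := v in (u0 + v0, u1 + v1, u2 + v2).
Definition vscal (c : R) (u : vec3) : vec3 :=
  let '(u0, u1, u2) := u in (c * u0, c * u1, c * u2).
Definition det3 (u v w : vec3) : R :=
  let '(u0, u1, u2) := u in let '(v0, v1, v2) := v in let '(w0, w1, w2) := w in
  u0 * (v1 * w2 - v2 * w1) - u1 * (v0 * w2 - v2 * w0) + u2 * (v0 * w1 - v1 * w0).

Definition acosh (x : R) : R := ln (x + sqrt (x ^ 2 - 1)).

(** Hyperbolic distance in the disc:
    cosh d(z,w) = 1 + 2|z-w|^2 / ((1-|z|^2)(1-|w|^2)). *)
Definition hdist (z w : point) : R := acosh (- mink (lift z) (lift w)).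

(** Unit-free tangent vector at p of the geodesic from p towards q. *)
Definition tangent (p q : point) : vec3 :=
  vadd (lift q) (vscal (mink (lift p) (lift q)) (lift p)).

(** Hyperbolic (= Euclidean, by conformality) angle at p between the geodesic
    segments [p,q] and [p,r], in [0, PI]. *)
Definition hangle (p q r : point) : R :=
  let tq := tangent p q in let tr := tangent p r in
  acos (mink tq tr / sqrt (mink tq tq * mink tr tr)).

(** Orientation: positive iff (a, b, c) are in anticlockwise order
    (c lies strictly to the left of the oriented geodesic from a to b). *)
Definition orient (a b c : point) : R := det3 (lift a) (lift b) (lift c).

(** * Polygons
    A 2k-gon is given by its vertices v 0, ..., v (2k-1) (as a function on nat,
    only the values below 2k matter).  Side j (j < 2k) is the geodesic segment
    from v j to v (j+1 mod 2k); the sides are labeled 0, ..., 2k-1 in this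
    anticlockwise order (0-based version of the labels 1..2k). *)
Definition nxt (k i : nat) : nat := (S i) mod (2 * k).
Definition prv (k i : nat) : nat := (i + 2 * k - 1) mod (2 * k).

Definition convex_polygon (k : nat) (v : nat -> point) : Prop :=
  (forall i, (i < 2 * k)%nat -> in_disc (v i)) /\
  (forall i j, (i < 2 * k)%nat -> (j < 2 * k)%nat -> j <> i -> j <> nxt k i ->
     orient (v i) (v (nxt k i)) (v j) > 0).

Definition right_angled (k : nat) (v : nat -> point) : Prop :=
  convex_polygon k v /\
  (forall i, (i < 2 * k)%nat -> hangle (v i) (v (prv k i)) (v (nxt k i)) = PI / 2).

Definition regular (k : nat) (v : nat -> point) : Prop :=
  forall i, (i < 2 * k)%nat -> hdist (v i) (v (nxt k i)) = hdist (v 0%nat) (v 1%nat).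

Definition region (k : nat) (v : nat -> point) (z : point) : Prop :=
  in_disc z /\ forall i, (i < 2 * k)%nat -> orient (v i) (v (nxt k i)) z >= 0.

Definition is_isometry (f : point -> point) : Prop :=
  (forall z, in_disc z -> in_disc (f z)) /\
  (forall z w, in_disc z -> in_disc w -> hdist (f z) (f w) = hdist z w).

Definition isometric (k : nat) (v w : nat -> point) : Prop :=
  exists f, is_isometry f /\
    forall z, region k w z <-> exists y, region k v y /\ f y = z.

Definition on_side (k : nat) (v : nat -> point) (j : nat) (p : point) : Prop :=
  in_disc p /\ p <> v j /\ p <> v (nxt k j) /\
  hdist (v j) p + hdist p (v (nxt k j)) = hdist (v j) (v (nxt k j)).

(** * Closed billiard trajectories
    A closed billiard trajectory is described by its cyclic list of bounce
    points ps = [p_0; ...; p_(n-1)]: the trajectory is the closed piecewise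
    geodesic path p_0 -> p_1 -> ... -> p_(n-1) -> p_0.  The list s records the
    label of the side hit at each bounce (its billiard sequence). *)
Definition closed_traj (k : nat) (v : nat -> point) (s : list nat) (ps : list point)
  : Prop :=
  let n := length s in
  length ps = n /\ (1 <= n)%nat /\
  forall i, (i < n)%nat ->
    let j := nth i s 0%nat in
    let p := nth i ps (0, 0) in
    let q := nth ((i + n - 1) mod n) ps (0, 0) in
    let r := nth ((S i) mod n) ps (0, 0) in
    (j < 2 * k)%nat /\ on_side k v j p /\ p <> r /\
    (* angle of incidence = angle of reflection, measured with the two
       halves of the edge on either side of p *)
    hangle p q (v j) = hangle p r (v (nxt k j)).

Definition rotl {A : Type} (m : nat) (l : list A) : list A :=
  skipn m l ++ firstn m l.

Definition shift_labels (k r : nat) (s : list nat) : list nat :=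
  map (fun x => (x + r) mod (2 * k))%nat s.

Definition billiard_sequence (k : nat) (a : list nat) : Prop :=
  exists v ps, right_angled k v /\ closed_traj k v a ps.

(** Membership in gamma_{a,P}: closed billiard trajectories whose billiard
    sequence w.r.t. some anticlockwise labeling equals a as a cyclic list. *)
Definition in_gamma (k : nat) (v : nat -> point) (a : list nat) (ps : list point)
  : Prop :=
  exists s, closed_traj k v s ps /\
    exists r m, shift_labels k r s = rotl m a.

Definition same_traj (ps ps' : list point) : Prop := exists m, ps' = rotl m ps.

Fixpoint sumR (l : list R) : R := match l with nil => 0 | x :: l' => x + sumR l' end.
Definition traj_length (ps : list point) : R :=
  let n := length ps in
  sumR (map (fun i => hdist (nth i ps (0, 0)) (nth ((S i) mod n) ps (0, 0))) (seq 0 n)).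

(** L is the average length L_avg(a,P) of the trajectories in gamma_{a,P}:
    T lists every trajectory of gamma_{a,P} exactly once (up to choice of
    starting bounce), gamma_{a,P} is nonempty, and L is the mean length. *)
Definition avg_length (k : nat) (v : nat -> point) (a : list nat) (L : R) : Prop :=
  exists T : list (list point),
    T <> nil /\
    (forall ps, In ps T -> in_gamma k v a ps) /\
    (forall ps, in_gamma k v a ps -> exists ps', In ps' T /\ same_traj ps' ps) /\
    (forall i j, (i < length T)%nat -> (j < length T)%nat -> i <> j ->
       ~ same_traj (nth i T nil) (nth j T nil)) /\
    L = sumR (map traj_length T) / INR (length T).

(* Main.v *)
Require Import Defs.
From Stdlib Require Import Reals Ranalysis5 Lra Lia List Wf_nat.
From Stdlib Require Import FunctionalExtensionality ClassicalEpsilon.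
Import ListNotations.
Open Scope R_scope.
Open Scope bool_scope.

(** Lift the disc to the hyperboloid.  With the inward unit normals [m i] of the sides of a
    right-angled polygon, consecutive normals are orthogonal and all other pairs satisfy
    [- mink (m i) (m j) = cosh d_ij >= 1], [d_ij] being the distance between the two lines.

    The reflections in the sides generate a right-angled Coxeter group.  Every entry of a word applied
    to a nonnegative vector is, up to a descent of the word, a function of the [d_ij] built from
    [cosh] by sums and products, hence nonnegative, monotone and log-convex.  For the word of a
    billiard trajectory this entry grows like [exp] of the length travelled.

    Relations between the distances of the sides [i], [i+1], [j], [j+1] show that the mean of
    [d_(i,i+j)] over [i] is at least its value for the regular polygon, strictly unless all sides are
    equal.  Log-convexity (Jensen) and monotonicity then bound the average over all cyclic labellings
    of the growth exponents below by the exponent in the regular polygon; in the strict case the gain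
    is exponential in the number of bounces.

    That the same billiard words are realised in every right-angled polygon is shown by deforming one
    polygon into another: whether the axis of a word separates two neighbouring vertices is read off
    from traces, and a trace can only vanish if a word acts trivially, which by faithfulness of the
    Coxeter representation would already happen in the polygon where the trajectory is given. *)

(** * Hyperbolic functions and finite sums *)

(** The distances between the sides of one polygon satisfy relations, and their means over all
    rotations need not come from any polygon. Words are therefore evaluated at free parameters, and
    the sign of an entry is decided combinatorially, for all parameters at once; evaluating it on
    one trajectory in one polygon is then enough to know it everywhere, in particular at the mean
    distances. Lengths are only read off asymptotically: along N periods the entries are compared
    with exp of the length up to a constant factor, which disappears after taking logarithms and
    dividing by N. Hence a strict increase of the entries is of no help unless it is exponential in
    N. It is obtained by moving from the regular parameters towards the mean ones by the fraction
    1/M only, M being the number of letters: each letter then contributes a relative gain of order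
    1/M, together a fixed factor, and log-convexity raises this factor to a power of order M on the
    whole segment. *)

Lemma exp_mul_neg (x : R) : exp x * exp (- x) = 1.
Proof. rewrite <- exp_plus, Rplus_opp_r; apply exp_0. Qed.

Lemma cosh_add (x y : R) : cosh (x + y) = cosh x * cosh y + sinh x * sinh y.
Proof. unfold cosh, sinh. rewrite Ropp_plus_distr, !exp_plus. field. Qed.

Lemma sinh_add (x y : R) : sinh (x + y) = sinh x * cosh y + cosh x * sinh y.
Proof. unfold cosh, sinh. rewrite Ropp_plus_distr, !exp_plus. field. Qed.

Lemma cosh_opp (x : R) : cosh (- x) = cosh x.
Proof. unfold cosh; rewrite Ropp_involutive; lra. Qed.

Lemma sinh_opp (x : R) : sinh (- x) = - sinh x.
Proof. unfold sinh; rewrite Ropp_involutive; lra. Qed.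

Lemma cosh_sub (x y : R) : cosh (x - y) = cosh x * cosh y - sinh x * sinh y.
Proof. unfold Rminus at 1; rewrite cosh_add, cosh_opp, sinh_opp; ring. Qed.

Lemma cosh_sq (x : R) : cosh x * cosh x = 1 + sinh x * sinh x.
Proof. unfold cosh, sinh. pose proof (exp_mul_neg x). nra. Qed.

Lemma cosh_double (x : R) : cosh (2 * x) = 2 * (cosh x * cosh x) - 1.
Proof.
  replace (2 * x) with (x + x) by ring.
  rewrite cosh_add. pose proof (cosh_sq x). lra.
Qed.

Lemma cosh_ge_1 (x : R) : 1 <= cosh x.
Proof.
  unfold cosh. pose proof (exp_mul_neg x). pose proof (exp_pos x). pose proof (exp_pos (- x)).
  pose proof (Rle_0_sqr (exp x - 1)). unfold Rsqr in *.
  apply (Rmult_le_reg_l (exp x)); [lra |]. nra.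
Qed.

Lemma sinh_nonneg (x : R) : 0 <= x -> 0 <= sinh x.
Proof.
  intros [H | <-]; [left | rewrite sinh_0; lra].
  rewrite <- sinh_0. apply sinh_lt. exact H.
Qed.

Lemma sinh_positive (x : R) : 0 < x -> 0 < sinh x.
Proof. intros H. rewrite <- sinh_0. apply sinh_lt. exact H. Qed.

Lemma sinh_lt_cosh (x : R) : sinh x < cosh x.
Proof. unfold sinh, cosh. pose proof (exp_pos (- x)). lra. Qed.

Lemma cosh_le (x y : R) : 0 <= x -> x <= y -> cosh x <= cosh y.
Proof.
  intros Hx Hxy. pose proof (cosh_sq x). pose proof (cosh_sq y).
  pose proof (sinh_nonneg x Hx).
  assert (sinh x <= sinh y).
  { destruct Hxy as [Hxy | ->]; [left; apply sinh_lt; exact Hxy | lra]. }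
  pose proof (cosh_ge_1 x). pose proof (cosh_ge_1 y). nra.
Qed.

Lemma cosh_lt (x y : R) : 0 <= x -> x < y -> cosh x < cosh y.
Proof.
  intros Hx Hxy. pose proof (cosh_sq x). pose proof (cosh_sq y).
  pose proof (sinh_nonneg x Hx). pose proof (sinh_lt x y Hxy).
  pose proof (cosh_ge_1 x). pose proof (cosh_ge_1 y). nra.
Qed.

Lemma cosh_le_inv (x y : R) : 0 <= y -> cosh x <= cosh y -> x <= y.
Proof.
  intros Hy H. destruct (Rle_or_lt x y) as [h | h]; [exact h |].
  pose proof (cosh_lt y x Hy h). lra.
Qed.

Lemma cosh_inj (x y : R) : 0 <= x -> 0 <= y -> cosh x = cosh y -> x = y.
Proof. intros Hx Hy H. apply Rle_antisym; apply cosh_le_inv; lra. Qed.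

Lemma cosh_Rabs (x : R) : cosh (Rabs x) = cosh x.
Proof. unfold Rabs; destruct (Rcase_abs x); [apply cosh_opp | reflexivity]. Qed.

Lemma cosh_le_exp (x : R) : 0 <= x -> cosh x <= exp x.
Proof.
  intros Hx. unfold cosh. assert (exp (- x) <= exp x); [| lra].
  destruct Hx as [Hx | <-]; [left; apply exp_increasing; lra | rewrite Ropp_0; lra].
Qed.

Lemma cosh_acosh (x : R) : 1 <= x -> cosh (acosh x) = x.
Proof.
  intros H. unfold acosh, cosh.
  assert (Hs : 0 <= x ^ 2 - 1) by nra.
  pose proof (sqrt_pos (x ^ 2 - 1)). pose proof (sqrt_sqrt _ Hs) as Hq.
  set (s := sqrt (x ^ 2 - 1)) in *.
  rewrite exp_Ropp, exp_ln by lra. field_simplify_eq; [nra | lra].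
Qed.

Lemma acosh_nonneg (x : R) : 1 <= x -> 0 <= acosh x.
Proof.
  intros H. unfold acosh. rewrite <- ln_1.
  pose proof (sqrt_pos (x ^ 2 - 1)).
  destruct (Req_dec (x + sqrt (x ^ 2 - 1)) 1) as [e | e]; [rewrite e; lra |].
  left. apply ln_increasing; lra.
Qed.

Lemma acosh_cosh (t : R) : 0 <= t -> acosh (cosh t) = t.
Proof.
  intros H. apply cosh_inj; [apply acosh_nonneg, cosh_ge_1 | exact H |].
  apply cosh_acosh, cosh_ge_1.
Qed.

Lemma sinh_acosh_sq (x : R) : 1 <= x -> sinh (acosh x) * sinh (acosh x) = x * x - 1.
Proof. intros H. pose proof (cosh_sq (acosh x)) as h. rewrite cosh_acosh in h; lra. Qed.

Lemma acosh_pos (x : R) : 1 < x -> 0 < acosh x.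
Proof.
  intros H. destruct (acosh_nonneg x) as [h | h]; [lra | exact h |].
  exfalso. pose proof (cosh_acosh x). rewrite <- h, cosh_0 in H0. lra.
Qed.

Fixpoint rsum (n : nat) (f : nat -> R) : R :=
  match n with O => 0 | S n' => rsum n' f + f n' end.

Lemma rsum_ext (n : nat) (f g : nat -> R) :
  (forall i, (i < n)%nat -> f i = g i) -> rsum n f = rsum n g.
Proof. induction n; simpl; intros H; [reflexivity |]. rewrite IHn, H by auto. reflexivity. Qed.

Lemma rsum_plus (n : nat) (f g : nat -> R) :
  rsum n (fun i => f i + g i) = rsum n f + rsum n g.
Proof. induction n; simpl; [lra |]. rewrite IHn; ring. Qed.

Lemma rsum_scal (n : nat) (c : R) (f : nat -> R) :
  rsum n (fun i => c * f i) = c * rsum n f.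
Proof. induction n; simpl; [lra |]. rewrite IHn; ring. Qed.

Lemma rsum_const (n : nat) (c : R) : rsum n (fun _ => c) = INR n * c.
Proof.
  induction n; [simpl; lra |]. change (rsum (S n) (fun _ => c)) with (rsum n (fun _ => c) + c).
  rewrite IHn, S_INR; ring.
Qed.

Lemma rsum_le (n : nat) (f g : nat -> R) :
  (forall i, (i < n)%nat -> f i <= g i) -> rsum n f <= rsum n g.
Proof.
  induction n; simpl; intros H; [lra |].
  apply Rplus_le_compat; [apply IHn; auto | apply H; auto].
Qed.

Lemma rsum_le_eq (n : nat) (f g : nat -> R) :
  (forall i, (i < n)%nat -> f i <= g i) -> rsum n f = rsum n g ->
  forall i, (i < n)%nat -> f i = g i.
Proof.
  induction n; simpl; intros H He i Hi; [lia |].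
  assert (H1 : rsum n f <= rsum n g) by (apply rsum_le; auto).
  pose proof (H n (Nat.lt_succ_diag_r n)).
  destruct (Nat.eq_dec i n) as [-> | Hn]; [lra |].
  apply IHn; [auto | lra | lia].
Qed.

Lemma rsum_add (a b : nat) (f : nat -> R) :
  rsum (a + b) f = rsum a f + rsum b (fun i => f (a + i)%nat).
Proof.
  induction b; simpl; [rewrite Nat.add_0_r; lra |].
  rewrite Nat.add_succ_r. simpl. rewrite IHb. ring.
Qed.

Lemma rsum_shift1 (n : nat) (f : nat -> R) :
  f n = f O -> rsum n (fun i => f (S i)) = rsum n f.
Proof.
  intros H. assert (h : rsum (1 + n) f = rsum n f + f n) by reflexivity.
  rewrite rsum_add in h. simpl in h. lra.
Qed.

Lemma rsum_shift (n s : nat) (f : nat -> R) :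
  (forall i, f (i + n)%nat = f i) -> rsum n (fun i => f (i + s)%nat) = rsum n f.
Proof.
  intros H. induction s as [| s IH].
  - apply rsum_ext; intros; rewrite Nat.add_0_r; reflexivity.
  - rewrite <- IH.
    transitivity (rsum n (fun i => (fun i => f (i + s)%nat) (S i))).
    + apply rsum_ext; intros; f_equal; lia.
    + apply (rsum_shift1 n (fun i => f (i + s)%nat)). simpl. rewrite Nat.add_comm. apply H.
Qed.

Lemma rsum_period_mul (n q : nat) (f : nat -> R) :
  (forall i, f (i + q)%nat = f i) -> rsum (n * q) f = INR n * rsum q f.
Proof.
  intros H. induction n as [| n IH]; [simpl; lra |].
  rewrite S_INR. replace (S n * q)%nat with (n * q + q)%nat by lia.
  rewrite rsum_add, IH.
  replace (rsum q (fun i => f (n * q + i)%nat)) with (rsum q f); [ring |].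
  apply rsum_ext; intros i _. clear IH. induction n as [| n IHn]; [reflexivity |].
  rewrite IHn, <- (H (n * q + i)%nat). f_equal; lia.
Qed.

(** Tangent-line inequality for the convex function [acosh (cosh x + cosh y)];
    since [p + q <= 1] it follows from the convexity of [exp]. *)
Lemma acosh_sum_tangent (x0 y0 t0 x y t : R) :
  0 <= x0 -> 0 <= y0 -> 0 < t0 -> 0 <= t ->
  cosh t0 = cosh x0 + cosh y0 -> cosh x + cosh y <= cosh t ->
  t0 + sinh x0 / sinh t0 * (x - x0) + sinh y0 / sinh t0 * (y - y0) <= t.
Proof.
  intros Hx0 Hy0 Ht0 Ht H0 H.
  set (p := sinh x0 / sinh t0). set (q := sinh y0 / sinh t0).
  pose proof (sinh_positive t0 Ht0) as Hs.
  pose proof (sinh_nonneg x0 Hx0) as Hsx. pose proof (sinh_nonneg y0 Hy0) as Hsy.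
  assert (Hp : p * sinh t0 = sinh x0) by (unfold p; field; lra).
  assert (Hq : q * sinh t0 = sinh y0) by (unfold q; field; lra).
  assert (Hp0 : 0 <= p) by (unfold p; apply Rmult_le_pos; [lra | left; apply Rinv_0_lt_compat; lra]).
  assert (Hq0 : 0 <= q) by (unfold q; apply Rmult_le_pos; [lra | left; apply Rinv_0_lt_compat; lra]).
  pose proof (cosh_sq t0). pose proof (cosh_sq x0). pose proof (cosh_sq y0).
  pose proof (cosh_ge_1 x0). pose proof (cosh_ge_1 y0). pose proof (cosh_ge_1 t0).
  assert (Hpq : p + q <= 1).
  { assert (sinh x0 * sinh y0 <= cosh x0 * cosh y0).
    { pose proof (sinh_lt_cosh x0). pose proof (sinh_lt_cosh y0).
      apply Rmult_le_compat; lra. }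
    assert (Hst : sinh t0 * sinh t0 = (cosh x0 + cosh y0) * (cosh x0 + cosh y0) - 1)
      by (rewrite <- H0; lra).
    apply (Rmult_le_reg_r (sinh t0)); [exact Hs |].
    replace ((p + q) * sinh t0) with (sinh x0 + sinh y0) by lra. rewrite Rmult_1_l.
    apply Rsqr_incr_0; unfold Rsqr; nra. }
  set (X := x - x0). set (Y := y - y0). set (Z := p * X + q * Y).
  destruct (Rle_or_lt (t0 + Z) t) as [h | h]; [unfold Z in h; lra | exfalso].
  assert (Hc : cosh t < cosh (t0 + Z)) by (apply cosh_lt; lra).
  assert (Hexp : forall X Y, exp (p * X + q * Y) <= p * exp X + q * exp Y + (1 - p - q)).
  { intros X' Y'. set (W := p * X' + q * Y').
    assert (A : forall u, exp W * (1 + (u - W)) <= exp u).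
    { intros u. replace u with (W + (u - W)) at 2 by ring. rewrite exp_plus.
      apply Rmult_le_compat_l; [left; apply exp_pos |].
      destruct (Req_dec (u - W) 0) as [e | e]; [rewrite e, exp_0; lra |].
      left. apply exp_ineq1. exact e. }
    pose proof (A X') as A1. pose proof (A Y') as A2. pose proof (A 0) as A3. rewrite exp_0 in A3.
    pose proof (Rmult_le_compat_l p _ _ Hp0 A1). pose proof (Rmult_le_compat_l q _ _ Hq0 A2).
    assert (Hr : 0 <= 1 - p - q) by lra. pose proof (Rmult_le_compat_l _ _ _ Hr A3).
    replace (exp W) with (p * (exp W * (1 + (X' - W))) + q * (exp W * (1 + (Y' - W)))
      + (1 - p - q) * (exp W * (1 + (0 - W)))) by (unfold W; ring).
    lra. }
  assert (Hub : cosh (t0 + Z) <=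
     (exp t0 * (p * exp X + q * exp Y + (1 - p - q)) +
      exp (- t0) * (p * exp (- X) + q * exp (- Y) + (1 - p - q))) / 2).
  { unfold cosh. rewrite Ropp_plus_distr, !exp_plus.
    assert (exp Z <= p * exp X + q * exp Y + (1 - p - q)) by apply Hexp.
    assert (exp (- Z) <= p * exp (- X) + q * exp (- Y) + (1 - p - q)).
    { replace (- Z) with (p * (- X) + q * (- Y)) by (unfold Z; ring). apply Hexp. }
    pose proof (exp_pos t0). pose proof (exp_pos (- t0)). nra. }
  (* Since sinh a = pa sinh t0, the terms with sinh A agree on both sides. What remains is pa cosh
     t0 (cosh A - 1) <= cosh a (cosh A - 1), so pa cosh t0 <= cosh a is enough. *)
  assert (K : forall a pa A, sinh a = pa * sinh t0 -> 0 <= a -> 0 <= pa -> cosh a <= cosh t0 ->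
     (exp t0 * (pa * exp A) + exp (- t0) * (pa * exp (- A))) / 2
       <= cosh (a + A) - cosh a + pa * cosh t0).
  { intros a pa A Ha Ha0 Hpa Hca. rewrite cosh_add.
    assert (E1 : exp A = cosh A + sinh A) by (unfold cosh, sinh; field).
    assert (E2 : exp (- A) = cosh A - sinh A) by (unfold cosh, sinh; field).
    assert (E3 : exp t0 = cosh t0 + sinh t0) by (unfold cosh, sinh; field).
    assert (E4 : exp (- t0) = cosh t0 - sinh t0) by (unfold cosh, sinh; field).
    rewrite E1, E2, E3, E4, Ha.
    assert (Hle : pa * cosh t0 <= cosh a).
    { pose proof (cosh_sq a). pose proof (cosh_ge_1 a).
      assert (pa <= 1).
      { assert (sinh a <= sinh t0); [| nra].
        destruct (Req_dec a t0) as [-> | ne]; [lra |].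
        left; apply sinh_lt. pose proof (cosh_le_inv a t0). lra. }
      assert (pa * pa * (cosh t0 * cosh t0) <= cosh a * cosh a).
      { rewrite (cosh_sq t0), (cosh_sq a), Ha. nra. }
      assert (0 <= pa * cosh t0) by nra. nra. }
    pose proof (cosh_ge_1 A). nra. }
  pose proof (K x0 p X) as K1. pose proof (K y0 q Y) as K2.
  replace (x0 + X) with x in K1 by (unfold X; ring).
  replace (y0 + Y) with y in K2 by (unfold Y; ring).
  specialize (K1 (eq_sym Hp) Hx0 Hp0 ltac:(lra)).
  specialize (K2 (eq_sym Hq) Hy0 Hq0 ltac:(lra)).
  assert (E : (exp t0 * (1 - p - q) + exp (- t0) * (1 - p - q)) / 2 = (1 - p - q) * cosh t0)
    by (unfold cosh; field).
  nra.
Qed.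

Definition mean (n : nat) (f : nat -> R) : R := rsum n f / INR n.

Lemma mean_const_mul (n : nat) (f : nat -> R) : (0 < n)%nat -> rsum n f = INR n * mean n f.
Proof. intros H. unfold mean. field. apply not_0_INR; lia. Qed.

Lemma mean_nonneg (n : nat) (f : nat -> R) :
  (0 < n)%nat -> (forall i, (i < n)%nat -> 0 <= f i) -> 0 <= mean n f.
Proof.
  intros Hn H. unfold mean. apply Rmult_le_pos.
  - replace 0 with (rsum n (fun _ => 0)) by (rewrite rsum_const; ring).
    apply rsum_le; exact H.
  - left; apply Rinv_0_lt_compat, lt_0_INR; exact Hn.
Qed.

(** Jensen's inequality for [acosh (cosh x + cosh y)]: when the tangent inequalities at the means
    are summed over i, their linear terms cancel. In the equality case each of them is an equality,
    and [acosh (cosh (x i) + cosh (y i))] is squeezed between the tangent and [t i]. *)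
Lemma cosh_mean_sum (n : nat) (x y t : nat -> R) :
  (0 < n)%nat ->
  (forall i, (i < n)%nat -> 0 <= x i) -> (forall i, (i < n)%nat -> 0 <= y i) ->
  (forall i, (i < n)%nat -> 0 <= t i) ->
  (forall i, (i < n)%nat -> cosh (x i) + cosh (y i) <= cosh (t i)) ->
  cosh (mean n x) + cosh (mean n y) <= cosh (mean n t) /\
  (cosh (mean n x) + cosh (mean n y) = cosh (mean n t) ->
   forall i, (i < n)%nat -> cosh (x i) + cosh (y i) = cosh (t i)).
Proof.
  intros Hn Hx Hy Ht H.
  pose proof (mean_nonneg n x Hn Hx) as Hx0. pose proof (mean_nonneg n y Hn Hy) as Hy0.
  pose proof (mean_nonneg n t Hn Ht) as Htm.
  set (x0 := mean n x) in *. set (y0 := mean n y) in *.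
  pose proof (cosh_ge_1 x0) as c1. pose proof (cosh_ge_1 y0) as c2.
  set (t0 := acosh (cosh x0 + cosh y0)).
  assert (Ht0 : cosh t0 = cosh x0 + cosh y0) by (apply cosh_acosh; lra).
  assert (Hpos : 0 < t0) by (apply acosh_pos; lra).
  set (L := fun i => t0 + sinh x0 / sinh t0 * (x i - x0) + sinh y0 / sinh t0 * (y i - y0)).
  assert (HL : forall i, (i < n)%nat -> L i <= t i).
  { intros i Hi. apply acosh_sum_tangent; auto. }
  assert (HS : rsum n L = INR n * t0).
  { transitivity (rsum n (fun i => (t0 - sinh x0 / sinh t0 * x0 - sinh y0 / sinh t0 * y0)
       + (sinh x0 / sinh t0 * x i + sinh y0 / sinh t0 * y i))).
    - apply rsum_ext; intros; unfold L; ring.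
    - rewrite !rsum_plus, !rsum_scal, rsum_const, (mean_const_mul n x), (mean_const_mul n y) by exact Hn.
      fold x0 y0. ring. }
  pose proof (rsum_le n L t HL) as Hle.
  rewrite HS, (mean_const_mul n t Hn) in Hle.
  assert (HnR : 0 < INR n) by (apply lt_0_INR; exact Hn).
  assert (Hle' : t0 <= mean n t) by (apply (Rmult_le_reg_l (INR n)); lra).
  split.
  - rewrite <- Ht0. apply cosh_le; lra.
  - intros He i Hi.
    assert (E0 : t0 = mean n t) by (apply cosh_inj; lra).
    assert (EL : L i = t i).
    { apply (rsum_le_eq n L t HL); [| exact Hi].
      rewrite HS, (mean_const_mul n t Hn), E0. reflexivity. }
    pose proof (cosh_ge_1 (x i)). pose proof (cosh_ge_1 (y i)).
    assert (h1 : cosh (acosh (cosh (x i) + cosh (y i))) = cosh (x i) + cosh (y i))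
      by (apply cosh_acosh; lra).
    assert (h2 : L i <= acosh (cosh (x i) + cosh (y i))).
    { apply acosh_sum_tangent; auto; [apply acosh_nonneg; lra | lra]. }
    assert (h3 : acosh (cosh (x i) + cosh (y i)) <= t i).
    { apply cosh_le_inv; [auto |]. rewrite h1. auto. }
    rewrite <- h1. f_equal. lra.
Qed.

(** * Sign dichotomy for words in a right-angled Coxeter group *)

Definition params := nat -> nat -> R.

Definition lincomb (a b : R) (d e : params) : params := fun i j => a * d i j + b * e i j.

Definition linear_form (l : params -> R) : Prop :=
  forall a b d e, l (lincomb a b d e) = a * l d + b * l e.

(** The class of functions of the line distances [d] to which the entries of words belong; it is closed
    under sums and products, and the tangent condition says that its members are log-convex. *)
Definition good (f : params -> R) : Prop :=
  (forall d, 0 <= f d) /\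
  (forall d e, (forall i j, 0 <= d i j <= e i j) -> f d <= f e) /\
  (forall d, exists l, linear_form l /\ forall e, f d * exp (l e - l d) <= f e).

Lemma good_ext (f g : params -> R) : (forall d, f d = g d) -> good f -> good g.
Proof. intros H. replace g with f; [auto | apply functional_extensionality, H]. Qed.

Lemma exp_convex_tangent (m u : R) : exp m * (1 + (u - m)) <= exp u.
Proof.
  replace u with (m + (u - m)) at 2 by ring. rewrite exp_plus.
  apply Rmult_le_compat_l; [left; apply exp_pos |].
  destruct (Req_dec (u - m) 0) as [e | e]; [rewrite e, exp_0; lra |].
  left. apply exp_ineq1. exact e.
Qed.

Lemma good_const (c : R) : 0 <= c -> good (fun _ => c).
Proof.
  intros H. repeat split; intros; try lra.
  exists (fun _ => 0). split; [intros a b d' e'; ring |].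
  intros _. rewrite Rminus_diag, exp_0. lra.
Qed.

(** The supporting form of the sum at d is the average of the two supporting forms with weights f d
    and g d, normalised to sum 1. If both values vanish, the zero form does. *)
Lemma good_plus (f g : params -> R) : good f -> good g -> good (fun d => f d + g d).
Proof.
  intros (f1 & f2 & f3) (g1 & g2 & g3). split; [| split].
  - intros d. pose proof (f1 d). pose proof (g1 d). lra.
  - intros d e H. pose proof (f2 d e H). pose proof (g2 d e H). lra.
  - intros d. destruct (f3 d) as (l & Hl & Hf). destruct (g3 d) as (l' & Hl' & Hg).
    pose proof (f1 d) as F. pose proof (g1 d) as G.
    destruct (Req_dec (f d + g d) 0) as [e0 | ne].
    + exists (fun _ => 0). split; [intros a b d' e'; ring |].
      intros e. rewrite e0. pose proof (f1 e). pose proof (g1 e). lra.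
    + set (s := f d / (f d + g d)). set (s' := g d / (f d + g d)).
      assert (S1 : s * (f d + g d) = f d) by (unfold s; field; lra).
      assert (S2 : s' * (f d + g d) = g d) by (unfold s'; field; lra).
      assert (S3 : s + s' = 1) by (unfold s, s'; field; lra).
      exists (fun e => s * l e + s' * l' e). split.
      { intros a b d' e'. rewrite Hl, Hl'. ring. }
      intros e. specialize (Hf e). specialize (Hg e).
      set (u := l e - l d) in *. set (v := l' e - l' d) in *.
      replace (s * l e + s' * l' e - (s * l d + s' * l' d)) with (s * u + s' * v)
        by (unfold u, v; ring).
      set (m := s * u + s' * v).
      pose proof (exp_convex_tangent m u) as A. pose proof (exp_convex_tangent m v) as B.
      pose proof (Rmult_le_compat_l _ _ _ F A) as A'.
      pose proof (Rmult_le_compat_l _ _ _ G B) as B'.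
      assert (E : (f d + g d) * exp m
        = f d * (exp m * (1 + (u - m))) + g d * (exp m * (1 + (v - m)))).
      { assert (E : (f d + g d) * m = f d * u + g d * v).
        { transitivity (s * (f d + g d) * u + s' * (f d + g d) * v); [unfold m; ring |].
          rewrite S1, S2. reflexivity. }
        transitivity (exp m * (f d + g d) + exp m * (f d * u + g d * v - (f d + g d) * m));
          [rewrite E; ring | ring]. }
      lra.
Qed.

Lemma good_mult (f g : params -> R) : good f -> good g -> good (fun d => f d * g d).
Proof.
  intros (f1 & f2 & f3) (g1 & g2 & g3). split; [| split].
  - intros d. apply Rmult_le_pos; auto.
  - intros d e H. apply Rmult_le_compat; auto.
  - intros d. destruct (f3 d) as (l & Hl & Hf). destruct (g3 d) as (l' & Hl' & Hg).
    exists (fun e => l e + l' e). split; [intros a b d' e'; rewrite Hl, Hl'; ring |].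
    intros e.
    replace (l e + l' e - (l d + l' d)) with ((l e - l d) + (l' e - l' d)) by ring.
    rewrite exp_plus.
    replace (f d * g d * (exp (l e - l d) * exp (l' e - l' d)))
      with ((f d * exp (l e - l d)) * (g d * exp (l' e - l' d))) by ring.
    apply Rmult_le_compat; auto; apply Rmult_le_pos; auto; left; apply exp_pos.
Qed.

(** The supporting form of log cosh at t has slope tanh t. The inequality is convexity of exp
    applied to the two exponentials in cosh (t + u), with weights proportional to exp t and exp (-
    t). *)
Lemma good_cosh (c : R) (i j : nat) : 0 <= c -> good (fun d => cosh (c * d i j)).
Proof.
  intros Hc. split; [| split].
  - intros d. pose proof (cosh_ge_1 (c * d i j)). lra.
  - intros d e H. destruct (H i j). apply cosh_le; [apply Rmult_le_pos; lra |].
    apply Rmult_le_compat_l; lra.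
  - intros d. set (t := c * d i j).
    pose proof (cosh_ge_1 t) as Ht.
    exists (fun e => sinh t / cosh t * (c * e i j)). split.
    { intros a b d' e'. unfold lincomb. ring. }
    intros e. set (u := c * e i j - t).
    replace (sinh t / cosh t * (c * e i j) - sinh t / cosh t * (c * d i j))
      with (sinh t / cosh t * u) by (unfold u, t; ring).
    replace (c * e i j) with (t + u) by (unfold u; ring).
    set (m := sinh t / cosh t * u).
    assert (E : m * cosh t = sinh t * u) by (unfold m; field; lra).
    pose proof (exp_convex_tangent m u) as A. pose proof (exp_convex_tangent m (- u)) as B.
    unfold cosh at 2. rewrite Ropp_plus_distr, !exp_plus.
    pose proof (exp_pos t). pose proof (exp_pos (- t)).
    pose proof (Rmult_le_compat_l (exp t) _ _ ltac:(lra) A).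
    pose proof (Rmult_le_compat_l (exp (- t)) _ _ ltac:(lra) B).
    replace (cosh t * exp m) with
      ((exp t * (exp m * (1 + (u - m))) + exp (- t) * (exp m * (1 + (- u - m)))) / 2); [lra |].
    transitivity (exp m * (cosh t + sinh t * u - m * cosh t)); [unfold cosh, sinh; field |].
    rewrite E. ring.
Qed.

(** Chebyshev polynomials of the second kind in cosh t, that is sinh ((i + 1) t) / sinh t; the
    recursion also covers t = 0. *)
Fixpoint cheb (i : nat) (t : R) : R :=
  match i with
  | O => 1
  | S i' => match i' with O => 2 * cosh t | S i'' => 2 * cosh t * cheb i' t - cheb i'' t end
  end.

Lemma cheb_SS (i : nat) (t : R) : cheb (S (S i)) t = 2 * cosh t * cheb (S i) t - cheb i t.
Proof. reflexivity. Qed.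

(** The recursion subtracts and so shows neither positivity nor monotonicity. The identity U_(i+2) =
    U_i + 2 T_(i+2) does, since it adds only cosh of multiples of t. Two consecutive cases are
    carried through the induction. *)
Lemma cheb_cosh (i : nat) (t : R) :
  cheb (S (S i)) t = cheb i t + 2 * cosh (INR (S (S i)) * t) /\
  cheb (S (S (S i))) t = cheb (S i) t + 2 * cosh (INR (S (S (S i))) * t).
Proof.
  assert (P : forall a b, 2 * cosh a * cosh b = cosh (a + b) + cosh (a - b)).
  { intros a b. rewrite cosh_add, cosh_sub. ring. }
  induction i as [| i [IH1 IH2]].
  - split; rewrite ?cheb_SS; simpl cheb; rewrite ?cheb_SS; simpl cheb.
    + replace (INR 2 * t) with (2 * t) by (simpl; ring). rewrite cosh_double. ring.
    + replace (INR 3 * t) with (2 * t + t) by (simpl; ring). rewrite cosh_add, cosh_double.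
      replace (2 * t) with (t + t) by ring. rewrite sinh_add.
      pose proof (f_equal (Rmult (cosh t)) (cosh_sq t)). lra.
  - split; [exact IH2 |].
    rewrite cheb_SS, IH2, IH1.
    replace (2 * cosh t * (cheb (S i) t + 2 * cosh (INR (S (S (S i))) * t)))
      with (2 * cosh t * cheb (S i) t + 2 * (2 * cosh (INR (S (S (S i))) * t) * cosh t)) by ring.
    rewrite P. pose proof IH1 as h. rewrite cheb_SS in h.
    replace (INR (S (S (S i))) * t + t) with (INR (S (S (S (S i)))) * t)
      by (rewrite (S_INR (S (S (S i)))); ring).
    replace (INR (S (S (S i))) * t - t) with (INR (S (S i)) * t)
      by (rewrite (S_INR (S (S i))); ring).
    lra.
Qed.

Lemma good_cheb (k i j : nat) : good (fun d => cheb k (d i j)).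
Proof.
  assert (A : forall c, 0 <= c -> good (fun d => 2 * cosh (c * d i j))).
  { intros c Hc. apply good_mult; [apply good_const; lra | apply good_cosh, Hc]. }
  assert (H : good (fun d => cheb k (d i j)) /\ good (fun d => cheb (S k) (d i j))); [| tauto].
  induction k as [| k [IH1 IH2]]; split; auto.
  - apply (good_const 1). lra.
  - simpl. apply (good_ext (fun d => 2 * cosh (1 * d i j))); [intros; now rewrite Rmult_1_l |].
    apply A. lra.
  - apply (good_ext (fun d => cheb k (d i j) + 2 * cosh (INR (S (S k)) * d i j))).
    + intros d. symmetry. apply cheb_cosh.
    + apply good_plus; [exact IH1 | apply A, pos_INR].
Qed.

(** * The reflection representation with free Gram parameters *)

Section Coxeter.

Variable adj : nat -> nat -> bool.
Hypothesis adj_sym : forall i j, adj i j = adj j i.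

(** Reading d only at (min, max) makes the matrix symmetric for every d, so no symmetry has to be
    imposed on parameters. *)
Definition gram (d : params) (i j : nat) : R :=
  if adj i j then 0 else cosh (d (Nat.min i j) (Nat.max i j)).

(** The reflection [u] acting on the values [g j = mink (m j) x] of a point on the wall normals, as if
    the entries of the Gram matrix were independent parameters. *)
Definition reflect (d : params) (u : nat) (g : nat -> R) : nat -> R :=
  fun j => if Nat.eq_dec j u then - g u else g j + 2 * gram d u j * g u.

(** The last letter of the list acts first. *)
Definition act (d : params) (s : list nat) (x : nat -> R) : nat -> R :=
  fold_right (reflect d) x s.

Definition positive_at (s : list nat) (j : nat) : Prop :=
  forall x, (forall i, 0 <= x i) -> good (fun d => act d s x j).

Lemma act_cons (d : params) (u : nat) (s : list nat) (x : nat -> R) :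
  act d (u :: s) x = reflect d u (act d s x).
Proof. reflexivity. Qed.

(** [j] is a left descent of [s]. *)
Definition negative_at (s : list nat) (j : nat) : Prop :=
  exists t, (length t < length s)%nat /\ positive_at t j /\
    forall d x, act d s x = reflect d j (act d t x).

Lemma gram_sym (d : params) (i j : nat) : gram d i j = gram d j i.
Proof. unfold gram. rewrite adj_sym, Nat.min_comm, Nat.max_comm. reflexivity. Qed.

Lemma reflect_self (d : params) (u : nat) (g : nat -> R) : reflect d u g u = - g u.
Proof. unfold reflect. destruct (Nat.eq_dec u u); [reflexivity | congruence]. Qed.

Lemma reflect_other (d : params) (u j : nat) (g : nat -> R) :
  j <> u -> reflect d u g j = g j + 2 * gram d u j * g u.
Proof. intros H. unfold reflect. destruct (Nat.eq_dec j u); [congruence | reflexivity]. Qed.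

Lemma reflect_involutive (d : params) (u : nat) (g : nat -> R) : reflect d u (reflect d u g) = g.
Proof.
  apply functional_extensionality. intros j. destruct (Nat.eq_dec j u) as [-> | n].
  - rewrite !reflect_self. ring.
  - rewrite (reflect_other d u j (reflect d u g) n), (reflect_other d u j g n), reflect_self. ring.
Qed.

Lemma reflect_commute (d : params) (u v : nat) (g : nat -> R) :
  adj u v = true -> reflect d u (reflect d v g) = reflect d v (reflect d u g).
Proof.
  intros H. assert (H0 : gram d u v = 0) by (unfold gram; rewrite H; reflexivity).
  assert (H1 : gram d v u = 0) by (rewrite gram_sym; exact H0).
  destruct (Nat.eq_dec u v) as [-> | nuv]; [reflexivity |].
  apply functional_extensionality. intros j.
  unfold reflect.
  repeat match goal with |- context [Nat.eq_dec ?a ?b] => destruct (Nat.eq_dec a b) end;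
    subst; try congruence; rewrite ?H0, ?H1; ring.
Qed.

Lemma good_gram (u j : nat) : good (fun d => 2 * gram d u j).
Proof.
  unfold gram. destruct (adj u j).
  - apply good_const; lra.
  - apply good_mult; [apply good_const; lra |].
    apply (good_ext (fun d => cosh (1 * d (Nat.min u j) (Nat.max u j))));
      [intros; now rewrite Rmult_1_l | apply good_cosh; lra].
Qed.

(** Alternating descents at two letters [a], [b] produce Chebyshev polynomials of the Gram entry. *)
Lemma dihedral (n : nat) :
  (forall s, (length s < n)%nat -> forall j, positive_at s j \/ negative_at s j) ->
  forall m t a b, (length t < n)%nat -> (length t <= m)%nat ->
  a <> b -> adj a b = false -> positive_at t a ->
  forall i x, (forall k, 0 <= x k) ->
  good (fun d => cheb (S i) (d (Nat.min a b) (Nat.max a b)) * act d t x a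
                 + cheb i (d (Nat.min a b) (Nat.max a b)) * act d t x b).
Proof.
  intros Hn m. induction m as [| m IH]; intros t a b Ht Htm Hab Hadj Ha i x Hx;
    destruct (Hn t Ht b) as [Hb | (t' & Hlen & Hb & E)].
  1, 3: apply good_plus; apply good_mult; try apply good_cheb; [apply Ha | apply Hb]; exact Hx.
  - lia.
  - apply (good_ext (fun d => cheb (S (S i)) (d (Nat.min b a) (Nat.max b a)) * act d t' x b
                 + cheb (S i) (d (Nat.min b a) (Nat.max b a)) * act d t' x a)).
    + intros d. rewrite E, reflect_self, reflect_other by exact Hab.
      rewrite gram_sym. unfold gram. rewrite Hadj, (Nat.min_comm b a), (Nat.max_comm b a), cheb_SS.
      ring.
    + apply IH; auto; try lia. rewrite adj_sym; exact Hadj.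
Qed.

(** Strong induction on the length of the word u :: s. If u is a descent of s, the two u cancel and
    a shorter word remains. Otherwise s is nonnegative at u: if s is also nonnegative at j, so is
    the sum, and if j is a descent of s commuting with u, it remains one. Only a descent j that does
    not commute with u leads to the infinite dihedral group of j and u. *)
Lemma sign_dichotomy_aux (n : nat) :
  forall s, (length s < n)%nat -> forall j, positive_at s j \/ negative_at s j.
Proof.
  induction n as [| n IH]; intros s Hs j; [lia |].
  destruct s as [| u s].
  { left. intros x Hx. apply (good_const (x j)), Hx. }
  simpl in Hs.
  destruct (IH s ltac:(lia) u) as [Hu | (t & Hlen & Hu & E)].
  2: { destruct (IH t ltac:(lia) j) as [Hj | (t' & Hlen' & Hj & E')].
       - left. intros x Hx. apply (good_ext (fun d => act d t x j)); [| apply Hj, Hx].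
         intros d. rewrite act_cons.
         rewrite E, reflect_involutive. reflexivity.
       - right. exists t'. cbn [length]. split; [lia |]. split; [exact Hj |].
         intros d x. rewrite act_cons.
         rewrite E, reflect_involutive. apply E'. }
  destruct (Nat.eq_dec j u) as [-> | Hju].
  { right. exists s. cbn [length]. split; [lia |]. split; [exact Hu |]. reflexivity. }
  destruct (IH s ltac:(lia) j) as [Hj | (t & Hlen & Hj & E)].
  { left. intros x Hx.
    apply (good_ext (fun d => act d s x j + 2 * gram d u j * act d s x u)).
    - intros d. symmetry. apply (reflect_other d u j (act d s x) Hju).
    - apply good_plus; [apply Hj, Hx | apply good_mult; [apply good_gram | apply Hu, Hx]]. }
  destruct (adj u j) eqn:Hadj.
  { right. exists (u :: t). cbn [length]. split; [lia |]. split.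
    - intros x Hx. apply (good_ext (fun d => act d t x j)); [| apply Hj, Hx].
      intros d. rewrite act_cons.
      rewrite reflect_other by exact Hju. unfold gram. rewrite Hadj. ring.
    - intros d x. rewrite act_cons. rewrite E.
      apply reflect_commute, Hadj. }
  (* With c the Gram entry of j and u, the value at j is (4 c^2 - 1) t_j + 2 c t_u. The coefficients
     are [cheb 2] and [cheb 1], so the dihedral lemma takes care of the minus sign. *)
  left. intros x Hx.
  apply (good_ext (fun d => cheb 2 (d (Nat.min j u) (Nat.max j u)) * act d t x j
                 + cheb 1 (d (Nat.min j u) (Nat.max j u)) * act d t x u)).
  - intros d. rewrite act_cons.
    rewrite reflect_other by exact Hju. rewrite E, reflect_self, reflect_other by auto.
    rewrite (gram_sym d j u). unfold gram. rewrite Hadj.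
    rewrite (Nat.min_comm j u), (Nat.max_comm j u), cheb_SS. simpl cheb. ring.
  - apply (dihedral n IH (length t)); auto; try lia. rewrite adj_sym; exact Hadj.
Qed.

Lemma sign_dichotomy (s : list nat) (j : nat) : positive_at s j \/ negative_at s j.
Proof. apply (sign_dichotomy_aux (S (length s))). lia. Qed.

Lemma negative_at_nonpos (s : list nat) (j : nat) (d : params) (x : nat -> R) :
  negative_at s j -> (forall i, 0 <= x i) -> act d s x j <= 0.
Proof.
  intros (t & _ & Hp & E) Hx. rewrite E, reflect_self.
  destruct (Hp x Hx) as (H & _). specialize (H d). lra.
Qed.

(** The sign belongs to the word and the letter alone: one strictly positive value at one parameter
    excludes a descent and thereby gives goodness in all parameters. *)
Lemma positive_at_of_pos (s : list nat) (j : nat) (d : params) (x : nat -> R) :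
  (forall i, 0 <= x i) -> 0 < act d s x j -> positive_at s j.
Proof.
  intros Hx H. destruct (sign_dichotomy s j) as [h | h]; [exact h |].
  pose proof (negative_at_nonpos s j d x h Hx). lra.
Qed.

(** The outermost letter u must be a descent of the rest of the word, since otherwise the coordinate
    of the image at u would be nonpositive, whereas x is positive there. Cancelling u shortens the
    word for all parameters simultaneously, until it is empty. *)
Lemma act_faithful (s : list nat) (d : params) (x : nat -> R) :
  (forall i, 0 < x i) -> act d s x = x -> forall e y, act e s y = y.
Proof.
  intros Hx. remember (length s) as n eqn:Hn. assert (Hle : (length s <= n)%nat) by lia. clear Hn.
  revert s Hle. induction n as [| n IH]; intros s Hle H e y; destruct s as [| u s]; simpl in Hle;
    try reflexivity; try lia.
  destruct (sign_dichotomy s u) as [h | (t & Hlen & Hp & E)].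
  - exfalso. assert (h' : 0 <= act d s x u).
    { destruct (h x) as (P & _); [intros i; left; apply Hx | apply P]. }
    assert (E : act d (u :: s) x u = x u) by (rewrite H; reflexivity).
    change (reflect d u (act d s x) u = x u) in E. rewrite reflect_self in E.
    specialize (Hx u). lra.
  - assert (E' : forall d' x', act d' (u :: s) x' = act d' t x').
    { intros d' x'. change (reflect d' u (act d' s x') = act d' t x').
      rewrite E, reflect_involutive. reflexivity. }
    rewrite E'. apply IH; [lia |]. rewrite <- E'. exact H.
Qed.

Lemma reflect_linear (d : params) (u : nat) (a b : R) (g h : nat -> R) :
  reflect d u (fun j => a * g j + b * h j) = fun j => a * reflect d u g j + b * reflect d u h j.
Proof.
  apply functional_extensionality. intros j. unfold reflect.
  destruct (Nat.eq_dec j u); ring.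
Qed.

Lemma act_linear (d : params) (s : list nat) (a b : R) (x y : nat -> R) :
  act d s (fun j => a * x j + b * y j) = fun j => a * act d s x j + b * act d s y j.
Proof.
  induction s as [| u s IH]; [reflexivity |].
  rewrite !act_cons, IH. apply reflect_linear.
Qed.

End Coxeter.

(** * Minkowski geometry *)

(** The Lorentzian cross product; its signs are those for which
    [mink (vcross u v) w = det3 u v w]. *)
Definition vcross (u v : vec3) : vec3 :=
  let '(u0, u1, u2) := u in let '(v0, v1, v2) := v in
  (u2 * v1 - u1 * v2, u2 * v0 - u0 * v2, u0 * v1 - u1 * v0).

Ltac vec := repeat (let y := fresh "y" in intro y);
  repeat match goal with v : vec3 |- _ => destruct v as [[? ?] ?] end;
  unfold mink, vadd, vscal, vcross, det3 in *.

Lemma vec_ext (x0 x1 x2 y0 y1 y2 : R) :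
  x0 = y0 -> x1 = y1 -> x2 = y2 -> ((x0, x1, x2) : vec3) = (y0, y1, y2).
Proof. congruence. Qed.

Ltac vring := vec; first [ring | apply vec_ext; ring].

Lemma mink_comm (u v : vec3) : mink u v = mink v u.
Proof. vring. Qed.
Lemma mink_add_l (u v w : vec3) : mink (vadd u v) w = mink u w + mink v w.
Proof. vring. Qed.
Lemma mink_add_r (u v w : vec3) : mink w (vadd u v) = mink w u + mink w v.
Proof. vring. Qed.
Lemma mink_scal_l (c : R) (u v : vec3) : mink (vscal c u) v = c * mink u v.
Proof. vring. Qed.
Lemma mink_scal_r (c : R) (u v : vec3) : mink u (vscal c v) = c * mink u v.
Proof. vring. Qed.
Ltac mexp := rewrite ?mink_add_l, ?mink_add_r, ?mink_scal_l, ?mink_scal_r,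
  ?mink_add_l, ?mink_add_r, ?mink_scal_l, ?mink_scal_r.
Lemma mink_cross (u v w : vec3) : mink (vcross u v) w = det3 u v w.
Proof. vring. Qed.
Lemma det3_rot (u v w : vec3) : det3 u v w = det3 v w u.
Proof. vring. Qed.
Lemma det3_swap (u v w : vec3) : det3 u v w = - det3 v u w.
Proof. vring. Qed.
Lemma det3_eq23 (a b : vec3) : det3 a b b = 0.
Proof. vring. Qed.
Lemma det3_eq13 (a b : vec3) : det3 a b a = 0.
Proof. vring. Qed.
Lemma mink_cross_cross (a b c d : vec3) :
  mink (vcross a b) (vcross c d) = mink a d * mink b c - mink a c * mink b d.
Proof. vring. Qed.
Lemma cross_cross (a b c : vec3) :
  vcross (vcross a b) c = vadd (vscal (mink b c) a) (vscal (- mink a c) b).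
Proof. vring. Qed.
Lemma det3_sq (a b c : vec3) :
  det3 a b c * det3 a b c =
  - (mink a a * (mink b b * mink c c - mink b c * mink b c)
     - mink a b * (mink a b * mink c c - mink b c * mink a c)
     + mink a c * (mink a b * mink b c - mink b b * mink a c)).
Proof. vring. Qed.
Lemma dual_expansion (a b c y : vec3) :
  vscal (det3 a b c) y =
  vadd (vscal (mink y a) (vcross b c))
    (vadd (vscal (mink y b) (vcross c a)) (vscal (mink y c) (vcross a b))).
Proof. vring. Qed.
Lemma vscal_vscal (a b : R) (u : vec3) : vscal a (vscal b u) = vscal (a * b) u.
Proof. vring. Qed.
Lemma vscal_1 (u : vec3) : vscal 1 u = u.
Proof. vring. Qed.

Lemma vscal_cancel (c : R) (u v : vec3) : c <> 0 -> vscal c u = vscal c v -> u = v.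
Proof.
  intros Hc H. apply (f_equal (vscal (/ c))) in H.
  rewrite !vscal_vscal, Rinv_l, !vscal_1 in H by exact Hc. exact H.
Qed.

Lemma vec_eq_of_mink (a b c x y : vec3) :
  det3 a b c <> 0 -> mink x a = mink y a -> mink x b = mink y b -> mink x c = mink y c -> x = y.
Proof.
  intros Hd Ha Hb Hc. apply (vscal_cancel (det3 a b c)); [exact Hd |].
  rewrite !dual_expansion, Ha, Hb, Hc. reflexivity.
Qed.

Definition frame (p e m : vec3) : Prop :=
  mink p p = -1 /\ mink e e = 1 /\ mink m m = 1 /\
  mink p e = 0 /\ mink p m = 0 /\ mink e m = 0.

Lemma frame_det (p e m : vec3) : frame p e m -> det3 p e m <> 0.
Proof.
  intros (h1 & h2 & h3 & h4 & h5 & h6) H. pose proof (det3_sq p e m) as D.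
  rewrite H, h1, h2, h3, h4, h5, h6 in D. lra.
Qed.

Lemma frame_expand (p e m x : vec3) : frame p e m ->
  x = vadd (vscal (- mink x p) p) (vadd (vscal (mink x e) e) (vscal (mink x m) m)).
Proof.
  intros F. pose proof (frame_det p e m F) as Hd.
  destruct F as (h1 & h2 & h3 & h4 & h5 & h6).
  apply (vec_eq_of_mink p e m _ _ Hd); mexp;
    rewrite ?(mink_comm e p), ?(mink_comm m p), ?(mink_comm m e), ?h1, ?h2, ?h3, ?h4, ?h5, ?h6; ring.
Qed.

Lemma frame_mink (p e m x y : vec3) : frame p e m ->
  mink x y = - mink x p * mink y p + mink x e * mink y e + mink x m * mink y m.
Proof.
  intros F. rewrite (frame_expand p e m x F) at 1. mexp.
  rewrite (mink_comm p y), (mink_comm e y), (mink_comm m y). ring.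
Qed.

Definition hyp (x : vec3) : Prop := mink x x = -1 /\ 0 < fst (fst x).

(** The reversed Cauchy-Schwarz inequality on the upper sheet. The identity [E] exhibits (x0 y0)^2 -
    (1 + D)^2 as a sum of squares, which also settles equality. *)
Lemma hyp_mink_aux (x0 x1 x2 y0 y1 y2 : R) :
  - x0 * x0 + x1 * x1 + x2 * x2 = -1 -> 0 < x0 ->
  - y0 * y0 + y1 * y1 + y2 * y2 = -1 -> 0 < y0 ->
  1 <= x0 * y0 - x1 * y1 - x2 * y2 /\
  (x0 * y0 - x1 * y1 - x2 * y2 = 1 -> x0 = y0 /\ x1 = y1 /\ x2 = y2).
Proof.
  intros Hx Hx0 Hy Hy0. set (D := x1 * y1 + x2 * y2).
  assert (E : (x0 * y0) * (x0 * y0) =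
    (1 + D) * (1 + D) + ((x1 - y1) * (x1 - y1) + (x2 - y2) * (x2 - y2))
    + (x1 * y2 - x2 * y1) * (x1 * y2 - x2 * y1)).
  { replace ((x0 * y0) * (x0 * y0)) with ((x0 * x0) * (y0 * y0)) by ring.
    replace (x0 * x0) with (1 + x1 * x1 + x2 * x2) by lra.
    replace (y0 * y0) with (1 + y1 * y1 + y2 * y2) by lra. unfold D. ring. }
  pose proof (Rle_0_sqr (x1 - y1)) as S1. pose proof (Rle_0_sqr (x2 - y2)) as S2.
  pose proof (Rle_0_sqr (x1 * y2 - x2 * y1)) as S3. unfold Rsqr in *.
  assert (Hpos : 0 < x0 * y0) by (apply Rmult_lt_0_compat; assumption).
  split.
  - assert (1 + D <= x0 * y0); [| unfold D in *; lra].
    destruct (Rle_or_lt (1 + D) (x0 * y0)) as [h | h]; [exact h |]. nra.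
  - intros H. assert (HD : x0 * y0 = 1 + D) by (unfold D; lra). rewrite HD in E.
    assert (e1 : x1 - y1 = 0) by (apply Rsqr_0_uniq; unfold Rsqr; lra).
    assert (e2 : x2 - y2 = 0) by (apply Rsqr_0_uniq; unfold Rsqr; lra).
    assert (x1 = y1) by lra. assert (x2 = y2) by lra. subst.
    split; [nra | split; lra].
Qed.

Lemma hyp_mink (x y : vec3) : hyp x -> hyp y -> 1 <= - mink x y.
Proof.
  destruct x as [[x0 x1] x2], y as [[y0 y1] y2]. intros [H1 H2] [H3 H4].
  unfold mink in *. simpl in *. pose proof (hyp_mink_aux x0 x1 x2 y0 y1 y2 H1 H2 H3 H4). lra.
Qed.

Lemma hyp_mink_eq (x y : vec3) : hyp x -> hyp y -> - mink x y = 1 -> x = y.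
Proof.
  destruct x as [[x0 x1] x2], y as [[y0 y1] y2]. intros [H1 H2] [H3 H4] H.
  unfold mink in *. simpl in *. pose proof (hyp_mink_aux x0 x1 x2 y0 y1 y2 H1 H2 H3 H4) as [_ K].
  destruct K as (-> & -> & ->); [lra | reflexivity].
Qed.

Lemma orth_nonneg (p a : vec3) : hyp p -> mink p a = 0 -> 0 <= mink a a.
Proof.
  destruct p as [[p0 p1] p2], a as [[a0 a1] a2]. intros [H1 H2] H.
  unfold mink in *. simpl in *.
  assert (E : (p0 * a0) * (p0 * a0) + (p1 * a2 - p2 * a1) * (p1 * a2 - p2 * a1)
     = (p1 * p1 + p2 * p2) * (a1 * a1 + a2 * a2)).
  { replace (p0 * a0) with (p1 * a1 + p2 * a2) by lra. ring. }
  pose proof (Rle_0_sqr (p1 * a2 - p2 * a1)) as S. unfold Rsqr in S.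
  assert (F : p0 * p0 = 1 + p1 * p1 + p2 * p2) by lra.
  assert (0 < p0 * p0) by nra.
  apply (Rmult_le_reg_l (p0 * p0)); [assumption |]. rewrite Rmult_0_r.
  replace (p0 * p0 * (- a0 * a0 + a1 * a1 + a2 * a2))
    with (p0 * p0 * (a1 * a1 + a2 * a2) - (p0 * a0) * (p0 * a0)) by ring.
  rewrite F. nra.
Qed.

(** Lagrange's identity in the tangent plane at p, where the form is positive definite; the
    determinant with p is the area term. *)
Lemma orth_cauchy (p a b : vec3) : hyp p -> mink p a = 0 -> mink p b = 0 ->
  mink a b * mink a b + det3 a b p * det3 a b p = mink a a * mink b b.
Proof.
  intros [H _] Ha Hb. rewrite det3_sq, (mink_comm a p), (mink_comm b p), H, Ha, Hb. ring.
Qed.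

Definition hdv (x y : vec3) : R := acosh (- mink x y).

Lemma hd_nonneg (x y : vec3) : hyp x -> hyp y -> 0 <= hdv x y.
Proof. intros. apply acosh_nonneg, hyp_mink; assumption. Qed.

Lemma cosh_hd (x y : vec3) : hyp x -> hyp y -> cosh (hdv x y) = - mink x y.
Proof. intros. apply cosh_acosh, hyp_mink; assumption. Qed.

Lemma hd_comm (x y : vec3) : hdv x y = hdv y x.
Proof. unfold hdv. rewrite mink_comm. reflexivity. Qed.

Lemma hd_pos (x y : vec3) : hyp x -> hyp y -> x <> y -> 0 < hdv x y.
Proof.
  intros Hx Hy H. apply acosh_pos. destruct (hyp_mink x y Hx Hy) as [h | h]; [exact h |].
  exfalso; apply H, hyp_mink_eq; auto.
Qed.

Lemma hd_eq_0 (x : vec3) : hyp x -> hdv x x = 0.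
Proof.
  intros [H _]. unfold hdv. rewrite H. replace (- -1) with (cosh 0) by (rewrite cosh_0; ring).
  apply acosh_cosh; lra.
Qed.

Lemma sinh_hd_sq (x y : vec3) : hyp x -> hyp y ->
  sinh (hdv x y) * sinh (hdv x y) = mink x y * mink x y - 1.
Proof. intros. unfold hdv. rewrite sinh_acosh_sq; [ring | apply hyp_mink; assumption]. Qed.

(** The law of cosines without angles: w is s times the cosine of the angle at y, and the
    determinant is s times its sine up to sign. *)
Lemma hd_triangle_aux (x y z : vec3) : hyp x -> hyp y -> hyp z ->
  let s := sinh (hdv x y) * sinh (hdv y z) in
  let w := mink x z + mink x y * mink y z in
  w * w + det3 x y z * det3 x y z = s * s /\ 0 <= s.
Proof.
  intros Hx Hy Hz s w. split.
  - unfold s. replace (sinh (hdv x y) * sinh (hdv y z) * (sinh (hdv x y) * sinh (hdv y z)))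
      with ((sinh (hdv x y) * sinh (hdv x y)) * (sinh (hdv y z) * sinh (hdv y z))) by ring.
    rewrite !sinh_hd_sq by assumption. rewrite det3_sq. unfold w.
    destruct Hx as [-> _], Hy as [-> _], Hz as [-> _]. ring.
  - apply Rmult_le_pos; apply sinh_nonneg, hd_nonneg; assumption.
Qed.

Lemma hd_triangle (x y z : vec3) : hyp x -> hyp y -> hyp z -> hdv x z <= hdv x y + hdv y z.
Proof.
  intros Hx Hy Hz. destruct (hd_triangle_aux x y z Hx Hy Hz) as [H H0]. cbv zeta in H, H0.
  apply cosh_le_inv; [pose proof (hd_nonneg x y Hx Hy); pose proof (hd_nonneg y z Hy Hz); lra |].
  rewrite cosh_add, !cosh_hd by assumption.
  set (s := sinh (hdv x y) * sinh (hdv y z)) in *.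
  pose proof (Rle_0_sqr (det3 x y z)) as S. unfold Rsqr in S.
  set (w := mink x z + mink x y * mink y z) in *.
  assert (- w <= s); [| unfold w in *; lra].
  destruct (Rle_or_lt (- w) s) as [h | h]; [exact h | nra].
Qed.

Lemma hd_triangle_eq (x y z : vec3) : hyp x -> hyp y -> hyp z ->
  hdv x y + hdv y z = hdv x z -> det3 x y z = 0.
Proof.
  intros Hx Hy Hz He. destruct (hd_triangle_aux x y z Hx Hy Hz) as [H H0]. cbv zeta in H, H0.
  assert (E : cosh (hdv x y + hdv y z) = cosh (hdv x z)) by (rewrite He; reflexivity).
  rewrite cosh_add, !cosh_hd in E by assumption.
  apply Rsqr_0_uniq. unfold Rsqr. nra.
Qed.

Lemma lift_hyp (z : point) : in_disc z -> hyp (lift z).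
Proof.
  unfold in_disc, nsq. destruct z as [a b]. simpl. intros H.
  unfold hyp, lift, mink, nsq; simpl. split; [field; lra |].
  apply Rdiv_lt_0_compat; nra.
Qed.

Definition unlift (x : vec3) : point :=
  let '(x0, x1, x2) := x in (x1 / (1 + x0), x2 / (1 + x0)).

Lemma unlift_lift (z : point) : in_disc z -> unlift (lift z) = z.
Proof.
  unfold in_disc, nsq. destruct z as [a b]. simpl. intros H.
  unfold unlift, lift, nsq; simpl.
  f_equal; field; lra.
Qed.

Lemma unlift_disc (x : vec3) : hyp x -> in_disc (unlift x) /\ lift (unlift x) = x.
Proof.
  destruct x as [[x0 x1] x2]. intros [H H0]. unfold mink in H. simpl in *.
  assert (E : x1 * x1 + x2 * x2 = (x0 - 1) * (x0 + 1)) by nra.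
  assert (N : nsq (x1 / (1 + x0), x2 / (1 + x0)) = (x0 - 1) / (1 + x0)).
  { unfold nsq; simpl. transitivity ((x1 * x1 + x2 * x2) / ((1 + x0) * (1 + x0))); [field; lra |].
    rewrite E. field. lra. }
  split.
  - unfold in_disc. rewrite N. apply (Rmult_lt_reg_r (1 + x0)); [lra |].
    unfold Rdiv. rewrite Rmult_assoc, Rinv_l by lra. lra.
  - unfold lift. rewrite N. simpl.
    assert (1 - (x0 - 1) / (1 + x0) = 2 / (1 + x0)) as -> by (field; lra).
    apply vec_ext; field; lra.
Qed.

Lemma lift_inj (z w : point) : in_disc z -> in_disc w -> lift z = lift w -> z = w.
Proof. intros Hz Hw H. rewrite <- (unlift_lift z Hz), <- (unlift_lift w Hw), H. reflexivity. Qed.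

Lemma hdist_hd (z w : point) : hdist z w = hdv (lift z) (lift w).
Proof. reflexivity. Qed.

(** Inward unit normals [m i] and vertices [v i] of a right-angled [n]-gon, with indices
    read modulo [n]; side [i] joins [v i] to [v (i + 1)]. *)
Record rpoly (n : nat) (v m : nat -> vec3) (len : nat -> R) : Prop := {
  rp_per_v : forall i, v (i + n)%nat = v i;
  rp_per_m : forall i, m (i + n)%nat = m i;
  rp_per_len : forall i, len (i + n)%nat = len i;
  rp_hyp : forall i, hyp (v i);
  rp_frame : forall i, frame (v (S i)) (m i) (m (S i));
  rp_det : forall i, det3 (v (S i)) (m i) (m (S i)) = 1;
  rp_len : forall i, 0 < len i;
  rp_next : forall i, v (S (S i)) =
    vadd (vscal (cosh (len (S i))) (v (S i))) (vscal (sinh (len (S i))) (m i));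
  rp_prev : forall i, v i =
    vadd (vscal (cosh (len i)) (v (S i))) (vscal (sinh (len i)) (m (S i)));
  rp_in : forall i j, (2 <= j < n)%nat -> 0 < mink (m i) (v (i + j)%nat)
}.

(** * Right-angled polygons *)

Section Polygon.

Variables (n : nat) (v m : nat -> vec3) (len : nat -> R).
Hypothesis Hn : (6 <= n)%nat.
Hypothesis RP : rpoly n v m len.

Let per_v := rp_per_v _ _ _ _ RP.
Let per_m := rp_per_m _ _ _ _ RP.
Let fr := rp_frame _ _ _ _ RP.
Let next := rp_next _ _ _ _ RP.
Let prev := rp_prev _ _ _ _ RP.

Lemma rp_unit (i : nat) : mink (m i) (m i) = 1.
Proof. apply (fr i). Qed.

Lemma rp_orth (i : nat) : mink (m i) (m (S i)) = 0.
Proof. apply (fr i). Qed.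

Lemma rp_on_end (i : nat) : mink (m i) (v (S i)) = 0.
Proof. rewrite mink_comm. apply (fr i). Qed.

Lemma rp_on_start (i : nat) : mink (m i) (v i) = 0.
Proof.
  rewrite <- (per_m i), <- (per_v i).
  replace (i + n)%nat with (S (i + n - 1)) by lia. rewrite mink_comm. apply (fr (i + n - 1)).
Qed.

Lemma rp_normal_next (i : nat) : m (S (S i)) =
  vadd (vscal (- sinh (len (S i))) (v (S i))) (vscal (- cosh (len (S i))) (m i)).
Proof.
  pose proof (sinh_positive _ (rp_len _ _ _ _ RP (S i))) as Hs.
  apply (vscal_cancel (sinh (len (S i)))); [lra |].
  pose proof (prev (S i)) as E. rewrite (next i) in E. pose proof (cosh_sq (len (S i))) as C.
  set (c := cosh _) in *. set (s := sinh _) in *.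
  assert (F : vscal s (m (S (S i))) = vadd (v (S i))
     (vscal (- c) (vadd (vscal c (v (S i))) (vscal s (m i))))).
  { rewrite E at 1. generalize (vadd (vscal c (v (S i))) (vscal s (m i))) as a.
    generalize (m (S (S i))) as b. clear. intros. vring. }
  rewrite F. generalize (v (S i)) as a. generalize (m i) as b. clear - C. intros. vec.
  apply vec_ext; [replace (r + - c * (c * r + s * r2)) with (r * (1 - c * c) - c * s * r2) by ring
   | replace (r0 + - c * (c * r0 + s * r3)) with (r0 * (1 - c * c) - c * s * r3) by ring
   | replace (r1 + - c * (c * r1 + s * r4)) with (r1 * (1 - c * c) - c * s * r4) by ring];
  rewrite C; ring.
Qed.

Lemma rp_vertex_nonneg (i j : nat) : (j <= n)%nat -> 0 <= mink (m i) (v (i + j)%nat).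
Proof.
  intros Hj.
  destruct (Nat.eq_dec j 0) as [-> | h0]; [rewrite Nat.add_0_r, rp_on_start; lra |].
  destruct (Nat.eq_dec j 1) as [-> | h1]; [rewrite Nat.add_1_r, rp_on_end; lra |].
  destruct (Nat.eq_dec j n) as [-> | hn]; [rewrite per_v, rp_on_start; lra |].
  left; apply (rp_in _ _ _ _ RP); lia.
Qed.

(** Expand [v i] in [v J], [v (S J)] and [m J]; the coefficients are nonnegative because [v i] lies
    on the inner side of the lines J - 1, J and J + 1. Pairing with [m i] kills [v i]. Were [m i]
    and [m J] to have a nonnegative product, every term would vanish, although [v (S J)] is strictly
    inside side i and has a positive coefficient. *)
Lemma rp_gram_neg (i j : nat) : (2 <= j <= n - 2)%nat -> mink (m i) (m (i + j)%nat) < 0.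
Proof.
  intros Hj.
  set (J := (i + j)%nat).
  pose proof (rp_len _ _ _ _ RP) as HL.
  assert (EJ : J = S (J - 1)) by lia.
  pose proof (next (J - 1)) as N. pose proof (prev J) as P. rewrite <- EJ in N.
  set (c := cosh (len J)) in *. set (s := sinh (len J)) in *.
  assert (Hs : 0 < s) by apply sinh_positive, HL.
  pose proof (fr (J - 1)) as F. rewrite <- EJ in F.
  assert (Hprev : 0 < mink (m (J - 1)) (v i)).
  { rewrite <- (per_v i). replace (i + n)%nat with ((J - 1) + (n - j + 1))%nat by lia.
    apply (rp_in _ _ _ _ RP). lia. }
  assert (Hnext : 0 <= mink (m (S J)) (v i)).
  { rewrite <- (per_v i). replace (i + n)%nat with (S J + (n - j - 1))%nat by lia.
    apply rp_vertex_nonneg. lia. }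
  assert (HJ : 0 < mink (m J) (v i)).
  { rewrite <- (per_v i). replace (i + n)%nat with (J + (n - j))%nat by lia.
    apply (rp_in _ _ _ _ RP). lia. }
  assert (H1 : 0 < mink (m i) (v J)) by (apply (rp_in _ _ _ _ RP); lia).
  assert (H2 : 0 <= mink (m i) (v (S J))).
  { replace (S J) with (i + S j)%nat by lia. apply rp_vertex_nonneg; lia. }
  (* The coefficients are found by pairing with the two neighbouring normals: [m (S J)] vanishes on
     [v (S J)] and [m (J - 1)] vanishes on [v J]. *)
  set (a := mink (m (S J)) (v i) / s). set (b := mink (m (J - 1)) (v i) / s).
  assert (Ha : 0 <= a) by (apply Rmult_le_pos; [lra | left; apply Rinv_0_lt_compat; lra]).
  assert (Hb : 0 < b) by (apply Rdiv_lt_0_compat; lra).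
  pose proof (fr J) as FJ.
  assert (X : v i = vadd (vscal a (v J)) (vadd (vscal b (v (S J))) (vscal (mink (m J) (v i)) (m J)))).
  { destruct F as (f1 & f2 & f3 & f4 & f5 & f6). destruct FJ as (g1 & g2 & g3 & g4 & g5 & g6).
    apply (vec_eq_of_mink (m J) (m (S J)) (m (J - 1))).
    - intros D. pose proof (det3_sq (m J) (m (S J)) (m (J - 1))) as Q. rewrite D in Q.
      pose proof (rp_normal_next (J - 1)) as E2. rewrite <- EJ in E2. fold c s in E2.
      assert (w1 : mink (m J) (m (J - 1)) = 0) by (rewrite mink_comm; exact f6).
      assert (w2 : mink (m (S J)) (m (J - 1)) = - c).
      { rewrite E2. mexp. rewrite f4, f2. ring. }
      rewrite g2, g3, g6, w1, w2, f2 in Q. pose proof (cosh_sq (len J)) as C. fold c s in C. nra.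
    - mexp. rewrite (mink_comm (v J)), (mink_comm (v (S J))), rp_on_start, rp_on_end, rp_unit.
      rewrite (mink_comm (v i)). ring.
    - mexp. rewrite (mink_comm (v i) (m (S J))), g5, g6.
      rewrite P. mexp. rewrite g5, g3. unfold a. field. lra.
    - mexp. rewrite (mink_comm (v i) (m (J - 1))), f4, (mink_comm (m J) (m (J - 1))), f6.
      rewrite N. mexp. rewrite f4, f2. unfold b. field. lra. }
  assert (Z : mink (m i) (v i) = 0) by apply rp_on_start.
  rewrite X in Z. revert Z. mexp. intros Z.
  destruct (Rlt_or_le (mink (m i) (m J)) 0) as [h | h]; [exact h | exfalso].
  assert (E0 : a * mink (m i) (v J) = 0) by nra.
  assert (E1 : b * mink (m i) (v (S J)) = 0) by nra.
  assert (a0 : a = 0) by nra.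
  assert (m0 : mink (m i) (v (S J)) = 0) by nra.
  destruct (Nat.eq_dec j (n - 2)) as [ej | nj].
  2:{ assert (0 < mink (m i) (v (S J))); [| lra].
      replace (S J) with (i + S j)%nat by lia. apply (rp_in _ _ _ _ RP). lia. }
  assert (0 < mink (m i) (v (S J))); [| lra].
  replace (S J) with (i + S j)%nat by lia. apply (rp_in _ _ _ _ RP). lia.
Qed.

Lemma rp_gram_le_0 (i j : nat) : (1 <= j <= n - 1)%nat -> mink (m i) (m (i + j)%nat) <= 0.
Proof.
  intros Hj.
  destruct (Nat.eq_dec j 1) as [-> | h1]; [rewrite Nat.add_1_r, rp_orth; lra |].
  destruct (Nat.eq_dec j (n - 1)) as [-> | h2].
  - rewrite mink_comm, <- (per_m i). replace (i + n)%nat with (S (i + (n - 1))) by lia.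
    rewrite rp_orth; lra.
  - left; apply rp_gram_neg; lia.
Qed.

(** In the frame at [v J] the unit length of [m i] reads z^2 = 1 + a^2 - y^2. The sign of its
    product with [m (S J)] gives a >= |y|, hence z^2 >= 1: the two lines cannot cross. *)
Lemma rp_gram (i j : nat) : (2 <= j <= n - 2)%nat -> 1 <= - mink (m i) (m (i + j)%nat).
Proof.
  intros Hj. set (J := (i + j)%nat).
  assert (EJ : J = S (J - 1)) by lia.
  pose proof (fr (J - 1)) as F. rewrite <- EJ in F.
  pose proof (frame_mink _ _ _ (m i) (m i) F) as Q. rewrite rp_unit in Q.
  pose proof (rp_normal_next (J - 1)) as E. rewrite <- EJ in E.
  assert (y1 : mink (m i) (m (J - 1)) <= 0).
  { replace (J - 1)%nat with (i + (j - 1))%nat by lia. apply rp_gram_le_0; lia. }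
  assert (y2 : mink (m i) (m (S J)) <= 0).
  { replace (S J) with (i + S j)%nat by lia. apply rp_gram_le_0; lia. }
  assert (y0 : mink (m i) (m J) < 0) by (apply rp_gram_neg; lia).
  rewrite E in y2. revert y2. mexp. intros y2.
  pose proof (sinh_positive _ (rp_len _ _ _ _ RP J)) as Hs.
  pose proof (sinh_lt_cosh (len J)) as Hc.
  set (a := mink (m i) (v J)) in *. set (y := mink (m i) (m (J - 1))) in *.
  set (z := mink (m i) (m J)) in *. set (s := sinh (len J)) in *. set (c := cosh (len J)) in *.
  assert (Hay : - y <= a).
  { apply (Rmult_le_reg_l s); [exact Hs |]. nra. }
  assert (1 <= z * z) by nra. nra.
Qed.

End Polygon.

(** * From a right-angled polygon in the disc to vertices and normals on the hyperboloid *)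

Section FromDefs.

Variables (k : nat) (P : nat -> point).
Hypothesis Hk : (3 <= k)%nat.
Hypothesis HP : right_angled k P.

Let n := (2 * k)%nat.

Definition vert (i : nat) : vec3 := lift (P (i mod (2 * k))).
Definition slen (i : nat) : R := hdv (vert i) (vert (S i)).
Definition snorm (i : nat) : vec3 := vscal (/ sinh (slen i)) (vcross (vert i) (vert (S i))).

Lemma vert_per (i : nat) : vert (i + 2 * k) = vert i.
Proof.
  unfold vert. f_equal. f_equal.
  rewrite <- (Nat.mul_1_l (2 * k)) at 1. apply Nat.Div0.mod_add.
Qed.

Lemma vert_hyp (i : nat) : hyp (vert i).
Proof. apply lift_hyp. apply HP. apply Nat.mod_upper_bound. lia. Qed.

Lemma vert_orient (i j : nat) : (2 <= j < 2 * k)%nat ->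
  0 < det3 (vert i) (vert (S i)) (vert (i + j)).
Proof.
  intros Hj. destruct HP as [[_ H] _].
  assert (Hi : (i mod (2 * k) < 2 * k)%nat) by (apply Nat.mod_upper_bound; lia).
  specialize (H (i mod (2 * k))%nat ((i + j) mod (2 * k))%nat Hi
    ltac:(apply Nat.mod_upper_bound; lia)).
  assert (E : nxt k (i mod (2 * k)) = (S i mod (2 * k))%nat).
  { unfold nxt. rewrite <- (Nat.add_1_r (i mod _)), <- (Nat.add_1_r i).
    apply Nat.Div0.add_mod_idemp_l. }
  rewrite E in H. unfold orient in H. unfold vert. apply H.
  - intros e. rewrite <- Nat.Div0.add_mod_idemp_l in e.
    set (r := (i mod (2 * k))%nat) in *.
    destruct (Nat.lt_ge_cases (r + j) (2 * k)) as [h | h].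
    + rewrite Nat.mod_small in e; lia.
    + replace (r + j)%nat with ((r + j - 2 * k) + 1 * (2 * k))%nat in e by lia.
      rewrite Nat.Div0.mod_add, Nat.mod_small in e; lia.
  - intros e. replace (S i) with (i + 1)%nat in e by lia.
    rewrite <- (Nat.Div0.add_mod_idemp_l i j), <- (Nat.Div0.add_mod_idemp_l i 1) in e.
    set (r := (i mod (2 * k))%nat) in *.
    assert (A : forall x, (x < 4 * k)%nat -> (x mod (2 * k))%nat = x \/
       ((x mod (2 * k))%nat = (x - 2 * k)%nat /\ (2 * k <= x)%nat)).
    { intros x Hx. destruct (Nat.lt_ge_cases x (2 * k)) as [h | h].
      - left. apply Nat.mod_small, h.
      - right. split; [| exact h]. replace x with ((x - 2 * k) + 1 * (2 * k))%nat at 1 by lia.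
        rewrite Nat.Div0.mod_add, Nat.mod_small; lia. }
    assert (B : forall x, (x < 2 * k)%nat -> (x mod (2 * k))%nat = x) by (intros; apply Nat.mod_small; lia).
    destruct (A (r + j)%nat) as [a | [a a']]; [lia | |]; destruct (A (r + 1)%nat) as [b | [b b']]; lia.
Qed.

Lemma vert_neq (i : nat) : vert i <> vert (S i).
Proof.
  intros e. pose proof (vert_orient i 2 ltac:(lia)) as H. rewrite <- e in H.
  pose proof (det3_swap (vert i) (vert i) (vert (i + 2))). lra.
Qed.

Lemma slen_pos (i : nat) : 0 < slen i.
Proof. apply hd_pos; [apply vert_hyp | apply vert_hyp | apply vert_neq]. Qed.

(** Outside [-1, 1] the total function [acos] takes the values PI and 0 only, so the equation itself
    puts x in the domain. *)
Lemma acos_half_pi (x : R) : acos x = PI / 2 -> x = 0.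
Proof.
  intros H. pose proof PI_RGT_0.
  assert (h : -1 <= x <= 1); [| rewrite <- (cos_acos x h), H; apply cos_PI2].
  unfold acos in H.
  destruct (Rle_dec x (-1)) as [a | a]; [lra |]. apply Rnot_le_lt in a.
  destruct (Rle_dec 1 x) as [b | b]; [lra |]. apply Rnot_le_lt in b. lra.
Qed.

Lemma tangent_sq (p q : point) : in_disc p -> in_disc q ->
  mink (tangent p q) (tangent p q) = mink (lift p) (lift q) * mink (lift p) (lift q) - 1.
Proof.
  intros Hp Hq. destruct (lift_hyp p Hp) as [hp _]. destruct (lift_hyp q Hq) as [hq _].
  unfold tangent. mexp. rewrite (mink_comm (lift q) (lift p)), hp, hq. ring.
Qed.

Lemma tangent_dot (p q r : point) : in_disc p ->
  mink (tangent p q) (tangent p r) =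
  mink (lift q) (lift r) + mink (lift p) (lift q) * mink (lift p) (lift r).
Proof.
  intros Hp. destruct (lift_hyp p Hp) as [hp _].
  unfold tangent. mexp. rewrite (mink_comm (lift q) (lift p)), hp. ring.
Qed.

(** The hyperbolic Pythagorean theorem: cosh of the hypotenuse is the product of the cosh of the
    legs. The denominator in [hangle] is positive because consecutive vertices differ, so it can be
    cleared. *)
Lemma vert_right (i : nat) :
  mink (vert i) (vert (S (S i))) + mink (vert (S i)) (vert i) * mink (vert (S i)) (vert (S (S i))) = 0.
Proof.
  destruct HP as [HC HA].
  assert (Hb : forall j, (j mod (2 * k) < 2 * k)%nat) by (intros; apply Nat.mod_upper_bound; lia).
  specialize (HA (S i mod (2 * k))%nat (Hb _)).
  assert (E1 : nxt k (S i mod (2 * k)) = (S (S i) mod (2 * k))%nat).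
  { unfold nxt. rewrite <- (Nat.add_1_r (S i mod _)), <- (Nat.add_1_r (S i)).
    apply Nat.Div0.add_mod_idemp_l. }
  assert (E2 : prv k (S i mod (2 * k)) = (i mod (2 * k))%nat).
  { unfold prv. replace (S i mod (2 * k) + 2 * k - 1)%nat with (S i mod (2 * k) + (2 * k - 1))%nat by lia.
    rewrite Nat.Div0.add_mod_idemp_l. replace (S i + (2 * k - 1))%nat with (i + 1 * (2 * k))%nat by lia.
    apply Nat.Div0.mod_add. }
  rewrite E1, E2 in HA. apply acos_half_pi in HA. fold (vert i) in HA.
  assert (D : forall j, in_disc (P (j mod (2 * k)))) by (intros; apply HC, Hb).
  rewrite !tangent_sq, tangent_dot in HA by apply D.
  change (lift (P (i mod (2 * k)))) with (vert i) in HA.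
  change (lift (P (S i mod (2 * k)))) with (vert (S i)) in HA.
  change (lift (P (S (S i) mod (2 * k)))) with (vert (S (S i))) in HA.
  set (N := (mink (vert (S i)) (vert i) * mink (vert (S i)) (vert i) - 1) *
     (mink (vert (S i)) (vert (S (S i))) * mink (vert (S i)) (vert (S (S i))) - 1)) in *.
  assert (HN : 0 < N).
  { assert (A : forall x y, hyp x -> hyp y -> x <> y -> 0 < mink x y * mink x y - 1).
    { intros x y Hx Hy Hxy. rewrite <- sinh_hd_sq by assumption.
      pose proof (sinh_positive _ (hd_pos x y Hx Hy Hxy)). nra. }
    apply Rmult_lt_0_compat; apply A; try apply vert_hyp.
    - intros e; apply (vert_neq i); auto.
    - apply vert_neq. }
  pose proof (sqrt_lt_R0 N HN). 
  apply (Rmult_eq_compat_r (sqrt N)) in HA. unfold Rdiv in HA.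
  rewrite Rmult_assoc, Rinv_l, Rmult_1_r, Rmult_0_l in HA by lra. exact HA.
Qed.

(** The right angle makes the square of [det3 a p b] the product of the two sinh^2, so the
    determinant is the product of the two sinh. The normals of the two sides form an orthonormal
    frame with p, each of them pointing along the other side. *)
Lemma corner (a p b : vec3) : hyp a -> hyp p -> hyp b -> 0 < det3 a p b ->
  mink a b + mink p a * mink p b = 0 ->
  let m := vscal (/ sinh (hdv a p)) (vcross a p) in
  let m' := vscal (/ sinh (hdv p b)) (vcross p b) in
  frame p m m' /\ det3 p m m' = 1 /\
  b = vadd (vscal (cosh (hdv p b)) p) (vscal (sinh (hdv p b)) m) /\
  a = vadd (vscal (cosh (hdv a p)) p) (vscal (sinh (hdv a p)) m').
Proof.
  intros Ha Hp Hb D R m m'.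
  assert (nap : a <> p).
  { intros ->. pose proof (det3_swap p p b). lra. }
  assert (npb : p <> b).
  { intros ->. rewrite det3_rot in D. pose proof (det3_swap b b a). lra. }
  pose proof (sinh_positive _ (hd_pos a p Ha Hp nap)) as sa.
  pose proof (sinh_positive _ (hd_pos p b Hp Hb npb)) as sb.
  pose proof (sinh_hd_sq a p Ha Hp) as qa. pose proof (sinh_hd_sq p b Hp Hb) as qb.
  pose proof (cosh_hd a p Ha Hp) as ca. pose proof (cosh_hd p b Hp Hb) as cb.
  set (s := sinh (hdv a p)) in *. set (t := sinh (hdv p b)) in *.
  destruct Ha as [ha _], Hp as [hp _], Hb as [hb _].
  rewrite (mink_comm p a) in R.
  assert (Dq : det3 a p b * det3 a p b = (s * t) * (s * t)).
  { rewrite det3_sq, ha, hp, hb. replace (s * t * (s * t)) with ((s * s) * (t * t)) by ring.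
    rewrite qa, qb. replace (mink a b) with (- (mink a p * mink p b)) by lra. ring. }
  assert (st : 0 < s * t) by (apply Rmult_lt_0_compat; assumption).
  assert (Dst : det3 a p b = s * t) by (apply Rsqr_inj; [lra | lra | exact Dq]).
  assert (mm : mink m m = 1).
  { unfold m. mexp. rewrite mink_cross_cross, ha, hp, (mink_comm p a).
    replace (mink a p * mink a p - -1 * -1) with (s * s) by lra. field. lra. }
  assert (mm' : mink m' m' = 1).
  { unfold m'. mexp. rewrite mink_cross_cross, hp, hb, (mink_comm b p).
    replace (mink p b * mink p b - -1 * -1) with (t * t) by lra. field. lra. }
  assert (pm : mink p m = 0).
  { unfold m. rewrite mink_scal_r, mink_comm, mink_cross.
    rewrite det3_eq23. ring. }
  assert (pm' : mink p m' = 0).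
  { unfold m'. rewrite mink_scal_r, mink_comm, mink_cross.
    rewrite det3_eq13. ring. }
  assert (mm0 : mink m m' = 0).
  { unfold m, m'. mexp. rewrite mink_cross_cross, hp.
    replace (mink a b * -1 - mink a p * mink p b) with (- (mink a b + mink a p * mink p b)) by ring.
    rewrite R. ring. }
  assert (bm : mink b m = t).
  { unfold m. mexp. rewrite mink_comm, mink_cross, Dst. field. lra. }
  assert (bm' : mink b m' = 0).
  { unfold m'. mexp. rewrite mink_comm, mink_cross.
    rewrite det3_eq23. ring. }
  assert (am' : mink a m' = s).
  { unfold m'. mexp. rewrite mink_comm, mink_cross, <- det3_rot, Dst. field. lra. }
  assert (am : mink a m = 0).
  { unfold m. mexp. rewrite mink_comm, mink_cross.
    rewrite det3_eq13. ring. }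
  assert (F : frame p m m') by (repeat split; assumption).
  assert (Eb : b = vadd (vscal (cosh (hdv p b)) p) (vscal t m)).
  { rewrite (frame_expand p m m' b F) at 1. rewrite bm, bm', cb, (mink_comm b p).
    clear. vring. }
  assert (Ea : a = vadd (vscal (cosh (hdv a p)) p) (vscal s m')).
  { rewrite (frame_expand p m m' a F) at 1. rewrite am, am', ca.
    clear. vring. }
  split; [exact F |]. split; [| split; assumption].
  apply (Rmult_eq_reg_l (s * t)); [| nra]. rewrite Rmult_1_r.
  transitivity (det3 a p b); [| exact Dst].
  rewrite Ea, Eb. clear. unfold m, m'. generalize (/ s) as u. generalize (/ t) as w.
  generalize (vcross a p) as x. generalize (vcross p b) as y.
  generalize (cosh (hdv a p)) as c. generalize (cosh (hdv p b)) as c'. vring.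
Qed.

Lemma rpoly_of_right_angled : rpoly (2 * k) vert snorm slen.
Proof.
  assert (C : forall i,
     frame (vert (S i)) (snorm i) (snorm (S i)) /\ det3 (vert (S i)) (snorm i) (snorm (S i)) = 1 /\
     vert (S (S i)) = vadd (vscal (cosh (slen (S i))) (vert (S i))) (vscal (sinh (slen (S i))) (snorm i)) /\
     vert i = vadd (vscal (cosh (slen i)) (vert (S i))) (vscal (sinh (slen i)) (snorm (S i)))).
  { intros i. apply corner; try apply vert_hyp.
    - replace (S (S i)) with (i + 2)%nat by lia. apply vert_orient. lia.
    - apply vert_right. }
  assert (PL : forall i, slen (i + 2 * k) = slen i).
  { intros i. unfold slen. replace (S (i + 2 * k)) with (S i + 2 * k)%nat by lia.
    rewrite !vert_per. reflexivity. }
  constructor; try (intros i; apply C).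
  - apply vert_per.
  - intros i. unfold snorm. rewrite PL. replace (S (i + 2 * k)) with (S i + 2 * k)%nat by lia.
    rewrite !vert_per. reflexivity.
  - exact PL.
  - apply vert_hyp.
  - apply slen_pos.
  - intros i j Hj. unfold snorm. rewrite mink_scal_l, mink_cross.
    apply Rmult_lt_0_compat; [apply Rinv_0_lt_compat, sinh_positive, slen_pos | apply vert_orient, Hj].
Qed.

End FromDefs.

(** * Mean distances between sides *)

Lemma cosh_prod_sum (a b : R) : cosh a * cosh b = (cosh (a + b) + cosh (a - b)) / 2.
Proof. rewrite cosh_add, cosh_sub. field. Qed.

Lemma cosh_half (a : R) : cosh a = 2 * (cosh (a / 2) * cosh (a / 2)) - 1.
Proof. rewrite <- cosh_double. f_equal. field. Qed.

Lemma cosh_sq_sum (a b : R) :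
  cosh a * cosh a + cosh b * cosh b = cosh (a + b) * cosh (a - b) + 1.
Proof.
  rewrite cosh_add, cosh_sub. pose proof (cosh_sq a) as A. pose proof (cosh_sq b) as B.
  replace ((cosh a * cosh b + sinh a * sinh b) * (cosh a * cosh b - sinh a * sinh b))
    with ((cosh a * cosh a) * (cosh b * cosh b) - (sinh a * sinh a) * (sinh b * sinh b)) by ring.
  rewrite A, B. ring.
Qed.

(** With [a, b = cosh (al ± be)] and [a', b' = cosh (ga ± de)] the hypothesis becomes
    [(a - b - a' - b')^2 = 4 (1 + b a' + b b' + a' b')], which is monotone in [b >= 1]. *)
Lemma quad_cosh (al be ga de : R) : 0 <= al -> 0 <= be ->
  let D := cosh al * cosh be - cosh ga * cosh de in
  0 < D ->
  D * D + 1 = cosh al * cosh al + cosh be * cosh be + cosh ga * cosh ga + cosh de * cosh de ->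
  cosh ((ga + de) / 2) + cosh ((ga - de) / 2) <= cosh ((al + be) / 2) /\
  (al = be -> cosh ((ga + de) / 2) + cosh ((ga - de) / 2) = cosh ((al + be) / 2)).
Proof.
  intros Hal Hbe D HD H.
  pose proof (cosh_sq_sum al be) as E1. pose proof (cosh_sq_sum ga de) as E2.
  unfold D in *. rewrite (cosh_prod_sum al be), (cosh_prod_sum ga de) in *.
  assert (Hab : cosh (al - be) <= cosh (al + be)).
  { rewrite cosh_add, cosh_sub. pose proof (sinh_nonneg al Hal). pose proof (sinh_nonneg be Hbe). nra. }
  assert (Hb1 : al = be -> cosh (al - be) = 1) by (intros ->; rewrite Rminus_diag; apply cosh_0).
  pose proof (cosh_ge_1 (al - be)) as Hb.
  pose proof (cosh_half (al + be)) as Ha2. pose proof (cosh_half (ga + de)) as Hc2.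
  pose proof (cosh_half (ga - de)) as Hd2.
  pose proof (cosh_ge_1 ((al + be) / 2)) as HA. pose proof (cosh_ge_1 ((ga + de) / 2)) as HC.
  pose proof (cosh_ge_1 ((ga - de) / 2)) as HF.
  pose proof (cosh_ge_1 (ga + de)) as Hc. pose proof (cosh_ge_1 (ga - de)) as Hd.
  set (a := cosh (al + be)) in *. set (b := cosh (al - be)) in *.
  set (c := cosh (ga + de)) in *. set (d := cosh (ga - de)) in *.
  set (A := cosh ((al + be) / 2)) in *. set (C := cosh ((ga + de) / 2)) in *.
  set (F := cosh ((ga - de) / 2)) in *.
  clearbody a b c d A C F. clear D Hal Hbe.
  set (X := a - b - c - d).
  assert (HX : X * X = 4 * (1 + b * c + b * d + c * d)) by (unfold X; lra).
  (* The squared relation leaves the sign of X open. If X < 0, positivity of D gives -X < 2 b and a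
     >= b gives -X <= c + d. The first bound forces c + d < b, and then (c + d)^2 <= b (c + d)
     contradicts the second. *)
  assert (X0 : 0 <= X).
  { destruct (Rle_or_lt 0 X) as [h | h]; [exact h | exfalso].
    assert (h1 : 0 < X + 2 * b) by (unfold X; lra).
    assert (h2 : 0 <= X + c + d) by (unfold X; lra).
    assert (h3 : (- X) * (- X) < (2 * b) * (2 * b)) by (apply Rmult_le_0_lt_compat; lra).
    assert (h4 : (- X) * (- X) <= (c + d) * (c + d)) by (apply Rmult_le_compat; lra).
    assert (h0 : 0 < c * d /\ 0 < b * c /\ 0 < b * d) by (repeat split; apply Rmult_lt_0_compat; lra).
    assert (h5 : b * (c + d) < b * b) by lra.
    assert (h6 : c + d < b) by (apply (Rmult_lt_reg_l b); lra).
    assert (h7 : (c + d) * (c + d) <= b * (c + d)) by (apply Rmult_le_compat_r; lra).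
    lra. }
  assert (P : (1 + c) * (1 + d) = (2 * C * F) * (2 * C * F)) by (rewrite Hc2, Hd2; ring).
  assert (Q : 0 <= 2 * C * F) by (repeat apply Rmult_le_pos; lra).
  split.
  - assert (0 <= (b - 1) * (c + d)) by (apply Rmult_le_pos; lra).
    assert (4 * ((1 + c) * (1 + d)) <= X * X) by lra.
    assert (2 * (2 * C * F) <= X) by (apply Rsqr_incr_0; unfold Rsqr; [rewrite P in *; lra | lra | lra]).
    apply Rsqr_incr_0; unfold Rsqr; [| lra | lra]. unfold X in *. lra.
  - intros e. specialize (Hb1 e). subst b.
    assert (X = 2 * (2 * C * F)).
    { apply Rsqr_inj; [lra | lra |]. unfold Rsqr. rewrite HX. nra. }
    apply Rsqr_inj; [lra | lra |]. unfold Rsqr. unfold X in *. nra.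
Qed.

(** Rests on the formula sinh al * sinh be = cosh ga of the right-angled pentagon, which takes over
    when the two inner ones of the four sides are adjacent and their Gram entry vanishes. *)
Lemma quad_cosh_degenerate (al be ga : R) : 0 <= al -> 0 <= be ->
  (cosh al * cosh be) * (cosh al * cosh be) + 1
    = cosh al * cosh al + cosh be * cosh be + cosh ga * cosh ga ->
  cosh (al + be) = cosh (al - be) + 2 * cosh ga.
Proof.
  intros Hal Hbe H. pose proof (cosh_ge_1 ga).
  pose proof (cosh_sq al) as A. pose proof (cosh_sq be) as B.
  pose proof (sinh_nonneg al Hal). pose proof (sinh_nonneg be Hbe).
  assert (sinh al * sinh be = cosh ga).
  { apply Rsqr_inj; [nra | lra |]. unfold Rsqr.
    replace (sinh al * sinh be * (sinh al * sinh be))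
      with ((sinh al * sinh al) * (sinh be * sinh be)) by ring.
    replace (sinh al * sinh al) with (cosh al * cosh al - 1) by lra.
    replace (sinh be * sinh be) with (cosh be * cosh be - 1) by lra. lra. }
  rewrite cosh_add, cosh_sub. lra.
Qed.

Section Distances.

Variables (n : nat) (v m : nat -> vec3) (len : nat -> R).
Hypothesis Hn : (6 <= n)%nat.
Hypothesis RP : rpoly n v m len.

(** Distance between the lines of sides [i] and [i + j], for [2 <= j <= n - 2]. *)
Definition side_dist (mm : nat -> vec3) (i j : nat) : R := acosh (- mink (mm i) (mm (i + j)%nat)).

Let gd := side_dist m.

Lemma side_dist_nonneg (i j : nat) : (2 <= j <= n - 2)%nat -> 0 <= gd i j.
Proof. intros H. apply acosh_nonneg, (rp_gram n v m len Hn RP i j H). Qed.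

Lemma cosh_side_dist (i j : nat) : (2 <= j <= n - 2)%nat ->
  cosh (gd i j) = - mink (m i) (m (i + j)%nat).
Proof. intros H. apply cosh_acosh, (rp_gram n v m len Hn RP i j H). Qed.

Lemma side_dist_per (i j : nat) : gd (i + n) j = gd i j.
Proof.
  unfold gd, side_dist. replace (i + n + j)%nat with ((i + j) + n)%nat by lia.
  rewrite !(rp_per_m _ _ _ _ RP). reflexivity.
Qed.

Lemma side_dist_sym (i j : nat) : (j <= n)%nat -> gd (i + j) (n - j) = gd i j.
Proof.
  intros Hj. unfold gd, side_dist. replace (i + j + (n - j))%nat with (i + n)%nat by lia.
  rewrite (rp_per_m _ _ _ _ RP), mink_comm. reflexivity.
Qed.

Lemma side_dist_2 (i : nat) : gd i 2 = len (S i).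
Proof.
  unfold gd, side_dist. replace (i + 2)%nat with (S (S i)) by lia.
  rewrite (rp_normal_next n v m len RP). mexp.
  rewrite (rp_on_end n v m len RP), (rp_unit n v m len RP).
  replace (- (- sinh (len (S i)) * 0 + - cosh (len (S i)) * 1)) with (cosh (len (S i))) by ring.
  apply acosh_cosh. left. apply (rp_len _ _ _ _ RP).
Qed.

Lemma vertex_cross (i : nat) : v (S i) = vscal (-1) (vcross (m i) (m (S i))).
Proof.
  pose proof (rp_frame _ _ _ _ RP i) as F. pose proof (frame_det _ _ _ F) as HD.
  apply (vec_eq_of_mink _ _ _ _ _ HD); rewrite mink_scal_l, mink_cross.
  - rewrite <- det3_rot, (rp_det _ _ _ _ RP). destruct F as (-> & _). ring.
  - destruct F as (_ & _ & _ & -> & _).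
    rewrite det3_eq13. ring.
  - destruct F as (_ & _ & _ & _ & -> & _).
    rewrite det3_eq23. ring.
Qed.

(** D is cosh of the distance between the vertices [v (S i)] and [v (S l)]. The relation comes from
    expanding the first vertex in the frame at the second, and the two normals at the second vertex
    in the frame at the first. *)
Lemma gram_relation (i l : nat) :
  let D := mink (m i) (m l) * mink (m (S i)) (m (S l)) - mink (m i) (m (S l)) * mink (m (S i)) (m l) in
  1 <= D /\
  D * D + 1 = mink (m i) (m l) * mink (m i) (m l) + mink (m (S i)) (m l) * mink (m (S i)) (m l)
    + (mink (m i) (m (S l)) * mink (m i) (m (S l)) + mink (m (S i)) (m (S l)) * mink (m (S i)) (m (S l))).
Proof.
  intros D.
  pose proof (rp_frame _ _ _ _ RP) as F.
  assert (E : D = - mink (v (S i)) (v (S l))).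
  { rewrite (vertex_cross i), (vertex_cross l). mexp. rewrite mink_cross_cross. unfold D. ring. }
  split; [rewrite E; apply hyp_mink; apply (rp_hyp _ _ _ _ RP) |].
  pose proof (frame_mink _ _ _ (v (S i)) (v (S i)) (F l)) as E1.
  pose proof (frame_mink _ _ _ (m l) (m l) (F i)) as E2.
  pose proof (frame_mink _ _ _ (m (S l)) (m (S l)) (F i)) as E3.
  rewrite (rp_unit n v m len RP) in E2, E3.
  assert (E0 : mink (v (S i)) (v (S i)) = -1) by apply (F i).
  rewrite E0 in E1. rewrite E.
  rewrite (mink_comm (m l) (v (S i))), (mink_comm (m l) (m i)), (mink_comm (m l) (m (S i))) in E2.
  rewrite (mink_comm (m (S l)) (v (S i))), (mink_comm (m (S l)) (m i)),
    (mink_comm (m (S l)) (m (S i))) in E3.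
  lra.
Qed.

Lemma side_dist_quad (i j : nat) : (3 <= j <= n - 3)%nat ->
  cosh ((gd i (S j) + gd (S i) (j - 1)) / 2) + cosh ((gd i (S j) - gd (S i) (j - 1)) / 2)
    <= cosh ((gd i j + gd (S i) j) / 2) /\
  (gd i j = gd (S i) j ->
   cosh ((gd i (S j) + gd (S i) (j - 1)) / 2) + cosh ((gd i (S j) - gd (S i) (j - 1)) / 2)
    = cosh ((gd i j + gd (S i) j) / 2)).
Proof.
  intros Hj. destruct (gram_relation i (i + j)) as [H1 H2].
  apply quad_cosh; try (apply side_dist_nonneg; lia); rewrite !cosh_side_dist by lia;
    replace (S i + (j - 1))%nat with (i + j)%nat by lia;
    replace (i + S j)%nat with (S (i + j)) by lia;
    replace (S i + j)%nat with (S (i + j)) by lia; cbv zeta in *; lra.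
Qed.

Lemma side_dist_quad_2 (i : nat) :
  cosh (gd i 2 + gd (S i) 2) = cosh (gd i 2 - gd (S i) 2) + 2 * cosh (gd i 3).
Proof.
  destruct (gram_relation i (i + 2)) as [H1 H2]. cbv zeta in *.
  assert (Z : mink (m (S i)) (m (i + 2)%nat) = 0).
  { replace (i + 2)%nat with (S (S i)) by lia. apply (rp_orth n v m len RP). }
  rewrite Z in *.
  apply quad_cosh_degenerate; try (apply side_dist_nonneg; lia). rewrite !cosh_side_dist by lia.
  replace (i + 3)%nat with (S (i + 2)) by lia. replace (S i + 2)%nat with (S (i + 2)) by lia. lra.
Qed.

Definition mean_dist (j : nat) : R := mean n (fun i => gd i j).

Lemma mean_dist_sym (j : nat) : (j <= n)%nat -> mean_dist (n - j) = mean_dist j.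
Proof.
  intros Hj. unfold mean_dist, mean. f_equal.
  rewrite <- (rsum_shift n j (fun i => gd i (n - j))) by (intros; apply side_dist_per).
  apply rsum_ext. intros i _. apply side_dist_sym, Hj.
Qed.

Lemma mean_shift1 (j : nat) : mean n (fun i => gd (S i) j) = mean_dist j.
Proof.
  unfold mean_dist, mean. f_equal.
  apply (rsum_shift1 n (fun i => gd i j)). rewrite <- (side_dist_per 0 j). reflexivity.
Qed.

(** Averages [side_dist_quad]. The differences enter through their absolute values, since the
    averaging lemma takes nonnegative arguments, and the mean of |y| is at least |mean y|. The
    product form is 1 + cosh x = 2 cosh^2 (x / 2). *)
Lemma mean_dist_quad (j : nat) : (3 <= j <= n - 3)%nat ->
  (1 + cosh (mean_dist (j - 1))) * (1 + cosh (mean_dist (S j)))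
    <= cosh (mean_dist j) * cosh (mean_dist j).
Proof.
  intros Hj. assert (Hn0 : (0 < n)%nat) by lia.
  assert (INn : INR n <> 0) by (apply not_0_INR; lia).
  set (x := fun i => (gd i (S j) + gd (S i) (j - 1)) / 2).
  set (y := fun i => Rabs ((gd i (S j) - gd (S i) (j - 1)) / 2)).
  set (t := fun i => (gd i j + gd (S i) j) / 2).
  destruct (cosh_mean_sum n x y t Hn0) as [H _].
  - intros i _. unfold x. pose proof (side_dist_nonneg i (S j) ltac:(lia)).
    pose proof (side_dist_nonneg (S i) (j - 1) ltac:(lia)). lra.
  - intros i _. apply Rabs_pos.
  - intros i _. unfold t. pose proof (side_dist_nonneg i j ltac:(lia)).
    pose proof (side_dist_nonneg (S i) j ltac:(lia)). lra.
  - intros i _. unfold x, y, t. rewrite cosh_Rabs. apply side_dist_quad, Hj.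
  - assert (ex : mean n x = (mean_dist (S j) + mean_dist (j - 1)) / 2).
    { rewrite <- (mean_shift1 (j - 1)). unfold mean_dist, mean.
      rewrite (rsum_ext n x (fun i => / 2 * (gd i (S j) + gd (S i) (j - 1))))
        by (intros; unfold x; field).
      rewrite rsum_scal, rsum_plus. field. exact INn. }
    assert (et : mean n t = mean_dist j).
    { transitivity ((mean_dist j + mean_dist j) / 2); [| field].
      rewrite <- (mean_shift1 j) at 2. unfold mean_dist, mean.
      rewrite (rsum_ext n t (fun i => / 2 * (gd i j + gd (S i) j))) by (intros; unfold t; field).
      rewrite rsum_scal, rsum_plus. field. exact INn. }
    assert (ey : Rabs ((mean_dist (S j) - mean_dist (j - 1)) / 2) <= mean n y).
    { rewrite <- (mean_shift1 (j - 1)). unfold mean_dist.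
      assert (A : forall q, (forall i, q i <= y i) -> mean n q <= mean n y).
      { intros q Hq. unfold mean. apply Rmult_le_compat_r; [left; apply Rinv_0_lt_compat, lt_0_INR; lia |].
        apply rsum_le; auto. }
      set (q := fun i => (gd i (S j) - gd (S i) (j - 1)) / 2).
      assert (eq1 : mean n q = (mean n (fun i => gd i (S j)) - mean n (fun i => gd (S i) (j - 1))) / 2).
      { unfold mean. rewrite (rsum_ext n q (fun i => / 2 * (gd i (S j)) + (- / 2) * gd (S i) (j - 1)))
          by (intros; unfold q; field).
        rewrite rsum_plus, !rsum_scal. field. exact INn. }
      rewrite <- eq1. apply Rabs_le. split.
      - assert (mean n (fun i => - q i) <= mean n y).
        { apply A. intros i. unfold y. rewrite <- Rabs_Ropp. apply Rle_abs. }
        replace (mean n (fun i => - q i)) with (- mean n q) in H0; [lra |].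
        unfold mean. rewrite (rsum_ext n (fun i => - q i) (fun i => -1 * q i)) by (intros; ring).
        rewrite rsum_scal. field. exact INn.
      - apply A. intros i. apply Rle_abs. }
    rewrite ex, et in H.
    apply (cosh_le _ _ (Rabs_pos _)) in ey. rewrite cosh_Rabs in ey.
    set (g := mean_dist (S j)) in *. set (e := mean_dist (j - 1)) in *.
    pose proof (cosh_half g) as hg. pose proof (cosh_half e) as he.
    pose proof (cosh_prod_sum (g / 2) (e / 2)) as P.
    replace (g / 2 + e / 2) with ((g + e) / 2) in P by field.
    replace (g / 2 - e / 2) with ((g - e) / 2) in P by field.
    assert (K : 2 * (cosh (g / 2) * cosh (e / 2)) <= cosh (mean_dist j)) by lra.
    pose proof (cosh_ge_1 (g / 2)). pose proof (cosh_ge_1 (e / 2)).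
    rewrite hg, he.
    replace ((1 + (2 * (cosh (e / 2) * cosh (e / 2)) - 1)) * (1 + (2 * (cosh (g / 2) * cosh (g / 2)) - 1)))
      with ((2 * (cosh (g / 2) * cosh (e / 2))) * (2 * (cosh (g / 2) * cosh (e / 2)))) by ring.
    assert (0 <= 2 * (cosh (g / 2) * cosh (e / 2))) by nra.
    apply Rmult_le_compat; assumption.
Qed.

(** Averaging is used twice: cosh t >= 1 + 2 cosh g is split as cosh g + cosh h with cosh h = 1 +
    cosh g, and h is itself bounded below in the mean. Equality forces cosh of the difference of
    neighbouring side lengths to be 1. *)
Lemma mean_dist_quad_2 :
  1 + cosh (mean_dist 3) <= cosh (mean_dist 2) * cosh (mean_dist 2) /\
  (1 + cosh (mean_dist 3) = cosh (mean_dist 2) * cosh (mean_dist 2) ->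
   forall i, (i < n)%nat -> len (S i) = len (S (S i))).
Proof.
  assert (Hn0 : (0 < n)%nat) by lia.
  assert (INn : INR n <> 0) by (apply not_0_INR; lia).
  set (g := fun i => gd i 3). set (h := fun i => acosh (1 + cosh (g i))).
  set (t := fun i => gd i 2 + gd (S i) 2).
  assert (Hg : forall i, (i < n)%nat -> 0 <= g i) by (intros; apply side_dist_nonneg; lia).
  assert (Hh : forall i, (i < n)%nat -> 0 <= h i).
  { intros i _. apply acosh_nonneg. pose proof (cosh_ge_1 (g i)). lra. }
  assert (Ch : forall i, cosh (h i) = 1 + cosh (g i)).
  { intros i. apply cosh_acosh. pose proof (cosh_ge_1 (g i)). lra. }
  assert (Ht : forall i, (i < n)%nat -> 0 <= t i).
  { intros i _. unfold t. pose proof (side_dist_nonneg i 2 ltac:(lia)).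
    pose proof (side_dist_nonneg (S i) 2 ltac:(lia)). lra. }
  assert (Q : forall i, cosh (t i) = cosh (gd i 2 - gd (S i) 2) + 2 * cosh (g i))
    by (intros; apply side_dist_quad_2).
  destruct (cosh_mean_sum n (fun _ => 0) g h Hn0) as [H1 _]; auto.
  { intros; lra. }
  { intros i _. rewrite Ch, cosh_0. lra. }
  destruct (cosh_mean_sum n g h t Hn0) as [H2 H3]; auto.
  { intros i _. rewrite Ch, Q. pose proof (cosh_ge_1 (gd i 2 - gd (S i) 2)). lra. }
  assert (E0 : mean n (fun _ => 0) = 0) by (unfold mean; rewrite rsum_const; field; exact INn).
  assert (Et : mean n t = 2 * mean_dist 2).
  { transitivity (mean_dist 2 + mean_dist 2); [| ring].
    rewrite <- (mean_shift1 2) at 2. unfold mean_dist, mean, t. rewrite rsum_plus. field. exact INn. }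
  assert (Eg : mean n g = mean_dist 3) by reflexivity.
  rewrite E0, cosh_0, Eg in H1. rewrite Eg, Et, cosh_double in H2. rewrite Eg, Et, cosh_double in H3.
  split; [lra |].
  intros He i Hi. specialize (H3 ltac:(lra) i Hi). rewrite Ch, Q in H3.
  assert (Z : cosh (gd i 2 - gd (S i) 2) = cosh 0) by (rewrite cosh_0; lra).
  rewrite <- cosh_Rabs in Z. apply cosh_inj in Z; [| apply Rabs_pos | lra].
  rewrite <- !side_dist_2. fold (gd i 2) (gd (S i) 2).
  destruct (Req_dec (gd i 2 - gd (S i) 2) 0) as [z | z]; [lra |].
  apply Rabs_no_R0 in z. contradiction.
Qed.

Hypothesis Hreg : forall i, len i = len O.

Lemma regular_mink (i j : nat) :
  mink (m i) (m (i + j)%nat) = mink (m O) (m j) /\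
  mink (m i) (m (i + S j)%nat) = mink (m O) (m (S j)) /\
  mink (m i) (v (i + S j)%nat) = mink (m O) (v (S j)).
Proof.
  induction j as [| j (IH1 & IH2 & IH3)].
  - rewrite Nat.add_0_r, Nat.add_1_r, !(rp_unit n v m len RP), !(rp_orth n v m len RP),
      !(rp_on_end n v m len RP). auto.
  - split; [exact IH2 |].
    replace (i + S (S j))%nat with (S (S (i + j))) by lia.
    rewrite !(rp_normal_next n v m len RP), !(rp_next _ _ _ _ RP). mexp.
    rewrite Nat.add_succ_r in IH3.
    rewrite (Hreg (S (i + j))), (Hreg (S j)), IH1, IH3. auto.
Qed.

Lemma regular_side_dist (i j : nat) : gd i j = gd O j.
Proof. unfold gd, side_dist. destruct (regular_mink i j) as [-> _]. reflexivity. Qed.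

Lemma regular_mean_dist (j : nat) : mean_dist j = gd O j.
Proof.
  unfold mean_dist, mean. rewrite (rsum_ext n _ (fun _ => gd O j)) by (intros; apply regular_side_dist).
  rewrite rsum_const. field. apply not_0_INR; lia.
Qed.

Lemma regular_quad (j : nat) : (3 <= j <= n - 3)%nat ->
  (1 + cosh (mean_dist (j - 1))) * (1 + cosh (mean_dist (S j)))
    = cosh (mean_dist j) * cosh (mean_dist j).
Proof.
  intros Hj. rewrite !regular_mean_dist.
  destruct (side_dist_quad 0 j Hj) as [_ H]. rewrite !(regular_side_dist 1) in H.
  specialize (H eq_refl).
  set (g := gd 0 (S j)) in *. set (e := gd 0 (j - 1)) in *.
  replace ((gd 0 j + gd 0 j) / 2) with (gd 0 j) in H by field.
  rewrite <- H. pose proof (cosh_half g) as hg. pose proof (cosh_half e) as he.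
  pose proof (cosh_prod_sum (g / 2) (e / 2)) as P.
  replace (g / 2 + e / 2) with ((g + e) / 2) in P by field.
  replace (g / 2 - e / 2) with ((g - e) / 2) in P by field.
  replace (cosh ((g + e) / 2) + cosh ((g - e) / 2)) with (2 * (cosh (g / 2) * cosh (e / 2))) by lra.
  rewrite hg, he. ring.
Qed.

Lemma regular_quad_2 : 1 + cosh (mean_dist 3) = cosh (mean_dist 2) * cosh (mean_dist 2).
Proof.
  rewrite !regular_mean_dist. pose proof (side_dist_quad_2 0) as H.
  rewrite !(regular_side_dist 1), Rminus_diag, cosh_0 in H.
  replace (gd 0 2 + gd 0 2) with (2 * gd 0 2) in H by ring. rewrite cosh_double in H. lra.
Qed.

End Distances.

(** * Comparison of sequences with a quadratic recursion *)

Lemma argmin_ratio (c c0 : nat -> R) (N : nat) : (2 <= N)%nat ->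
  exists j, (2 <= j <= N)%nat /\ forall i, (2 <= i <= N)%nat -> c j / c0 j <= c i / c0 i.
Proof.
  intros HN. induction N as [| N IH]; [lia |].
  destruct (Nat.eq_dec N 1) as [-> | h].
  - exists 2%nat. split; [lia |]. intros i Hi. replace i with 2%nat by lia. lra.
  - destruct IH as (j & Hj & H); [lia |].
    destruct (Rle_or_lt (c j / c0 j) (c (S N) / c0 (S N))) as [a | a].
    + exists j. split; [lia |]. intros i Hi.
      destruct (Nat.eq_dec i (S N)) as [-> | ne]; [exact a | apply H; lia].
    + exists (S N). split; [lia |]. intros i Hi.
      destruct (Nat.eq_dec i (S N)) as [-> | ne]; [lra |]. specialize (H i ltac:(lia)). lra.
Qed.

(** Discrete minimum principle: at an index where [c / c0] is minimal and less than 1,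
    [(1 + c_(j-1)) (1 + c_(j+1))] would exceed [(c_j)^2]. *)
Lemma log_concave_comparison (n : nat) (c c0 : nat -> R) : (6 <= n)%nat ->
  (forall j, 1 <= c j) -> (forall j, 1 <= c0 j) ->
  (forall j, (j <= n)%nat -> c (n - j)%nat = c j) ->
  (forall j, (j <= n)%nat -> c0 (n - j)%nat = c0 j) ->
  (forall j, (3 <= j <= n - 3)%nat -> (1 + c (j - 1)%nat) * (1 + c (S j)) <= c j * c j) ->
  (forall j, (3 <= j <= n - 3)%nat -> (1 + c0 (j - 1)%nat) * (1 + c0 (S j)) = c0 j * c0 j) ->
  1 + c 3%nat <= c 2%nat * c 2%nat -> 1 + c0 3%nat = c0 2%nat * c0 2%nat ->
  (forall j, (2 <= j <= n - 2)%nat -> c0 j <= c j) /\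
  (forall j, (2 <= j <= n - 2)%nat -> c j = c0 j -> 1 + c 3%nat = c 2%nat * c 2%nat /\ c 2%nat = c0 2%nat).
Proof.
  intros Hn H1 H10 Hs Hs0 Hq Hq0 H2 H20.
  assert (LE : forall j, (2 <= j <= n - 2)%nat -> c0 j <= c j).
  { destruct (argmin_ratio c c0 (n - 2) ltac:(lia)) as (j & Hj & Hmin).
    set (r := c j / c0 j) in *.
    assert (Hr0 : 0 < r) by (apply Rdiv_lt_0_compat; [specialize (H1 j) | specialize (H10 j)]; lra).
    assert (Hle : forall i, (2 <= i <= n - 2)%nat -> r * c0 i <= c i).
    { intros i Hi. specialize (Hmin i Hi). specialize (H10 i).
      apply (Rmult_le_compat_r (c0 i)) in Hmin; [| lra].
      unfold Rdiv in Hmin. rewrite Rmult_assoc, Rinv_l in Hmin by lra. lra. }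
    assert (Hcj : c j = r * c0 j) by (unfold r; specialize (H10 j); field; lra).
    destruct (Rle_or_lt 1 r) as [h | h].
    { intros i Hi. specialize (Hle i Hi). specialize (H10 i). nra. }
    exfalso.
    (* At index 2 the relation with index 3 replaces the product inequality: it would give 1 + r
       c0_3 <= 1 + c_3 <= r^2 (1 + c0_3), impossible for r < 1. Index n - 2 reduces to this one by
       symmetry. *)
    assert (K2 : c 2%nat = r * c0 2%nat -> False).
    { intros e. pose proof (Hle 3%nat ltac:(lia)) as L3. specialize (H10 3%nat).
      rewrite e in H2. nra. }
    destruct (Nat.eq_dec j 2) as [-> | n2]; [exact (K2 Hcj) |].
    destruct (Nat.eq_dec j (n - 2)) as [ej | n3].
    { apply K2. rewrite <- (Hs 2%nat), <- (Hs0 2%nat), <- ej by lia. exact Hcj. }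
    pose proof (Hle (j - 1)%nat ltac:(lia)) as La. pose proof (Hle (S j) ltac:(lia)) as Lb.
    specialize (Hq j ltac:(lia)). specialize (Hq0 j ltac:(lia)).
    pose proof (H10 (j - 1)%nat) as Ga. pose proof (H10 (S j)) as Gb.
    set (x := c (j - 1)%nat) in *. set (y := c (S j)) in *.
    set (x0 := c0 (j - 1)%nat) in *. set (y0 := c0 (S j)) in *.
    assert (A : r * (1 + x0) < 1 + x) by lra. assert (B : r * (1 + y0) < 1 + y) by lra.
    assert (P : (r * (1 + x0)) * (r * (1 + y0)) < (1 + x) * (1 + y)).
    { apply Rmult_le_0_lt_compat; nra. }
    rewrite Hcj in Hq. nra. }
  split; [exact LE |].
  assert (step : forall j, (3 <= j <= n - 3)%nat -> c j = c0 j -> c (j - 1)%nat = c0 (j - 1)%nat).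
  { intros j Hj e. specialize (Hq j Hj). specialize (Hq0 j Hj). rewrite e, <- Hq0 in Hq.
    pose proof (LE (j - 1)%nat ltac:(lia)) as La. pose proof (LE (S j) ltac:(lia)) as Lb.
    pose proof (H10 (j - 1)%nat). pose proof (H10 (S j)).
    assert ((1 + c (j - 1)%nat) * (1 + c0 (S j)) <= (1 + c0 (j - 1)%nat) * (1 + c0 (S j))) by nra.
    nra. }
  assert (down : forall d j, (2 <= j <= n - 3)%nat -> (j = 2 + d)%nat -> c j = c0 j -> c 2%nat = c0 2%nat).
  { induction d as [| d IH]; intros j Hj ej e.
    - rewrite ej in e. exact e.
    - apply (IH (j - 1)%nat); [lia | lia |]. apply step; [lia | exact e]. }
  intros j Hj e.
  assert (e2 : c 2%nat = c0 2%nat).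
  { destruct (Nat.eq_dec j (n - 2)) as [-> | ne].
    - rewrite (Hs 2%nat), (Hs0 2%nat) in e by lia. exact e.
    - apply (down (j - 2)%nat j); [lia | lia | exact e]. }
  split; [| exact e2].
  pose proof (LE 3%nat ltac:(lia)). rewrite e2 in *. lra.
Qed.

(** * Billiard words as products of reflections *)

Definition refl (u x : vec3) : vec3 := vadd x (vscal (-2 * mink x u) u).

Lemma refl_linear (u : vec3) (a b : R) (x y : vec3) :
  refl u (vadd (vscal a x) (vscal b y)) = vadd (vscal a (refl u x)) (vscal b (refl u y)).
Proof. unfold refl. vring. Qed.

Lemma refl_fix (u x : vec3) : mink x u = 0 -> refl u x = x.
Proof. intros H. unfold refl. rewrite H. clear. vring. Qed.

Lemma mink_refl (u x y : vec3) : mink u u = 1 -> mink (refl u x) (refl u y) = mink x y.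
Proof. intros H. unfold refl. mexp. rewrite (mink_comm u y), H. ring. Qed.

Lemma refl_involutive (u x : vec3) : mink u u = 1 -> refl u (refl u x) = x.
Proof.
  intros H. unfold refl at 1. unfold refl at 2. mexp. rewrite H. unfold refl.
  generalize (mink x u). intros t. clear. vring.
Qed.

Lemma mink_refl_self (u x : vec3) : mink u u = 1 -> mink u (refl u x) = - mink u x.
Proof. intros H. unfold refl. mexp. rewrite (mink_comm x u), H. ring. Qed.

Lemma hyp_of_mink_neg (p y : vec3) : hyp p -> mink y y = -1 -> mink y p < 0 -> hyp y.
Proof.
  intros Hp Hy H. split; [exact Hy |].
  destruct (Rlt_or_le 0 (fst (fst y))) as [h | h]; [exact h | exfalso].
  assert (Hn : hyp (vscal (-1) y)).
  { split; [mexp; rewrite Hy; ring |].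
    destruct y as [[y0 y1] y2]. unfold mink in Hy. simpl in *.
    assert (y0 <> 0) by (intros ->; nra). lra. }
  pose proof (hyp_mink _ _ Hn Hp) as K. rewrite mink_scal_l in K. lra.
Qed.

Lemma refl_hyp (u p x : vec3) : mink u u = 1 -> hyp p -> mink u p = 0 -> hyp x -> hyp (refl u x).
Proof.
  intros Hu Hp Hup Hx. apply (hyp_of_mink_neg p); [exact Hp | rewrite mink_refl by exact Hu; apply Hx |].
  rewrite <- (refl_fix u p) at 1 by (rewrite mink_comm; exact Hup).
  rewrite mink_refl by exact Hu. pose proof (hyp_mink x p Hx Hp). lra.
Qed.

Definition rword (m : nat -> vec3) (s : list nat) (x : vec3) : vec3 :=
  fold_right (fun u y => refl (m u) y) x s.

Lemma rword_cons (m : nat -> vec3) (u : nat) (s : list nat) (x : vec3) :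
  rword m (u :: s) x = refl (m u) (rword m s x).
Proof. reflexivity. Qed.

Lemma rword_linear (m : nat -> vec3) (s : list nat) (a b : R) (x y : vec3) :
  rword m s (vadd (vscal a x) (vscal b y)) = vadd (vscal a (rword m s x)) (vscal b (rword m s y)).
Proof.
  induction s as [| u s IH]; [reflexivity |].
  rewrite !rword_cons, IH, refl_linear. reflexivity.
Qed.

Lemma mink_rword (m : nat -> vec3) (s : list nat) (x y : vec3) :
  (forall i, mink (m i) (m i) = 1) -> mink (rword m s x) (rword m s y) = mink x y.
Proof.
  intros H. induction s as [| u s IH]; [reflexivity |].
  rewrite !rword_cons, mink_refl, IH; auto.
Qed.

(** Indices outside the polygon commute with everything. *)
Definition adjn (n i j : nat) : bool :=
  (n <=? i)%nat || (n <=? j)%nat || (i =? S j)%nat || (j =? S i)%nat ||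
  ((i =? 0)%nat && (S j =? n)%nat) || ((j =? 0)%nat && (S i =? n)%nat).

Lemma adjn_sym (n i j : nat) : adjn n i j = adjn n j i.
Proof.
  unfold adjn.
  destruct (n <=? i)%nat, (n <=? j)%nat, (i =? S j)%nat, (j =? S i)%nat, (i =? 0)%nat, (S j =? n)%nat,
    (j =? 0)%nat, (S i =? n)%nat; reflexivity.
Qed.

Lemma adjn_false (n i j : nat) : adjn n i j = false ->
  (i < n /\ j < n /\ (i = j \/ 2 <= Nat.max i j - Nat.min i j <= n - 2))%nat.
Proof.
  unfold adjn. rewrite !Bool.orb_false_iff, !Bool.andb_false_iff, !Nat.leb_gt, !Nat.eqb_neq. lia.
Qed.

Lemma adjn_true (n i j : nat) : (i < n)%nat -> (j < n)%nat -> adjn n i j = true ->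
  (i = S j \/ j = S i \/ (i = 0 /\ S j = n) \/ (j = 0 /\ S i = n))%nat.
Proof.
  intros Hi Hj. unfold adjn.
  rewrite !Bool.orb_true_iff, !Bool.andb_true_iff, !Nat.leb_le, !Nat.eqb_eq. lia.
Qed.

(** Turns distances indexed by first side and offset into parameters indexed by two labels. All
    other pairs get 0, so that order and means of parameters are controlled at every pair. *)
Definition dparam (n : nat) (dist : nat -> nat -> R) : params := fun i j =>
  if ((j <? n) && (2 <=? j - i) && (j - i <=? n - 2))%nat then dist i (j - i)%nat else 0.

Lemma dparam_cases (n : nat) (i j : nat) :
  ((j < n /\ 2 <= j - i <= n - 2)%nat /\ forall dist, dparam n dist i j = dist i (j - i)%nat) \/
  (forall dist, dparam n dist i j = 0).
Proof.
  unfold dparam.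
  destruct ((j <? n) && (2 <=? j - i) && (j - i <=? n - 2))%nat eqn:E; [left | right; reflexivity].
  rewrite !Bool.andb_true_iff, Nat.ltb_lt, !Nat.leb_le in E. split; [lia | reflexivity].
Qed.

Lemma dparam_valid (n i j : nat) (dist : nat -> nat -> R) :
  (j < n /\ 2 <= j - i <= n - 2)%nat -> dparam n dist i j = dist i (j - i)%nat.
Proof.
  intros H. unfold dparam.
  assert (E : ((j <? n) && (2 <=? j - i) && (j - i <=? n - 2))%nat = true).
  { rewrite !Bool.andb_true_iff, Nat.ltb_lt, !Nat.leb_le. lia. }
  rewrite E. reflexivity.
Qed.

Lemma periodic_mul {A : Type} (q : nat) (f : nat -> A) :
  (forall i, f (i + q)%nat = f i) -> forall N i, f (i + N * q)%nat = f i.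
Proof.
  intros H N. induction N as [| N IH]; intros i; [rewrite Nat.add_0_r; reflexivity |].
  rewrite <- (IH i), <- (H (i + N * q)%nat). f_equal. lia.
Qed.

Lemma periodic_mod {A : Type} (q : nat) (f : nat -> A) :
  (forall i, f (i + q)%nat = f i) -> forall i, f i = f (i mod q)%nat.
Proof.
  intros H i. rewrite (Nat.div_mod_eq i q) at 1.
  rewrite Nat.add_comm, Nat.mul_comm. apply periodic_mul, H.
Qed.

(** What the formal representation needs from the normals. No vertices are mentioned, so it also
    applies to the intermediate configurations of the deformation. *)
Record gram_family (n : nat) (m : nat -> vec3) : Prop := {
  gf_unit : forall i, (i < n)%nat -> mink (m i) (m i) = 1;
  gf_orth : forall i, (S i < n)%nat -> mink (m i) (m (S i)) = 0;
  gf_orth_last : mink (m 0%nat) (m (n - 1)%nat) = 0;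
  gf_apart : forall i j, (2 <= j <= n - 2)%nat -> (i + j < n)%nat -> 1 <= - mink (m i) (m (i + j)%nat)
}.

(** Padding by 1 keeps the coordinates of an interior point positive at every label; the padded
    entries never move, because their Gram entries with the sides vanish. *)
Definition coords (n : nat) (mm : nat -> vec3) (x : vec3) : nat -> R :=
  fun j => if (j <? n)%nat then mink (mm j) x else 1.

(** * Geometric realisation of the formal reflections *)

Section GramFamily.

Variables (n : nat) (m : nat -> vec3).
Hypothesis GF : gram_family n m.

Lemma gram_geometric (i j : nat) : (i < n)%nat -> (j < n)%nat -> i <> j ->
  gram (adjn n) (dparam n (side_dist m)) i j = - mink (m i) (m j).
Proof.
  intros Hi Hj Hij. unfold gram. destruct (adjn n i j) eqn:E.
  - assert (Z : mink (m i) (m j) = 0); [| lra].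
    destruct (adjn_true n i j Hi Hj E) as [-> | [-> | [[-> h] | [-> h]]]].
    + rewrite mink_comm. apply (gf_orth _ _ GF), Hi.
    + apply (gf_orth _ _ GF), Hj.
    + replace j with (n - 1)%nat by lia. apply (gf_orth_last _ _ GF).
    + rewrite mink_comm. replace i with (n - 1)%nat by lia. apply (gf_orth_last _ _ GF).
  - apply adjn_false in E.
    rewrite dparam_valid by lia. unfold side_dist.
    rewrite cosh_acosh by (apply (gf_apart _ _ GF); lia).
    replace (Nat.min i j + (Nat.max i j - Nat.min i j))%nat with (Nat.max i j) by lia.
    destruct (Nat.le_gt_cases i j) as [h | h].
    + rewrite Nat.min_l, Nat.max_r by lia. reflexivity.
    + rewrite Nat.min_r, Nat.max_l, mink_comm by lia. reflexivity.
Qed.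

Lemma reflect_coords (u : nat) (x : vec3) : (u < n)%nat ->
  reflect (adjn n) (dparam n (side_dist m)) u (coords n m x) = coords n m (refl (m u) x).
Proof.
  intros Hu. apply functional_extensionality. intros j.
  assert (Cu : coords n m x u = mink (m u) x).
  { unfold coords. destruct (Nat.ltb_spec u n); [reflexivity | lia]. }
  destruct (Nat.eq_dec j u) as [-> | ne].
  - rewrite reflect_self, Cu. unfold coords. destruct (Nat.ltb_spec u n); [| lia].
    symmetry. apply mink_refl_self, (gf_unit _ _ GF), Hu.
  - rewrite reflect_other, Cu by exact ne. unfold coords at 1 2.
    destruct (Nat.ltb_spec j n) as [h | h].
    + rewrite gram_geometric by auto. unfold refl. mexp.
      rewrite (mink_comm x (m u)), (mink_comm (m j) (m u)). ring.
    + unfold gram. assert (E : adjn n u j = true).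
      { unfold adjn. replace (n <=? j)%nat with true by (symmetry; apply Nat.leb_le, h).
        rewrite Bool.orb_true_r. reflexivity. }
      rewrite E. ring.
Qed.

Lemma act_coords (s : list nat) (x : vec3) : (forall u, In u s -> (u < n)%nat) ->
  act (adjn n) (dparam n (side_dist m)) s (coords n m x) = coords n m (rword m s x).
Proof.
  intros H. induction s as [| u s IH]; [reflexivity |].
  rewrite act_cons, rword_cons, IH by (intros; apply H; right; assumption).
  apply reflect_coords, H. left; reflexivity.
Qed.

End GramFamily.

Section Bridge.

Variables (n : nat) (v m : nat -> vec3) (len : nat -> R).
Hypothesis Hn : (6 <= n)%nat.
Hypothesis RP : rpoly n v m len.

Lemma gram_family_of_rpoly : gram_family n m.
Proof.
  constructor; intros.
  - apply (rp_unit n v m len RP).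
  - apply (rp_orth n v m len RP).
  - rewrite mink_comm, <- (rp_per_m _ _ _ _ RP 0). replace (0 + n)%nat with (S (n - 1)) by lia.
    apply (rp_orth n v m len RP).
  - apply (rp_gram n v m len Hn RP). assumption.
Qed.

(** The normalised midpoint of [v 0] and [v 2]: these vertices share no side, so each normal is
    positive on at least one of them. *)
Lemma interior_point : exists b, hyp b /\ forall j, (j < n)%nat -> 0 < mink (m j) b.
Proof.
  pose proof (rp_hyp _ _ _ _ RP) as HV.
  set (w := vadd (v 0%nat) (v 2%nat)).
  assert (Hw : mink w w <= -4).
  { unfold w. mexp. rewrite (mink_comm (v 2%nat) (v 0%nat)).
    destruct (HV 0%nat) as [-> _]. destruct (HV 2%nat) as [-> _].
    pose proof (hyp_mink _ _ (HV 0%nat) (HV 2%nat)). lra. }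
  assert (Hj : forall j, (j < n)%nat -> 0 < mink (m j) w).
  { intros j Hj. unfold w. mexp.
    assert (A : 0 <= mink (m j) (v 0%nat) /\ (j <> 0%nat -> j <> (n - 1)%nat -> 0 < mink (m j) (v 0%nat))).
    { rewrite <- (rp_per_v _ _ _ _ RP 0). replace (0 + n)%nat with (j + (n - j))%nat by lia. split.
      - apply (rp_vertex_nonneg n v m len Hn RP). lia.
      - intros. apply (rp_in _ _ _ _ RP). lia. }
    assert (B : 0 <= mink (m j) (v 2%nat) /\ (j <> 1%nat -> j <> 2%nat -> 0 < mink (m j) (v 2%nat))).
    { destruct (Nat.le_gt_cases j 2) as [h | h].
      - replace 2%nat with (j + (2 - j))%nat at 1 3 by lia. split.
        + apply (rp_vertex_nonneg n v m len Hn RP). lia.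
        + intros. apply (rp_in _ _ _ _ RP). lia.
      - rewrite <- (rp_per_v _ _ _ _ RP 2). replace (2 + n)%nat with (j + (2 + n - j))%nat by lia. split.
        + apply (rp_vertex_nonneg n v m len Hn RP). lia.
        + intros. apply (rp_in _ _ _ _ RP). lia. }
    destruct A as [A0 A1], B as [B0 B1].
    destruct (Nat.eq_dec j 1); [specialize (A1 ltac:(lia) ltac:(lia)); lra |].
    destruct (Nat.eq_dec j 2); [specialize (A1 ltac:(lia) ltac:(lia)); lra |].
    specialize (B1 ltac:(lia) ltac:(lia)). lra. }
  set (N := - mink w w). assert (HN : 0 < N) by (unfold N; lra).
  pose proof (sqrt_lt_R0 N HN) as Hs. pose proof (sqrt_sqrt N ltac:(lra)) as Hss.
  exists (vscal (/ sqrt N) w). split; [split |].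
  - mexp. replace (mink w w) with (- (sqrt N * sqrt N)) by (rewrite Hss; unfold N; ring). field. lra.
  - destruct (HV 0%nat) as [_ h0]. destruct (HV 2%nat) as [_ h2].
    assert (0 < fst (fst w)).
    { unfold w. destruct (v 0%nat) as [[? ?] ?], (v 2%nat) as [[? ?] ?]. simpl in *. lra. }
    destruct w as [[w0 w1] w2]. simpl in *. apply Rmult_lt_0_compat; [apply Rinv_0_lt_compat |]; assumption.
  - intros j Hj'. mexp. apply Rmult_lt_0_compat; [apply Rinv_0_lt_compat; assumption | auto].
Qed.

End Bridge.

(** A closed billiard trajectory of period [q] with bounces [p i] on the sides [a i], outgoing
    unit directions [t i] and segment lengths [L i]. *)
Record trajectory (n : nat) (m : nat -> vec3) (q : nat) (a : nat -> nat)
    (p t : nat -> vec3) (L : nat -> R) : Prop := {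
  tr_q : (1 <= q)%nat;
  tr_letter : forall i, (a i < n)%nat;
  tr_per_a : forall i, a (i + q)%nat = a i;
  tr_per_p : forall i, p (i + q)%nat = p i;
  tr_per_t : forall i, t (i + q)%nat = t i;
  tr_per_L : forall i, L (i + q)%nat = L i;
  tr_hyp : forall i, hyp (p i);
  tr_tan : forall i, mink (p i) (t i) = 0 /\ mink (t i) (t i) = 1;
  tr_len : forall i, 0 < L i;
  tr_move : forall i, p (S i) = vadd (vscal (cosh (L i)) (p i)) (vscal (sinh (L i)) (t i));
  tr_bounce : forall i, t (S i) =
    refl (m (a (S i))) (vadd (vscal (sinh (L i)) (p i)) (vscal (cosh (L i)) (t i)));
  tr_on : forall i, mink (m (a i)) (p i) = 0;
  tr_transverse : forall i, 0 < mink (m (a i)) (t i);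
  tr_side : forall i j, (j < n)%nat -> j <> a i -> 0 < mink (m j) (p i)
}.

(** The letters of the bounces e + 1, ..., e + M with the latest in front, in agreement with the
    order of action. *)
Fixpoint word (a : nat -> nat) (e M : nat) : list nat :=
  match M with O => [] | S M' => a (e + S M')%nat :: word a e M' end.

Lemma word_letters (n : nat) (a : nat -> nat) (e M u : nat) :
  (forall i, (a i < n)%nat) -> In u (word a e M) -> (u < n)%nat.
Proof.
  intros H. induction M as [| M IH]; simpl; [tauto |]. intros [<- | h]; auto.
Qed.

Definition span (L : nat -> R) (e M : nat) : R := rsum M (fun i => L (e + i)%nat).

Lemma span_S (L : nat -> R) (e M : nat) : span L e (S M) = span L e M + L (e + M)%nat.
Proof. reflexivity. Qed.

Lemma span_add (L : nat -> R) (e M N : nat) : span L e (M + N) = span L e M + span L (e + M) N.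
Proof.
  unfold span. rewrite rsum_add. f_equal. apply rsum_ext. intros. f_equal. lia.
Qed.

Lemma span_ge (L : nat -> R) (e M : nat) (l : R) : (forall i, l <= L i) -> INR M * l <= span L e M.
Proof.
  intros H. unfold span. rewrite <- rsum_const. apply rsum_le. auto.
Qed.

Lemma span_period (L : nat -> R) (q N e : nat) : (forall i, L (i + q)%nat = L i) ->
  span L e (N * q) = INR N * rsum q L.
Proof.
  intros H. unfold span. transitivity (INR N * rsum q (fun i => L (e + i)%nat)).
  - apply (rsum_period_mul N q (fun i => L (e + i)%nat)). intros i. rewrite <- (H (e + i)%nat). f_equal. lia.
  - f_equal. rewrite <- (rsum_shift q e L H). apply rsum_ext. intros. f_equal. lia.
Qed.

(** * Unfolding a trajectory *)

Section Flow.

Variables (n : nat) (m : nat -> vec3) (q : nat) (a : nat -> nat) (p t : nat -> vec3) (L : nat -> R).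
Hypothesis Hunit : forall i, mink (m i) (m i) = 1.
Hypothesis TR : trajectory n m q a p t L.

Let move := tr_move _ _ _ _ _ _ _ TR.
Let bounce := tr_bounce _ _ _ _ _ _ _ TR.
Let on := tr_on _ _ _ _ _ _ _ TR.

Definition sine (i : nat) : R := mink (m (a i)) (t i).

Lemma incoming (i : nat) :
  vadd (vscal (sinh (L i)) (p i)) (vscal (cosh (L i)) (t i)) = refl (m (a (S i))) (t (S i)).
Proof. rewrite (bounce i), refl_involutive by apply Hunit. reflexivity. Qed.

(** Unfolding seen from the current bounce: the reflections passed so far carry the start to the
    point at distance [span L e M] behind [p (e + M)], on the backward extension of the outgoing
    direction. *)
Lemma flow (e M : nat) :
  rword m (word a e M) (p e) =
    vadd (vscal (cosh (span L e M)) (p (e + M)%nat)) (vscal (- sinh (span L e M)) (t (e + M)%nat)) /\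
  rword m (word a e M) (t e) =
    vadd (vscal (- sinh (span L e M)) (p (e + M)%nat)) (vscal (cosh (span L e M)) (t (e + M)%nat)).
Proof.
  induction M as [| M [IH1 IH2]].
  - unfold span. simpl rsum. rewrite Nat.add_0_r, cosh_0, sinh_0. simpl. split; clear; generalize (p e) (t e); vring.
  - simpl word. rewrite !rword_cons, IH1, IH2, !refl_linear, span_S. clear IH1 IH2.
    replace (e + S M)%nat with (S (e + M)) by lia.
    set (i := (e + M)%nat). set (T := span L e M).
    pose proof (incoming i) as I.
    assert (Hp : refl (m (a (S i))) (p (S i)) = p (S i)).
    { apply refl_fix. rewrite mink_comm. apply on. }
    assert (Hs : refl (m (a (S i))) (vadd (vscal (sinh (L i)) (p i)) (vscal (cosh (L i)) (t i))) = t (S i)).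
    { rewrite I. apply refl_involutive, Hunit. }
    rewrite (move i), refl_linear in Hp. rewrite refl_linear in Hs.
    rewrite <- (move i) in Hp.
    set (X := refl (m (a (S i))) (p i)) in *. set (Y := refl (m (a (S i))) (t i)) in *.
    rewrite cosh_add, sinh_add, <- Hp, <- Hs. pose proof (cosh_sq (L i)) as C.
    revert C. generalize X Y (cosh (L i)) (sinh (L i)) (cosh T) (sinh T). clear.
    intros X Y c s C S' H. 
    assert (H' : 1 = c * c - s * s) by lra. 
    split; vec; apply vec_ext;
    match goal with |- ?l = ?r =>
      transitivity (1 * l); [ring | rewrite H'; ring] end.
Qed.

Lemma sine_incoming (i : nat) :
  mink (m (a (S i))) (vadd (vscal (sinh (L i)) (p i)) (vscal (cosh (L i)) (t i))) = - sine (S i).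
Proof. rewrite incoming. apply mink_refl_self, Hunit. Qed.

(** On a geodesic meeting a line under the angle theta, sinh of the distance to the line is sinh x
    sin theta at distance x from the intersection. The length has one segment more than the word has
    letters, because the last bounce is not reflected. *)
Lemma flow_value (e M : nat) :
  mink (m (a (S (e + M)))) (rword m (word a e M) (p e)) = sinh (span L e (S M)) * sine (S (e + M)) /\
  mink (m (a (S (e + M)))) (rword m (word a e M) (t e)) = - cosh (span L e (S M)) * sine (S (e + M)).
Proof.
  destruct (flow e M) as [-> ->]. rewrite span_S. set (i := (e + M)%nat). set (T := span L e M).
  pose proof (on (S i)) as O. rewrite (move i) in O. pose proof (sine_incoming i) as Sn.
  revert O Sn. mexp. intros O Sn. rewrite sinh_add, cosh_add.
  pose proof (cosh_sq (L i)) as C.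
  set (x := mink (m (a (S i))) (p i)) in *. set (y := mink (m (a (S i))) (t i)) in *.
  set (c := cosh (L i)) in *. set (s := sinh (L i)) in *.
  assert (Ex : x = s * sine (S i)).
  { transitivity (x * (c * c - s * s)); [rewrite C; ring |].
    transitivity (c * (c * x + s * y) - s * (s * x + c * y)); [ring | rewrite O, Sn; ring]. }
  assert (Ey : y = - c * sine (S i)).
  { transitivity (y * (c * c - s * s)); [rewrite C; ring |].
    transitivity (c * (s * x + c * y) - s * (c * x + s * y)); [ring | rewrite O, Sn; ring]. }
  rewrite Ex, Ey. split; ring.
Qed.

Lemma traj_dist (i : nat) : hdv (p i) (p (S i)) = L i.
Proof.
  unfold hdv. rewrite (move i). mexp.
  destruct (tr_tan _ _ _ _ _ _ _ TR i) as [-> _]. destruct (tr_hyp _ _ _ _ _ _ _ TR i) as [-> _].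
  replace (- (cosh (L i) * -1 + sinh (L i) * 0)) with (cosh (L i)) by ring.
  apply acosh_cosh. left. apply (tr_len _ _ _ _ _ _ _ TR).
Qed.

Lemma mink_le_of_orth (u x y : vec3) : mink u u = 1 -> hyp x -> hyp y -> mink u y = 0 ->
  mink u x <= - mink x y.
Proof.
  intros Hu Hx Hy Huy. set (A := vadd x (vscal (mink x y) y)).
  assert (HyA : mink y A = 0).
  { unfold A. mexp. rewrite (mink_comm y x). destruct Hy as [-> _]. ring. }
  pose proof (orth_cauchy y u A Hy ltac:(rewrite mink_comm; exact Huy) HyA) as Q.
  assert (E1 : mink u A = mink u x) by (unfold A; mexp; rewrite Huy; ring).
  assert (E2 : mink A A = mink x y * mink x y - 1).
  { unfold A. mexp. rewrite (mink_comm y x). destruct Hx as [-> _], Hy as [-> _]. ring. }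
  rewrite E1, E2, Hu in Q. pose proof (Rle_0_sqr (det3 u A y)) as Sq. unfold Rsqr in Sq.
  pose proof (hyp_mink x y Hx Hy).
  destruct (Rle_or_lt (mink u x) (- mink x y)) as [h | h]; [exact h | nra].
Qed.

(** The reflection at a bounce fixes that bounce, so by the triangle inequality the distance from
    the image of b to the current bounce grows by at most one segment per letter; the coordinate is
    at most cosh of this distance. *)
Lemma growth_upper (b : vec3) (M : nat) : hyp b ->
  mink (m (a (S M))) (rword m (word a 0 M) b) <= exp (hdv b (p 0%nat) + span L 0 (S M)).
Proof.
  intros Hb.
  pose proof (tr_hyp _ _ _ _ _ _ _ TR) as HP.
  assert (H : hyp (rword m (word a 0 M) b) /\
     hdv (rword m (word a 0 M) b) (p M) <= hdv b (p 0%nat) + span L 0 M).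
  { induction M as [| M [IH1 IH2]]; [simpl; unfold span; simpl; split; [exact Hb | lra] |].
    simpl word. rewrite rword_cons. set (X := rword m (word a 0 M) b) in *.
    split.
    - apply (refl_hyp _ (p (S M))); auto.
    - assert (E : hdv (refl (m (a (S M))) X) (p (S M)) = hdv X (p (S M))).
      { unfold hdv. rewrite <- (refl_fix (m (a (S M))) (p (S M))) at 1 by (rewrite mink_comm; apply on).
        rewrite mink_refl by apply Hunit. reflexivity. }
      rewrite E, span_S. pose proof (hd_triangle X (p M) (p (S M)) IH1 (HP M) (HP (S M))) as T.
      rewrite traj_dist in T. simpl. lra. }
  destruct H as [H1 H2]. set (X := rword m (word a 0 M) b) in *.
  pose proof (mink_le_of_orth (m (a (S M))) X (p (S M)) (Hunit _) H1 (HP (S M)) (on (S M))) as K.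
  rewrite <- (cosh_hd X (p (S M)) H1 (HP (S M))) in K.
  pose proof (hd_triangle X (p M) (p (S M)) H1 (HP M) (HP (S M))) as T. rewrite traj_dist in T.
  rewrite span_S. simpl.
  assert (D : hdv X (p (S M)) <= hdv b (p 0%nat) + (span L 0 M + L M)) by lra.
  pose proof (hd_nonneg X (p (S M)) H1 (HP (S M))) as Hnn.
  pose proof (cosh_le _ _ Hnn D) as C1.
  assert (0 <= hdv b (p 0%nat) + (span L 0 M + L M)) by lra.
  pose proof (cosh_le_exp _ H). lra.
Qed.

(** Deleting the reflection at bounce [c]: [D], [S] are the distances travelled before and after. *)
Lemma deletion_loss (c M : nat) (D : R) : 0 < D ->
  let S' := span L c (S M) in
  let u := m (a c) in
  let dir := refl u (t c) in
  2 <= sine c * sine (S (c + M)) * cosh S' ->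
  mink (m (a (S (c + M)))) (rword m (word a c M) (vadd (vscal (cosh D) (p c)) (vscal (- sinh D) dir)))
  <= sinh (D + S') * sine (S (c + M)) - sinh D * sine c * sine c * sine (S (c + M)) * cosh S'.
Proof.
  intros HD S' u dir HS.
  destruct (flow_value c M) as [F1 F2]. fold S' in F1, F2.
  set (sv := sine (S (c + M))) in *. set (sc := sine c) in *.
  assert (Hsc : 0 < sc) by apply (tr_transverse _ _ _ _ _ _ _ TR).
  assert (Hsv : 0 < sv) by apply (tr_transverse _ _ _ _ _ _ _ TR).
  set (w := word a c M) in *. set (mv := m (a (S (c + M)))) in *.
  destruct (tr_tan _ _ _ _ _ _ _ TR c) as [pt tt].
  destruct (tr_hyp _ _ _ _ _ _ _ TR c) as [pp _].
  pose proof (on c) as up. fold u in up.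
  (* [nu] is the part of the side normal orthogonal to the line of the trajectory. Only the part
     along [t c] grows with S'. By Lagrange's identity [nu] contributes at most 1, and the
     assumption on cosh S' makes this error at most half of the main term. *)
  set (nu := vadd (vscal 1 u) (vscal (- sc) (t c))).
  assert (Enu : mink (p c) nu = 0).
  { unfold nu. mexp. rewrite (mink_comm (p c) u), up, pt. ring. }
  assert (Etnu : mink (t c) nu = 0).
  { unfold nu. mexp. rewrite tt, (mink_comm (t c) u). fold sc. unfold sc, sine, u. ring. }
  assert (Enn : mink nu nu = 1 - sc * sc).
  { unfold nu. mexp. rewrite tt, (mink_comm (t c) u). unfold u. rewrite Hunit.
    change (mink (m (a c)) (t c)) with sc. ring. }
  assert (Hphi : mink mv (rword m w nu) <= 1).
  { set (P := rword m w (p c)). set (T := rword m w (t c)). set (N := rword m w nu).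
    assert (PP : mink P P = -1) by (unfold P; rewrite mink_rword; auto).
    assert (TT : mink T T = 1) by (unfold T; rewrite mink_rword; auto).
    assert (NN : mink N N = 1 - sc * sc) by (unfold N; rewrite mink_rword; auto).
    assert (PT : mink P T = 0) by (unfold P, T; rewrite mink_rword; auto).
    assert (PN : mink P N = 0) by (unfold P, N; rewrite mink_rword; auto).
    assert (TN : mink T N = 0) by (unfold T, N; rewrite mink_rword; auto).
    set (A := vadd (vscal 1 mv) (vadd (vscal (sinh S' * sv) P) (vscal (cosh S' * sv) T))).
    fold P in F1. fold T in F2.
    assert (PA : mink P A = 0).
    { unfold A. mexp. rewrite (mink_comm P mv), F1, PP, PT. ring. }
    assert (AA : mink A A = 1 - sv * sv).
    { unfold A. mexp. rewrite (mink_comm P mv), (mink_comm T mv), (mink_comm T P), F1, F2, PP, TT, PT.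
      unfold mv. rewrite Hunit. pose proof (cosh_sq S') as C.
      transitivity (1 - sv * sv * (cosh S' * cosh S' - sinh S' * sinh S')); [ring | rewrite C; ring]. }
    assert (AN : mink A N = mink mv N).
    { unfold A. mexp. rewrite PN, TN. ring. }
    assert (Q : mink A N * mink A N + det3 A N P * det3 A N P = mink A A * mink N N).
    { rewrite det3_sq, (mink_comm A P), (mink_comm N P), PP, PA, PN. ring. }
    rewrite AN, AA, NN in Q. pose proof (Rle_0_sqr (det3 A N P)) as Sq. unfold Rsqr in Sq.
    assert (N0 : 0 <= 1 - sc * sc).
    { rewrite <- Enn. apply (orth_nonneg (p c)); [apply (tr_hyp _ _ _ _ _ _ _ TR) | exact Enu]. }
    assert (0 <= sv * sv) by nra.
    assert ((1 - sv * sv) * (1 - sc * sc) <= 1 * 1) by nra.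
    destruct (Rle_or_lt (mink mv N) 1) as [h | h]; [exact h | nra]. }
  assert (Eu : u = vadd (vscal 1 nu) (vscal sc (t c))) by (unfold nu; clear; generalize u (t c); vring).
  assert (Hu : mink mv (rword m w u) <= 1 - sc * (cosh S' * sv)).
  { rewrite Eu, rword_linear. mexp. rewrite F2. lra. }
  assert (Ed : dir = vadd (vscal 1 (t c)) (vscal (-2 * sc) u)).
  { unfold dir, refl. rewrite (mink_comm (t c) u). change (mink u (t c)) with sc.
    clear. generalize (t c) u; vring. }
  rewrite rword_linear, Ed, rword_linear. mexp. rewrite F1, F2, sinh_add.
  pose proof (sinh_positive D HD) as Hsd.
  assert (K : 2 * (sinh D * sc) * mink mv (rword m w u) <= 2 * (sinh D * sc) * (1 - sc * (cosh S' * sv))).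
  { apply Rmult_le_compat_l; [|exact Hu]. assert (0 < sinh D * sc) by (apply Rmult_lt_0_compat; assumption). lra. }
  assert (K2 : (sinh D * sc) * 2 <= (sinh D * sc) * (sc * sv * cosh S')).
  { apply Rmult_le_compat_l; [|exact HS]. left; apply Rmult_lt_0_compat; assumption. }
  nra.
Qed.

End Flow.

(** * Growth of billiard words *)

Lemma finite_lower_bound (N : nat) (f : nat -> R) : (forall j, (j < N)%nat -> 0 < f j) ->
  exists k, 0 < k /\ forall j, (j < N)%nat -> k <= f j.
Proof.
  induction N as [| N IH]; intros H.
  - exists 1. split; [lra | lia].
  - destruct IH as (k & Hk & K); [auto |].
    exists (Rmin k (f N)). split; [apply Rmin_glb_lt; auto |].
    intros j Hj. destruct (Nat.eq_dec j N) as [-> | ne]; [apply Rmin_r |].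
    apply Rle_trans with k; [apply Rmin_l | apply K; lia].
Qed.

Lemma periodic_lower_bound (q : nat) (f : nat -> R) : (1 <= q)%nat ->
  (forall i, f (i + q)%nat = f i) -> (forall i, 0 < f i) -> exists k, 0 < k /\ forall i, k <= f i.
Proof.
  intros Hq Hp Hf. destruct (finite_lower_bound q f) as (k & Hk & K); [auto |].
  exists k. split; [exact Hk |]. intros i. rewrite (periodic_mod q f Hp i).
  apply K, Nat.mod_upper_bound. lia.
Qed.

Lemma linear_rsum (l : params -> R) (N : nat) (w : R) (d : nat -> params) : linear_form l ->
  l (fun i j => rsum N (fun r => w * d r i j)) = rsum N (fun r => w * l (d r)).
Proof.
  intros Hl. induction N as [| N IH].
  - simpl. pose proof (Hl 0 0 (fun _ _ => 0) (fun _ _ => 0)) as H.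
    unfold lincomb in H.
    replace (fun _ _ : nat => 0 * 0 + 0 * 0) with (fun _ _ : nat => 0) in H
      by (apply functional_extensionality; intros; apply functional_extensionality; intros; ring).
    rewrite H. ring.
  - simpl rsum. rewrite <- IH.
    rewrite <- (Rmult_1_l (l (fun i j => rsum N (fun r => w * d r i j)))), <- Hl.
    f_equal. apply functional_extensionality; intros i. apply functional_extensionality; intros j.
    unfold lincomb. ring.
Qed.

(** The supporting form at the mean is linear, so its values at the [d r] average to its value at
    the mean and cancel in the sum. *)
Lemma good_jensen (f : params -> R) (N : nat) (d : nat -> params) : good f -> (0 < N)%nat ->
  0 < f (fun i j => mean N (fun r => d r i j)) ->
  INR N * ln (f (fun i j => mean N (fun r => d r i j))) <= rsum N (fun r => ln (f (d r))).
Proof.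
  intros (_ & _ & T) HN Hpos.
  assert (HNR : 0 < INR N) by (apply lt_0_INR; exact HN).
  set (db := fun i j => mean N (fun r => d r i j)) in *.
  destruct (T db) as (l & Hl & H).
  assert (E : l db = rsum N (fun r => / INR N * l (d r))).
  { rewrite <- linear_rsum by exact Hl. f_equal.
    apply functional_extensionality; intros i. apply functional_extensionality; intros j.
    unfold db, mean. rewrite rsum_scal. field. lra. }
  replace (INR N * ln (f db)) with (rsum N (fun r => ln (f db) + (l (d r) + - l db))).
  - apply rsum_le. intros r _. specialize (H (d r)).
    replace (l (d r) + - l db) with (l (d r) - l db) by ring.
    rewrite <- (ln_exp (l (d r) - l db)), <- ln_mult by (try apply exp_pos; exact Hpos).
    assert (0 < f db * exp (l (d r) - l db)) by (apply Rmult_lt_0_compat; [exact Hpos | apply exp_pos]).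
    destruct H as [H | H]; [left; apply ln_increasing; assumption | rewrite H; lra].
  - rewrite !rsum_plus, !rsum_const. rewrite rsum_scal in E.
    replace (rsum N (fun r => l (d r))) with (INR N * l db) by (rewrite E; field; lra). ring.
Qed.

(** Lets bounded errors drop out of inequalities that are linear in the number of periods. *)
Lemma archimedean_le (A B c : R) (N0 : nat) :
  (forall N, (N0 <= N)%nat -> INR N * B <= INR N * A + c) -> B <= A.
Proof.
  intros H. destruct (Rle_or_lt B A) as [h | h]; [exact h | exfalso].
  destruct (INR_unbounded (c / (B - A))) as [N HN].
  specialize (H (N + N0 + 1)%nat ltac:(lia)).
  assert (E : c < INR N * (B - A)).
  { apply (Rmult_lt_compat_r (B - A)) in HN; [| lra].
    unfold Rdiv in HN. rewrite Rmult_assoc, Rinv_l in HN; lra. }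
  rewrite !plus_INR in H. simpl in H. pose proof (pos_INR N0). nra.
Qed.

Lemma cosh_tangent (x u : R) : cosh x + u * sinh x <= cosh (x + u).
Proof.
  unfold cosh at 2. rewrite Ropp_plus_distr, !exp_plus.
  pose proof (exp_convex_tangent 0 u) as A. pose proof (exp_convex_tangent 0 (- u)) as B.
  rewrite exp_0 in A, B. pose proof (exp_pos x). pose proof (exp_pos (- x)).
  unfold cosh, sinh. nra.
Qed.

Lemma cosh_ge_half (x : R) : 0 <= x -> x / 2 <= cosh x.
Proof.
  intros Hx. unfold cosh. pose proof (exp_pos (- x)).
  pose proof (exp_convex_tangent 0 x) as A. rewrite exp_0 in A. lra.
Qed.

Lemma word_first (a : nat -> nat) (c M : nat) : word a c (S M) = word a (S c) M ++ [a (S c)].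
Proof.
  induction M as [| M IH].
  - simpl. rewrite Nat.add_1_r. reflexivity.
  - replace (word a c (S (S M))) with (a (c + S (S M))%nat :: word a c (S M)) by reflexivity.
    rewrite IH. simpl. repeat f_equal. lia.
Qed.

Lemma act_app (adj : nat -> nat -> bool) (d : params) (s s' : list nat) (x : nat -> R) :
  act adj d (s ++ s') x = act adj d s (act adj d s' x).
Proof. unfold act. apply fold_right_app. Qed.

Lemma rpoly_rotate (n : nat) (v m : nat -> vec3) (len : nat -> R) (r : nat) :
  rpoly n v m len ->
  rpoly n (fun i => v (i + r)%nat) (fun i => m (i + r)%nat) (fun i => len (i + r)%nat).
Proof.
  intros H. constructor.
  - intros i. replace (i + n + r)%nat with (i + r + n)%nat by lia. apply (rp_per_v _ _ _ _ H).
  - intros i. replace (i + n + r)%nat with (i + r + n)%nat by lia. apply (rp_per_m _ _ _ _ H).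
  - intros i. replace (i + n + r)%nat with (i + r + n)%nat by lia. apply (rp_per_len _ _ _ _ H).
  - intros i. apply (rp_hyp _ _ _ _ H).
  - intros i. apply (rp_frame _ _ _ _ H).
  - intros i. apply (rp_det _ _ _ _ H).
  - intros i. apply (rp_len _ _ _ _ H).
  - intros i. apply (rp_next _ _ _ _ H).
  - intros i. apply (rp_prev _ _ _ _ H).
  - intros i j Hj. replace (i + j + r)%nat with (i + r + j)%nat by lia. apply (rp_in _ _ _ _ H), Hj.
Qed.

(** * Gain from enlarging the parameters *)

Section Growth.

Variables (n : nat) (v m : nat -> vec3) (len : nat -> R).
Hypothesis Hn : (6 <= n)%nat.
Hypothesis RP : rpoly n v m len.
Variables (q : nat) (a : nat -> nat) (p t : nat -> vec3) (L : nat -> R).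
Hypothesis TR : trajectory n m q a p t L.

Let d := dparam n (side_dist m).
Let unit := rp_unit n v m len RP.
Let letters := tr_letter _ _ _ _ _ _ _ TR.
Let sn := sine m a t.

Lemma sine_pos (i : nat) : 0 < sn i.
Proof. apply (tr_transverse _ _ _ _ _ _ _ TR). Qed.

Lemma coords_letter (x : vec3) (i : nat) : coords n m x (a i) = mink (m (a i)) x.
Proof. unfold coords. destruct (Nat.ltb_spec (a i) n) as [h | h]; [reflexivity |]. specialize (letters i). lia. Qed.

Lemma coords_point_nonneg (i j : nat) : 0 <= coords n m (p i) j.
Proof.
  unfold coords. destruct (Nat.ltb_spec j n) as [h | h]; [| lra].
  destruct (Nat.eq_dec j (a i)) as [-> | ne].
  - rewrite (tr_on _ _ _ _ _ _ _ TR). lra.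
  - left. apply (tr_side _ _ _ _ _ _ _ TR); assumption.
Qed.

Lemma act_word_coords (c M : nat) (x : vec3) :
  act (adjn n) d (word a c M) (coords n m x) = coords n m (rword m (word a c M) x).
Proof.
  apply (act_coords n m (gram_family_of_rpoly n v m len Hn RP)). intros u Hu. apply (word_letters n a c M u letters Hu).
Qed.

Lemma act_word_value (c M : nat) :
  act (adjn n) d (word a c M) (coords n m (p c)) (a (S (c + M)))
    = sinh (span L c (S M)) * sn (S (c + M)).
Proof.
  rewrite act_word_coords, coords_letter.
  apply (flow_value n m q a p t L unit TR).
Qed.

Lemma span_pos (c M : nat) : 0 < span L c (S M).
Proof.
  unfold span. simpl. pose proof (tr_len _ _ _ _ _ _ _ TR (c + M)%nat).
  assert (0 <= rsum M (fun i => L (c + i)%nat)); [| lra].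
  replace 0 with (rsum M (fun _ => 0)) by (rewrite rsum_const; ring).
  apply rsum_le. intros. left. apply (tr_len _ _ _ _ _ _ _ TR).
Qed.

(** The trajectory itself decides the dichotomy: its bounce [p c] has nonnegative coordinates and a
    strictly positive value, so the entry is good at all parameters. *)
Lemma word_positive (c M : nat) : positive_at (adjn n) (word a c M) (a (S (c + M))).
Proof.
  apply (positive_at_of_pos _ (adjn_sym n) _ _ d (coords n m (p c))).
  - intros i. apply coords_point_nonneg.
  - rewrite act_word_value. apply Rmult_lt_0_compat; [apply sinh_positive, span_pos | apply sine_pos].
Qed.

Variables (M : nat) (e : params) (kappa : R).
Hypothesis Hkappa : 0 <= kappa.
Hypothesis He : forall i j, 0 <= d i j <= e i j.
Hypothesis Hgram : forall i j, i <> j ->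
  (1 + kappa) * gram (adjn n) d i j <= gram (adjn n) e i j.

Let vv := a (S M).
Let x0 := coords n m (p 0%nat).
Let full := act (adjn n) d (word a 0 M) x0 vv.

(** The first [c] reflections use the parameters [d] of the polygon, the others the larger ones [e]. *)
Definition mixed (c : nat) : R :=
  act (adjn n) e (word a c (M - c)) (act (adjn n) d (word a 0 c) x0) vv.

Lemma full_value : full = sinh (span L 0 (S M)) * sn (S M).
Proof. apply (act_word_value 0 M). Qed.

(** Trades the parameters of the single letter [a (S c)]. The excess is the image of [z], and z >=
    kappa y, where [y] is what the reflection adds to the other coordinates. Positivity of the
    remaining word carries both inequalities through to the end. *)
Lemma mixed_step (c : nat) : (c < M)%nat ->
  mixed (S c) <= mixed c /\
  kappa * (full - mink (m vv) (rword m (word a (S c) (M - S c)) (rword m (word a 0 c) (p 0%nat))))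
    <= mixed c - mixed (S c).
Proof.
  intros Hc. unfold mixed.
  set (M' := (M - S c)%nat). replace (M - c)%nat with (S M') by lia.
  set (w := word a (S c) M'). set (u := a (S c)).
  set (X := rword m (word a 0 c) (p 0%nat)). set (g := act (adjn n) d (word a 0 c) x0).
  assert (Eg : g = coords n m X) by (apply act_word_coords).
  assert (gu : 0 < g u).
  { rewrite Eg. unfold u. rewrite coords_letter. unfold X.
    pose proof (flow_value n m q a p t L unit TR 0 c) as [F _]. simpl Nat.add in F. rewrite F.
    apply Rmult_lt_0_compat; [apply sinh_positive, span_pos | apply sine_pos]. }
  rewrite (word_first a c M'), act_app. fold w u.
  change (act (adjn n) e [u] g) with (reflect (adjn n) e u g).
  replace (act (adjn n) d (word a 0 (S c)) x0) with (reflect (adjn n) d u g) by reflexivity.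
  assert (Pos : positive_at (adjn n) w vv).
  { unfold w, vv. replace (S M) with (S (S c + M')) by lia. apply word_positive. }
  set (y := fun j => if Nat.eq_dec j u then 0 else 2 * gram (adjn n) d u j * g u).
  set (z := fun j => if Nat.eq_dec j u then 0
             else 2 * (gram (adjn n) e u j - gram (adjn n) d u j) * g u).
  assert (gram0 : forall j, 0 <= gram (adjn n) d u j).
  { intros j. unfold gram. destruct (adjn n u j); [lra |]. pose proof (cosh_ge_1 (d (Nat.min u j) (Nat.max u j))). lra. }
  assert (y0 : forall j, 0 <= y j).
  { intros j. unfold y. destruct (Nat.eq_dec j u); [lra |]. specialize (gram0 j). nra. }
  assert (zy : forall j, 0 <= 1 * z j + (- kappa) * y j).
  { intros j. unfold z, y. destruct (Nat.eq_dec j u) as [_ | ne]; [lra |].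
    specialize (Hgram u j ltac:(auto)). 
    replace (1 * (2 * (gram (adjn n) e u j - gram (adjn n) d u j) * g u) + - kappa * (2 * gram (adjn n) d u j * g u))
      with (2 * g u * (gram (adjn n) e u j - (1 + kappa) * gram (adjn n) d u j)) by ring.
    apply Rmult_le_pos; lra. }
  assert (z0 : forall j, 0 <= z j).
  { intros j. specialize (zy j). specialize (y0 j). nra. }
  assert (Ez : act (adjn n) e w (reflect (adjn n) e u g) vv - act (adjn n) e w (reflect (adjn n) d u g) vv
     = act (adjn n) e w z vv).
  { transitivity (1 * act (adjn n) e w (reflect (adjn n) e u g) vv
      + (-1) * act (adjn n) e w (reflect (adjn n) d u g) vv); [ring |].
    pose proof (act_linear (adjn n) e w 1 (-1) (reflect (adjn n) e u g) (reflect (adjn n) d u g)) as H.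
    apply (f_equal (fun h => h vv)) in H. rewrite <- H. f_equal. f_equal.
    apply functional_extensionality. intros j. unfold reflect, z. destruct (Nat.eq_dec j u); ring. }
  destruct (Pos z z0) as (P1 & P2 & _). pose proof (P1 e) as Pe. pose proof (P2 d e He) as Pd.
  split; [lra |].
  apply Rle_trans with (act (adjn n) d w z vv); [| lra].
  assert (Hzy : kappa * act (adjn n) d w y vv <= act (adjn n) d w z vv).
  { destruct (Pos _ zy) as (Q & _). specialize (Q d).
    rewrite (act_linear (adjn n) d w 1 (- kappa) z y) in Q. lra. }
  apply Rle_trans with (kappa * act (adjn n) d w y vv); [| exact Hzy].
  apply Rmult_le_compat_l; [exact Hkappa |].
  set (E := fun j => if Nat.eq_dec j u then 1 else 0).
  assert (E0 : 0 <= act (adjn n) d w E vv).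
  { assert (hE : forall j, 0 <= E j) by (intros j; unfold E; destruct (Nat.eq_dec j u); lra).
    destruct (Pos E hE) as (Q & _). apply Q. }
  (* [y] differs from reflect g - g only at u, by 2 g u. Its image is therefore the value of the
     full word minus that of the word with the letter u deleted, plus a nonnegative term. *)
  assert (Ey : act (adjn n) d w y vv = act (adjn n) d w (reflect (adjn n) d u g) vv
      - act (adjn n) d w g vv + 2 * g u * act (adjn n) d w E vv).
  { pose proof (act_linear (adjn n) d w 1 (-1) (reflect (adjn n) d u g) g) as H1.
    pose proof (act_linear (adjn n) d w 1 (2 * g u) (fun j => 1 * reflect (adjn n) d u g j + -1 * g j) E) as H2.
    rewrite H1 in H2. apply (f_equal (fun h => h vv)) in H2.
    transitivity (1 * (1 * act (adjn n) d w (reflect (adjn n) d u g) vv + -1 * act (adjn n) d w g vv)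
       + 2 * g u * act (adjn n) d w E vv); [| ring].
    rewrite <- H2. f_equal. f_equal. apply functional_extensionality. intros j.
    unfold y, E, reflect. destruct (Nat.eq_dec j u) as [-> | ne]; ring. }
  assert (Ef : act (adjn n) d w (reflect (adjn n) d u g) vv = full).
  { unfold full. replace M with (c + S M')%nat at 1 by lia.
    assert (W : word a 0 (c + S M') = w ++ word a 0 (S c)).
    { unfold w. clear. induction M' as [| k IH].
      - rewrite Nat.add_1_r. reflexivity.
      - replace (c + S (S k))%nat with (S (c + S k)) by lia. simpl word at 1.
        change (a (S (c + S k)) :: word a 0 (c + S k) = (a (S c + S k)%nat :: word a (S c) k) ++ word a 0 (S c)).
        rewrite IH. simpl. repeat f_equal; lia. }
    rewrite W, act_app. reflexivity. }
  assert (Edel : act (adjn n) d w g vv = mink (m vv) (rword m w X)).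
  { rewrite Eg. unfold w. rewrite act_word_coords. apply coords_letter. }
  assert (0 <= 2 * g u * act (adjn n) d w E vv) by (apply Rmult_le_pos; lra).
  rewrite Ey, Ef, Edel. lra.
Qed.

Variables (smin lmin : R) (K : nat).
Hypothesis Hsmin : 0 < smin /\ forall i, smin <= sn i.
Hypothesis Hlmin : 0 < lmin /\ forall i, lmin <= L i.
Hypothesis HK : 4 / (smin * smin) <= INR K * lmin.

(** For D >= lmin one has cosh D <= coth lmin sinh D, hence sinh (D + S') <= (1 + coth lmin) sinh D
    cosh S'. The rate is the loss smin^2 sinh D cosh S' caused by a deletion, divided by this
    bound. *)
Definition loss_rate : R := smin * smin / (1 + cosh lmin / sinh lmin).

Lemma loss_rate_pos : 0 < loss_rate.
Proof.
  unfold loss_rate. destruct Hsmin as [h _], Hlmin as [h' _].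
  pose proof (sinh_positive lmin h'). pose proof (cosh_ge_1 lmin).
  apply Rdiv_lt_0_compat; [nra |].
  assert (0 < cosh lmin / sinh lmin) by (apply Rdiv_lt_0_compat; lra). lra.
Qed.

(** At least K segments remain, so S' >= K lmin >= 4 / smin^2, and cosh S' >= S' / 2 meets the
    requirement of [deletion_loss]. *)
Lemma mixed_gain (c : nat) : (c < M)%nat -> (K <= M - c)%nat ->
  kappa * (loss_rate * full) <= mixed c - mixed (S c).
Proof.
  intros Hc HcK. destruct (mixed_step c Hc) as [_ G].
  eapply Rle_trans; [| exact G]. apply Rmult_le_compat_l; [exact Hkappa |].
  set (M' := (M - S c)%nat). set (D := span L 0 (S c)).
  set (S' := span L (S c) (S M')).
  destruct Hsmin as [s0 Hs], Hlmin as [l0 Hl].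
  assert (HD : lmin <= D).
  { unfold D. pose proof (span_ge L 0 (S c) lmin Hl) as A. rewrite S_INR in A.
    pose proof (pos_INR c). nra. }
  assert (HS : INR K * lmin <= S').
  { pose proof (span_ge L (S c) (S M') lmin Hl) as A.
    assert (INR K <= INR (S M')) by (apply le_INR; lia). fold S' in A. nra. }
  assert (HS0 : 0 <= S').
  { pose proof (pos_INR K). nra. }
  pose proof (cosh_ge_half S' HS0) as CS.
  set (sc := sn (S c)). set (sv := sn (S M)).
  assert (A1 : smin <= sc) by apply Hs. assert (A2 : smin <= sv) by apply Hs.
  assert (B2 : smin * smin <= sc * sv) by (apply Rmult_le_compat; lra).
  assert (B0 : 0 < smin * smin) by nra.
  assert (H2 : 2 <= sc * sv * cosh S').
  { assert (C1 : 2 / (smin * smin) <= cosh S').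
    { replace (2 / (smin * smin)) with ((4 / (smin * smin)) / 2) by (field; lra). lra. }
    apply Rle_trans with ((smin * smin) * (2 / (smin * smin))); [right; field; lra |].
    apply Rmult_le_compat; try lra.
    apply Rmult_le_pos; [lra | left; apply Rinv_0_lt_compat; lra]. }
  pose proof (deletion_loss n m q a p t L unit TR (S c) M' D ltac:(lra)) as DL.
  replace (S c + M')%nat with M in DL by lia.
  specialize (DL H2). fold S' in DL.
  change (sine m a t (S M)) with sv in DL. change (sine m a t (S c)) with sc in DL.
  assert (EX : rword m (word a 0 c) (p 0%nat) =
     vadd (vscal (cosh D) (p (S c))) (vscal (- sinh D) (refl (m (a (S c))) (t (S c))))).
  { rewrite <- (incoming n m q a p t L unit TR c).
    destruct (flow n m q a p t L unit TR 0 c) as [F _]. simpl Nat.add in F. rewrite F.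
    rewrite (tr_move _ _ _ _ _ _ _ TR c). unfold D. rewrite span_S. simpl Nat.add.
    set (T := span L 0 c). rewrite cosh_add, sinh_add. pose proof (cosh_sq (L c)) as C.
    revert C. generalize (p c) (t c) (cosh (L c)) (sinh (L c)) (cosh T) (sinh T). clear.
    intros X Y cc s C S' H. assert (H' : 1 = cc * cc - s * s) by lra.
    vec; apply vec_ext; match goal with |- ?l = ?r =>
      transitivity (1 * l); [ring | rewrite H'; ring] end. }
  rewrite EX. fold M'. unfold vv. 
  assert (EF : full = sinh (D + S') * sv).
  { rewrite full_value. fold sv. f_equal. f_equal. unfold D, S'.
    replace (S M) with (S c + S M')%nat by lia. rewrite span_add. reflexivity. }
  rewrite EF.
  apply Rle_trans with (sinh D * sc * sc * sv * cosh S'); [| lra].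
  assert (shD : 0 < sinh D) by (apply sinh_positive; lra).
  assert (shl : 0 < sinh lmin) by (apply sinh_positive; lra).
  set (B := cosh lmin / sinh lmin).
  assert (HB : cosh D <= B * sinh D).
  { assert (X : 0 <= sinh (D - lmin)) by (apply sinh_nonneg; lra).
    unfold Rminus in X. rewrite sinh_add, cosh_opp, sinh_opp in X.
    apply (Rmult_le_reg_l (sinh lmin)); [exact shl |].
    replace (sinh lmin * (B * sinh D)) with (cosh lmin * sinh D) by (unfold B; field; lra). lra. }
  assert (Bpos : 0 < B) by (apply Rdiv_lt_0_compat; [pose proof (cosh_ge_1 lmin); lra | exact shl]).
  pose proof (cosh_ge_1 S') as CS1. pose proof (sinh_lt_cosh S') as SC.
  pose proof (sinh_nonneg S' HS0) as SN. pose proof (cosh_ge_1 D) as CD.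
  assert (F1 : sinh (D + S') <= cosh S' * sinh D * (1 + B)).
  { rewrite sinh_add.
    assert (cosh D * sinh S' <= (B * sinh D) * cosh S') by (apply Rmult_le_compat; lra). lra. }
  apply Rle_trans with (loss_rate * (cosh S' * sinh D * (1 + B) * sv)).
  - apply Rmult_le_compat_l; [left; apply loss_rate_pos |]. apply Rmult_le_compat_r; lra.
  - unfold loss_rate. fold B.
    replace (smin * smin / (1 + B) * (cosh S' * sinh D * (1 + B) * sv))
      with ((smin * smin) * (cosh S' * sinh D * sv)) by (field; lra).
    replace (sinh D * sc * sc * sv * cosh S') with ((sc * sc) * (cosh S' * sinh D * sv)) by ring.
    apply Rmult_le_compat_r; [| apply Rmult_le_compat; lra].
    apply Rmult_le_pos; [apply Rmult_le_pos |]; lra.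
Qed.

Lemma growth_gain : (K <= M)%nat ->
  full * (1 + (INR M - INR K) * (kappa * loss_rate)) <= act (adjn n) e (word a 0 M) x0 vv.
Proof.
  intros HKM.
  assert (F0 : 0 < full).
  { rewrite full_value. apply Rmult_lt_0_compat; [apply sinh_positive, span_pos | apply sine_pos]. }
  pose proof loss_rate_pos as LR.
  assert (MM : mixed M = full).
  { unfold mixed. rewrite Nat.sub_diag. reflexivity. }
  (* For j < K the factor is at most 1 and the first conjunct suffices; the quantified gain enters
     from j = K on. *)
  assert (H : forall j, (j <= M)%nat -> full <= mixed (M - j) /\
     full * (1 + (INR j - INR K) * (kappa * loss_rate)) <= mixed (M - j)).
  { assert (kl : 0 <= kappa * loss_rate) by (apply Rmult_le_pos; lra).
    assert (Hneg : forall x, x <= 0 -> full * (1 + x * (kappa * loss_rate)) <= full).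
    { intros x Hx. pose proof (Rmult_le_pos (- x) _ ltac:(lra) kl) as A.
      pose proof (Rmult_le_pos full _ ltac:(lra) A). lra. }
    induction j as [| j IH]; intros Hj.
    - rewrite Nat.sub_0_r, MM. split; [lra |]. apply Hneg. simpl INR. pose proof (pos_INR K). lra.
    - destruct IH as [I1 I2]; [lia |].
      assert (Hc : (M - S j < M)%nat) by lia.
      destruct (mixed_step _ Hc) as [St _].
      replace (S (M - S j)) with (M - j)%nat in St by lia.
      split; [lra |].
      destruct (Nat.le_gt_cases K (S j)) as [h | h].
      + pose proof (mixed_gain (M - S j) Hc ltac:(lia)) as G.
        replace (S (M - S j)) with (M - j)%nat in G by lia. rewrite S_INR. lra.
      + assert (INR (S j) <= INR K) by (apply le_INR; lia).
        eapply Rle_trans; [apply Hneg; lra | lra]. }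
  destruct (H M (le_n M)) as [_ G]. rewrite Nat.sub_diag in G.
  unfold mixed in G. rewrite Nat.sub_0_r in G. exact G.
Qed.

End Growth.

(** * Comparison with the regular polygon *)

Lemma dparam_nonneg (n : nat) (dist : nat -> nat -> R) :
  (forall i j, (2 <= j <= n - 2)%nat -> 0 <= dist i j) -> forall i j, 0 <= dparam n dist i j.
Proof.
  intros H i j. destruct (dparam_cases n i j) as [[h E] | E]; rewrite E; [apply H; lia | lra].
Qed.

Lemma dparam_le (n : nat) (dist dist' : nat -> nat -> R) :
  (forall i j, (2 <= j <= n - 2)%nat -> dist i j <= dist' i j) ->
  forall i j, dparam n dist i j <= dparam n dist' i j.
Proof.
  intros H i j. destruct (dparam_cases n i j) as [[h E] | E]; rewrite !E; [apply H; lia | lra].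
Qed.

Section Comparison.

Variables (n : nat).
Hypothesis Hn : (6 <= n)%nat.
Variables (v0 m0 : nat -> vec3) (len0 : nat -> R).
Hypothesis RP0 : rpoly n v0 m0 len0.
Hypothesis Hreg : forall i, len0 i = len0 O.
Variables (v m : nat -> vec3) (len : nat -> R).
Hypothesis RP : rpoly n v m len.

Let D0 := mean_dist n m0.
Let D := mean_dist n m.

Lemma mean_dist_nonneg (v' m' : nat -> vec3) (len' : nat -> R) (j : nat) :
  rpoly n v' m' len' -> (2 <= j <= n - 2)%nat -> 0 <= mean_dist n m' j.
Proof.
  intros R' Hj. apply mean_nonneg; [lia |]. intros i _.
  apply (side_dist_nonneg n v' m' len' Hn R' i j Hj).
Qed.

(** Equality at one offset spreads to offset 2 and there to the equality case of [mean_dist_quad_2],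
    so all sides are equal. Their length is the mean distance at offset 2, because the side between
    two sides is their common perpendicular. *)
Lemma mean_dist_comparison :
  (forall j, (2 <= j <= n - 2)%nat -> D0 j <= D j) /\
  (forall j, (2 <= j <= n - 2)%nat -> D j = D0 j -> forall i, len i = len0 O).
Proof.
  destruct (log_concave_comparison n (fun j => cosh (D j)) (fun j => cosh (D0 j))) as [H1 H2];
    try exact Hn; try (intros; apply cosh_ge_1).
  - intros j Hj. unfold D. rewrite (mean_dist_sym n v m len Hn RP j Hj). reflexivity.
  - intros j Hj. unfold D0. rewrite (mean_dist_sym n v0 m0 len0 Hn RP0 j Hj). reflexivity.
  - intros j Hj. apply (mean_dist_quad n v m len Hn RP j Hj).
  - intros j Hj. apply (regular_quad n v0 m0 len0 Hn RP0 Hreg j Hj).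
  - apply (mean_dist_quad_2 n v m len Hn RP).
  - apply (regular_quad_2 n v0 m0 len0 Hn RP0 Hreg).
  - split.
    + intros j Hj. apply cosh_le_inv; [apply (mean_dist_nonneg v m len); assumption | apply H1, Hj].
    + intros j Hj E. destruct (H2 j Hj) as [E1 E2]; [rewrite E; reflexivity |].
      destruct (mean_dist_quad_2 n v m len Hn RP) as [_ Q]. specialize (Q E1).
      assert (C : forall i, len i = len 1%nat).
      { assert (A : forall i, (i < n)%nat -> len (S i) = len 1%nat).
        { induction i as [| i IH]; intros Hi; [reflexivity |]. rewrite <- IH by lia. symmetry. apply Q. lia. }
        intros i. rewrite (periodic_mod n len (rp_per_len _ _ _ _ RP) i).
        destruct (i mod n)%nat as [| r] eqn:Er.
        - rewrite <- (rp_per_len _ _ _ _ RP 0). replace (0 + n)%nat with (S (n - 1)) by lia. apply A. lia.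
        - apply A. pose proof (Nat.mod_upper_bound i n). lia. }
      apply cosh_inj in E2; [| apply (mean_dist_nonneg v m len); [exact RP | lia]
        | apply (mean_dist_nonneg v0 m0 len0); [exact RP0 | lia]].
      intros i. rewrite C.
      assert (F : D 2%nat = len 1%nat).
      { unfold D, mean_dist, mean.
        rewrite (rsum_ext n _ (fun _ => len 1%nat)).
        - rewrite rsum_const. field. apply not_0_INR; lia.
        - intros. rewrite (side_dist_2 n v m len Hn RP). apply C. }
      assert (F0 : D0 2%nat = len0 O).
      { unfold D0. rewrite (regular_mean_dist n v0 m0 len0 Hn RP0 Hreg), (side_dist_2 n v0 m0 len0 Hn RP0). apply Hreg. }
      rewrite <- F, <- F0. exact E2.
Qed.

(** Makes sinh (D0 j) positive, so that a gap between the distances yields a proportional gap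
    between the Gram entries already to first order. *)
Lemma regular_mean_dist_pos (j : nat) : (2 <= j <= n - 2)%nat -> 0 < D0 j.
Proof.
  intros Hj. assert (A : 1 < cosh (D0 j)).
  { assert (A2 : 1 < cosh (D0 2%nat)).
    { pose proof (regular_quad_2 n v0 m0 len0 Hn RP0 Hreg) as Q. fold D0 in Q.
      pose proof (cosh_ge_1 (D0 3%nat)). pose proof (cosh_ge_1 (D0 2%nat)). nra. }
    destruct (Nat.eq_dec j 2) as [-> | h2]; [exact A2 |].
    destruct (Nat.eq_dec j (n - 2)) as [-> | h3].
    - unfold D0. rewrite (mean_dist_sym n v0 m0 len0 Hn RP0 2) by lia. exact A2.
    - pose proof (regular_quad n v0 m0 len0 Hn RP0 Hreg j ltac:(lia)) as Q. fold D0 in Q.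
      pose proof (cosh_ge_1 (D0 (j - 1)%nat)). pose proof (cosh_ge_1 (D0 (S j))).
      pose proof (cosh_ge_1 (D0 j)). nra. }
  destruct (mean_dist_nonneg v0 m0 len0 j RP0 Hj) as [h | h]; [exact h |].
  exfalso. unfold D0 in A. rewrite <- h, cosh_0 in A. lra.
Qed.

Variables (q : nat) (a : nat -> nat).
Variables (p0 t0 : nat -> vec3) (L0 : nat -> R).
Hypothesis TR0 : trajectory n m0 q a p0 t0 L0.
Variables (p t : nat -> nat -> vec3) (L : nat -> nat -> R).
Hypothesis TR : forall r, (r < n)%nat ->
  trajectory n (fun i => m (i + r)%nat) q a (p r) (t r) (L r).

Let x0 := coords n m0 (p0 O).
Let F (M : nat) (d : params) := act (adjn n) d (word a 0 M) x0 (a (S M)).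
Let d0 := dparam n (side_dist m0).
Let dbar : params := dparam n (fun _ j => D j).
Let dr (r : nat) : params := dparam n (side_dist (fun i => m (i + r)%nat)).

Lemma params_regular : d0 = dparam n (fun _ j => D0 j).
Proof.
  apply functional_extensionality; intros i. apply functional_extensionality; intros j.
  unfold d0. destruct (dparam_cases n i j) as [[h E] | E]; rewrite !E; [| reflexivity].
  rewrite (regular_side_dist n v0 m0 len0 Hn RP0 Hreg). unfold D0.
  rewrite (regular_mean_dist n v0 m0 len0 Hn RP0 Hreg). reflexivity.
Qed.

(** Labelling r sees sides i + r and j + r as i and j. The average over labellings therefore depends
    on the offset only; this is where the average over cyclically related trajectories enters. *)
Lemma params_mean : dbar = fun i j => mean n (fun r => dr r i j).
Proof.
  apply functional_extensionality; intros i. apply functional_extensionality; intros j.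
  unfold dbar, dr. destruct (dparam_cases n i j) as [[h E] | E].
  - rewrite E. unfold D, mean_dist, mean. f_equal.
    rewrite <- (rsum_shift n i (fun r => side_dist m r (j - i)))
      by (intros; apply (side_dist_per n v m len Hn RP)).
    apply rsum_ext. intros r _. rewrite E. unfold side_dist. f_equal. f_equal. f_equal; f_equal; lia.
  - rewrite E. unfold mean. rewrite (rsum_ext n _ (fun _ => 0)) by (intros; apply E).
    rewrite rsum_const. field. apply not_0_INR; lia.
Qed.

Lemma good_F (M : nat) : good (F M).
Proof.
  apply (word_positive n v0 m0 len0 Hn RP0 q a p0 t0 L0 TR0 0 M).
  intros i. apply (coords_point_nonneg n m0 q a p0 t0 L0 TR0 0).
Qed.

Lemma F_value (M : nat) : F M d0 = sinh (span L0 0 (S M)) * sine m0 a t0 (S M).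
Proof. apply (act_word_value n v0 m0 len0 Hn RP0 q a p0 t0 L0 TR0 0 M). Qed.

Lemma F_pos (M : nat) : 0 < F M d0.
Proof.
  rewrite F_value. apply Rmult_lt_0_compat.
  - apply sinh_positive, (span_pos n m0 q a p0 t0 L0 TR0).
  - apply (sine_pos n m0 q a p0 t0 L0 TR0).
Qed.

Lemma params_le : forall i j, 0 <= d0 i j <= dbar i j.
Proof.
  intros i j. rewrite params_regular. split.
  - apply dparam_nonneg. intros _ j' Hj. apply (mean_dist_nonneg v0 m0 len0 j' RP0 Hj).
  - apply dparam_le. intros _ j' Hj. apply mean_dist_comparison, Hj.
Qed.

(** The start coordinates come from the regular polygon and need not be those of a point of the
    rotated one. They are dominated by C times the coordinates of an interior point b of it;
    positivity of the word preserves this, and for b the triangle inequality applies. *)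
Lemma F_upper (r : nat) : (r < n)%nat ->
  exists C, 0 < C /\ forall M, F M (dr r) <= C * exp (span (L r) 0 (S M)).
Proof.
  intros Hr. pose proof (TR r Hr) as T.
  pose proof (rpoly_rotate n v m len r RP) as R'.
  set (m' := fun i => m (i + r)%nat) in *.
  destruct (interior_point n _ m' _ Hn R') as (b & Hb & Hbj).
  destruct (finite_lower_bound n (fun j => mink (m' j) b)) as (k & Hk & Kj); [exact Hbj |].
  assert (HC : exists C, 0 < C /\ forall j, x0 j <= C * coords n m' b j).
  { assert (X : exists B, 1 <= B /\ forall j, x0 j <= B).
    { assert (G : exists B, 1 <= B /\ forall j, (j < n)%nat -> mink (m0 j) (p0 0%nat) <= B).
      { generalize n as N. induction N as [| N (B & HB & IB)].
        - exists 1. split; [lra | lia].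
        - exists (Rmax B (mink (m0 N) (p0 0%nat))). split.
          + apply Rle_trans with B; [exact HB | apply Rmax_l].
          + intros j Hj. destruct (Nat.eq_dec j N) as [-> | ne]; [apply Rmax_r |].
            apply Rle_trans with B; [apply IB; lia | apply Rmax_l]. }
      destruct G as (B & HB & G). exists B. split; [exact HB |]. intros j. unfold x0, coords.
      destruct (Nat.ltb_spec j n); [apply G; assumption | exact HB]. }
    destruct X as (B & HB & X).
    (* The minimum with 1 accounts for the padded labels, where the coordinates equal 1. *)
    set (k' := Rmin k 1). assert (0 < k') by (apply Rmin_glb_lt; lra).
    exists (B / k'). split; [apply Rdiv_lt_0_compat; lra |].
    intros j. specialize (X j). apply Rle_trans with B; [exact X |].
    assert (k' <= coords n m' b j).
    { unfold coords. destruct (Nat.ltb_spec j n) as [h | h].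
      - apply Rle_trans with k; [apply Rmin_l | apply Kj, h].
      - apply Rmin_r. }
    replace B with (B / k' * k') at 1 by (field; lra).
    apply Rmult_le_compat_l; [left; apply Rdiv_lt_0_compat; lra | assumption]. }
  destruct HC as (C & HC & HCj).
  exists (C * exp (hdv b (p r 0%nat))). split; [apply Rmult_lt_0_compat; [exact HC | apply exp_pos] |].
  intros M. rewrite Rmult_assoc, <- exp_plus.
  assert (U : forall i, mink (m' i) (m' i) = 1) by (intros; apply (rp_unit n _ m' _ R')).
  pose proof (growth_upper n m' q a (p r) (t r) (L r) U T b M Hb) as GU.
  apply Rle_trans with (C * mink (m' (a (S M))) (rword m' (word a 0 M) b));
    [| apply Rmult_le_compat_l; [lra | exact GU]].
  assert (P : positive_at (adjn n) (word a 0 M) (a (S M)))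
    by apply (word_positive n v0 m0 len0 Hn RP0 q a p0 t0 L0 TR0 0 M).
  destruct (P (fun j => C * coords n m' b j + -1 * x0 j)) as (Q & _).
  { intros j. specialize (HCj j). lra. }
  specialize (Q (dr r)). rewrite act_linear in Q.
  rewrite <- (coords_letter n m' Hn q a (p r) (t r) (L r) T (rword m' (word a 0 M) b) (S M)).
  rewrite <- (act_word_coords n _ m' _ Hn R' q a (p r) (t r) (L r) T 0 M b).
  unfold F. unfold dr in *. fold m' in Q. fold m'. lra.
Qed.

Lemma F_lower : exists C, 0 < C /\ forall M, C * exp (span L0 0 (S M)) <= F M d0.
Proof.
  destruct (periodic_lower_bound q L0) as (l & Hl & HL);
    [apply TR0 | apply TR0 | apply TR0 |].
  destruct (periodic_lower_bound q (sine m0 a t0)) as (s & Hs & HS).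
  { apply TR0. }
  { intros i. unfold sine. rewrite (tr_per_a _ _ _ _ _ _ _ TR0), (tr_per_t _ _ _ _ _ _ _ TR0). reflexivity. }
  { apply (sine_pos n m0 q a p0 t0 L0 TR0). }
  (* For x >= l, sinh x = exp x (1 - exp (-2 x)) / 2 is at least c exp x; l bounds every segment
     from below. *)
  set (c := (1 - exp (- 2 * l)) / 2).
  assert (Hc : 0 < c).
  { unfold c. assert (exp (-2 * l) < exp 0) by (apply exp_increasing; lra). rewrite exp_0 in *. lra. }
  exists (c * s). split; [apply Rmult_lt_0_compat; assumption |].
  intros M. rewrite F_value. set (x := span L0 0 (S M)).
  assert (Hx : l <= x).
  { unfold x. pose proof (span_ge L0 0 (S M) l HL) as A. rewrite S_INR in A. pose proof (pos_INR M). nra. }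
  assert (E : c * exp x <= sinh x).
  { unfold sinh, c. replace (- x) with (x + - 2 * x) by ring. rewrite exp_plus.
    assert (exp (-2 * x) <= exp (-2 * l)).
    { destruct Hx as [Hx | ->]; [left; apply exp_increasing; lra | lra]. }
    pose proof (exp_pos x). nra. }
  replace (c * s * exp x) with ((c * exp x) * s) by ring.
  apply Rmult_le_compat; [| lra | exact E | apply HS].
  left; apply Rmult_lt_0_compat; [exact Hc | apply exp_pos].
Qed.

Lemma gram_scaled (k h : R) : 0 <= h <= 1 -> 0 <= k ->
  (forall j, (2 <= j <= n - 2)%nat -> k * cosh (D0 j) <= (D j - D0 j) * sinh (D0 j)) ->
  forall i j, i <> j ->
  (1 + h * k) * gram (adjn n) d0 i j <= gram (adjn n) (lincomb (1 - h) h d0 dbar) i j.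
Proof.
  intros Hh Hk Hkap i j Hij. unfold gram. destruct (adjn n i j) eqn:E; [lra |].
  apply adjn_false in E.
  set (i' := Nat.min i j). set (j' := Nat.max i j).
  assert (V : (j' < n /\ 2 <= j' - i' <= n - 2)%nat) by (unfold i', j'; lia).
  unfold lincomb. rewrite params_regular. unfold dbar. rewrite !dparam_valid by exact V.
  set (o := (j' - i')%nat). specialize (Hkap o ltac:(unfold o; lia)).
  replace ((1 - h) * D0 o + h * D o) with (D0 o + h * (D o - D0 o)) by ring.
  pose proof (cosh_tangent (D0 o) (h * (D o - D0 o))) as T.
  assert (h * (k * cosh (D0 o)) <= h * ((D o - D0 o) * sinh (D0 o))) by (apply Rmult_le_compat_l; lra).
  lra.
Qed.

(** The parameter [y] lies at 1/M of the segment. Since F grows there by exp eta, the supporting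
    form at [y] drops by at least eta towards [d0]; being linear, it rises by as much in each of the
    M - 1 steps left towards [dbar]. *)
Lemma F_gain : (forall j, (2 <= j <= n - 2)%nat -> D0 j < D j) ->
  exists eta K, 0 < eta /\ forall M, (K <= M)%nat -> F M d0 * exp ((INR M - 1) * eta) <= F M dbar.
Proof.
  intros Hlt.
  destruct (periodic_lower_bound q L0) as (l & Hl & HL);
    [apply TR0 | apply TR0 | apply TR0 |].
  destruct (periodic_lower_bound q (sine m0 a t0)) as (s & Hs & HS).
  { apply TR0. }
  { intros i. unfold sine. rewrite (tr_per_a _ _ _ _ _ _ _ TR0), (tr_per_t _ _ _ _ _ _ _ TR0). reflexivity. }
  { apply (sine_pos n m0 q a p0 t0 L0 TR0). }
  destruct (finite_lower_bound (n - 3)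
     (fun j => (D (S (S j)) - D0 (S (S j))) * sinh (D0 (S (S j))) / cosh (D0 (S (S j))))) as (k & Hk & Kj).
  { intros j Hj. pose proof (Hlt (S (S j)) ltac:(lia)). pose proof (regular_mean_dist_pos (S (S j)) ltac:(lia)) as X.
    pose proof (cosh_ge_1 (D0 (S (S j)))). apply sinh_positive in X.
    apply Rdiv_lt_0_compat; [| lra]. apply Rmult_lt_0_compat; lra. }
  assert (Hkap : forall j, (2 <= j <= n - 2)%nat -> k * cosh (D0 j) <= (D j - D0 j) * sinh (D0 j)).
  { intros j Hj. specialize (Kj (j - 2)%nat ltac:(lia)).
    replace (S (S (j - 2))) with j in Kj by lia.
    pose proof (cosh_ge_1 (D0 j)) as c1.
    apply (Rmult_le_compat_r (cosh (D0 j))) in Kj; [| lra].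
    replace ((D j - D0 j) * sinh (D0 j) / cosh (D0 j) * cosh (D0 j))
      with ((D j - D0 j) * sinh (D0 j)) in Kj by (field; lra). exact Kj. }
  destruct (INR_unbounded (4 / (s * s) / l)) as [K HK].
  assert (HK' : 4 / (s * s) <= INR K * l).
  { apply (Rmult_lt_compat_r l) in HK; [| exact Hl].
    unfold Rdiv in HK at 1. rewrite Rmult_assoc, Rinv_l in HK by lra. lra. }
  set (rate := loss_rate s l).
  assert (Hrate : 0 < rate).
  { apply (loss_rate_pos m0 a t0 L0); split; assumption. }
  (* For M >= 2 K + 1 one has (M - K) / M >= 1/2, which accounts for the division by 2. *)
  set (eta := ln (1 + k * rate / 2)).
  assert (Heta : 0 < eta).
  { unfold eta. rewrite <- ln_1. apply ln_increasing; [lra |]. assert (0 < k * rate) by (apply Rmult_lt_0_compat; assumption). lra. }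
  exists eta, (2 * K + 1)%nat. split; [exact Heta |].
  intros M HM.
  assert (HMR : 0 < INR M) by (apply lt_0_INR; lia).
  assert (HKM : 2 * INR K <= INR M).
  { replace (2 * INR K) with (INR (2 * K)) by (rewrite mult_INR; simpl; ring). apply le_INR; lia. }
  set (h := / INR M).
  assert (Hh : 0 <= h <= 1).
  { split; [left; apply Rinv_0_lt_compat; exact HMR |].
    unfold h. rewrite <- Rinv_1. apply Rinv_le_contravar; [lra |]. change 1 with (INR 1). apply le_INR; lia. }
  set (y := lincomb (1 - h) h d0 dbar).
  assert (Hy : forall i j, 0 <= d0 i j <= y i j).
  { intros i j. pose proof (params_le i j). unfold y, lincomb. nra. }
  pose proof (growth_gain n v0 m0 len0 Hn RP0 q a p0 t0 L0 TR0 M y (h * k)) as G.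
  specialize (G ltac:(apply Rmult_le_pos; lra) Hy (gram_scaled k h Hh ltac:(lra) Hkap) s l K
     (conj Hs HS) (conj Hl HL) HK' ltac:(lia)).
  fold x0 d0 rate in G. change (act (adjn n) d0 (word a 0 M) x0 (a (S M))) with (F M d0) in G.
  change (act (adjn n) y (word a 0 M) x0 (a (S M))) with (F M y) in G.
  pose proof (F_pos M) as FP.
  assert (FY : F M d0 * exp eta <= F M y).
  { eapply Rle_trans; [| exact G]. apply Rmult_le_compat_l; [lra |].
    unfold eta. rewrite exp_ln by (assert (0 < k * rate) by (apply Rmult_lt_0_compat; assumption); lra).
    replace ((INR M - INR K) * (h * k * rate)) with ((INR M - INR K) * h * (k * rate)) by ring.
    assert (1 / 2 <= (INR M - INR K) * h).
    { unfold h. apply (Rmult_le_reg_r (INR M)); [exact HMR |]. rewrite Rmult_assoc, Rinv_l by lra. lra. }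
    assert (0 < k * rate) by (apply Rmult_lt_0_compat; assumption). nra. }
  destruct (good_F M) as (_ & _ & T). destruct (T y) as (f & Hf & Tf).
  pose proof (Tf d0) as T1. pose proof (Tf dbar) as T2.
  assert (Ey : f y = (1 - h) * f d0 + h * f dbar) by apply Hf.
  set (De := f dbar - f d0).
  replace (f d0 - f y) with (- (h * De)) in T1 by (rewrite Ey; unfold De; ring).
  replace (f dbar - f y) with ((INR M - 1) * (h * De)) in T2
    by (rewrite Ey; unfold De, h; field; lra).
  assert (FYpos : 0 < F M y) by (pose proof (exp_pos eta); nra).
  assert (HDe : eta <= h * De).
  { destruct (Rle_or_lt eta (h * De)) as [g | g]; [exact g | exfalso].
    assert (exp (h * De) < exp eta) by (apply exp_increasing; exact g).
    assert (exp (h * De) * exp (- (h * De)) = 1) by apply exp_mul_neg.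
    pose proof (exp_pos (- (h * De))). pose proof (exp_pos (h * De)).
    apply (Rmult_le_compat_r (exp (h * De))) in T1; [| lra].
    rewrite Rmult_assoc, (Rmult_comm (exp (- (h * De)))) in T1. nra. }
  assert (M1 : 0 <= INR M - 1).
  { assert (INR 1 <= INR M) by (apply le_INR; lia). simpl in H. lra. }
  assert (EE : exp ((INR M - 1) * eta) <= exp ((INR M - 1) * (h * De))).
  { assert ((INR M - 1) * eta <= (INR M - 1) * (h * De)) as [X | X] by (apply Rmult_le_compat_l; assumption).
    - left; apply exp_increasing, X.
    - rewrite X; lra. }
  eapply Rle_trans; [| exact T2].
  apply Rmult_le_compat; [lra | left; apply exp_pos | | exact EE].
  assert (1 <= exp eta) by (rewrite <- exp_0; left; apply exp_increasing; exact Heta). nra.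
Qed.

Lemma ln_F_upper (M : nat) : 0 < F M dbar ->
  INR n * ln (F M dbar) <= rsum n (fun r => ln (F M (dr r))).
Proof.
  intros H. rewrite params_mean in *. apply (good_jensen (F M) n dr (good_F M)); [lia | exact H].
Qed.

(** The supporting exponential at [dbar] has a positive coefficient and lies below F everywhere. *)
Lemma F_dr_pos (M r : nat) : 0 < F M dbar -> 0 < F M (dr r).
Proof.
  intros H. destruct (good_F M) as (_ & _ & T). destruct (T dbar) as (f & _ & Tf).
  specialize (Tf (dr r)). pose proof (exp_pos (f (dr r) - f dbar)).
  assert (0 < F M dbar * exp (f (dr r) - f dbar)) by (apply Rmult_lt_0_compat; assumption). lra.
Qed.

Lemma upper_constants : exists C, forall M, 0 < F M dbar ->
  rsum n (fun r => ln (F M (dr r))) <= C + rsum n (fun r => span (L r) 0 (S M)).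
Proof.
  assert (H : forall N, (N <= n)%nat -> exists C, forall M, 0 < F M dbar ->
     rsum N (fun r => ln (F M (dr r))) <= C + rsum N (fun r => span (L r) 0 (S M))).
  { induction N as [| N IH]; intros HN.
    - exists 0. intros; simpl; lra.
    - destruct IH as (C & HC); [lia |]. destruct (F_upper N ltac:(lia)) as (C' & HC' & HU).
      exists (C + ln C'). intros M HM. specialize (HC M HM). specialize (HU M). simpl.
      assert (ln (F M (dr N)) <= ln C' + span (L N) 0 (S M)); [| lra].
      rewrite <- (ln_exp (span (L N) 0 (S M))), <- ln_mult by (try apply exp_pos; exact HC').
      destruct HU as [HU | ->]; [left; apply ln_increasing; [apply F_dr_pos, HM | exact HU] | lra]. }
  apply H. lia.
Qed.

Lemma main_inequality :
  INR n * rsum q L0 <= rsum n (fun r => rsum q (L r)) /\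
  (INR n * rsum q L0 = rsum n (fun r => rsum q (L r)) -> forall i, len i = len0 O).
Proof.
  destruct upper_constants as (C & HC). destruct F_lower as (B & HB & HLow).
  assert (Hq : (1 <= q)%nat) by apply TR0.
  assert (HnR : 0 < INR n) by (apply lt_0_INR; lia).
  (* Both claims follow from this estimate, with eta = 0 for the inequality and eta > 0 for the
     strict case. Words of N full periods make the lengths N times the period plus a fixed
     remainder. *)
  assert (core : forall eta K, 0 <= eta ->
     (forall M, (K <= M)%nat -> F M d0 * exp ((INR M - 1) * eta) <= F M dbar) ->
     INR n * (rsum q L0 + INR q * eta) <= rsum n (fun r => rsum q (L r))).
  { intros eta K Heta HE.
    set (X := rsum n (fun r => L r 0%nat)).
    apply (archimedean_le _ _ (C + X - INR n * ln B + INR n * eta - INR n * L0 0%nat) K).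
    intros N HN. set (M := (N * q)%nat).
    assert (HM : (K <= M)%nat) by (unfold M; nia).
    specialize (HE M HM). specialize (HLow M).
    assert (Epos : 0 < exp ((INR M - 1) * eta)) by apply exp_pos.
    assert (F0 : 0 < F M d0) by apply F_pos.
    assert (Fb : 0 < F M dbar).
    { assert (0 < F M d0 * exp ((INR M - 1) * eta)) by (apply Rmult_lt_0_compat; assumption). lra. }
    pose proof (ln_F_upper M Fb) as J. specialize (HC M Fb).
    assert (low : ln B + span L0 0 (S M) + (INR M - 1) * eta <= ln (F M dbar)).
    { assert (P1 : 0 < B * exp (span L0 0 (S M)))
        by (apply Rmult_lt_0_compat; [exact HB | apply exp_pos]).
      assert (EQ : ln (B * exp (span L0 0 (S M)) * exp ((INR M - 1) * eta))
         = ln B + span L0 0 (S M) + (INR M - 1) * eta).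
      { rewrite (ln_mult _ _ P1 Epos), (ln_mult _ _ HB (exp_pos _)), !ln_exp. reflexivity. }
      rewrite <- EQ.
      assert (B * exp (span L0 0 (S M)) * exp ((INR M - 1) * eta) <= F M dbar) as [l | l].
      { eapply Rle_trans; [| exact HE]. apply Rmult_le_compat_r; [lra | exact HLow]. }
      - left; apply ln_increasing; [| exact l].
        repeat apply Rmult_lt_0_compat; try apply exp_pos; exact HB.
      - rewrite l; lra. }
    assert (S0 : span L0 0 (S M) = INR N * rsum q L0 + L0 0%nat).
    { rewrite span_S. unfold M. rewrite (span_period L0 q N 0) by apply TR0. f_equal.
      apply (periodic_mul q L0), TR0. }
    assert (Sr : rsum n (fun r => span (L r) 0 (S M)) = INR N * rsum n (fun r => rsum q (L r)) + X).
    { unfold X. rewrite <- rsum_scal, <- rsum_plus. apply rsum_ext. intros r Hr.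
      rewrite span_S. unfold M. rewrite (span_period (L r) q N 0) by apply (TR r Hr). f_equal.
      apply (periodic_mul q (L r)), (TR r Hr). }
    rewrite S0 in low. rewrite Sr in HC.
    assert (EM : INR M = INR N * INR q) by apply mult_INR. rewrite EM in low.
    apply (Rmult_le_compat_l (INR n)) in low; [| lra].
    lra. }
  assert (le0 : INR n * rsum q L0 <= rsum n (fun r => rsum q (L r))).
  { specialize (core 0 0%nat ltac:(lra)).
    replace (INR n * (rsum q L0 + INR q * 0)) with (INR n * rsum q L0) in core by ring.
    apply core. intros M _. rewrite Rmult_0_r, exp_0, Rmult_1_r.
    destruct (good_F M) as (_ & mono & _). apply mono, params_le. }
  split; [exact le0 |].
  intros E. destruct mean_dist_comparison as [H1 H2].
  assert (dec : (forall j, (2 <= j <= n - 2)%nat -> D0 j < D j) \/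
     exists j, (2 <= j <= n - 2)%nat /\ D j = D0 j).
  { assert (G : forall N, (N <= n - 2)%nat -> (forall j, (2 <= j <= N)%nat -> D0 j < D j) \/
      exists j, (2 <= j <= n - 2)%nat /\ D j = D0 j).
    { induction N as [| N IH]; intros HN; [left; lia |].
      destruct IH as [IH | IH]; [lia | | right; exact IH].
      destruct (Nat.le_gt_cases 2 (S N)) as [h | h]; [| left; lia].
      destruct (H1 (S N) ltac:(lia)) as [l | l].
      - left. intros j Hj. destruct (Nat.eq_dec j (S N)) as [-> | ne]; [exact l | apply IH; lia].
      - right. exists (S N). split; [lia | auto]. }
    apply (G (n - 2)%nat). lia. }
  destruct dec as [Hlt | (j & Hj & Ej)]; [| exact (H2 j Hj Ej)].
  exfalso. destruct (F_gain Hlt) as (eta & K & Heta & HE).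
  specialize (core eta K ltac:(lra) HE).
  assert (0 < INR q) by (apply lt_0_INR; lia).
  assert (0 < INR n * (INR q * eta)) by (repeat apply Rmult_lt_0_compat; assumption). lra.
Qed.

End Comparison.

(** * Tangent directions and side points *)

Definition dir (p x : vec3) : vec3 :=
  vscal (/ sinh (hdv p x)) (vadd x (vscal (mink p x) p)).

Lemma dir_tangent (p x : vec3) : hyp p -> hyp x -> p <> x ->
  0 < sinh (hdv p x) /\
  vadd x (vscal (mink p x) p) = vscal (sinh (hdv p x)) (dir p x) /\
  mink p (dir p x) = 0 /\ mink (dir p x) (dir p x) = 1 /\
  x = vadd (vscal (cosh (hdv p x)) p) (vscal (sinh (hdv p x)) (dir p x)).
Proof.
  intros Hp Hx Hne.
  pose proof (sinh_positive _ (hd_pos p x Hp Hx Hne)) as Hs.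
  pose proof (sinh_hd_sq p x Hp Hx) as Q. pose proof (cosh_hd p x Hp Hx) as C.
  destruct Hp as [hp _], Hx as [hx _].
  assert (E : vadd x (vscal (mink p x) p) = vscal (sinh (hdv p x)) (dir p x)).
  { unfold dir. rewrite vscal_vscal, Rinv_r, vscal_1 by lra. reflexivity. }
  split; [exact Hs |]. split; [exact E |]. split; [| split].
  - unfold dir. mexp. rewrite hp. ring.
  - assert (W : mink (vadd x (vscal (mink p x) p)) (vadd x (vscal (mink p x) p))
      = sinh (hdv p x) * sinh (hdv p x)).
    { rewrite Q. mexp. rewrite (mink_comm x p), hp, hx. ring. }
    unfold dir. rewrite mink_scal_l, mink_scal_r, W. field. lra.
  - rewrite <- E, C. clear. generalize (mink p x). intros c. vring.
Qed.

Lemma dir_back (p x : vec3) : hyp p -> hyp x -> p <> x ->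
  dir x p = vscal (-1) (vadd (vscal (sinh (hdv p x)) p) (vscal (cosh (hdv p x)) (dir p x))).
Proof.
  intros Hp Hx Hne. destruct (dir_tangent p x Hp Hx Hne) as (Hs & _ & _ & _ & E).
  unfold dir at 1. rewrite (hd_comm x p), (mink_comm x p).
  replace (mink p x) with (- cosh (hdv p x)) by (rewrite cosh_hd by assumption; ring).
  apply (vscal_cancel (sinh (hdv p x))); [lra |].
  rewrite vscal_vscal, Rinv_r, vscal_1 by lra. rewrite E at 2.
  pose proof (cosh_sq (hdv p x)) as C. set (c := cosh (hdv p x)) in *. set (s := sinh (hdv p x)) in *.
  generalize (dir p x) as d. clear - C. intros d.
  vec. apply vec_ext; match goal with |- ?r + - c * (c * ?r + s * ?e) = _ =>
    transitivity (r * (1 - c * c) - c * s * e); [ring | rewrite C; ring] end.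
Qed.

Lemma hangle_dir (p q r : point) : in_disc p -> in_disc q -> in_disc r -> p <> q -> p <> r ->
  hangle p q r = acos (mink (dir (lift p) (lift q)) (dir (lift p) (lift r))).
Proof.
  intros Hp Hq Hr Hpq Hpr.
  assert (Npq : lift p <> lift q) by (intros e; apply Hpq, lift_inj; assumption).
  assert (Npr : lift p <> lift r) by (intros e; apply Hpr, lift_inj; assumption).
  destruct (dir_tangent _ _ (lift_hyp p Hp) (lift_hyp q Hq) Npq) as (s1 & E1 & _ & U1 & _).
  destruct (dir_tangent _ _ (lift_hyp p Hp) (lift_hyp r Hr) Npr) as (s2 & E2 & _ & U2 & _).
  unfold hangle, tangent. rewrite E1, E2. f_equal. mexp. rewrite U1, U2.
  set (s := sinh (hdv (lift p) (lift q))) in *. set (t := sinh (hdv (lift p) (lift r))) in *.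
  replace (s * (s * 1) * (t * (t * 1))) with ((s * t) * (s * t)) by ring.
  assert (0 < s * t) by (apply Rmult_lt_0_compat; assumption).
  rewrite sqrt_square by lra. field. lra.
Qed.

(** Turns metric betweenness into a linear condition. Equality in the triangle inequality puts X in
    the plane of A and B, the coefficient of each end being sinh of the distance to the other end
    over sinh of the length; conversely, the coefficients determine both distances. *)
Lemma between_combination (A B X : vec3) : hyp A -> hyp B -> A <> B -> hyp X ->
  (X <> A /\ X <> B /\ hdv A X + hdv X B = hdv A B <->
   exists x y, 0 < x /\ 0 < y /\ X = vadd (vscal x A) (vscal y B)).
Proof.
  intros HA HB HAB HX.
  pose proof (hd_pos A B HA HB HAB) as Hl. pose proof (sinh_positive _ Hl) as Hs.
  pose proof (cosh_hd A B HA HB) as CL. pose proof (sinh_hd_sq A B HA HB) as SQ.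
  set (l := hdv A B) in *. split.
  - intros (N1 & N2 & E).
    pose proof (hd_pos A X HA HX ltac:(auto)) as Ha. pose proof (hd_pos X B HX HB N2) as Hb.
    pose proof (hd_triangle_eq A X B HA HX HB E) as D.
    exists (sinh (hdv X B) / sinh l), (sinh (hdv A X) / sinh l).
    split; [apply Rdiv_lt_0_compat; [apply sinh_positive |]; assumption |].
    split; [apply Rdiv_lt_0_compat; [apply sinh_positive |]; assumption |].
    set (e := dir A B). destruct (dir_tangent A B HA HB HAB) as (_ & E1 & E2 & E3 & E4).
    fold l e in E1, E2, E3, E4.
    set (m := vscal (/ sinh l) (vcross A B)).
    assert (F : frame A e m).
    { repeat split; try assumption; try apply HA.
      - unfold m. mexp. rewrite mink_cross_cross. destruct HA as [-> _], HB as [-> _].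
        rewrite (mink_comm B A). replace (mink A B * mink A B - -1 * -1) with (sinh l * sinh l).
        + field. lra.
        + fold l in SQ. lra.
      - unfold m. rewrite mink_scal_r, mink_comm, mink_cross, det3_eq13. ring.
      - unfold e, dir, m. mexp. rewrite (mink_comm B), (mink_comm A (vcross A B)), !mink_cross, det3_eq13, det3_eq23. ring. }
    rewrite (frame_expand A e m X F) at 1.
    assert (Xm : mink X m = 0).
    { unfold m. rewrite mink_scal_r, mink_comm, mink_cross.
      assert (det3 A B X = - det3 A X B) as -> by (clear; vring). rewrite D. ring. }
    assert (XA : - mink X A = cosh (hdv A X)) by (rewrite cosh_hd, mink_comm by assumption; ring).
    assert (Xe : mink X e = sinh (hdv A X)).
    { unfold e, dir. fold l. mexp. replace (mink X B) with (- cosh (hdv X B)) by (rewrite cosh_hd by assumption; ring).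
      replace (hdv X B) with (l - hdv A X) by lra. rewrite cosh_sub.
      replace (mink A B) with (- cosh l) by lra. replace (mink X A) with (- cosh (hdv A X)) by lra.
      field. lra. }
    rewrite Xm, XA, Xe. replace (hdv X B) with (l - hdv A X) by lra. rewrite E4.
    unfold Rminus. rewrite sinh_add, cosh_opp, sinh_opp.
    generalize m e. intros m' e'. generalize (cosh (hdv A X)) (sinh (hdv A X)). intros c s.
    revert Hs. generalize (cosh l) (sinh l). clear. intros cl sl Hs.
    vec. apply vec_ext; field; lra.
  - intros (x & y & Hx & Hy & E).
    pose proof HX as [HXX _]. pose proof HA as [HAA _]. pose proof HB as [HBB _].
    assert (E1 : mink A X = - (x + y * cosh l)).
    { rewrite E. mexp. rewrite HAA. replace (mink A B) with (- cosh l) by lra. ring. }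
    assert (E2 : mink X B = - (x * cosh l + y)).
    { rewrite E. mexp. rewrite HBB. replace (mink A B) with (- cosh l) by lra. ring. }
    assert (N : x * x + y * y + 2 * (x * y * cosh l) = 1).
    { rewrite E in HXX. revert HXX. mexp. rewrite (mink_comm B A), HAA, HBB.
      replace (mink A B) with (- cosh l) by lra. intros. lra. }
    pose proof (cosh_sq l) as C.
    assert (S1 : sinh (hdv A X) = y * sinh l).
    { apply Rsqr_inj; [apply sinh_nonneg, hd_nonneg; assumption | apply Rmult_le_pos; lra |].
      unfold Rsqr. rewrite sinh_hd_sq, E1 by assumption.
      replace (y * sinh l * (y * sinh l)) with (y * y * (cosh l * cosh l - 1)) by (rewrite C; ring).
      replace 1 with (x * x + y * y + 2 * (x * y * cosh l)) at 1. ring. }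
    assert (S2 : sinh (hdv X B) = x * sinh l).
    { apply Rsqr_inj; [apply sinh_nonneg, hd_nonneg; assumption | apply Rmult_le_pos; lra |].
      unfold Rsqr. rewrite sinh_hd_sq, E2 by assumption.
      replace (x * sinh l * (x * sinh l)) with (x * x * (cosh l * cosh l - 1)) by (rewrite C; ring).
      replace 1 with (x * x + y * y + 2 * (x * y * cosh l)) at 1. ring. }
    split; [| split].
    + intros e. rewrite e, hd_eq_0, sinh_0 in S1 by assumption. nra.
    + intros e. rewrite e, hd_eq_0, sinh_0 in S2 by assumption. nra.
    + apply cosh_inj; [pose proof (hd_nonneg A X HA HX); pose proof (hd_nonneg X B HX HB); lra | lra |].
      rewrite cosh_add, !cosh_hd, S1, S2, E1, E2 by assumption.
      transitivity (cosh l * (x * x + y * y + x * y * cosh l) + x * y * (1 + sinh l * sinh l)); [ring |].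
      rewrite <- C. transitivity (cosh l * (x * x + y * y + 2 * (x * y * cosh l))); [ring |].
      rewrite N. ring.
Qed.

Lemma acos_inj (x y : R) : -1 <= x <= 1 -> -1 <= y <= 1 -> acos x = acos y -> x = y.
Proof. intros Hx Hy H. rewrite <- (cos_acos x Hx), <- (cos_acos y Hy), H. reflexivity. Qed.

(** Equal angles fix the component along the side; unit length gives the normal component up to
    sign, and the sign conditions select the inward one. *)
Lemma reflection_law (p e m u w : vec3) : frame p e m ->
  mink p u = 0 -> mink u u = 1 -> 0 <= mink m u ->
  mink p w = 0 -> mink w w = 1 -> 0 <= mink m w ->
  (acos (mink u (vscal (-1) e)) = acos (mink w e) <-> w = refl m (vscal (-1) u)).
Proof.
  intros F pu uu mu pw ww mw.
  pose proof (frame_mink p e m u u F) as Nu. pose proof (frame_mink p e m w w F) as Nw.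
  rewrite uu, (mink_comm u p), pu, (mink_comm u m) in Nu.
  rewrite ww, (mink_comm w p), pw, (mink_comm w m) in Nw.
  assert (R : refl m (vscal (-1) u) = vadd (vscal (- mink u e) e) (vscal (mink m u) m)).
  { unfold refl. mexp. rewrite (frame_expand p e m u F) at 1. rewrite (mink_comm u p), pu, (mink_comm u m).
    generalize (mink u e) (mink m u). clear. intros. vring. }
  rewrite R, mink_scal_r. split.
  - intros H. apply acos_inj in H; [| nra | nra].
    assert (mink m w = mink m u) by (apply Rsqr_inj; [assumption | assumption | unfold Rsqr; nra]).
    rewrite (frame_expand p e m w F) at 1. rewrite (mink_comm w p), pw, (mink_comm w m), H0, <- H.
    generalize (mink u e) (mink m u). clear. intros. vring.
  - intros ->. f_equal. mexp. destruct F as (_ & -> & _ & _ & _ & Fem).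
    rewrite (mink_comm m e), Fem. ring.
Qed.

Section SidePoints.

Variables (n : nat) (v m : nat -> vec3) (len : nat -> R).
Hypothesis Hn : (6 <= n)%nat.
Hypothesis RP : rpoly n v m len.

Definition side_point (u : nat) (x : vec3) : Prop :=
  exists a b, 0 < a /\ 0 < b /\ x = vadd (vscal a (v u)) (vscal b (v (S u))).

Lemma side_point_on (u : nat) (x : vec3) : side_point u x -> mink (m u) x = 0.
Proof.
  intros (a & b & _ & _ & ->). mexp.
  rewrite (rp_on_start n v m len Hn RP), (rp_on_end n v m len RP). ring.
Qed.

Lemma side_point_in (u j : nat) (x : vec3) : (u < n)%nat -> (j < n)%nat -> j <> u ->
  side_point u x -> 0 < mink (m j) x.
Proof.
  intros Hu Hj Hne (a & b & Ha & Hb & ->). mexp.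
  assert (A : 0 <= mink (m j) (v u) /\ ((u <> j)%nat -> (u mod n <> S j mod n)%nat -> 0 < mink (m j) (v u))).
  { destruct (Nat.le_gt_cases j u) as [h | h].
    - replace u with (j + (u - j))%nat at 1 4 by lia. split; [apply (rp_vertex_nonneg n v m len Hn RP); lia |].
      intros _ N. apply (rp_in _ _ _ _ RP). destruct (Nat.eq_dec u (S j)) as [-> | ?]; [congruence | lia].
    - rewrite <- (rp_per_v _ _ _ _ RP u). replace (u + n)%nat with (j + (u + n - j))%nat at 1 2 by lia.
      split; [apply (rp_vertex_nonneg n v m len Hn RP); lia |].
      intros _ N. apply (rp_in _ _ _ _ RP).
      destruct (Nat.eq_dec (u + n) (S j)) as [E | ?]; [| lia].
      exfalso. apply N. rewrite <- E. replace (u + n)%nat with (u + 1 * n)%nat by lia.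
      rewrite Nat.Div0.mod_add. reflexivity. }
  assert (B : 0 <= mink (m j) (v (S u)) /\ ((u mod n = S j mod n)%nat -> 0 < mink (m j) (v (S u)))).
  { destruct (Nat.le_gt_cases j u) as [h | h].
    - replace (S u) with (j + (S u - j))%nat by lia. split; [apply (rp_vertex_nonneg n v m len Hn RP); lia |].
      intros N. apply (rp_in _ _ _ _ RP).
      rewrite (Nat.mod_small u) in N by lia.
      destruct (Nat.eq_dec (S j) n) as [E | ?].
      + rewrite E, Nat.Div0.mod_same in N. lia.
      + rewrite Nat.mod_small in N; lia.
    - rewrite <- (rp_per_v _ _ _ _ RP (S u)). replace (S u + n)%nat with (j + (S u + n - j))%nat by lia.
      split; [apply (rp_vertex_nonneg n v m len Hn RP); lia |].
      intros N. apply (rp_in _ _ _ _ RP).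
      rewrite (Nat.mod_small u) in N by lia.
      destruct (Nat.eq_dec (S j) n) as [E | ?].
      + rewrite E, Nat.Div0.mod_same in N. lia.
      + rewrite Nat.mod_small in N; lia. }
  destruct A as [A0 A1], B as [B0 B1].
  destruct (Nat.eq_dec (u mod n)%nat (S j mod n)%nat) as [E | E].
  - specialize (B1 E). nra.
  - specialize (A1 ltac:(auto) E). nra.
Qed.

(** The coefficients are the values at the normals of the two neighbouring sides divided by sinh of
    the side length; [u + n - 1] is the predecessor of u modulo n. *)
Lemma side_point_of_signs (u : nat) (x : vec3) :
  mink (m u) x = 0 -> 0 < mink (m (S u)) x -> 0 < mink (m (u + n - 1)%nat) x -> side_point u x.
Proof.
  intros H0 H1 H2.
  pose proof (rp_frame _ _ _ _ RP u) as F.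
  set (s := sinh (len u)). assert (Hs : 0 < s) by apply sinh_positive, (rp_len _ _ _ _ RP).
  set (w := (u + n - 1)%nat) in *.
  pose proof (rp_normal_next n v m len RP w) as N.
  pose proof (rp_next _ _ _ _ RP w) as V2.
  replace (S w) with (u + n)%nat in N, V2 by (unfold w; lia).
  replace (S (u + n)) with (S u + n)%nat in N, V2 by lia.
  rewrite !(rp_per_v _ _ _ _ RP), (rp_per_len _ _ _ _ RP) in V2.
  rewrite (rp_per_v _ _ _ _ RP), (rp_per_m _ _ _ _ RP), (rp_per_len _ _ _ _ RP) in N.
  pose proof (rp_prev _ _ _ _ RP u) as V1. fold s in V1, V2, N.
  exists (mink (m (S u)) x / s), (mink (m w) x / s).
  split; [apply Rdiv_lt_0_compat; assumption |].
  split; [apply Rdiv_lt_0_compat; assumption |].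
  destruct F as (f1 & f2 & f3 & f4 & f5 & f6).
  pose proof (frame_det _ _ _ (rp_frame _ _ _ _ RP u)) as HD.
  assert (Vm : mink (v u) (m (S u)) = s).
  { rewrite V1. mexp. rewrite f5, f3. ring. }
  assert (mw : mink (m w) x = s * (- mink (v (S u)) x) - cosh (len u) * mink (m (S u)) x).
  { rewrite N. 
    assert (V1' : v u = vadd (vscal (cosh (len u)) (v (S u))) (vscal s (m (S u)))) by exact V1.
    assert (mink (v (S u)) x = cosh (len u) * mink (v u) x + s * mink (m w) x).
    { rewrite V2 at 1. mexp. ring. }
    assert (mink (v u) x = cosh (len u) * mink (v (S u)) x + s * mink (m (S u)) x).
    { rewrite V1 at 1. mexp. ring. }
    pose proof (cosh_sq (len u)) as C. fold s in C.
    apply (Rmult_eq_reg_l s); [| lra].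
    rewrite N in H3. revert H3. mexp. intros H3. 
    rewrite H3 in H.
    assert (s * mink (m w) x = (1 - cosh (len u) * cosh (len u)) * mink (v (S u)) x - cosh (len u) * s * mink (m (S u)) x).
    { rewrite N. mexp. lra. }
    rewrite C in H4. rewrite N in H4. revert H4. mexp. intros H4. lra. }
  apply (vec_eq_of_mink _ _ _ _ _ HD); mexp.
  - rewrite (mink_comm (v u)), f1. rewrite V1. mexp. rewrite f1, f5.
    rewrite mw, (mink_comm x). field. lra.
  - rewrite (mink_comm x), H0, (mink_comm (v u)), (rp_on_start n v m len Hn RP), f4. ring.
  - rewrite (mink_comm x), Vm, f5. field. lra.
Qed.

End SidePoints.

(** * Closed trajectories in the disc and on the hyperboloid *)

Lemma mod_S_mod (i q : nat) : (S (i mod q) mod q)%nat = (S i mod q)%nat.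
Proof.
  rewrite <- (Nat.add_1_r (i mod q)), <- (Nat.add_1_r i). apply Nat.Div0.add_mod_idemp_l.
Qed.

Lemma mod_pred_mod (i q : nat) : (0 < q)%nat -> ((S i mod q + q - 1) mod q)%nat = (i mod q)%nat.
Proof.
  intros Hq. replace (S i mod q + q - 1)%nat with (S i mod q + (q - 1))%nat by lia.
  rewrite Nat.Div0.add_mod_idemp_l. replace (S i + (q - 1))%nat with (i + 1 * q)%nat by lia.
  apply Nat.Div0.mod_add.
Qed.

Lemma mod_add_self (i q : nat) : ((i + q) mod q)%nat = (i mod q)%nat.
Proof. replace (i + q)%nat with (i + 1 * q)%nat by lia. apply Nat.Div0.mod_add. Qed.

Section SideFrame.

Variables (n : nat) (v m : nat -> vec3) (len : nat -> R).
Hypothesis Hn : (6 <= n)%nat.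
Hypothesis RP : rpoly n v m len.

Lemma rp_vert_neq (u : nat) : v u <> v (S u).
Proof.
  intros e. pose proof (rp_in _ _ _ _ RP (S u) (n - 1) ltac:(lia)) as H.
  replace (S u + (n - 1))%nat with (u + n)%nat in H by lia.
  rewrite (rp_per_v _ _ _ _ RP), e, (rp_on_start n v m len Hn RP) in H. lra.
Qed.

Lemma side_frame (u : nat) (x : vec3) : hyp x -> side_point v u x ->
  x <> v u /\ x <> v (S u) /\ frame x (dir x (v (S u))) (m u) /\
  dir x (v u) = vscal (-1) (dir x (v (S u))).
Proof.
  intros Hx Sx. pose proof (rp_hyp _ _ _ _ RP) as HV.
  pose proof (side_point_on n v m len Hn RP u x Sx) as Ox.
  destruct (between_combination (v u) (v (S u)) x (HV _) (HV _) (rp_vert_neq u) Hx) as [_ B].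
  destruct (B Sx) as (N1 & N2 & E). split; [exact N1 |]. split; [exact N2 |].
  destruct (dir_tangent x (v u) Hx (HV _) N1) as (s1 & E1 & T1 & U1 & _).
  destruct (dir_tangent x (v (S u)) Hx (HV _) N2) as (s2 & E2 & T2 & U2 & _).
  assert (M1 : mink (dir x (v u)) (m u) = 0).
  { unfold dir. mexp. rewrite (mink_comm (v u)), (mink_comm x (m u)), Ox, (rp_on_start n v m len Hn RP). ring. }
  assert (M2 : mink (dir x (v (S u))) (m u) = 0).
  { unfold dir. mexp. rewrite (mink_comm (v (S u))), (mink_comm x (m u)), Ox, (rp_on_end n v m len RP). ring. }
  assert (F : frame x (dir x (v (S u))) (m u)).
  { repeat split; try assumption; [apply Hx | apply (rp_unit n v m len RP) | rewrite mink_comm; exact Ox]. }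
  split; [exact F |].
  rewrite (frame_expand _ _ _ (dir x (v u)) F) at 1. rewrite M1, (mink_comm (dir x (v u)) x), T1.
  assert (K : mink (dir x (v u)) (dir x (v (S u))) = -1).
  { apply (Rmult_eq_reg_l (sinh (hdv x (v u)) * sinh (hdv x (v (S u))))).
    2: { assert (0 < sinh (hdv x (v u)) * sinh (hdv x (v (S u)))) by (apply Rmult_lt_0_compat; assumption). lra. }
    transitivity (mink (vadd (v u) (vscal (mink x (v u)) x)) (vadd (v (S u)) (vscal (mink x (v (S u))) x))).
    - rewrite E1, E2. mexp. ring.
    - mexp. rewrite (mink_comm (v u) x), (proj1 Hx).
      assert (Q : cosh (hdv (v u) x + hdv x (v (S u))) = cosh (hdv (v u) (v (S u)))) by (rewrite E; reflexivity).
      rewrite cosh_add, (hd_comm (v u) x) in Q.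
      rewrite (cosh_hd x (v u) Hx (HV _)), (cosh_hd x (v (S u)) Hx (HV _)), (cosh_hd (v u) (v (S u)) (HV _) (HV _)) in Q.
      lra. }
  rewrite K. generalize (dir x (v (S u))) (m u). generalize x. clear. intros x0 e w. vring.
Qed.

End SideFrame.

Lemma traj_side_point (n : nat) (v m : nat -> vec3) (len : nat -> R) (Hn : (6 <= n)%nat)
  (RP : rpoly n v m len) (q : nat) (a : nat -> nat) (p t : nat -> vec3) (L : nat -> R)
  (TR : trajectory n m q a p t L) (i : nat) : side_point v (a i) (p i).
Proof.
  assert (la : (a i < n)%nat) by apply TR.
  assert (X : forall j, (j mod n <> a i)%nat -> 0 < mink (m j) (p i)).
  { intros j Hj. rewrite (periodic_mod n m (rp_per_m _ _ _ _ RP) j).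
    apply (tr_side _ _ _ _ _ _ _ TR); [apply Nat.mod_upper_bound; lia | exact Hj]. }
  apply (side_point_of_signs n v m len Hn RP); [apply TR | apply X | apply X].
  - destruct (Nat.eq_dec (S (a i)) n) as [e | ne]; [rewrite e, Nat.Div0.mod_same; lia | rewrite Nat.mod_small; lia].
  - destruct (Nat.eq_dec (a i) 0) as [e | ne]; [rewrite e, Nat.mod_small; lia |].
    replace (a i + n - 1)%nat with ((a i - 1) + 1 * n)%nat by lia.
    rewrite Nat.Div0.mod_add, Nat.mod_small; lia.
Qed.

Section Conversion.

Variables (k : nat) (P : nat -> point).
Hypothesis Hk : (3 <= k)%nat.
Hypothesis HP : right_angled k P.

Let n := (2 * k)%nat.
Let V := vert k P.
Let m := snorm k P.
Let RP : rpoly n V m (slen k P) := rpoly_of_right_angled k P Hk HP.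
Let Hn : (6 <= n)%nat.
Proof. unfold n. lia. Qed.

Lemma lift_vertex (j : nat) : (j < 2 * k)%nat ->
  lift (P j) = V j /\ lift (P (nxt k j)) = V (S j) /\ in_disc (P j) /\ in_disc (P (nxt k j)).
Proof.
  intros Hj. pose proof HP as [[D _] _]. unfold V, vert, nxt. rewrite (Nat.mod_small j) by exact Hj.
  repeat split; apply D; [exact Hj | apply Nat.mod_upper_bound; lia].
Qed.

Lemma on_side_iff (j : nat) (x : point) : (j < 2 * k)%nat ->
  (on_side k P j x <-> in_disc x /\ side_point V j (lift x)).
Proof.
  intros Hj. destruct (lift_vertex j Hj) as (E1 & E2 & D1 & D2).
  pose proof (rp_hyp _ _ _ _ RP) as HV. pose proof (rp_vert_neq n V m _ Hn RP j) as N.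
  unfold on_side, side_point. rewrite !hdist_hd, E1, E2. split.
  - intros (Dx & N1 & N2 & E). split; [exact Dx |].
    apply (between_combination (V j) (V (S j)) (lift x) (HV _) (HV _) N (lift_hyp x Dx)).
    split; [| split; [| exact E]].
    + rewrite <- E1. intros e. apply N1, lift_inj; assumption.
    + rewrite <- E2. intros e. apply N2, lift_inj; assumption.
  - intros (Dx & Sx). split; [exact Dx |].
    apply (between_combination (V j) (V (S j)) (lift x) (HV _) (HV _) N (lift_hyp x Dx)) in Sx.
    destruct Sx as (N1 & N2 & E). rewrite <- E1 in N1. rewrite <- E2 in N2.
    split; [intros e; apply N1; rewrite e; reflexivity |]. split; [intros e; apply N2; rewrite e; reflexivity | exact E].
Qed.

(** The local bounce condition of [closed_traj] at [y], for previous and next bounces [x], [z]. *)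
Lemma bounce_iff (u : nat) (x y z : point) : (u < 2 * k)%nat ->
  in_disc x -> in_disc y -> in_disc z -> x <> y -> y <> z -> side_point V u (lift y) ->
  0 <= mink (m u) (lift x) -> 0 <= mink (m u) (lift z) ->
  (hangle y x (P u) = hangle y z (P (nxt k u)) <->
   dir (lift y) (lift z) = refl (m u) (vscal (-1) (dir (lift y) (lift x)))).
Proof.
  intros Hu Dx Dy Dz Nxy Nyz Sy mx mz.
  destruct (lift_vertex u Hu) as (E1 & E2 & D1 & D2).
  pose proof (lift_hyp y Dy) as Hy.
  destruct (side_frame n V m _ Hn RP u (lift y) Hy Sy) as (N1 & N2 & F & B).
  rewrite !hangle_dir; auto.
  2-3: intros e; first [apply N1; rewrite e; assumption | apply N2; rewrite e; assumption].
  rewrite E1, E2, B.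
  assert (G : forall w, in_disc w -> y <> w -> 0 <= mink (m u) (lift w) ->
     mink (lift y) (dir (lift y) (lift w)) = 0 /\
     mink (dir (lift y) (lift w)) (dir (lift y) (lift w)) = 1 /\
     0 <= mink (m u) (dir (lift y) (lift w))).
  { intros w Dw Nw mw.
    assert (Nw' : lift y <> lift w) by (intros e; apply Nw, lift_inj; assumption).
    destruct (dir_tangent _ _ Hy (lift_hyp w Dw) Nw') as (s & E & T & U & _).
    split; [exact T |]. split; [exact U |].
    unfold dir. mexp. rewrite (side_point_on n V m _ Hn RP u (lift y) Sy).
    apply Rmult_le_pos; [left; apply Rinv_0_lt_compat; exact s | lra]. }
  destruct (G x Dx ltac:(auto) mx) as (A1 & A2 & A3). destruct (G z Dz Nyz mz) as (B1 & B2 & B3).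
  apply (reflection_law (lift y)); assumption.
Qed.

Lemma closed_traj_trajectory (s : list nat) (ps : list point) : closed_traj k P s ps ->
  let q := length s in
  length ps = q /\ (forall i, in_disc (nth (i mod q) ps (0, 0))) /\
  exists t L, trajectory n m q (fun i => nth (i mod q) s 0%nat)
    (fun i => lift (nth (i mod q) ps (0, 0))) t L.
Proof.
  intros (Hlen & Hq & H) q. fold q in Hlen, Hq, H. split; [exact Hlen |].
  set (a := fun i => nth (i mod q) s 0%nat). set (pt := fun i => nth (i mod q) ps (0, 0)).
  assert (Hb : forall i, (i mod q < q)%nat) by (intros; apply Nat.mod_upper_bound; lia).
  assert (HA : forall i, (a i < 2 * k)%nat /\ on_side k P (a i) (pt i) /\ pt i <> pt (S i) /\
     hangle (pt (S i)) (pt i) (P (a (S i))) = hangle (pt (S i)) (pt (S (S i))) (P (nxt k (a (S i))))).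
  { intros i. destruct (H (i mod q)%nat (Hb i)) as (h1 & h2 & h3 & _).
    rewrite mod_S_mod in h3. split; [exact h1 |]. split; [exact h2 |]. split; [exact h3 |].
    destruct (H (S i mod q)%nat (Hb (S i))) as (_ & _ & _ & h4).
    rewrite mod_S_mod, mod_pred_mod in h4 by lia. exact h4. }
  assert (HD : forall i, in_disc (pt i)) by (intros i; apply (HA i)).
  split; [exact HD |].
  set (p := fun i => lift (pt i)).
  assert (Hp : forall i, hyp (p i)) by (intros; apply lift_hyp, HD).
  assert (HS : forall i, side_point V (a i) (p i)).
  { intros i. destruct (HA i) as (h1 & h2 & _). apply on_side_iff in h2; [apply h2 | exact h1]. }
  assert (Hon : forall i, mink (m (a i)) (p i) = 0)
    by (intros i; apply (side_point_on n V m _ Hn RP), HS).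
  assert (Hin : forall i j, (j < n)%nat -> j <> a i -> 0 < mink (m j) (p i)).
  { intros i j Hj Hne. apply (side_point_in n V m _ Hn RP (a i) j); auto. apply (HA i). }
  assert (Hge : forall i j, (j < n)%nat -> 0 <= mink (m j) (p i)).
  { intros i j Hj. destruct (Nat.eq_dec j (a i)) as [-> | ne]; [rewrite Hon; lra | left; auto]. }
  assert (Hne : forall i, p i <> p (S i)).
  { intros i e. destruct (HA i) as (_ & _ & h & _). apply h, lift_inj; auto. }
  set (L := fun i => hdv (p i) (p (S i))). set (t := fun i => dir (p i) (p (S i))).
  assert (HL : forall i, 0 < L i) by (intros; apply hd_pos; auto).
  assert (HT : forall i, mink (p i) (t i) = 0 /\ mink (t i) (t i) = 1 /\
     p (S i) = vadd (vscal (cosh (L i)) (p i)) (vscal (sinh (L i)) (t i))).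
  { intros i. destruct (dir_tangent _ _ (Hp i) (Hp (S i)) (Hne i)) as (_ & _ & h1 & h2 & h3). auto. }
  assert (HR : forall i, t (S i) =
     refl (m (a (S i))) (vadd (vscal (sinh (L i)) (p i)) (vscal (cosh (L i)) (t i)))).
  { intros i. destruct (HA i) as (_ & _ & n1 & h). destruct (HA (S i)) as (l1 & _ & n2 & _).
    apply (bounce_iff (a (S i)) (pt i) (pt (S i)) (pt (S (S i))) l1 (HD _) (HD _) (HD _) n1 n2
      (HS _) (Hge i _ l1) (Hge (S (S i)) _ l1)) in h.
    change (dir (p (S i)) (p (S (S i))) = refl (m (a (S i))) (vscal (-1) (dir (p (S i)) (p i)))) in h.
    unfold t at 1. rewrite h, (dir_back _ _ (Hp i) (Hp (S i)) (Hne i)). fold (L i) (t i).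
    rewrite vscal_vscal. replace (-1 * -1) with 1 by ring. rewrite vscal_1. reflexivity. }
  assert (Hper : forall i, a (i + q)%nat = a i /\ pt (i + q)%nat = pt i).
  { intros i. unfold a, pt. rewrite mod_add_self. auto. }
  assert (Hpp : forall i, p (i + q)%nat = p i) by (intros i; unfold p; rewrite (proj2 (Hper i)); reflexivity).
  assert (HpS : forall i, p (S (i + q)) = p (S i)) by (intros i; apply (Hpp (S i))).
  assert (Hout : forall i, 0 <= mink (m (a i)) (t i)).
  { intros i. unfold t, dir. mexp. rewrite Hon.
    pose proof (sinh_positive _ (HL i)) as s1.
    apply Rmult_le_pos; [left; apply Rinv_0_lt_compat; exact s1 |].
    pose proof (Hge (S i) (a i) ltac:(apply (HA i))). lra. }
  (* The bounce condition also holds for motion along a side. Such a path would keep the same letter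
     and the same direction on one line for ever, so after q segments it could not be back at
     [p i]. *)
  assert (Htr : forall i, 0 < mink (m (a i)) (t i)).
  { intros i. destruct (Hout i) as [h | h]; [exact h | exfalso].
    assert (G : forall M, a (i + M)%nat = a i /\
       p (i + M)%nat = vadd (vscal (cosh (span L i M)) (p i)) (vscal (sinh (span L i M)) (t i)) /\
       t (i + M)%nat = vadd (vscal (sinh (span L i M)) (p i)) (vscal (cosh (span L i M)) (t i))).
    { induction M as [| M (I1 & I2 & I3)].
      - rewrite Nat.add_0_r. unfold span. simpl rsum. rewrite cosh_0, sinh_0.
        split; [reflexivity |]. generalize (p i) (t i). clear. split; vring.
      - rewrite Nat.add_succ_r, span_S. set (j := (i + M)%nat) in *.
        destruct (HT j) as (_ & _ & Mv).
        assert (E1 : p (S j) = vadd (vscal (cosh (span L i M + L j)) (p i)) (vscal (sinh (span L i M + L j)) (t i))).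
        { rewrite Mv, I2, I3, cosh_add, sinh_add. generalize (p i) (t i). clear. vring. }
        assert (E2 : vadd (vscal (sinh (L j)) (p j)) (vscal (cosh (L j)) (t j)) =
            vadd (vscal (sinh (span L i M + L j)) (p i)) (vscal (cosh (span L i M + L j)) (t i))).
        { rewrite I2, I3, cosh_add, sinh_add. generalize (p i) (t i). clear. vring. }
        assert (Ea : a (S j) = a i).
        { destruct (Nat.eq_dec (a i) (a (S j))) as [e | ne]; [auto | exfalso].
          pose proof (Hin (S j) (a i) ltac:(apply (HA i)) ne) as K. rewrite E1 in K.
          revert K. mexp. rewrite Hon, <- h. lra. }
        split; [exact Ea |]. split; [exact E1 |].
        rewrite HR, E2, Ea. apply refl_fix. mexp.
        rewrite (mink_comm (p i)), (mink_comm (t i)), Hon, <- h. ring. }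
    destruct (G q) as (_ & G2 & _). rewrite Hpp in G2.
    destruct (HT i) as (T1 & _). apply (f_equal (mink (p i))) in G2. revert G2. mexp.
    rewrite T1, (proj1 (Hp i)). intros G2.
    assert (S0 : 0 < span L i q).
    { unfold span. destruct q as [| q']; [lia |]. simpl.
      assert (0 <= rsum q' (fun i0 => L (i + i0)%nat)).
      { replace 0 with (rsum q' (fun _ => 0)) by (rewrite rsum_const; ring).
        apply rsum_le. intros; left; apply HL. }
      specialize (HL (i + q')%nat). lra. }
    pose proof (cosh_lt 0 (span L i q) ltac:(lra) S0). rewrite cosh_0 in *. lra. }
  exists t, L. constructor; auto.
  - intros i. apply (HA i).
  - intros i. apply (Hper i).
  - intros i. unfold t. rewrite Hpp, HpS. reflexivity.
  - intros i. unfold L. rewrite Hpp, HpS. reflexivity.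
  - intros i. destruct (HT i) as (h1 & h2 & _). auto.
  - intros i. apply (HT i).
Qed.

Lemma trajectory_closed_traj (q : nat) (a : nat -> nat) (p t : nat -> vec3) (L : nat -> R) :
  trajectory n m q a p t L ->
  closed_traj k P (map a (seq 0 q)) (map (fun i => unlift (p i)) (seq 0 q)).
Proof.
  intros TR.
  assert (Hq : (1 <= q)%nat) by apply TR.
  set (pt := fun i => unlift (p i)).
  assert (Hp : forall i, in_disc (pt i) /\ lift (pt i) = p i) by (intros; apply unlift_disc, TR).
  assert (NA : forall i, (i < q)%nat -> nth i (map a (seq 0 q)) 0%nat = a i).
  { intros i Hi. rewrite (nth_indep _ 0%nat (a 0%nat)) by (rewrite length_map, length_seq; exact Hi).
    rewrite map_nth, seq_nth by exact Hi. reflexivity. }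
  assert (NP : forall i, (i < q)%nat -> nth i (map pt (seq 0 q)) (0, 0) = pt i).
  { intros i Hi. rewrite (nth_indep _ (0, 0) (pt 0%nat)) by (rewrite length_map, length_seq; exact Hi).
    rewrite map_nth, seq_nth by exact Hi. reflexivity. }
  assert (Hne : forall i, p i <> p (S i)).
  { intros i e. pose proof (traj_dist n m q a p t L TR i) as E. rewrite <- e, hd_eq_0 in E by apply TR.
    pose proof (tr_len _ _ _ _ _ _ _ TR i). lra. }
  assert (HS : forall i, side_point V (a i) (p i)).
  { apply (traj_side_point n V m _ Hn RP q a p t L TR). }
  assert (Hge : forall i j, (j < n)%nat -> 0 <= mink (m j) (p i)).
  { intros i j Hj. destruct (Nat.eq_dec j (a i)) as [-> | ne].
    - rewrite (tr_on _ _ _ _ _ _ _ TR); lra.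
    - left. apply (tr_side _ _ _ _ _ _ _ TR); assumption. }
  assert (Hpp : forall i, pt (i mod q)%nat = pt i).
  { intros i. symmetry. apply (periodic_mod q pt). intros j. unfold pt.
    rewrite (tr_per_p _ _ _ _ _ _ _ TR). reflexivity. }
  assert (Hb : forall i, (i mod q < q)%nat) by (intros; apply Nat.mod_upper_bound; lia).
  unfold closed_traj. rewrite !length_map, !length_seq. split; [reflexivity |]. split; [exact Hq |].
  intros i Hi. cbv zeta. rewrite NA, NP, !NP by auto. rewrite !Hpp.
  assert (la : (a i < 2 * k)%nat) by apply TR.
  destruct (Hp i) as [Di Li].
  split; [exact la |]. split.
  { apply on_side_iff; [exact la |]. split; [exact Di |]. rewrite Li. apply HS. }
  split; [intros e; apply (Hne i); destruct (Hp (S i)) as [_ Ls]; rewrite <- Li, <- Ls, e; reflexivity |].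
  assert (Ei : exists j, pt (i + q - 1)%nat = pt j /\ pt (S j) = pt i /\ a (S j) = a i /\ pt (S (S j)) = pt (S i)).
  { exists (i + q - 1)%nat. split; [reflexivity |].
    replace (S (i + q - 1)) with (i + q)%nat by lia. replace (S (i + q)) with (S i + q)%nat by lia.
    unfold pt. rewrite !(tr_per_p _ _ _ _ _ _ _ TR), (tr_per_a _ _ _ _ _ _ _ TR). auto. }
  destruct Ei as (j & -> & <- & <- & <-).
  destruct (Hp j) as [Dj Lj]. destruct (Hp (S j)) as [Dj1 Lj1]. destruct (Hp (S (S j))) as [Dj2 Lj2].
  assert (la' : (a (S j) < 2 * k)%nat) by apply TR.
  apply bounce_iff; auto; rewrite ?Lj, ?Lj1, ?Lj2.
  - intros e. apply (Hne j). rewrite <- Lj, <- Lj1, e. reflexivity.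
  - intros e. apply (Hne (S j)). rewrite <- Lj1, <- Lj2, e. reflexivity.
  - apply HS.
  - apply Hge, la'.
  - apply Hge, la'.
  - assert (D : forall l, dir (p l) (p (S l)) = t l).
    { intros l. unfold dir. rewrite (traj_dist n m q a p t L TR l).
      pose proof (sinh_positive _ (tr_len _ _ _ _ _ _ _ TR l)) as s.
      destruct (tr_tan _ _ _ _ _ _ _ TR l) as [T1 T2].
      assert (E : mink (p l) (p (S l)) = - cosh (L l)).
      { rewrite (tr_move _ _ _ _ _ _ _ TR l). mexp. rewrite T1, (proj1 (tr_hyp _ _ _ _ _ _ _ TR l)). ring. }
      rewrite E, (tr_move _ _ _ _ _ _ _ TR l). generalize (p l) (t l).
      revert s. generalize (cosh (L l)) (sinh (L l)). clear. intros c s Hs x y.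
      vec. apply vec_ext; field; lra. }
    rewrite D, (tr_bounce _ _ _ _ _ _ _ TR), (dir_back _ _ (tr_hyp _ _ _ _ _ _ _ TR j)
      (tr_hyp _ _ _ _ _ _ _ TR (S j)) (Hne j)), (traj_dist n m q a p t L TR j), D, vscal_vscal.
    replace (-1 * -1) with 1 by ring. rewrite vscal_1. reflexivity.
Qed.

End Conversion.

(** * The axis of a billiard word *)

(** The Clifford algebra of Minkowski space, scalar plus vector part: [N N = mink N N] for vectors. *)
Definition quat := (R * vec3)%type.
Definition qmul (x y : quat) : quat :=
  (fst x * fst y + mink (snd x) (snd y),
   vadd (vscal (fst x) (snd y)) (vadd (vscal (fst y) (snd x)) (vcross (snd x) (snd y)))).
Definition qvec (x : vec3) : quat := (0, x).
Definition qscal (c : R) (x : quat) : quat := (c * fst x, vscal c (snd x)).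
Definition qone : quat := (1, (0, 0, 0)).
Definition qnorm (x : quat) : R := fst x * fst x - mink (snd x) (snd x).

Ltac quatring := repeat (let y := fresh "y" in intro y);
  repeat match goal with x : quat |- _ => destruct x as [? [[? ?] ?]] end;
  repeat match goal with x : vec3 |- _ => destruct x as [[? ?] ?] end;
  unfold qmul, qvec, qscal, qone, qnorm, mink, vadd, vscal, vcross; simpl;
  first [ring | apply f_equal2; [ring | apply vec_ext; ring]].

Lemma qmul_assoc (x y z : quat) : qmul x (qmul y z) = qmul (qmul x y) z.
Proof. quatring. Qed.
Lemma qmul_one_l (x : quat) : qmul qone x = x.
Proof. quatring. Qed.
Lemma qmul_one_r (x : quat) : qmul x qone = x.
Proof. quatring. Qed.
Lemma qmul_scal_l (c : R) (x y : quat) : qmul (qscal c x) y = qscal c (qmul x y).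
Proof. quatring. Qed.
Lemma qmul_scal_r (c : R) (x y : quat) : qmul x (qscal c y) = qscal c (qmul x y).
Proof. quatring. Qed.
Lemma qscal_qscal (c d : R) (x : quat) : qscal c (qscal d x) = qscal (c * d) x.
Proof. quatring. Qed.
Lemma qnorm_mul (x y : quat) : qnorm (qmul x y) = qnorm x * qnorm y.
Proof. quatring. Qed.

Lemma qvec_sq (u : vec3) : qmul (qvec u) (qvec u) = qscal (mink u u) qone.
Proof. quatring. Qed.

Lemma qmul_scalar_move (c e : R) (x y : vec3) :
  qmul (c, (0, 0, 0)) (qvec x) = qscal e (qmul (qvec y) (c, (0, 0, 0))) -> vscal c x = vscal (e * c) y.
Proof.
  intros H. apply (f_equal snd) in H. transitivity (snd (qmul (c, (0, 0, 0)) (qvec x))); [| rewrite H];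
  clear; repeat match goal with x : vec3 |- _ => destruct x as [[? ?] ?] end; unfold qmul, qscal, qvec, vadd, vscal, vcross; simpl;
  apply vec_ext; ring.
Qed.

Lemma qvec_refl (u x : vec3) : mink u u = 1 ->
  qmul (qvec u) (qvec x) = qscal (-1) (qmul (qvec (refl u x)) (qvec u)).
Proof.
  intros H. transitivity (qscal (-1) (qmul (qvec (vadd (vscal (mink u u) x) (vscal (-2 * mink x u) u))) (qvec u))).
  - transitivity (qscal (mink u u) (qmul (qvec u) (qvec x))).
    + rewrite H. generalize (qmul (qvec u) (qvec x)). clear. quatring.
    + clear. quatring.
  - rewrite H, vscal_1. reflexivity.
Qed.

Lemma refl_cross (u x y : vec3) : mink u u = 1 ->
  vcross (refl u x) (refl u y) = vscal (-1) (refl u (vcross x y)).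
Proof.
  intros H. unfold refl.
  transitivity (vadd (vscal (1 - 2 * mink u u) (vcross x y)) (vscal (2 * mink (vcross x y) u) u)).
  - clear. vring.
  - rewrite H. generalize (vcross x y). clear. vring.
Qed.

Definition qword (m : nat -> vec3) (s : list nat) : quat :=
  fold_right (fun u y => qmul (qvec (m u)) y) qone s.

Lemma qword_cons (m : nat -> vec3) (u : nat) (s : list nat) :
  qword m (u :: s) = qmul (qvec (m u)) (qword m s).
Proof. reflexivity. Qed.

Lemma qword_app (m : nat -> vec3) (s s' : list nat) :
  qword m (s ++ s') = qmul (qword m s) (qword m s').
Proof.
  induction s as [| u s IH]; [symmetry; apply qmul_one_l |].
  rewrite <- app_comm_cons, !qword_cons, IH. apply qmul_assoc.
Qed.

Section Words.

Variables (n : nat) (m : nat -> vec3).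
Hypothesis unit : forall i, (i < n)%nat -> mink (m i) (m i) = 1.

(** Makes [qword] a lift of [rword] to the Clifford algebra: words act by conjugation, twisted by
    the parity of the length. What is gained is the scalar part, which plays the role of a trace. *)
Lemma qword_move (s : list nat) (x : vec3) : (forall u, In u s -> (u < n)%nat) ->
  qmul (qword m s) (qvec x) = qscal ((-1) ^ length s) (qmul (qvec (rword m s x)) (qword m s)).
Proof.
  intros H. induction s as [| u s IH].
  - simpl. rewrite qmul_one_l, qmul_one_r. generalize (qvec x). clear. quatring.
  - rewrite qword_cons, rword_cons, <- qmul_assoc, IH by (intros; apply H; right; assumption).
    rewrite qmul_scal_r, qmul_assoc, qvec_refl by (apply unit, H; left; reflexivity).
    rewrite qmul_scal_l, qscal_qscal, <- qmul_assoc. simpl length. rewrite <- tech_pow_Rmult.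
    f_equal. ring.
Qed.

Lemma rword_cross (s : list nat) (x y : vec3) : (forall u, In u s -> (u < n)%nat) ->
  vcross (rword m s x) (rword m s y) = vscal ((-1) ^ length s) (rword m s (vcross x y)).
Proof.
  intros H. induction s as [| u s IH].
  - simpl. symmetry. apply vscal_1.
  - rewrite !rword_cons, refl_cross, IH by first [apply unit, H; left; reflexivity | intros; apply H; right; assumption].
    simpl length. rewrite <- tech_pow_Rmult. generalize ((-1) ^ length s) (rword m s (vcross x y)) (m u).
    clear. unfold refl. vring.
Qed.

Lemma qnorm_qword (s : list nat) : (forall u, In u s -> (u < n)%nat) ->
  qnorm (qword m s) = (-1) ^ length s.
Proof.
  intros H. induction s as [| u s IH].
  - unfold qword, qnorm, qone, mink. simpl. ring.
  - rewrite qword_cons, qnorm_mul, IH by (intros; apply H; right; assumption).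
    simpl length. rewrite <- tech_pow_Rmult. f_equal. unfold qnorm, qvec. simpl fst. simpl snd.
    rewrite unit by (apply H; left; reflexivity). ring.
Qed.

End Words.

Lemma word_length (a : nat -> nat) (e M : nat) : length (word a e M) = M.
Proof. induction M; simpl; congruence. Qed.

Lemma sign_pow_sq (q : nat) : (-1) ^ q * (-1) ^ q = 1.
Proof. rewrite <- Rpow_mult_distr. replace (-1 * -1) with 1 by ring. apply pow1. Qed.

(** Up to a scalar, the normal of the line supporting the segment after bounce [i]. *)
Definition axis (m : nat -> vec3) (a : nat -> nat) (q i : nat) : vec3 := snd (qword m (word a i q)).

Lemma hyp_scal (c : R) (x : vec3) : 0 < c -> hyp x -> hyp (vscal c x) -> c = 1.
Proof.
  intros Hc [H _] [K _]. revert K. mexp. rewrite H. intros K.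
  assert (E : (c - 1) * (c + 1) = 0) by lra.
  apply Rmult_integral in E. destruct E; lra.
Qed.

Section AxisTrajectory.

Variables (n : nat) (v m : nat -> vec3) (len : nat -> R).
Hypothesis Hn : (6 <= n)%nat.
Hypothesis RP : rpoly n v m len.
Variables (q : nat) (a : nat -> nat) (p t : nat -> vec3) (L : nat -> R).
Hypothesis TR : trajectory n m q a p t L.

Let side_point_of_traj := traj_side_point n v m len Hn RP q a p t L TR.

Lemma word_in (i M u : nat) : In u (word a i M) -> (u < n)%nat.
Proof.
  induction M as [| M IH]; [intros [] |]. intros [<- | H]; [apply TR | exact (IH H)].
Qed.

Lemma traj_frame (i : nat) : frame (p i) (t i) (vcross (p i) (t i)).
Proof.
  destruct (tr_tan _ _ _ _ _ _ _ TR i) as [T1 T2]. destruct (tr_hyp _ _ _ _ _ _ _ TR i) as [P1 _].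
  repeat split; auto.
  - rewrite mink_cross_cross, (mink_comm (t i) (p i)), P1, T1, T2. ring.
  - rewrite mink_comm, mink_cross. apply det3_eq13.
  - rewrite mink_comm, mink_cross. apply det3_eq23.
Qed.

Lemma traj_period_pos (i : nat) : 0 < span L i q.
Proof.
  assert (Hq : (1 <= q)%nat) by apply TR. unfold span. destruct q as [| q']; [lia |]. simpl.
  assert (0 <= rsum q' (fun i0 => L (i + i0)%nat)).
  { replace 0 with (rsum q' (fun _ => 0)) by (rewrite rsum_const; ring).
    apply rsum_le. intros; left; apply TR. }
  pose proof (tr_len _ _ _ _ _ _ _ TR (i + q')%nat). lra.
Qed.

(** The word of one period preserves the supporting line of the trajectory, so its quaternion
    commutes with the normal of that line. *)
Lemma traj_axis (i : nat) : exists b, b <> 0 /\ axis m a q i = vscal b (vcross (p i) (t i)).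
Proof.
  set (nu := vcross (p i) (t i)). set (s := word a i q).
  assert (Hs : forall u, In u s -> (u < n)%nat) by (intros u; apply word_in).
  pose proof (fun j (_ : (j < n)%nat) => rp_unit n v m len RP j) as U.
  destruct (flow n m q a p t L (rp_unit n v m len RP) TR i q) as [Fp Ft].
  rewrite (tr_per_p _ _ _ _ _ _ _ TR), (tr_per_t _ _ _ _ _ _ _ TR) in Fp, Ft. fold s in Fp, Ft.
  pose proof (sinh_positive _ (traj_period_pos i)) as SP. set (D := span L i q) in *.
  pose proof (sign_pow_sq q) as Eq.
  assert (Enu : rword m s nu = vscal ((-1) ^ q) nu).
  { pose proof (rword_cross n m U s (p i) (t i) Hs) as C.
    unfold s in C at 3. rewrite word_length in C. fold nu in C.
    apply (f_equal (vscal ((-1) ^ q))) in C. rewrite vscal_vscal, Eq, vscal_1 in C. rewrite <- C, Fp, Ft.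
    f_equal. pose proof (cosh_sq D) as ch. unfold nu.
    transitivity (vscal (cosh D * cosh D - sinh D * sinh D) (vcross (p i) (t i))).
    - generalize (p i) (t i). clear. vring.
    - rewrite ch. generalize (vcross (p i) (t i)). clear. vring. }
  pose proof (qword_move n m U s nu Hs) as M. unfold s in M at 2. rewrite word_length, Enu in M.
  assert (M' : qmul (qword m s) (qvec nu) = qmul (qvec nu) (qword m s)).
  { rewrite M. transitivity (qscal ((-1) ^ q * (-1) ^ q) (qmul (qvec nu) (qword m s))).
    - generalize (qword m s) nu ((-1) ^ q). clear. quatring.
    - rewrite Eq. generalize (qmul (qvec nu) (qword m s)). clear. quatring. }
  set (w := axis m a q i). assert (Ew : qword m s = (fst (qword m s), w)) by (unfold w, axis, s; apply surjective_pairing).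
  assert (Z : vcross w nu = vscal 0 nu).
  { apply (f_equal snd) in M'. rewrite Ew in M'. revert M'. generalize (fst (qword m s)). unfold qmul, qvec. simpl.
    generalize nu w. clear. intros nu w c H.
    apply (f_equal (fun z => vscal (/2) (vadd z (vscal (-1) (vadd (vscal 0 w) (vadd (vscal c nu) (vcross nu w))))))) in H.
    transitivity (vscal (/ 2) (vadd (vadd (vscal c nu) (vadd (vscal 0 w) (vcross w nu)))
      (vscal (-1) (vadd (vscal 0 w) (vadd (vscal c nu) (vcross nu w)))))).
    - clear. vec. apply vec_ext; field.
    - rewrite H. clear. vring. }
  pose proof (traj_frame i) as F. fold nu in F. destruct F as (P1 & T2 & N2 & T1 & _).
  assert (Eb : w = vscal (mink w nu) nu).
  { pose proof (cross_cross w nu nu) as C. rewrite Z, N2, vscal_1 in C.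
    transitivity (vadd (vadd w (vscal (- mink w nu) nu)) (vscal (mink w nu) nu)).
    - generalize (mink w nu). generalize w nu. clear. intros x y c. vring.
    - rewrite <- C. generalize (mink w nu). generalize nu. clear. intros y c. vring. }
  (* With a vanishing coefficient the quaternion would be a scalar and the word would act as a sign;
     but it moves [p i] along the line by D > 0 and so creates a component along [t i]. *)
  exists (mink w nu). split; [| exact Eb]. intros e.
  rewrite e in Eb.
  pose proof (qword_move n m U s (p i) Hs) as K. unfold s in K at 2. rewrite word_length, Fp in K.
  pose proof (qnorm_qword n m U s Hs) as Nm. unfold s in Nm at 2. rewrite word_length in Nm.
  assert (W0 : w = (0, 0, 0)) by (rewrite Eb; generalize nu; clear; vring).
  rewrite Ew, W0 in K, Nm. revert K Nm. generalize (fst (qword m s)). intros c K Nm.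
  apply qmul_scalar_move in K. apply (f_equal (mink (t i))) in K. revert K. mexp.
  rewrite T2, !(mink_comm (t i) (p i)), T1. intros K.
  assert (K' : (-1) ^ q * c * sinh D = 0) by lra.
  assert (q0 : (-1) ^ q <> 0) by (intros e'; rewrite e' in Eq; lra).
  assert (c = 0).
  { apply Rmult_integral in K'. destruct K' as [K' | K']; [| lra].
    apply Rmult_integral in K'. tauto. }
  subst c. apply q0. rewrite <- Nm. unfold qnorm, mink. simpl. ring.
Qed.

(** The line of the trajectory crosses side [a i] transversally at [p i], strictly between the ends.
    If it also contained an end, it would meet the line of the side twice, making [p i] a vertex. *)
Lemma traj_axis_signs (i : nat) :
  mink (axis m a q i) (v (a i)) * mink (axis m a q i) (v (S (a i))) < 0 /\ mink (axis m a q i) (p i) = 0.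
Proof.
  destruct (traj_axis i) as (b & Hb & E). rewrite E, !mink_scal_l.
  pose proof (traj_frame i) as F. set (nu := vcross (p i) (t i)) in *.
  assert (Z : mink nu (p i) = 0) by (rewrite mink_comm; apply F).
  split; [| rewrite Z; ring].
  destruct (side_point_of_traj i) as (x & y & Hx & Hy & Ep).
  pose proof (rp_hyp _ _ _ _ RP (a i)) as HV. pose proof (tr_hyp _ _ _ _ _ _ _ TR i) as Hp.
  assert (NZ : mink nu (v (a i)) <> 0).
  { intros e. pose proof (frame_expand _ _ _ (v (a i)) F) as X. fold nu in X.
    rewrite (mink_comm (v (a i)) nu), e in X.
    assert (B : mink (v (a i)) (t i) = 0).
    { pose proof (rp_on_start n v m len Hn RP (a i)) as O. rewrite X in O. revert O. mexp.
      rewrite (tr_on _ _ _ _ _ _ _ TR). intros O.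
      assert (O' : mink (v (a i)) (t i) * mink (m (a i)) (t i) = 0) by lra.
      apply Rmult_integral in O'. pose proof (tr_transverse _ _ _ _ _ _ _ TR i). destruct O'; lra. }
    rewrite B in X.
    assert (X' : v (a i) = vscal (- mink (v (a i)) (p i)) (p i)).
    { rewrite X at 1. generalize (- mink (v (a i)) (p i)) (p i) (t i) nu. clear. intros. vring. }
    pose proof (hyp_mink _ _ HV Hp) as G.
    assert (C1 : - mink (v (a i)) (p i) = 1).
    { apply (hyp_scal _ (p i)); [lra | exact Hp | rewrite <- X'; exact HV]. }
    destruct (side_frame n v m len Hn RP (a i) (p i) Hp (side_point_of_traj i)) as [N1 _]. apply N1.
    rewrite X', C1, vscal_1. reflexivity. }
  assert (Q : x * mink nu (v (a i)) + y * mink nu (v (S (a i))) = 0).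
  { rewrite <- Z, Ep. mexp. ring. }
  set (s0 := mink nu (v (a i))) in *. set (s1 := mink nu (v (S (a i)))) in *.
  assert (s1 = - (x / y) * s0) by (apply (Rmult_eq_reg_l y); [field_simplify; lra | lra]).
  replace (b * s0 * (b * s1)) with (- (x / y) * ((b * s0) * (b * s0))) by (rewrite H; ring).
  assert (0 < x / y) by (apply Rdiv_lt_0_compat; assumption).
  assert (b * s0 <> 0) by (apply Rmult_integral_contrapositive; auto).
  assert (0 < (b * s0) * (b * s0)) by (apply Rlt_0_sqr; assumption).
  assert (0 < x / y * ((b * s0) * (b * s0))) by (apply Rmult_lt_0_compat; assumption). lra.
Qed.

Lemma traj_letters_distinct (i : nat) : a i <> a (S i).
Proof.
  intros e. pose proof (tr_on _ _ _ _ _ _ _ TR (S i)) as O. rewrite <- e, (tr_move _ _ _ _ _ _ _ TR) in O.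
  revert O. mexp. rewrite (tr_on _ _ _ _ _ _ _ TR).
  pose proof (tr_transverse _ _ _ _ _ _ _ TR i). pose proof (sinh_positive _ (tr_len _ _ _ _ _ _ _ TR i)).
  assert (0 < sinh (L i) * mink (m (a i)) (t i)) by (apply Rmult_lt_0_compat; assumption). lra.
Qed.

End AxisTrajectory.

(** The axis is computed from normals and letters alone and vanishes at a single ray of the segment
    of side [a i]; both bounces lie on this ray, and the hyperboloid meets it once. *)
Lemma trajectory_unique (n : nat) (v m : nat -> vec3) (len : nat -> R) (Hn : (6 <= n)%nat)
  (RP : rpoly n v m len) (q : nat) (a : nat -> nat) (p t : nat -> vec3) (L : nat -> R)
  (p' t' : nat -> vec3) (L' : nat -> R) :
  trajectory n m q a p t L -> trajectory n m q a p' t' L' -> forall i, p i = p' i.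
Proof.
  intros TR TR' i.
  destruct (traj_side_point n v m len Hn RP q a p t L TR i) as (x & y & Hx & Hy & E).
  destruct (traj_side_point n v m len Hn RP q a p' t' L' TR' i) as (x' & y' & Hx' & Hy' & E').
  destruct (traj_axis_signs n v m len Hn RP q a p t L TR i) as [S Z].
  destruct (traj_axis_signs n v m len Hn RP q a p' t' L' TR' i) as [_ Z'].
  rewrite E in Z. rewrite E' in Z'. revert Z Z' S. mexp. set (w := axis m a q i).
  set (s0 := mink w (v (a i))). set (s1 := mink w (v (Datatypes.S (a i)))). intros Z Z' S.
  assert (s1 <> 0) by (intros e; rewrite e in S; lra).
  assert (Ey : y = - (x * s0) / s1) by (field_simplify_eq; lra).
  assert (Ey' : y' = - (x' * s0) / s1) by (field_simplify_eq; lra).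
  assert (C : p' i = vscal (x' / x) (p i)).
  { rewrite E, E', Ey, Ey'. generalize (v (a i)) (v (Datatypes.S (a i))). clear - H Hx. vec.
    apply vec_ext; field; lra. }
  assert (C1 : x' / x = 1).
  { apply (hyp_scal _ (p i)); [apply Rdiv_lt_0_compat; assumption | apply TR | rewrite <- C; apply TR']. }
  rewrite C, C1, vscal_1. reflexivity.
Qed.

Lemma word_period (a : nat -> nat) (q : nat) : (forall i, a (i + q)%nat = a i) ->
  forall i M, word a (i + q) M = word a i M.
Proof.
  intros H i M. induction M as [| M IH]; [reflexivity |]. simpl. rewrite IH. f_equal.
  rewrite <- (H (i + S M)%nat). f_equal. lia.
Qed.

(** By periodicity the words read from bounces i and i + 1 are conjugate by the reflection at bounce
    i + 1; on vector parts, conjugation by a unit vector is minus the reflection. *)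
Lemma axis_step (m : nat -> vec3) (a : nat -> nat) (q : nat) : (forall i, a (i + q)%nat = a i) ->
  forall i, mink (m (a (S i))) (m (a (S i))) = 1 ->
  refl (m (a (S i))) (axis m a q (S i)) = vscal (-1) (axis m a q i).
Proof.
  intros H i U. set (N := m (a (S i))) in *.
  assert (E : qmul (qvec N) (qword m (word a i q)) = qmul (qword m (word a (S i) q)) (qvec N)).
  { unfold N. rewrite <- (H (S i)) at 1. rewrite <- qword_cons.
    replace (S i + q)%nat with (i + S q)%nat by lia.
    change (a (i + S q)%nat :: word a i q) with (word a i (S q)).
    rewrite word_first, qword_app. simpl. rewrite qmul_one_r. reflexivity. }
  assert (E' : qword m (word a i q) = qmul (qvec N) (qmul (qword m (word a (S i) q)) (qvec N))).
  { rewrite <- E, qmul_assoc, qvec_sq, U, qmul_scal_l, qmul_one_l.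
    generalize (qword m (word a i q)). clear. quatring. }
  unfold axis. rewrite E'. generalize (qword m (word a (S i) q)). revert U. generalize N. clear. intros N U [c w].
  unfold refl. simpl fst. simpl snd.
  transitivity (vadd (vscal (mink N N) w) (vscal (-2 * mink w N) N)).
  { rewrite U. generalize (mink w N). clear. intros c. vring. }
  transitivity (vadd (vscal (- c * (mink N N - mink N N)) N) (vadd (vscal (mink N N) w) (vscal (-2 * mink w N) N))).
  { generalize (mink N N) (mink w N). clear. intros c' d. vring. }
  clear. destruct w as [[? ?] ?], N as [[? ?] ?].
  unfold qmul, qvec, mink, vadd, vscal, vcross; simpl. apply vec_ext; ring.
Qed.

Definition normalize (y : vec3) : vec3 := vscal (/ sqrt (- mink y y)) y.

Lemma hyp_cone (x y : vec3) (a b : R) : hyp x -> hyp y -> 0 < a -> 0 < b ->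
  let z := vadd (vscal a x) (vscal b y) in 0 < / sqrt (- mink z z) /\ hyp (normalize z).
Proof.
  intros Hx Hy Ha Hb z. pose proof (hyp_mink x y Hx Hy) as G.
  assert (Hz : 0 < - mink z z).
  { unfold z. mexp. rewrite (mink_comm y x), (proj1 Hx), (proj1 Hy).
    assert (0 < a * a) by (apply Rmult_lt_0_compat; assumption).
    assert (0 < b * b) by (apply Rmult_lt_0_compat; assumption).
    assert (0 < a * b) by (apply Rmult_lt_0_compat; assumption).
    assert (0 <= a * b * (- mink x y - 1)) by (apply Rmult_le_pos; lra). lra. }
  pose proof (sqrt_lt_R0 _ Hz) as Hs. pose proof (sqrt_sqrt _ (Rlt_le _ _ Hz)) as Hss.
  assert (Hi : 0 < / sqrt (- mink z z)) by (apply Rinv_0_lt_compat; exact Hs).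
  split; [exact Hi |]. unfold normalize. split.
  - mexp. replace (mink z z) with (- (sqrt (- mink z z) * sqrt (- mink z z))) at 3 by lra. field. lra.
  - revert Hi. generalize (/ sqrt (- mink z z)). intros c Hc.
    destruct Hx as [_ Hx], Hy as [_ Hy]. unfold z. destruct x as [[? ?] ?], y as [[? ?] ?]. simpl in *.
    apply Rmult_lt_0_compat; [exact Hc |].
    apply Rplus_lt_0_compat; apply Rmult_lt_0_compat; assumption.
Qed.

(** Within the tangent plane at p the directions orthogonal to w form a line, w being nonzero as z
    witnesses; unit length and the sign against m leave one vector. *)
Lemma unit_tangent_unique (p w z x y m : vec3) : hyp p -> mink w p = 0 -> mink w z <> 0 ->
  mink p x = 0 -> mink x x = 1 -> mink w x = 0 -> 0 < mink m x ->
  mink p y = 0 -> mink y y = 1 -> mink w y = 0 -> 0 < mink m y -> x = y.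
Proof.
  intros Hp Wp Wz Px Xx Wx Mx Py Yy Wy My.
  assert (F : frame p x (vcross p x)).
  { repeat split; auto; [apply Hp | | |].
    - rewrite mink_cross_cross, (mink_comm x p), (proj1 Hp), Px, Xx. ring.
    - rewrite mink_comm, mink_cross. apply det3_eq13.
    - rewrite mink_comm, mink_cross. apply det3_eq23. }
  assert (D : det3 p x y = 0).
  { pose proof (dual_expansion p x y w) as E. rewrite Wp, Wx, Wy in E.
    apply (f_equal (fun u => mink u z)) in E. revert E. mexp. intros E.
    assert (E' : det3 p x y * mink w z = 0) by lra.
    apply Rmult_integral in E'. tauto. }
  pose proof (frame_expand _ _ _ y F) as E.
  rewrite (mink_comm y p), Py, (mink_comm y (vcross p x)), mink_cross, D in E.
  assert (E' : y = vscal (mink y x) x).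
  { rewrite E at 1. generalize (vcross p x) (mink y x). clear. intros u c. vring. }
  rewrite E' in My, Yy. revert My Yy. mexp. rewrite Xx. set (c := mink y x) in *. intros My Yy.
  assert (0 < c) by (apply (Rmult_lt_reg_r (mink m x)); [exact Mx | lra]).
  assert (C : (c - 1) * (c + 1) = 0) by lra.
  apply Rmult_integral in C. assert (C1 : c = 1) by (destruct C; lra).
  rewrite E', C1, vscal_1. reflexivity.
Qed.

Lemma mink_dir_orth (w p x : vec3) : mink w p = 0 -> mink w x = 0 -> mink w (dir p x) = 0.
Proof. intros H K. unfold dir. mexp. rewrite H, K. ring. Qed.

Lemma mink_dir_pos (m p x : vec3) : hyp p -> hyp x -> p <> x -> mink m p = 0 -> 0 < mink m x -> 0 < mink m (dir p x).
Proof.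
  intros Hp Hx N H K. destruct (dir_tangent p x Hp Hx N) as [S _]. unfold dir. mexp. rewrite H.
  apply Rmult_lt_0_compat; [apply Rinv_0_lt_compat; exact S | lra].
Qed.

(** Bounce i is placed where the axis line of i crosses side [a i]. Consecutive axis lines are
    mirror images in the side between them, so each line contains two consecutive bounces and the
    reflection law holds. *)
Lemma trajectory_of_axis (n : nat) (v m : nat -> vec3) (len : nat -> R) (Hn : (6 <= n)%nat)
  (RP : rpoly n v m len) (q : nat) (a : nat -> nat) :
  (1 <= q)%nat -> (forall i, (a i < n)%nat) -> (forall i, a (i + q)%nat = a i) ->
  (forall i, a i <> a (S i)) ->
  (forall i, mink (axis m a q i) (v (a i)) * mink (axis m a q i) (v (S (a i))) < 0) ->
  exists p t L, trajectory n m q a p t L.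
Proof.
  intros Hq La Pa Da Sg. set (w := axis m a q).
  (* As [w i] has opposite signs at the two ends, the absolute values taken crosswise are positive
     weights for which it vanishes. *)
  set (y := fun i => vadd (vscal (Rabs (mink (w i) (v (S (a i))))) (v (a i)))
                          (vscal (Rabs (mink (w i) (v (a i)))) (v (S (a i))))).
  set (p := fun i => normalize (y i)). set (c := fun i => / sqrt (- mink (y i) (y i))).
  assert (Pw : forall i, w (i + q)%nat = w i) by (intros i; unfold w, axis; rewrite word_period; auto).
  assert (NZ : forall i, mink (w i) (v (a i)) <> 0 /\ mink (w i) (v (S (a i))) <> 0).
  { intros i. specialize (Sg i). fold (w i) in Sg.
    split; intros e; rewrite e in Sg; rewrite ?Rmult_0_l, ?Rmult_0_r in Sg; lra. }
  assert (Hy : forall i, 0 < c i /\ hyp (p i)).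
  { intros i. destruct (NZ i). apply hyp_cone; try apply (rp_hyp _ _ _ _ RP); apply Rabs_pos_lt; assumption. }
  assert (Hp : forall i, hyp (p i)) by (intros; apply Hy).
  assert (Hs : forall i, side_point v (a i) (p i)).
  { intros i. destruct (NZ i). destruct (Hy i) as [C _].
    exists (c i * Rabs (mink (w i) (v (S (a i))))), (c i * Rabs (mink (w i) (v (a i)))).
    split; [apply Rmult_lt_0_compat; [exact C | apply Rabs_pos_lt; assumption] |].
    split; [apply Rmult_lt_0_compat; [exact C | apply Rabs_pos_lt; assumption] |].
    unfold p, normalize. fold (c i). unfold y.
    generalize (c i) (Rabs (mink (w i) (v (a i)))) (Rabs (mink (w i) (v (S (a i))))).
    generalize (v (a i)) (v (S (a i))). clear. vring. }
  assert (Hw : forall i, mink (w i) (p i) = 0).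
  { intros i. unfold p, normalize. mexp. fold (c i). unfold y. mexp.
    specialize (Sg i). fold (w i) in Sg. destruct (NZ i) as [N0 N1].
    set (s0 := mink (w i) (v (a i))) in *. set (s1 := mink (w i) (v (S (a i)))) in *.
    assert (E : Rabs s1 * s0 + Rabs s0 * s1 = 0).
    { destruct (Rlt_or_le 0 s0) as [h | h].
      - assert (s1 < 0). { destruct (Rlt_or_le s1 0) as [k | k]; [exact k |].
          assert (0 <= s0 * s1) by (apply Rmult_le_pos; lra). lra. }
        rewrite (Rabs_pos_eq s0), (Rabs_left s1) by lra. ring.
      - assert (0 < s1). { destruct (Rlt_or_le 0 s1) as [k | k]; [exact k |].
          assert (0 <= (- s0) * (- s1)) by (apply Rmult_le_pos; lra). lra. }
        rewrite (Rabs_left s0), (Rabs_pos_eq s1) by lra. ring. }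
    rewrite E. ring. }
  assert (On : forall i, mink (m (a i)) (p i) = 0) by (intros; apply (side_point_on n v m len Hn RP), Hs).
  assert (In' : forall i j, (j < n)%nat -> j <> a i -> 0 < mink (m j) (p i)).
  { intros i j Hj ne. apply (side_point_in n v m len Hn RP (a i)); auto. }
  assert (St : forall i, refl (m (a (S i))) (w (S i)) = vscal (-1) (w i)).
  { intros i. apply axis_step; [exact Pa | apply (rp_unit n v m len RP)]. }
  (* [p (S i)] is fixed by the reflection that exchanges the axis lines of i and i + 1, so it lies
     on both. *)
  assert (Hw' : forall i, mink (w i) (p (S i)) = 0).
  { intros i. pose proof (mink_refl (m (a (S i))) (w (S i)) (p (S i)) (rp_unit n v m len RP _)) as E.
    rewrite Hw, (refl_fix _ (p (S i))), St, mink_scal_l in E by (rewrite mink_comm; apply On). lra. }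
  assert (Np : forall i, p i <> p (S i)).
  { intros i e. pose proof (In' i (a (S i)) (La _) ltac:(auto)) as K. rewrite e, On in K. lra. }
  assert (Np' : forall i, p (S i) <> p i) by (intros i e; apply (Np i); auto).
  assert (Pp : forall i, p (i + q)%nat = p i) by (intros i; unfold p, y; rewrite Pw, Pa; reflexivity).
  assert (PpS : forall i, p (S (i + q)) = p (S i)) by (intros i; apply (Pp (S i))).
  exists p, (fun i => dir (p i) (p (S i))), (fun i => hdv (p i) (p (S i))).
  constructor; auto.
  - intros i. rewrite Pp, PpS. reflexivity.
  - intros i. rewrite Pp, PpS. reflexivity.
  - intros i. destruct (dir_tangent _ _ (Hp i) (Hp (S i)) (Np i)) as (_ & _ & h1 & h2 & _). auto.
  - intros i. apply hd_pos; auto.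
  - intros i. apply (dir_tangent _ _ (Hp i) (Hp (S i)) (Np i)).
  - intros i. set (M := m (a (S i))).
    assert (U : mink M M = 1) by apply (rp_unit n v m len RP).
    set (d := vadd (vscal (sinh (hdv (p i) (p (S i)))) (p i)) (vscal (cosh (hdv (p i) (p (S i)))) (dir (p i) (p (S i))))).
    assert (Ed : d = vscal (-1) (dir (p (S i)) (p i))).
    { rewrite (dir_back _ _ (Hp i) (Hp (S i)) (Np i)). fold d. rewrite vscal_vscal.
      replace (-1 * -1) with 1 by ring. rewrite vscal_1. reflexivity. }
    destruct (dir_tangent _ _ (Hp (S i)) (Hp (S (S i))) (Np (S i))) as (_ & _ & A1 & A2 & _).
    destruct (dir_tangent _ _ (Hp (S i)) (Hp i) (Np' i)) as (_ & _ & B1 & B2 & _).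
    apply (unit_tangent_unique (p (S i)) (w (S i)) (v (a (S i))) _ _ M); auto.
    + apply NZ.
    + apply mink_dir_orth; auto.
    + apply mink_dir_pos; auto; [apply On | apply In'; auto].
    + rewrite <- (refl_fix M (p (S i))) at 1 by (rewrite mink_comm; apply On).
      rewrite mink_refl, Ed, mink_scal_r, B1 by exact U. ring.
    + rewrite mink_refl, Ed by exact U. mexp. rewrite B2. ring.
    + rewrite <- (refl_involutive M (w (S i)) U). rewrite mink_refl by exact U. unfold M. rewrite St, Ed.
      mexp. rewrite (mink_dir_orth (w i) (p (S i)) (p i)) by auto. ring.
    + rewrite mink_refl_self, Ed by exact U. mexp.
      assert (0 < mink M (dir (p (S i)) (p i))); [| lra].
      apply mink_dir_pos; auto; [apply On | apply In'; auto].
  - intros i. apply mink_dir_pos; auto.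
Qed.

(** * Trace coordinates of vertices *)

Lemma vec_zero_of_cross (z a b : vec3) : mink a a = 1 -> mink b b = 1 -> mink a b = 0 ->
  vcross z a = (0, 0, 0) -> vcross z b = (0, 0, 0) -> z = (0, 0, 0).
Proof.
  intros A B AB Za Zb.
  assert (X : forall y, mink y y = 1 -> vcross z y = (0, 0, 0) -> z = vscal (mink z y) y).
  { intros y Y Zy. pose proof (cross_cross z y y) as E. rewrite Zy, Y, vscal_1 in E.
    transitivity (vadd (vadd z (vscal (- mink z y) y)) (vscal (mink z y) y)).
    - generalize (mink z y). clear. vring.
    - rewrite <- E. generalize (mink z y). clear. vring. }
  pose proof (X a A Za) as Ea. pose proof (X b B Zb) as Eb.
  assert (C : mink z a = 0) by (rewrite Eb, mink_scal_l, (mink_comm b a), AB; ring).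
  rewrite Ea, C. clear. vring.
Qed.

Lemma rword_fixed_of_scalar (n : nat) (m : nat -> vec3) (s : list nat) (c : R) (x : vec3) :
  (forall i, (i < n)%nat -> mink (m i) (m i) = 1) -> (forall u, In u s -> (u < n)%nat) ->
  (-1) ^ length s = 1 -> qword m s = (c, (0, 0, 0)) -> rword m s x = x.
Proof.
  intros U Hs E Q. pose proof (qword_move n m U s x Hs) as K. pose proof (qnorm_qword n m U s Hs) as N.
  rewrite Q, E in K, N. apply qmul_scalar_move in K.
  assert (C : c <> 0) by (intros ->; revert N; unfold qnorm, mink; simpl; lra).
  symmetry. apply (vscal_cancel c); [exact C | rewrite K; f_equal; ring].
Qed.

Lemma vector_of_trivial_word (n : nat) (m : nat -> vec3) (s : list nat) :
  (forall i, (i < n)%nat -> mink (m i) (m i) = 1) -> (forall u, In u s -> (u < n)%nat) ->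
  (-1) ^ length s = 1 -> (2 <= n)%nat -> mink (m 0%nat) (m 1%nat) = 0 ->
  (forall x, rword m s x = x) -> snd (qword m s) = (0, 0, 0).
Proof.
  intros U Hs E Hn O F.
  assert (Z : forall x, vcross (snd (qword m s)) x = (0, 0, 0)).
  { intros x. pose proof (qword_move n m U s x Hs) as K. rewrite E, F in K.
    apply (f_equal snd) in K. revert K. generalize (qword m s). clear. intros [c w] K.
    unfold qmul, qvec, qscal in K. simpl in *.
    transitivity (vscal (/ 2) (vadd (vadd (vscal c x) (vadd (vscal 0 w) (vcross w x)))
      (vscal (-1) (vscal 1 (vadd (vscal 0 w) (vadd (vscal c x) (vcross x w))))))).
    - clear. vec. apply vec_ext; field.
    - rewrite K. clear. vring. }
  apply (vec_zero_of_cross _ (m 0%nat) (m 1%nat)); auto; apply U; lia.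
Qed.

Lemma neg_one_pow_double (s : list nat) : (-1) ^ length (s ++ s) = 1.
Proof. rewrite length_app, pow_add. apply sign_pow_sq. Qed.

(** Two orthogonal normals multiply to their cross product, for adjacent sides the common vertex up
    to sign. The scalar part of the longer word is thus the pairing of the axis with that vertex. *)
Lemma qword_pair (m : nat -> vec3) (s : list nat) (u u' : nat) : mink (m u) (m u') = 0 ->
  qword m (s ++ [u; u']) = qmul (qword m s) (qvec (vcross (m u) (m u'))).
Proof.
  intros O. rewrite qword_app. f_equal. simpl. rewrite qmul_one_r. unfold qmul, qvec. simpl. rewrite O.
  f_equal; [ring |]. generalize (m u) (m u'). clear. vring.
Qed.

Section ScalarPart.

Variables (n : nat) (v m : nat -> vec3) (len : nat -> R).
Hypothesis Hn : (6 <= n)%nat.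
Hypothesis RP : rpoly n v m len.
Variables (q : nat) (a : nat -> nat) (p t : nat -> vec3) (L : nat -> R).
Hypothesis TR : trajectory n m q a p t L.

Lemma rpoly_vec_ext (x y : vec3) : (forall j, (j < n)%nat -> mink (m j) x = mink (m j) y) -> x = y.
Proof.
  intros H.
  assert (D : det3 (m 0%nat) (m 1%nat) (m 2%nat) <> 0).
  { rewrite (rp_normal_next n v m len RP 0).
    pose proof (rp_det _ _ _ _ RP 0) as D1.
    pose proof (sinh_positive _ (rp_len _ _ _ _ RP 1)) as s.
    replace (det3 _ _ _) with (- sinh (len 1%nat) * det3 (v 1%nat) (m 0%nat) (m 1%nat)); [rewrite D1; lra |].
    generalize (sinh (len 1%nat)) (cosh (len 1%nat)) (v 1%nat) (m 0%nat) (m 1%nat). clear. vring. }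
  apply (vec_eq_of_mink _ _ _ _ _ D); rewrite 2!(mink_comm _ (m _)); apply H; lia.
Qed.

(** Faithfulness transports triviality of a word from any Gram family to the polygon itself, where
    it is excluded because the trajectory avoids the vertices. *)
Lemma scalar_part_nonzero (M : nat -> vec3) (b : vec3) (i u u' : nat) :
  gram_family n M -> (forall j, (j < n)%nat -> 0 < mink (M j) b) ->
  (u < n)%nat -> (u' < n)%nat -> mink (m u) (m u') = 0 -> 
  mink (axis m a q i) (vcross (m u) (m u')) <> 0 ->
  fst (qword M (word a i q ++ [u; u'])) <> 0.
Proof.
  intros GM Hb Hu Hu' O F0 FM.
  set (z := word a i q ++ [u; u']) in *.
  pose proof (fun j (_ : (j < n)%nat) => rp_unit n v m len RP j) as U.
  assert (Hz : forall x, In x (z ++ z) -> (x < n)%nat).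
  { assert (Hz : forall x, In x z -> (x < n)%nat).
    { intros x Hx. apply in_app_or in Hx. destruct Hx as [Hx | [<- | [<- | []]]]; auto.
      apply (word_in n m q a p t L TR i q x Hx). }
    intros x Hx. apply in_app_or in Hx. destruct Hx; auto. }
  (* A quaternion without scalar part squares to a scalar but need not be one, so it is the doubled
     word that acts trivially. *)
  assert (QM : exists c, qword M (z ++ z) = (c, (0, 0, 0))).
  { rewrite qword_app. revert FM. generalize (qword M z). clear. intros [c w]. simpl. intros ->.
    exists (mink w w). unfold qmul. simpl. f_equal; [ring |]. revert w. vring. }
  destruct QM as [c QM].
  pose proof (rword_fixed_of_scalar n M (z ++ z) c b (gf_unit _ _ GM) Hz (neg_one_pow_double z) QM) as FB.
  pose proof (act_coords n M GM (z ++ z) b Hz) as AC. rewrite FB in AC.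
  assert (Pos : forall j, 0 < coords n M b j).
  { intros j. unfold coords. destruct (Nat.ltb_spec j n); [auto | lra]. }
  pose proof (act_faithful _ (adjn_sym n) _ _ _ Pos AC (dparam n (side_dist m))) as Triv.
  assert (RT : forall x, rword m (z ++ z) x = x).
  { intros x. apply rpoly_vec_ext. intros j Hj.
    pose proof (Triv (coords n m x)) as T.
    rewrite (act_coords n m (gram_family_of_rpoly n v m len Hn RP)) in T by exact Hz.
    apply (f_equal (fun f => f j)) in T. unfold coords in T. destruct (Nat.ltb_spec j n); [exact T | lia]. }
  pose proof (vector_of_trivial_word n m (z ++ z) U Hz (neg_one_pow_double z) ltac:(lia)
    (rp_orth n v m len RP 0) RT) as VZ.
  rewrite qword_app in VZ.
  assert (Ez : qword m z = qmul (qword m (word a i q)) (qvec (vcross (m u) (m u')))) by (apply qword_pair, O).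
  set (X := vcross (m u) (m u')) in *. set (w := axis m a q i) in *.
  assert (Ew : qword m (word a i q) = (fst (qword m (word a i q)), w)) by apply surjective_pairing.
  set (e := fst (qword m (word a i q))) in *.
  (* The vector part of the square is 2 mink w X times this vector. Pairing with X gives e = 0, so w
     is a multiple of the timelike X, whereas the axis of a trajectory is spacelike. *)
  assert (Z0 : vadd (vscal e X) (vcross w X) = (0, 0, 0)).
  { apply (vscal_cancel (2 * mink w X)); [lra |].
    transitivity (snd (qmul (qword m z) (qword m z))).
    - rewrite Ez, Ew. unfold qmul, qvec. simpl. generalize w X e. clear. vec. apply vec_ext; ring.
    - rewrite VZ. clear. vring. }
  assert (XX : mink X X = -1).
  { unfold X. rewrite mink_cross_cross, (mink_comm (m u') (m u)), O, !U by assumption. ring. }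
  assert (e0 : e = 0).
  { apply (f_equal (fun y => mink y X)) in Z0. revert Z0. mexp. rewrite XX, mink_cross, det3_eq23.
    replace (mink (0, 0, 0) X) with 0 by (generalize X; clear; vring). lra. }
  rewrite e0 in Z0.
  assert (W : vcross w X = (0, 0, 0)) by (rewrite <- Z0; generalize w X; clear; vring).
  pose proof (cross_cross w X X) as CC. rewrite W, XX in CC.
  assert (Ww : w = vscal (- mink w X) X).
  { transitivity (vadd (vscal (-1) (vadd (vscal (-1) w) (vscal (- mink w X) X))) (vscal (- mink w X) X)).
    - generalize (mink w X) w X. clear. intros d. vring.
    - rewrite <- CC. generalize (mink w X) X. clear. intros d. vring. }
  destruct (traj_axis n v m len Hn RP q a p t L TR i) as (be & Hbe & Eb). fold w in Eb.
  pose proof (traj_frame n m q a p t L TR i) as Fr. set (nu := vcross (p i) (t i)) in *.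
  assert (P1 : mink w w = be * be) by (rewrite Eb; mexp; rewrite (proj1 (proj2 (proj2 Fr))); ring).
  assert (P2 : mink w w = - (mink w X * mink w X)).
  { rewrite Ww at 1 2. mexp. rewrite XX. ring. }
  assert (0 < be * be) by (apply Rlt_0_sqr; exact Hbe).
  assert (0 <= mink w X * mink w X) by apply Rle_0_sqr. lra.
Qed.

End ScalarPart.

Definition framed (o e x : vec3) : vec3 := (- mink x o, mink x e, mink x (vcross o e)).

Section Framed.

Variables (o e : vec3).
Hypothesis Ho : mink o o = -1.
Hypothesis He : mink e e = 1.
Hypothesis Hoe : mink o e = 0.

Lemma framed_frame : frame o e (vcross o e).
Proof.
  repeat split; auto.
  - rewrite mink_cross_cross, (mink_comm e o), Ho, He, Hoe. ring.
  - rewrite mink_comm, mink_cross. apply det3_eq13.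
  - rewrite mink_comm, mink_cross. apply det3_eq23.
Qed.

Lemma mink_framed (x y : vec3) : mink (framed o e x) (framed o e y) = mink x y.
Proof. rewrite (frame_mink _ _ _ x y framed_frame). unfold framed, mink at 1. ring. Qed.

(** Completing o, e by [vcross o e] fixes the orientation, so the change of frame respects cross
    products as well as [mink] and leaves scalar parts of words unchanged. *)
Lemma framed_cross (x y : vec3) : framed o e (vcross x y) = vcross (framed o e x) (framed o e y).
Proof.
  set (f := vcross o e).
  assert (E0 : vscal (-1) o = vcross e f).
  { transitivity (vscal (-1) (vcross f e)); [| generalize e f; clear; vring].
    unfold f. rewrite cross_cross, He, Hoe. generalize o e. clear. vring. }
  assert (E1 : e = vcross f o).
  { unfold f. rewrite cross_cross, (mink_comm e o), Hoe, Ho. generalize o e. clear. vring. }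
  unfold framed. fold f. 
  assert (A : - mink (vcross x y) o = mink x f * mink y e - mink x e * mink y f).
  { replace (- mink (vcross x y) o) with (mink (vcross x y) (vscal (-1) o)) by (mexp; ring).
    rewrite E0, mink_cross_cross. ring. }
  assert (B : mink (vcross x y) e = mink x o * mink y f - mink x f * mink y o).
  { rewrite E1 at 1. rewrite mink_cross_cross. ring. }
  assert (C : mink (vcross x y) f = mink x e * mink y o - mink x o * mink y e).
  { unfold f. rewrite mink_cross_cross. ring. }
  rewrite A, B, C. unfold vcross. apply vec_ext; ring.
Qed.

Lemma qword_framed (m : nat -> vec3) (s : list nat) :
  qword (fun j => framed o e (m j)) s = (fst (qword m s), framed o e (snd (qword m s))).
Proof.
  induction s as [| u s IH].
  - unfold qword, qone. simpl. f_equal. unfold framed, mink. 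
    destruct o as [[? ?] ?], e as [[? ?] ?]. simpl. apply vec_ext; ring.
  - rewrite !qword_cons, IH. generalize (qword m s). intros [c w]. unfold qmul, qvec. cbn [fst snd].
    rewrite mink_framed. f_equal. rewrite <- framed_cross.
    set (x := m u). set (y := vcross x w). unfold framed. mexp. unfold vadd, vscal. apply vec_ext; ring.
Qed.

End Framed.

(** * Polar coordinates of a right-angled polygon *)

(** Normals of the lines at distance [artanh (T j)] from the centre whose consecutive members are
    orthogonal: the directions of the feet of their perpendiculars differ by [acos (T j * T (S j))]. *)
Definition angle (T : nat -> R) (j : nat) : R := rsum j (fun i => acos (T i * T (S i))).
Definition polar (T : nat -> R) (j : nat) : vec3 :=
  vscal (/ sqrt (1 - T j * T j)) (- T j, cos (angle T j), sin (angle T j)).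

Lemma rsum_nonneg (n : nat) (f : nat -> R) : (forall i, (i < n)%nat -> 0 <= f i) -> 0 <= rsum n f.
Proof.
  intros H. replace 0 with (rsum n (fun _ => 0)) by (rewrite rsum_const; ring). apply rsum_le, H.
Qed.

Lemma rsum_term (n j : nat) (f : nat -> R) : (forall i, (i < n)%nat -> 0 <= f i) -> (j < n)%nat -> f j <= rsum n f.
Proof.
  intros H Hj. replace n with (S j + (n - S j))%nat by lia. rewrite rsum_add. simpl.
  assert (0 <= rsum j f) by (apply rsum_nonneg; intros; apply H; lia).
  assert (0 <= rsum (n - S j) (fun i => f (S (j + i)))) by (apply rsum_nonneg; intros; apply H; lia). lra.
Qed.

Lemma acos_decr (x y : R) : -1 <= x -> x < y -> y <= 1 -> acos y < acos x.
Proof.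
  intros Hx Hxy Hy. destruct (Rlt_or_le (acos y) (acos x)) as [h | h]; [exact h | exfalso].
  pose proof (acos_bound x). pose proof (acos_bound y).
  assert (cos (acos y) <= cos (acos x)) by (apply cos_decr_1; lra).
  rewrite !cos_acos in * by lra. lra.
Qed.

Section Polar.

Variables (n : nat) (T : nat -> R).
Hypothesis Hn : (6 <= n)%nat.
Hypothesis HT : forall j, 0 < T j < 1.

Let phi (i : nat) := acos (T i * T (S i)).

Lemma polar_prod (i j : nat) : 0 < T i * T j < 1.
Proof.
  pose proof (HT i). pose proof (HT j). split; [apply Rmult_lt_0_compat; lra |].
  assert (0 < T i * (1 - T j)) by (apply Rmult_lt_0_compat; lra). lra.
Qed.

Lemma polar_angle_bound (i : nat) : 0 < phi i < PI / 2.
Proof.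
  pose proof (polar_prod i (S i)) as H. split; [apply acos_bound_lt; lra |].
  rewrite <- acos_0. apply acos_decr; lra.
Qed.

(** [acos (T i)] is the angle of parallelism of line i, half the angle under which the line is seen
    from the centre. *)
Lemma polar_angle_acos (i j : nat) : acos (T i) <= acos (T i * T j).
Proof.
  left. pose proof (HT i). pose proof (HT j). pose proof (polar_prod i j).
  apply acos_decr; [lra | | lra]. assert (0 < T i * (1 - T j)) by (apply Rmult_lt_0_compat; lra). lra.
Qed.

Lemma angle_S (j : nat) : angle T (S j) = angle T j + phi j.
Proof. reflexivity. Qed.

Lemma polar_root (j : nat) : 0 < sqrt (1 - T j * T j) /\ sqrt (1 - T j * T j) * sqrt (1 - T j * T j) = 1 - T j * T j.
Proof.
  pose proof (polar_prod j j). split; [apply sqrt_lt_R0; lra | apply sqrt_sqrt; lra].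
Qed.

Lemma mink_polar (i j : nat) : mink (polar T i) (polar T j) =
  / sqrt (1 - T i * T i) * / sqrt (1 - T j * T j) * (cos (angle T j - angle T i) - T i * T j).
Proof. unfold polar. mexp. rewrite cos_minus. unfold mink. ring. Qed.

Lemma polar_unit (j : nat) : mink (polar T j) (polar T j) = 1.
Proof.
  rewrite mink_polar. replace (angle T j - angle T j) with 0 by ring. rewrite cos_0.
  destruct (polar_root j) as [H E]. set (s := sqrt (1 - T j * T j)) in *. rewrite <- E. field. lra.
Qed.

Lemma polar_orth (j : nat) : mink (polar T j) (polar T (S j)) = 0.
Proof.
  rewrite mink_polar, angle_S. replace (angle T j + phi j - angle T j) with (phi j) by ring.
  unfold phi. pose proof (polar_prod j (S j)). rewrite cos_acos by lra. ring.
Qed.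

Lemma polar_interior (j : nat) : 0 < mink (polar T j) (1, 0, 0).
Proof.
  unfold polar. mexp. destruct (polar_root j) as [H _]. unfold mink. pose proof (HT j).
  apply Rmult_lt_0_compat; [apply Rinv_0_lt_compat; exact H | lra].
Qed.

Hypothesis per : forall j, T (j + n)%nat = T j.
Hypothesis closed : angle T n = 2 * PI.

Lemma angle_add (i l : nat) : angle T (i + l) = angle T i + rsum l (fun j => phi (i + j)%nat).
Proof. unfold angle. apply rsum_add. Qed.

(** Two lines do not cross when the angle between their feet is at least the sum of their angles of
    parallelism, in both directions around the centre. For non-neighbouring lines each direction
    contains two different steps, one next to either line, and these already have the required
    sizes. *)
Lemma polar_gram : gram_family n (polar T).
Proof.
  constructor.
  - intros i _. apply polar_unit.
  - intros i _. apply polar_orth.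
  - rewrite mink_polar. replace (angle T 0) with 0 by reflexivity.
    assert (E : angle T (n - 1) = 2 * PI - phi (n - 1)%nat).
    { rewrite <- closed. replace n with (S (n - 1)) at 2 by lia. rewrite angle_S. ring. }
    rewrite E. replace (2 * PI - phi (n - 1)%nat - 0) with (- phi (n - 1)%nat + 2 * INR 1 * PI) by (simpl; ring).
    rewrite cos_period, cos_neg. unfold phi. replace (S (n - 1)) with n by lia.
    pose proof (polar_prod (n - 1) n). rewrite cos_acos by lra.
    rewrite (per 0 : T n = T 0%nat). ring.
  - intros i l Hl Hil. set (j := (i + l)%nat) in *.
    set (A := acos (T i)). set (B := acos (T j)). set (th := angle T j - angle T i).
    assert (PH : forall k, 0 <= phi k) by (intros k; left; apply polar_angle_bound).
    assert (L1 : A + B <= th).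
    { unfold th, j. rewrite angle_add. replace l with (S (l - 2) + 1)%nat by lia. rewrite rsum_add.
      assert (phi i <= rsum (S (l - 2)) (fun k => phi (i + k)%nat)).
      { pose proof (rsum_term (S (l - 2)) 0 (fun k => phi (i + k)%nat) (fun k _ => PH (i + k)%nat) ltac:(lia)) as X.
        cbv beta in X. rewrite Nat.add_0_r in X. exact X. }
      assert (A <= phi i) by apply polar_angle_acos.
      assert (B <= rsum 1 (fun k => phi (i + (S (l - 2) + k))%nat)).
      { simpl. rewrite Rplus_0_l. unfold phi. replace (S (i + S (l - 2 + 0))) with j by (unfold j; lia).
        rewrite Rmult_comm. apply polar_angle_acos. }
      lra. }
    assert (L2 : th <= 2 * PI - (A + B)).
    { rewrite <- closed. replace n with (S j + (n - S j))%nat by lia. rewrite angle_add, angle_S. unfold th.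
      assert (B <= phi j) by apply polar_angle_acos.
      assert (0 <= rsum (n - S j) (fun k => phi (S j + k)%nat)) by (apply rsum_nonneg; auto).
      enough (A <= angle T i + rsum (n - S j) (fun k => phi (S j + k)%nat)) by lra.
      destruct i as [| i].
      - assert (A <= phi (n - 1)%nat).
        { unfold phi, A. replace (S (n - 1)) with n by lia. rewrite Rmult_comm, (per 0 : T n = T 0%nat).
          apply polar_angle_acos. }
        pose proof (rsum_term (n - S j) (n - 1 - S j) (fun k => phi (S j + k)%nat) (fun k _ => PH (S j + k)%nat) ltac:(lia)) as X.
        cbv beta in X. replace (S j + (n - 1 - S j))%nat with (n - 1)%nat in X by lia.
        change (angle T 0) with 0. lra.
      - rewrite angle_S. assert (0 <= angle T i) by (apply rsum_nonneg; intros; apply PH).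
        assert (A <= phi i) by (unfold phi, A; rewrite Rmult_comm; apply polar_angle_acos). lra. }
    assert (AB : forall k, 0 <= acos (T k) < PI / 2 /\ cos (acos (T k)) = T k /\ sin (acos (T k)) = sqrt (1 - T k * T k)).
    { intros k. pose proof (HT k). pose proof (acos_bound (T k)). split; [split; [lra |] |].
      - rewrite <- acos_0. apply acos_decr; lra.
      - split; [apply cos_acos; lra | apply sin_acos; lra]. }
    destruct (AB i) as (Ai & cA & sA). destruct (AB j) as (Bj & cB & sB). fold A in Ai, cA, sA. fold B in Bj, cB, sB.
    assert (C : cos th <= cos (A + B)).
    { destruct (Rle_or_lt th PI) as [h | h]; [apply cos_decr_1; lra |].
      replace (cos th) with (cos (2 * PI - th)).
      - apply cos_decr_1; lra.
      - replace (2 * PI - th) with (- th + 2 * INR 1 * PI) by (simpl; ring). rewrite cos_period. apply cos_neg. }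
    rewrite cos_plus, cA, cB, sA, sB in C.
    destruct (polar_root i) as [ri _]. destruct (polar_root j) as [rj _].
    rewrite mink_polar. fold th.
    set (x := sqrt (1 - T i * T i)) in *. set (y := sqrt (1 - T j * T j)) in *.
    assert (xy : 0 < x * y) by (apply Rmult_lt_0_compat; assumption).
    apply (Rmult_le_reg_l (x * y)); [exact xy |].
    replace (x * y * - (/ x * / y * (cos th - T i * T j))) with (T i * T j - cos th) by (field; lra). lra.
Qed.

End Polar.

(** Polar coordinates about an interior point, [T j] being tanh of the distance to side j. Closing
    up of the normals only gives an angle sum with cosine 1; that it is a single turn needs a
    separate argument. *)
Lemma rpoly_polar (n : nat) (v m : nat -> vec3) (len : nat -> R) : (6 <= n)%nat -> rpoly n v m len ->
  exists o e T, mink o o = -1 /\ mink e e = 1 /\ mink o e = 0 /\ (forall j, 0 < T j < 1) /\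
    (forall j, T (j + n)%nat = T j) /\ angle T n = 2 * PI /\ forall j, framed o e (m j) = polar T j.
Proof.
  intros Hn RP. destruct (interior_point n v m len Hn RP) as (o & Ho & Hin).
  set (h := fun j => mink (m j) o).
  assert (Hper : forall j, h (j + n)%nat = h j) by (intros; unfold h; rewrite (rp_per_m _ _ _ _ RP); reflexivity).
  assert (Hh : forall j, 0 < h j).
  { intros j. rewrite (periodic_mod n h Hper). apply Hin, Nat.mod_upper_bound. lia. }
  set (r := fun j => sqrt (1 + h j * h j)).
  assert (Hr : forall j, 0 < r j /\ r j * r j = 1 + h j * h j).
  { intros j. assert (0 < h j * h j) by (apply Rmult_lt_0_compat; apply Hh).
    split; [apply sqrt_lt_R0; lra | apply sqrt_sqrt; lra]. }
  set (T := fun j => h j / r j).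
  assert (HT : forall j, 0 < T j < 1).
  { intros j. destruct (Hr j) as [r0 r2]. specialize (Hh j). unfold T. split; [apply Rdiv_lt_0_compat; lra |].
    apply (Rmult_lt_reg_r (r j)); [exact r0 |]. replace (h j / r j * r j) with (h j) by (field; lra).
    rewrite Rmult_1_l. apply Rsqr_incrst_0; unfold Rsqr; lra. }
  assert (Hs : forall j, / sqrt (1 - T j * T j) = r j).
  { intros j. destruct (Hr j) as [r0 r2]. replace (1 - T j * T j) with (Rsqr (/ r j)).
    - rewrite sqrt_Rsqr by (left; apply Rinv_0_lt_compat; exact r0). apply Rinv_inv.
    - unfold Rsqr, T. field_simplify_eq; [lra | lra]. }
  assert (HT' : forall j, r j * T j = h j).
  { intros j. unfold T. destruct (Hr j). field. lra. }
  set (e := vscal (/ r 0%nat) (vadd (m 0%nat) (vscal (h 0%nat) o))).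
  destruct (Hr 0%nat) as [r0 r2].
  assert (He : mink e e = 1).
  { unfold e. mexp. rewrite (rp_unit n v m len RP), (mink_comm o (m 0%nat)), (proj1 Ho). fold (h 0%nat).
    field_simplify_eq; lra. }
  assert (Hoe : mink o e = 0).
  { unfold e. mexp. rewrite (mink_comm o (m 0%nat)), (proj1 Ho). fold (h 0%nat). ring. }
  exists o, e, T. split; [apply Ho |]. split; [exact He |]. split; [exact Hoe |]. split; [exact HT |].
  assert (HTper : forall j, T (j + n)%nat = T j) by (intros; unfold T, r; rewrite Hper; reflexivity).
  split; [exact HTper |].
  set (Phi := framed o e).
  assert (MP : forall x y, mink (Phi x) (Phi y) = mink x y) by (apply mink_framed; [apply Ho | exact He | exact Hoe]).
  assert (All : forall j, Phi (m j) = polar T j).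
  { induction j as [| j IH].
    - unfold polar. rewrite Hs. unfold angle. simpl rsum. rewrite cos_0, sin_0.
      assert (E : m 0%nat = vadd (vscal (- h 0%nat) o) (vscal (r 0%nat) e)).
      { unfold e. rewrite vscal_vscal, Rinv_r, vscal_1 by lra. generalize (h 0%nat) (m 0%nat) o. clear. vring. }
      unfold Phi, framed. rewrite E at 1 2 3. mexp.
      rewrite (mink_comm e o), Hoe, He, (proj1 Ho), !(mink_comm _ (vcross o e)), !mink_cross, det3_eq13, det3_eq23.
      unfold vscal. pose proof (HT' 0%nat). apply vec_ext; [lra | ring | ring].
    - set (x := Phi (m (S j))). destruct (Hr j) as [rj rj2]. destruct (Hr (S j)) as [rs rs2].
      assert (Ex : exists x1 x2, x = (- h (S j), x1, x2)) by (unfold x, Phi, framed; eauto).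
      destruct Ex as (x1 & x2 & Ex).
      assert (Ux : x1 * x1 + x2 * x2 = r (S j) * r (S j)).
      { pose proof (MP (m (S j)) (m (S j))) as X. fold x in X. rewrite Ex, (rp_unit n v m len RP) in X.
        unfold mink in X. lra. }
      assert (Ox : r j * (cos (angle T j) * x1 + sin (angle T j) * x2) = h j * h (S j)).
      { pose proof (MP (m j) (m (S j))) as X. fold x in X. rewrite Ex, (rp_orth n v m len RP), IH in X.
        unfold polar in X. rewrite Hs, mink_scal_l in X. unfold mink in X.
        rewrite <- (HT' j). lra. }
      (* Orthogonality leaves two mirror-image directions for the next normal; the vertex between
         the two sides lying on the upper sheet selects the anticlockwise one. *)
      assert (Dx : 0 < r j * (cos (angle T j) * x2 - sin (angle T j) * x1)).
      { pose proof (hyp_mink _ _ (rp_hyp _ _ _ _ RP (S j)) Ho) as X.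
        rewrite (vertex_cross n v m len RP j) in X.
        assert (F : framed o e (vcross (m j) (m (S j))) = vcross (polar T j) x).
        { rewrite framed_cross by (first [apply Ho | assumption]). rewrite <- IH. reflexivity. }
        rewrite mink_scal_l in X. revert X F. generalize (vcross (m j) (m (S j))). intros X0 X F.
        apply (f_equal (fun z => fst (fst z))) in F. unfold framed at 1 in F. cbn [fst] in F.
        unfold polar in F. rewrite Ex, Hs in F. unfold vcross, vscal in F. cbn [fst] in F. 
        lra. }
      set (A := cos (angle T j) * x1 + sin (angle T j) * x2) in *.
      set (B := cos (angle T j) * x2 - sin (angle T j) * x1) in *.
      pose proof (sin2_cos2 (angle T j)) as SC. unfold Rsqr in SC.
      assert (AB2 : A * A + B * B = r (S j) * r (S j)).
      { rewrite <- Ux. unfold A, B.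
        transitivity ((sin (angle T j) * sin (angle T j) + cos (angle T j) * cos (angle T j)) * (x1 * x1 + x2 * x2)); [ring |].
        rewrite SC. ring. }
      assert (E1 : x1 = cos (angle T j) * A - sin (angle T j) * B).
      { unfold A, B. transitivity ((sin (angle T j) * sin (angle T j) + cos (angle T j) * cos (angle T j)) * x1); [rewrite SC; ring | ring]. }
      assert (E2 : x2 = sin (angle T j) * A + cos (angle T j) * B).
      { unfold A, B. transitivity ((sin (angle T j) * sin (angle T j) + cos (angle T j) * cos (angle T j)) * x2); [rewrite SC; ring | ring]. }
      pose proof (polar_prod T HT j (S j)) as PP.
      set (c := T j * T (S j)) in *.
      assert (EA : A = r (S j) * c).
      { apply (Rmult_eq_reg_l (r j)); [| lra]. rewrite Ox. unfold c. rewrite <- (HT' j), <- (HT' (S j)). ring. }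
      assert (PB : 0 < B) by (apply (Rmult_lt_reg_l (r j)); lra).
      assert (Hc : 0 < 1 - c * c). { assert (0 < (1 - c) * (1 + c)) by (apply Rmult_lt_0_compat; lra). lra. }
      assert (EB : B = r (S j) * sqrt (1 - c * c)).
      { pose proof (sqrt_lt_R0 _ Hc) as q0. pose proof (sqrt_sqrt _ (Rlt_le _ _ Hc)) as q2.
        apply Rsqr_inj; [lra | apply Rmult_le_pos; lra |]. unfold Rsqr.
        replace (r (S j) * sqrt (1 - c * c) * (r (S j) * sqrt (1 - c * c)))
          with (r (S j) * r (S j) * (sqrt (1 - c * c) * sqrt (1 - c * c))) by ring.
        rewrite q2, <- AB2. replace (A * A + B * B) with (r (S j) * r (S j)) at 2 by lra.
        replace (B * B) with (r (S j) * r (S j) - A * A) by lra. rewrite EA. ring. }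
      assert (CA : cos (acos c) = c) by (apply cos_acos; lra).
      assert (SA : sin (acos c) = sqrt (1 - c * c)) by (apply sin_acos; lra).
      rewrite Ex. unfold polar. rewrite Hs. rewrite angle_S. fold c. rewrite cos_plus, sin_plus, CA, SA.
      unfold vscal. apply vec_ext; [rewrite <- (HT' (S j)); ring | rewrite E1, EA, EB; ring | rewrite E2, EA, EB; ring]. }
  split; [| exact All].
  set (phi := fun i => acos (T i * T (S i))).
  assert (Hphi : forall i, 0 < phi i < PI / 2) by (intros; apply (polar_angle_bound T HT)).
  assert (Hang : forall i, angle T (S i) = angle T i + phi i) by reflexivity.
  pose proof (HT 0%nat) as HT0. pose proof (polar_root T HT 0%nat) as [s0 _].
  assert (Zero : angle T 0 = 0) by reflexivity.
  assert (Mono : forall i, 0 <= angle T i) by (intros; apply rsum_nonneg; intros i0 _; left; apply Hphi).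
  assert (EC : cos (angle T n) = 1).
  { pose proof (All n) as X. pose proof (rp_per_m _ _ _ _ RP 0) as Y. simpl in Y. rewrite Y, All in X.
    pose proof (HTper 0%nat) as Z. simpl in Z. unfold polar in X. rewrite Z, Zero, cos_0 in X.
    unfold vscal in X. injection X as X _. rewrite Rmult_1_r in X. symmetry in X.
    apply (Rmult_eq_reg_l (/ sqrt (1 - T 0%nat * T 0%nat))); [| apply Rgt_not_eq, Rinv_0_lt_compat; exact s0]. lra. }
  assert (Turn : forall x, 0 < x < 2 * PI -> cos x < 1).
  { intros x Hx. destruct (Rle_or_lt x PI) as [hx | hx].
    - rewrite <- cos_0. apply cos_decreasing_1; lra.
    - replace (cos x) with (cos (2 * PI - x)).
      + rewrite <- cos_0. apply cos_decreasing_1; lra.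
      + replace (2 * PI - x) with (- x + 2 * INR 1 * PI) by (simpl; ring). rewrite cos_period. apply cos_neg. }
  assert (Low : 2 * PI <= angle T n).
  { destruct (Rlt_or_le (angle T n) (2 * PI)) as [hx | hx]; [exfalso | exact hx].
    assert (0 < angle T n).
    { replace n with (S (n - 1)) by lia. rewrite Hang. pose proof (Mono (n - 1)%nat). pose proof (Hphi (n - 1)%nat). lra. }
    pose proof (Turn (angle T n) ltac:(lra)). lra. }
  (* The feet wind around the centre once: otherwise line 0 would lie, after one turn, between two
     consecutive lines that both meet it or are disjoint from it, and the two angles would be too large. *)
  destruct (Rle_lt_or_eq_dec _ _ Low) as [Gt | Eq]; [exfalso | symmetry; exact Eq].
  assert (Find : exists j, (j < n)%nat /\ angle T j <= 2 * PI < angle T (S j)).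
  { clear - Gt Zero. induction n as [| N IH]; [rewrite Zero in Gt; pose proof PI_RGT_0; lra |].
    destruct (Rlt_or_le (2 * PI) (angle T N)) as [hx | hx].
    - destruct (IH hx) as (j & Hj & X). exists j. split; [lia | exact X].
    - exists N. split; [lia | lra]. }
  destruct Find as (j & Hj & J1 & J2).
  assert (Jn : S j <> n).
  { intros En. rewrite En in J2. pose proof (Hang j) as X. rewrite En in X. pose proof (Hphi j). pose proof PI_RGT_0.
    pose proof (Turn (angle T n - 2 * PI) ltac:(lra)) as Y.
    replace (angle T n) with ((angle T n - 2 * PI) + 2 * INR 1 * PI) in EC by (simpl; ring).
    rewrite cos_period in EC. lra. }
  assert (J0 : j <> 0%nat).
  { intros ->. pose proof (Hang 0%nat). pose proof (Hphi 0%nat). pose proof PI_RGT_0. lra. }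
  pose proof (gram_family_of_rpoly n v m len Hn RP) as GF.
  assert (Neg : forall i, (0 < i < n)%nat -> cos (angle T i) <= T 0%nat * T i).
  { intros i Hi. assert (G : mink (m 0%nat) (m i) <= 0).
    { destruct (Nat.eq_dec i 1) as [-> | n1]; [rewrite (gf_orth _ _ GF) by lia; lra |].
      destruct (Nat.eq_dec i (n - 1)) as [-> | n2]; [rewrite (gf_orth_last _ _ GF); lra |].
      pose proof (gf_apart _ _ GF 0 i ltac:(lia) ltac:(lia)) as X. simpl in X. lra. }
    rewrite <- MP, !All, mink_polar, Zero, Rminus_0_r in G.
    destruct (polar_root T HT i) as [si _].
    assert (P : 0 < / sqrt (1 - T 0%nat * T 0%nat) * / sqrt (1 - T i * T i))
      by (apply Rmult_lt_0_compat; apply Rinv_0_lt_compat; assumption).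
    destruct (Rle_or_lt (cos (angle T i)) (T 0%nat * T i)) as [hx | hx]; [exact hx |].
    assert (0 < / sqrt (1 - T 0%nat * T 0%nat) * / sqrt (1 - T i * T i) * (cos (angle T i) - T 0%nat * T i))
      by (apply Rmult_lt_0_compat; lra). lra. }
  pose proof (Neg j ltac:(lia)) as N1. pose proof (Neg (S j) ltac:(lia)) as N2.
  pose proof (Hang j) as Hj'. pose proof (Hphi j) as Hpj.
  set (x := 2 * PI - angle T j). set (y := angle T (S j) - 2 * PI).
  assert (Cx : cos (angle T j) = cos x).
  { unfold x. replace (2 * PI - angle T j) with (- angle T j + 2 * INR 1 * PI) by (simpl; ring).
    rewrite cos_period, cos_neg. reflexivity. }
  assert (Cy : cos (angle T (S j)) = cos y).
  { replace (angle T (S j)) with (y + 2 * INR 1 * PI) by (unfold y; simpl; ring). apply cos_period. }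
  assert (Cxy : cos (x + y) = T j * T (S j)).
  { replace (x + y) with (phi j) by (unfold x, y; lra). unfold phi. pose proof (polar_prod T HT j (S j)).
    apply cos_acos; lra. }
  assert (xy : 0 <= x < PI / 2 /\ 0 <= y < PI / 2) by (unfold x, y; lra).
  rewrite cos_plus in Cxy. pose proof PI_RGT_0.
  assert (0 <= sin x * sin y) by (apply Rmult_le_pos; apply sin_ge_0; lra).
  assert (0 < cos x) by (apply cos_gt_0; lra). assert (0 < cos y) by (apply cos_gt_0; lra).
  rewrite Cx in N1. rewrite Cy in N2.
  (* The bounds give cos x cos y <= T_0^2 T_j T_(j+1), while cos x cos y >= cos (x + y) = T_j
     T_(j+1); but T_0 < 1. *)
  assert (P1 : cos x * cos y <= (T 0%nat * T j) * (T 0%nat * T (S j))) by (apply Rmult_le_compat; lra).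
  pose proof (polar_prod T HT 0 0) as P00. pose proof (polar_prod T HT j (S j)) as Pj.
  assert (0 < (1 - T 0%nat * T 0%nat) * (T j * T (S j))) by (apply Rmult_lt_0_compat; lra).
  lra.
Qed.

(** * Deforming one polygon into another *)

Lemma continuity_pt_comp_at (f g : R -> R) (x : R) :
  continuity_pt f x -> continuity_pt g (f x) -> continuity_pt (fun t => g (f t)) x.
Proof. intros Hf Hg. exact (continuity_pt_comp f g x Hf Hg). Qed.

Lemma continuity_pt_exp (x : R) : continuity_pt exp x.
Proof. apply derivable_continuous_pt, derivable_pt_exp. Qed.

Lemma continuity_pt_acos (x : R) : -1 < x < 1 -> continuity_pt acos x.
Proof. intros H. apply derivable_continuous_pt, derivable_pt_acos, H. Qed.

Lemma continuity_pt_rsum (n : nat) (f : nat -> R -> R) (x : R) :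
  (forall i, (i < n)%nat -> continuity_pt (f i) x) -> continuity_pt (fun t => rsum n (fun i => f i t)) x.
Proof.
  induction n as [| n IH]; intros H; simpl.
  - apply continuity_pt_const. intros y z. reflexivity.
  - apply (continuity_pt_plus (fun t => rsum n (fun i => f i t)) (f n)); [apply IH; auto | auto].
Qed.

Lemma continuity_pt_lt (f : R -> R) (x c : R) : continuity_pt f x -> f x < c ->
  exists d, 0 < d /\ forall y, Rabs (y - x) < d -> f y < c.
Proof.
  intros H K. destruct (H (c - f x) ltac:(lra)) as (d & Hd & X). exists d. split; [exact Hd |].
  intros y Hy. destruct (Req_dec x y) as [<- | ne]; [exact K |].
  specialize (X y (conj (conj I ne) Hy)). simpl in X. unfold R_dist in X.
  apply Rabs_def2 in X. lra.
Qed.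

(** The angle [acos (T i * T (S i))] as a function of x = - ln (T i) - ln (T (S i)). It increases
    with x, so the angle sum can be corrected by scaling the numbers - ln (T i). *)
Definition half_angle (x : R) : R := acos (exp (- x)).

Lemma exp_neg_bounds (x : R) : 0 < x -> 0 < exp (- x) < 1.
Proof. intros H. split; [apply exp_pos | rewrite <- exp_0; apply exp_increasing; lra]. Qed.

Lemma half_angle_incr (x y : R) : 0 < x < y -> half_angle x < half_angle y.
Proof.
  intros H. pose proof (exp_neg_bounds x ltac:(lra)). pose proof (exp_neg_bounds y ltac:(lra)).
  apply acos_decr; [lra | apply exp_increasing; lra | lra].
Qed.

Lemma half_angle_cont (x : R) : 0 < x -> continuity_pt half_angle x.
Proof.
  intros H. unfold half_angle. apply (continuity_pt_comp_at (fun t => exp (- t)) acos).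
  - apply (continuity_pt_comp_at (fun t => - t) exp); [| apply continuity_pt_exp].
    apply (continuity_pt_opp (fun t => t)), derivable_continuous_pt, derivable_pt_id.
  - pose proof (exp_neg_bounds x H). apply continuity_pt_acos. lra.
Qed.

(** * Restoring the angle sum by a scale factor *)

Section Scaling.

Variables (n : nat) (be : nat -> R -> R).
Hypothesis Hn : (6 <= n)%nat.
Hypothesis be_pos : forall i t, 0 < be i t.
Hypothesis be_cont : forall i t, continuity_pt (be i) t.

Let total (t l : R) : R := rsum n (fun i => half_angle (l * be i t)).

Lemma total_incr (t l l' : R) : 0 < l < l' -> total t l < total t l'.
Proof.
  intros H. unfold total.
  assert (X : forall N, (0 < N)%nat -> rsum N (fun i => half_angle (l * be i t)) < rsum N (fun i => half_angle (l' * be i t))).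
  { assert (Y : forall i, half_angle (l * be i t) < half_angle (l' * be i t)).
    { intros i. pose proof (be_pos i t). apply half_angle_incr. split; [apply Rmult_lt_0_compat; lra |].
      apply Rmult_lt_compat_r; lra. }
    induction N as [| N IH]; [lia |]. intros _. simpl. pose proof (Y N).
    destruct N as [| N']; [simpl; lra |]. specialize (IH ltac:(lia)). lra. }
  apply X. lia.
Qed.

Lemma total_cont_l (t l : R) : 0 < l -> continuity_pt (total t) l.
Proof.
  intros Hl. unfold total. apply (continuity_pt_rsum n (fun i x => half_angle (x * be i t))). intros i _.
  apply (continuity_pt_comp_at (fun x => x * be i t) half_angle).
  - apply (continuity_pt_mult (fun x => x) (fun _ => be i t)).
    + apply derivable_continuous_pt, derivable_pt_id.
    + apply continuity_pt_const. intros y z; reflexivity.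
  - apply half_angle_cont, Rmult_lt_0_compat; [exact Hl | apply be_pos].
Qed.

Lemma total_cont_t (t l : R) : 0 < l -> continuity_pt (fun x => total x l) t.
Proof.
  intros Hl. unfold total. apply (continuity_pt_rsum n (fun i x => half_angle (l * be i x))). intros i _.
  apply (continuity_pt_comp_at (fun x => l * be i x) half_angle).
  - apply (continuity_pt_mult (fun _ => l) (be i)); [| apply be_cont].
    apply continuity_pt_const. intros y z; reflexivity.
  - apply half_angle_cont, Rmult_lt_0_compat; [exact Hl | apply be_pos].
Qed.

Lemma scale_exists (t : R) : {l | 0 < l /\ total t l = 2 * PI}.
Proof.
  pose proof PI_RGT_0 as Pi0.
  assert (Hn6 : 6 <= INR n) by (replace 6 with (INR 6) by (simpl; lra); apply le_INR, Hn).
  (* Chosen so that [half_angle x0] is PI / n; a scale that keeps all arguments at most x0 makes the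
     total at most PI. *)
  set (x0 := - ln (cos (PI / INR n))).
  assert (In : 0 < PI / INR n <= PI / 6).
  { split; [apply Rdiv_lt_0_compat; lra |]. unfold Rdiv. apply Rmult_le_compat_l; [lra |].
    apply Rinv_le_contravar; lra. }
  assert (Cn : 0 < cos (PI / INR n) < 1).
  { split; [apply cos_gt_0; lra |]. rewrite <- cos_0. apply cos_decreasing_1; lra. }
  assert (X0 : 0 < x0). { unfold x0. assert (ln (cos (PI / INR n)) < 0); [| lra]. rewrite <- ln_1. apply ln_increasing; lra. }
  assert (H0 : half_angle x0 = PI / INR n).
  { unfold half_angle, x0. rewrite Ropp_involutive, exp_ln by lra. apply acos_cos. lra. }
  (* Gives exp (-2) < 1/2 = cos (PI / 3), hence [half_angle 2 > PI / 3]; at least six terms with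
     arguments above 2 then exceed 2 PI. *)
  assert (E2 : 4 < exp 2).
  { replace 2 with (1 + 1) by ring. rewrite exp_plus. pose proof (exp_ineq1 1 ltac:(lra)).
    assert (2 * 2 < exp 1 * exp 1) by (apply Rmult_gt_0_lt_compat; lra). lra. }
  assert (H2 : PI / 3 < half_angle 2).
  { unfold half_angle. rewrite <- (acos_cos (PI / 3)) by lra. rewrite cos_PI3. rewrite exp_Ropp.
    assert (/ exp 2 < / 4) by (apply Rinv_lt_contravar; [| exact E2]; apply Rmult_lt_0_compat; lra).
    assert (0 < / exp 2) by (apply Rinv_0_lt_compat; lra). apply acos_decr; lra. }
  set (B := rsum n (fun i => be i t)).
  assert (Bi : forall i, (i < n)%nat -> be i t <= B).
  { intros i Hi. apply (rsum_term n i (fun j => be j t)); [intros; left; apply be_pos | exact Hi]. }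
  assert (B0 : 0 < B) by (specialize (Bi 0%nat ltac:(lia)); pose proof (be_pos 0 t); lra).
  set (lo := x0 / B). assert (Hlo : 0 < lo) by (apply Rdiv_lt_0_compat; assumption).
  assert (Slo : total t lo < 2 * PI).
  { assert (total t lo <= rsum n (fun _ => PI / INR n)).
    { apply rsum_le. intros i Hi. rewrite <- H0. specialize (Bi i Hi). pose proof (be_pos i t).
      assert (L : lo * be i t <= x0).
      { replace x0 with (lo * B) by (unfold lo; field; lra). apply Rmult_le_compat_l; lra. }
      assert (0 < lo * be i t) by (apply Rmult_lt_0_compat; assumption).
      destruct L as [L | ->]; [left; apply half_angle_incr; lra | lra]. }
    rewrite rsum_const in H. replace (INR n * (PI / INR n)) with PI in H by (field; lra). lra. }
  set (hi := lo + rsum n (fun i => 3 / be i t)).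
  assert (Pi' : forall i, 0 < 3 / be i t) by (intros i; pose proof (be_pos i t); apply Rdiv_lt_0_compat; lra).
  assert (Hi : forall i, (i < n)%nat -> 2 < hi * be i t).
  { intros i Hi. pose proof (be_pos i t).
    assert (3 / be i t <= rsum n (fun j => 3 / be j t)).
    { apply (rsum_term n i (fun j => 3 / be j t)); [intros; left; apply Pi' | exact Hi]. }
    assert (3 / be i t * be i t <= hi * be i t) by (apply Rmult_le_compat_r; unfold hi; lra).
    replace (3 / be i t * be i t) with 3 in H3 by (field; lra). lra. }
  assert (Shi : 2 * PI < total t hi).
  { assert (rsum n (fun _ => half_angle 2) <= total t hi).
    { apply rsum_le. intros i Hi'. left. apply half_angle_incr. specialize (Hi i Hi'). lra. }
    rewrite rsum_const in H.
    assert (6 * (PI / 3) < INR n * half_angle 2); [| lra].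
    apply Rle_lt_trans with (INR n * (PI / 3)); [apply Rmult_le_compat_r; lra | apply Rmult_lt_compat_l; lra]. }
  assert (lohi : lo < hi).
  { unfold hi. assert (3 / be 0%nat t <= rsum n (fun j => 3 / be j t)).
    { apply (rsum_term n 0 (fun j => 3 / be j t)); [intros; left; apply Pi' | lia]. }
    specialize (Pi' 0%nat). lra. }
  destruct (IVT_interv (fun l => total t l - 2 * PI) lo hi) as (l & Hl & El); [| exact lohi | lra | lra |].
  - intros l Hl. apply (continuity_pt_minus (total t) (fun _ => 2 * PI)); [apply total_cont_l; lra |].
    apply continuity_pt_const. intros y z; reflexivity.
  - exists l. split; lra.
Qed.

Lemma scale_unique (t l l' : R) : 0 < l -> 0 < l' -> total t l = total t l' -> l = l'.
Proof.
  intros H H' E. destruct (Rtotal_order l l') as [h | [h | h]]; [| exact h |].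
  - pose proof (total_incr t l l' ltac:(lra)). lra.
  - pose proof (total_incr t l' l ltac:(lra)). lra.
Qed.

(** An implicit function obtained from monotonicity: the total is below 2 PI at [la t - d] and above
    it at [la t + d]; both persist for nearby t and trap the scale between them. *)
Lemma continuous_scale : exists la : R -> R, (forall t, continuity_pt la t) /\ (forall t, 0 < la t) /\
  forall t, rsum n (fun i => half_angle (la t * be i t)) = 2 * PI.
Proof.
  set (la := fun t => proj1_sig (scale_exists t)).
  assert (P : forall t, 0 < la t /\ total t (la t) = 2 * PI) by (intros t; exact (proj2_sig (scale_exists t))).
  exists la. split; [| split; intros t; apply P].
  intros t eps Heps. destruct (P t) as [l0 lt].
  (* Halving keeps [la t - d] positive, inside the range where the total is increasing and
     continuous. *)
  set (d := Rmin eps (la t) / 2).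
  assert (Hd : 0 < d /\ d < eps /\ d < la t).
  { unfold d. pose proof (Rmin_l eps (la t)). pose proof (Rmin_r eps (la t)).
    assert (0 < Rmin eps (la t)) by (apply Rmin_glb_lt; lra). lra. }
  destruct (continuity_pt_lt (fun x => total x (la t - d)) t (2 * PI)) as (d1 & P1 & Q1).
  { apply total_cont_t. lra. }
  { rewrite <- lt. apply total_incr. lra. }
  destruct (continuity_pt_lt (fun x => - total x (la t + d)) t (- (2 * PI))) as (d2 & P2 & Q2).
  { apply (continuity_pt_opp (fun x => total x (la t + d))), total_cont_t. lra. }
  { rewrite <- lt. pose proof (total_incr t (la t) (la t + d) ltac:(lra)). lra. }
  exists (Rmin d1 d2). split; [apply Rmin_glb_lt; assumption |].
  intros y [_ Hy]. simpl in *. unfold R_dist in *.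
  pose proof (Rmin_l d1 d2). pose proof (Rmin_r d1 d2).
  specialize (Q1 y ltac:(lra)). specialize (Q2 y ltac:(lra)). destruct (P y) as [ly Ey].
  assert (L1 : la t - d < la y).
  { destruct (Rlt_or_le (la t - d) (la y)) as [h | [h | h]]; [exact h | exfalso | exfalso].
    - pose proof (total_incr y (la y) (la t - d) ltac:(lra)). lra.
    - rewrite <- h in Q1. lra. }
  assert (L2 : la y < la t + d).
  { destruct (Rlt_or_le (la y) (la t + d)) as [h | [h | h]]; [exact h | exfalso | exfalso].
    - pose proof (total_incr y (la t + d) (la y) ltac:(lra)). lra.
    - rewrite h in Q2. lra. }
  apply Rabs_def1; lra.
Qed.

End Scaling.

(** * Continuity along the deformation and transfer of trajectories *)

Definition vcont (f : R -> vec3) : Prop := forall t,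
  continuity_pt (fun x => fst (fst (f x))) t /\ continuity_pt (fun x => snd (fst (f x))) t /\
  continuity_pt (fun x => snd (f x)) t.

Ltac cont := repeat first [apply continuity_pt_plus | apply continuity_pt_minus | apply continuity_pt_mult
  | apply continuity_pt_opp | solve [auto]].

Lemma qword_cont (M : R -> nat -> vec3) (s : list nat) : (forall j, vcont (fun t => M t j)) ->
  (forall t, continuity_pt (fun x => fst (qword (M x) s)) t) /\ vcont (fun x => snd (qword (M x) s)).
Proof.
  intros H. induction s as [| u s [IH1 IH2]].
  - split; [| split; [| split]]; try intros t; apply continuity_pt_const; intros y z; reflexivity.
  - assert (E : forall x, qword (M x) (u :: s) =
      (let '(a, b, c) := M x u in let '(w, (d, e, f)) := qword (M x) s in
       (- a * d + b * e + c * f, (w * a + (c * e - b * f), w * b + (c * d - a * f), w * c + (a * e - b * d))))).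
    { intros x. rewrite qword_cons. generalize (M x u) (qword (M x) s). clear. intros [[a b] c] [w [[d e] f]].
      unfold qmul, qvec, mink, vadd, vscal, vcross. simpl. f_equal; [ring | apply vec_ext; ring]. }
    set (a := fun x => fst (fst (M x u))). set (b := fun x => snd (fst (M x u))). set (c := fun x => snd (M x u)).
    set (w := fun x => fst (qword (M x) s)). set (d := fun x => fst (fst (snd (qword (M x) s)))).
    set (e := fun x => snd (fst (snd (qword (M x) s)))). set (f := fun x => snd (snd (qword (M x) s))).
    assert (Ca : forall t, continuity_pt a t) by (intros t; apply (H u t)).
    assert (Cb : forall t, continuity_pt b t) by (intros t; apply (H u t)).
    assert (Cc : forall t, continuity_pt c t) by (intros t; apply (H u t)).
    assert (Cd : forall t, continuity_pt d t) by (intros t; apply (IH2 t)).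
    assert (Ce : forall t, continuity_pt e t) by (intros t; apply (IH2 t)).
    assert (Cf : forall t, continuity_pt f t) by (intros t; apply (IH2 t)).
    assert (E' : forall x, qword (M x) (u :: s) = (((- a) * d + b * e + c * f)%F x,
      ((w * a + (c * e - b * f))%F x, (w * b + (c * d - a * f))%F x, (w * c + (a * e - b * d))%F x))).
    { intros x. rewrite E. unfold a, b, c, w, d, e, f.
      unfold plus_fct, mult_fct, minus_fct, opp_fct.
      destruct (M x u) as [[? ?] ?], (qword (M x) s) as [? [[? ?] ?]]. reflexivity. }
    assert (Cw : forall t, continuity_pt w t) by (intros t; apply IH1).
    split; [intros t | intros t; split; [| split]].
    + replace (fun x => fst (qword (M x) (u :: s))) with ((- a) * d + b * e + c * f)%F
        by (apply functional_extensionality; intros x; rewrite E'; reflexivity).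
      cont.
    + replace (fun x => fst (fst (snd (qword (M x) (u :: s))))) with (w * a + (c * e - b * f))%F
        by (apply functional_extensionality; intros x; rewrite E'; reflexivity).
      cont.
    + replace (fun x => snd (fst (snd (qword (M x) (u :: s))))) with (w * b + (c * d - a * f))%F
        by (apply functional_extensionality; intros x; rewrite E'; reflexivity).
      cont.
    + replace (fun x => snd (snd (qword (M x) (u :: s)))) with (w * c + (a * e - b * d))%F
        by (apply functional_extensionality; intros x; rewrite E'; reflexivity).
      cont.
Qed.

Lemma polar_cont (T : R -> nat -> R) (j : nat) : (forall t i, 0 < T t i < 1) ->
  (forall i t, continuity_pt (fun x => T x i) t) -> vcont (fun t => polar (T t) j).
Proof.
  intros HT CT.
  assert (CA : forall t, continuity_pt (fun x => angle (T x) j) t).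
  { intros t. unfold angle. apply (continuity_pt_rsum j (fun i x => acos (T x i * T x (S i)))). intros i _.
    apply (continuity_pt_comp_at (fun x => T x i * T x (S i)) acos).
    - apply (continuity_pt_mult (fun x => T x i) (fun x => T x (S i))); apply CT.
    - pose proof (polar_prod (T t) (HT t) i (S i)). apply continuity_pt_acos. lra. }
  assert (CR : forall t, continuity_pt (fun x => / sqrt (1 - T x j * T x j)) t).
  { intros t. destruct (polar_root (T t) (HT t) j) as [H _].
    apply (continuity_pt_inv (fun x => sqrt (1 - T x j * T x j))); [| lra].
    apply (continuity_pt_comp_at (fun x => 1 - T x j * T x j) sqrt).
    - apply (continuity_pt_minus (fun _ => 1) (fun x => T x j * T x j)).
      + apply continuity_pt_const. intros y z; reflexivity.
      + apply (continuity_pt_mult (fun x => T x j) (fun x => T x j)); apply CT.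
    - apply continuity_pt_sqrt. pose proof (polar_prod (T t) (HT t) j j). lra. }
  intros t. unfold polar, vscal. simpl. split; [| split].
  - apply (continuity_pt_mult (fun x => / sqrt (1 - T x j * T x j)) (fun x => - T x j)); [apply CR |].
    apply (continuity_pt_opp (fun x => T x j)), CT.
  - apply (continuity_pt_mult (fun x => / sqrt (1 - T x j * T x j)) (fun x => cos (angle (T x) j))); [apply CR |].
    apply (continuity_pt_comp_at (fun x => angle (T x) j) cos); [apply CA | apply continuity_cos].
  - apply (continuity_pt_mult (fun x => / sqrt (1 - T x j * T x j)) (fun x => sin (angle (T x) j))); [apply CR |].
    apply (continuity_pt_comp_at (fun x => angle (T x) j) sin); [apply CA | apply continuity_sin].
Qed.

(** Interpolate [ln (- ln T)] linearly and rescale [- ln T] to restore the angle sum [2 PI]. *)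
Lemma polar_path (n : nat) (T0 T1 : nat -> R) : (6 <= n)%nat ->
  (forall j, 0 < T0 j < 1) -> (forall j, T0 (j + n)%nat = T0 j) -> angle T0 n = 2 * PI ->
  (forall j, 0 < T1 j < 1) -> (forall j, T1 (j + n)%nat = T1 j) -> angle T1 n = 2 * PI ->
  exists T : R -> nat -> R, T 0 = T0 /\ T 1 = T1 /\ (forall j, vcont (fun t => polar (T t) j)) /\
    forall t, gram_family n (polar (T t)) /\ forall j, 0 < mink (polar (T t) j) (1, 0, 0).
Proof.
  intros Hn H0 P0 A0 H1 P1 A1.
  (* The map ln (- ln T) takes (0, 1) onto the real line, so its linear interpolation cannot leave
     the admissible range. *)
  set (al := fun (j : nat) (t : R) => exp ((1 - t) * ln (- ln (T0 j)) + t * ln (- ln (T1 j)))).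
  assert (Ln : forall x, 0 < x < 1 -> 0 < - ln x).
  { intros x Hx. assert (ln x < 0); [| lra]. rewrite <- ln_1. apply ln_increasing; lra. }
  assert (alp : forall j t, 0 < al j t) by (intros; apply exp_pos).
  assert (al0 : forall j, al j 0 = - ln (T0 j)).
  { intros j. unfold al. replace ((1 - 0) * _ + _) with (ln (- ln (T0 j))) by ring. apply exp_ln, Ln, H0. }
  assert (al1 : forall j, al j 1 = - ln (T1 j)).
  { intros j. unfold al. replace ((1 - 1) * _ + _) with (ln (- ln (T1 j))) by ring. apply exp_ln, Ln, H1. }
  assert (alc : forall j t, continuity_pt (al j) t).
  { intros j t. unfold al. apply (continuity_pt_comp_at (fun t => (1 - t) * ln (- ln (T0 j)) + t * ln (- ln (T1 j))) exp).
    - apply derivable_continuous_pt. reg.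
    - apply continuity_pt_exp. }
  set (be := fun (i : nat) (t : R) => al i t + al (S i) t).
  assert (bep : forall i t, 0 < be i t).
  { intros i t. unfold be. pose proof (alp i t). pose proof (alp (S i) t). lra. }
  assert (bec : forall i t, continuity_pt (be i) t).
  { intros i t. apply (continuity_pt_plus (al i) (al (S i))); apply alc. }
  destruct (continuous_scale n be Hn bep bec) as (la & Cla & Pla & Sla).
  set (T := fun t j => exp (- (la t * al j t))).
  assert (HT : forall t j, 0 < T t j < 1).
  { intros t j. apply exp_neg_bounds, Rmult_lt_0_compat; auto. }
  assert (TT : forall t i, T t i * T t (S i) = exp (- (la t * be i t))).
  { intros t i. unfold T. rewrite <- exp_plus. f_equal. unfold be. ring. }
  (* No rescaling happens at the ends: the scale is unique, and 1 already gives the sum 2 PI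
     there. *)
  assert (Ends : forall t T', (forall j, 0 < T' j < 1) -> angle T' n = 2 * PI -> (forall j, al j t = - ln (T' j)) -> T t = T').
  { intros t T' H' A' E'. assert (la1 : la t = 1).
    { apply (scale_unique n be Hn bep t); [apply Pla | lra |]. rewrite Sla, <- A'. unfold angle.
      apply rsum_ext. intros i _. unfold half_angle. f_equal. unfold be. rewrite !E', Rmult_1_l.
      replace (- (- ln (T' i) + - ln (T' (S i)))) with (ln (T' i) + ln (T' (S i))) by ring.
      rewrite exp_plus, !exp_ln by apply H'. reflexivity. }
    apply functional_extensionality. intros j. unfold T. rewrite la1, E', Rmult_1_l, Ropp_involutive.
    apply exp_ln, H'. }
  exists T. split; [apply Ends; auto |]. split; [apply Ends; auto |]. split.
  - intros j. apply polar_cont; [exact HT |]. intros i t. unfold T.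
    apply (continuity_pt_comp_at (fun x => - (la x * al i x)) exp); [| apply continuity_pt_exp].
    apply (continuity_pt_opp (fun x => la x * al i x)), (continuity_pt_mult la (al i)); auto.
  - intros t. split; [| intros j; apply (polar_interior (T t) (HT t))].
    apply (polar_gram n (T t) Hn (HT t)).
    + intros j. unfold T, al. rewrite P0, P1. reflexivity.
    + unfold angle. rewrite <- (Sla t). apply rsum_ext. intros i _. rewrite TT. reflexivity.
Qed.

(** The ends of each side hit have nonzero axis values in the first polygon. Each value is, up to
    sign, a scalar part that stays nonzero along the path, so the opposite signs demanded by
    [trajectory_of_axis] persist in the second polygon. *)
Lemma trajectory_transfer (n : nat) (v m v' m' : nat -> vec3) (len len' : nat -> R) (q : nat)
  (a : nat -> nat) (p t : nat -> vec3) (L : nat -> R) : (6 <= n)%nat ->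
  rpoly n v m len -> rpoly n v' m' len' -> trajectory n m q a p t L ->
  exists p' t' L', trajectory n m' q a p' t' L'.
Proof.
  intros Hn RP RP' TR.
  destruct (rpoly_polar n v m len Hn RP) as (o & e & T0 & O1 & O2 & O3 & H0 & P0 & A0 & E0).
  destruct (rpoly_polar n v' m' len' Hn RP') as (o' & e' & T1 & O1' & O2' & O3' & H1 & P1 & A1 & E1).
  destruct (polar_path n T0 T1 Hn H0 P0 A0 H1 P1 A1) as (T & F0 & F1 & CT & GT).
  assert (Key : forall i c, (c < n)%nat -> mink (axis m a q i) (v (S c)) <> 0 ->
    0 < mink (axis m a q i) (v (S c)) * mink (axis m' a q i) (v' (S c))).
  { intros i c Hc N. set (c' := (S c mod n)%nat). set (z := word a i q ++ [c; c']).
    assert (Hc' : (c' < n)%nat) by (apply Nat.mod_upper_bound; lia).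
    assert (M1 : m c' = m (S c)) by (symmetry; apply (periodic_mod n m (rp_per_m _ _ _ _ RP))).
    assert (M2 : m' c' = m' (S c)) by (symmetry; apply (periodic_mod n m' (rp_per_m _ _ _ _ RP'))).
    assert (Or : mink (m c) (m c') = 0) by (rewrite M1; apply (rp_orth n v m len RP)).
    assert (Or' : mink (m' c) (m' c') = 0) by (rewrite M2; apply (rp_orth n v' m' len' RP')).
    assert (S1 : fst (qword m z) = - mink (axis m a q i) (v (S c))).
    { unfold z. rewrite (qword_pair m _ _ _ Or), (vertex_cross n v m len RP), mink_scal_r, M1.
      unfold qmul, qvec, axis. simpl. ring. }
    assert (S2 : fst (qword m' z) = - mink (axis m' a q i) (v' (S c))).
    { unfold z. rewrite (qword_pair m' _ _ _ Or'), (vertex_cross n v' m' len' RP'), mink_scal_r, M2.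
      unfold qmul, qvec, axis. simpl. ring. }
    set (f := fun x => fst (qword (polar (T x)) z)).
    assert (f0 : f 0 = fst (qword m z)).
    { unfold f. rewrite F0. replace (polar T0) with (fun j => framed o e (m j)) by (apply functional_extensionality, E0).
      rewrite qword_framed by assumption. reflexivity. }
    assert (f1 : f 1 = fst (qword m' z)).
    { unfold f. rewrite F1. replace (polar T1) with (fun j => framed o' e' (m' j)) by (apply functional_extensionality, E1).
      rewrite qword_framed by assumption. reflexivity. }
    destruct (Rlt_or_le 0 (f 0 * f 1)) as [h | h]; [rewrite f0, f1, S1, S2 in h; lra | exfalso].
    destruct (IVT_cor f 0 1) as (x & _ & Z); [| lra | exact h |].
    { intros x. apply (qword_cont (fun y => polar (T y)) z CT). }
    revert Z. destruct (GT x) as [G I].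
    apply (scalar_part_nonzero n v m len Hn RP q a p t L TR _ (1, 0, 0)); auto.
    intros W. apply N. rewrite (vertex_cross n v m len RP), mink_scal_r, <- M1, W. ring. }
  apply (trajectory_of_axis n v' m' len' Hn RP' q a); try apply TR.
  - intros i. apply (traj_letters_distinct n m q a p t L TR).
  - intros i. destruct (traj_axis_signs n v m len Hn RP q a p t L TR i) as [Sg _].
    pose proof (tr_letter _ _ _ _ _ _ _ TR i) as la.
    (* The predecessor of [a i] modulo n: sides c and [a i] meet at vertex [a i], so [Key] applies
       to both ends of the side. *)
    set (c := ((a i + n - 1) mod n)%nat).
    assert (Hc : (c < n)%nat) by (apply Nat.mod_upper_bound; lia).
    assert (Vc : forall y : nat -> vec3, (forall j, y (j + n)%nat = y j) -> y (S c) = y (a i)).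
    { intros y Hy. unfold c. destruct (Nat.eq_dec (a i) 0) as [E | E].
      - rewrite E, Nat.mod_small by lia. rewrite <- (Hy 0%nat). f_equal. lia.
      - replace (a i + n - 1)%nat with (a i - 1 + 1 * n)%nat by lia.
        rewrite Nat.Div0.mod_add, Nat.mod_small by lia. f_equal. lia. }
    set (s0 := mink (axis m a q i) (v (a i))) in *. set (s1 := mink (axis m a q i) (v (S (a i)))) in *.
    assert (s0 <> 0) by (intros z; rewrite z in Sg; lra).
    assert (s1 <> 0) by (intros z; rewrite z in Sg; lra).
    pose proof (Key i (a i) la ltac:(assumption)) as K1. fold s1 in K1.
    pose proof (Key i c Hc) as K0. rewrite (Vc v (rp_per_v _ _ _ _ RP)), (Vc v' (rp_per_v _ _ _ _ RP')) in K0.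
    fold s0 in K0. specialize (K0 ltac:(assumption)).
    set (x0 := mink (axis m' a q i) (v' (a i))) in *. set (x1 := mink (axis m' a q i) (v' (S (a i)))) in *.
    assert (0 < (s0 * x0) * (s1 * x1)) by (apply Rmult_lt_0_compat; assumption).
    destruct (Rlt_or_le (x0 * x1) 0) as [h | h]; [exact h | exfalso].
    assert (0 <= - (s0 * s1) * (x0 * x1)) by (apply Rmult_le_pos; lra). lra.
Qed.

(** * The family of cyclically related trajectories *)

Lemma mod_add_cancel (n r x y : nat) : (x < n)%nat -> (y < n)%nat ->
  ((x + r) mod n = (y + r) mod n)%nat -> x = y.
Proof.
  intros Hx Hy H. rewrite <- (Nat.Div0.add_mod_idemp_r x r), <- (Nat.Div0.add_mod_idemp_r y r) in H.
  assert (Hr : (r mod n < n)%nat) by (apply Nat.mod_upper_bound; lia).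
  set (s := (r mod n)%nat) in *.
  assert (A : forall z, (z < 2 * n)%nat -> (z mod n)%nat = z \/ ((z mod n)%nat = (z - n)%nat /\ (n <= z)%nat)).
  { intros z Hz. destruct (Nat.lt_ge_cases z n) as [h | h].
    - left. apply Nat.mod_small, h.
    - right. split; [| exact h]. replace z with ((z - n) + 1 * n)%nat at 1 by lia.
      rewrite Nat.Div0.mod_add, Nat.mod_small; lia. }
  assert (B : forall z, (z < n)%nat -> (z mod n)%nat = z) by (intros; apply Nat.mod_small; lia).
  destruct (A (x + s)%nat) as [a | [a a']]; [lia | |]; destruct (A (y + s)%nat) as [b | [b b']]; lia.
Qed.

Lemma trajectory_relabel (n : nat) (m : nat -> vec3) (q r : nat) (a : nat -> nat) (p t : nat -> vec3) (L : nat -> R) :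
  (0 < n)%nat -> (forall j, m (j + n)%nat = m j) ->
  trajectory n (fun j => m (j + r)%nat) q a p t L ->
  trajectory n m q (fun i => (a i + r) mod n)%nat p t L.
Proof.
  intros Hn Hm TR.
  assert (E : forall j, m (j mod n)%nat = m j) by (intros; symmetry; apply periodic_mod, Hm).
  constructor; try apply TR; try (intros i; rewrite E; apply TR).
  - intros i. apply Nat.mod_upper_bound. lia.
  - intros i. rewrite (tr_per_a _ _ _ _ _ _ _ TR). reflexivity.
  (* Adding r (n - 1) subtracts r modulo n without leaving the natural numbers. *)
  - intros i j Hj ne. set (j' := ((j + r * (n - 1)) mod n)%nat).
    assert (Ej : ((j' + r) mod n)%nat = j).
    { unfold j'. rewrite Nat.Div0.add_mod_idemp_l. replace (j + r * (n - 1) + r)%nat with (j + r * n)%nat by nia.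
      rewrite Nat.Div0.mod_add. apply Nat.mod_small, Hj. }
    rewrite <- Ej, E. apply (tr_side _ _ _ _ _ _ _ TR).
    + apply Nat.mod_upper_bound. lia.
    + intros e. apply ne. rewrite <- Ej, e. reflexivity.
Qed.

Lemma trajectory_rotate (n : nat) (m : nat -> vec3) (q s : nat) (a : nat -> nat) (p t : nat -> vec3) (L : nat -> R) :
  trajectory n m q a p t L ->
  trajectory n m q (fun i => a (i + s)%nat) (fun i => p (i + s)%nat) (fun i => t (i + s)%nat) (fun i => L (i + s)%nat).
Proof.
  intros TR.
  assert (E : forall i, (i + q + s = i + s + q)%nat) by (intros; lia).
  constructor; intros; rewrite ?E; apply TR; assumption.
Qed.

(** [rotl m] is the identity once m reaches the length, so the effective rotation is supplied
    separately as j. *)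
Lemma nth_rotl {A : Type} (l : list A) (m : nat) : l <> nil ->
  exists j, (j < length l)%nat /\ forall d i, (i < length l)%nat -> nth i (rotl m l) d = nth ((i + j) mod length l) l d.
Proof.
  intros Hl. assert (0 < length l)%nat by (destruct l; [congruence | simpl; lia]).
  destruct (Nat.lt_ge_cases m (length l)) as [h | h].
  - exists m. split; [exact h |]. intros d i Hi. unfold rotl.
    destruct (Nat.lt_ge_cases (i + m) (length l)) as [k | k].
    + rewrite app_nth1 by (rewrite length_skipn; lia). rewrite nth_skipn, Nat.mod_small by lia. f_equal. lia.
    + rewrite app_nth2 by (rewrite length_skipn; lia). rewrite length_skipn, nth_firstn.
      destruct (Nat.ltb_spec (i - (length l - m)) m) as [_ | ]; [| lia].
      replace (i + m)%nat with ((i + m - length l) + 1 * length l)%nat by lia.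
      rewrite Nat.Div0.mod_add, Nat.mod_small by lia. f_equal. lia.
  - exists 0%nat. split; [lia |]. intros d i Hi. unfold rotl.
    rewrite skipn_all2, firstn_all2 by lia. rewrite Nat.add_0_r, Nat.mod_small by lia. reflexivity.
Qed.

Lemma rotl_of_nth {A : Type} (l l' : list A) (j : nat) (d : A) : length l' = length l ->
  (forall i, (i < length l)%nat -> nth i l' d = nth ((i + j) mod length l) l d) -> exists m, l' = rotl m l.
Proof.
  intros E H. destruct (Nat.eq_dec (length l) 0) as [z | nz].
  - exists 0%nat. destruct l; [| discriminate z]. destruct l'; [reflexivity | discriminate E].
  - set (m := (j mod length l)%nat). exists m.
    assert (Hm : (m < length l)%nat) by (apply Nat.mod_upper_bound; lia).
    assert (LR : length (rotl m l) = length l).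
    { unfold rotl. rewrite length_app, length_skipn, length_firstn. lia. }
    apply (nth_ext _ _ d d); [lia |]. intros i Hi. rewrite E in Hi. rewrite H by exact Hi.
    unfold rotl. rewrite <- Nat.Div0.add_mod_idemp_r. fold m.
    destruct (Nat.lt_ge_cases (i + m) (length l)) as [k | k].
    + rewrite app_nth1 by (rewrite length_skipn; lia). rewrite nth_skipn, Nat.mod_small by lia. f_equal. lia.
    + rewrite app_nth2 by (rewrite length_skipn; lia). rewrite length_skipn, nth_firstn.
      destruct (Nat.ltb_spec (i - (length l - m)) m) as [_ | ]; [| lia].
      replace (i + m)%nat with ((i + m - length l) + 1 * length l)%nat by lia.
      rewrite Nat.Div0.mod_add, Nat.mod_small by lia. f_equal. lia.
Qed.

Lemma least_positive (E : nat -> Prop) (n : nat) : (0 < n)%nat -> E n ->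
  exists d, (0 < d)%nat /\ E d /\ forall x, (0 < x < d)%nat -> ~ E x.
Proof.
  induction n as [n IH] using lt_wf_ind. intros Hn En.
  destruct (classic (exists x, (0 < x < n)%nat /\ E x)) as [(x & Hx & Ex) | N].
  - apply (IH x); [lia | lia | exact Ex].
  - exists n. split; [exact Hn |]. split; [exact En |]. intros x Hx Ex. apply N. eauto.
Qed.

Lemma nth_map_seq {A : Type} (f : nat -> A) (q i : nat) (d : A) : (i < q)%nat -> nth i (map f (seq 0 q)) d = f i.
Proof.
  intros Hi. rewrite (nth_indep _ d (f 0%nat)) by (rewrite length_map, length_seq; exact Hi).
  rewrite map_nth, seq_nth by exact Hi. reflexivity.
Qed.

Lemma sumR_map_seq (f : nat -> R) (q : nat) : sumR (map f (seq 0 q)) = rsum q f.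
Proof.
  assert (H : forall s, sumR (map f (seq s q)) = rsum q (fun i => f (s + i)%nat)).
  { induction q as [| q IH]; intros s; [reflexivity |].
    change (seq s (S q)) with (s :: seq (S s) q). cbn [map sumR]. rewrite IH.
    change (S q) with (1 + q)%nat. rewrite rsum_add. simpl rsum at 2. rewrite Nat.add_0_r, Rplus_0_l. f_equal.
    apply rsum_ext. intros i _. f_equal. lia. }
  rewrite H. reflexivity.
Qed.

(** The label shifts that merely rotate the cyclic word; they are the reason why different
    labellings can produce the same trajectory. *)
Definition label_period (n : nat) (a : nat -> nat) (x : nat) : Prop :=
  exists j, forall i, ((a i + x) mod n)%nat = a (i + j)%nat.

Lemma label_period_sub (n q : nat) (a : nat -> nat) (x d : nat) : (1 <= q)%nat ->
  (forall i, (a i < n)%nat) -> (forall i, a (i + q)%nat = a i) ->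
  label_period n a (x + d) -> label_period n a d -> label_period n a x.
Proof.
  intros Hq La Pa [j1 H1] [j2 H2]. exists (j1 + j2 * (q - 1))%nat. intros i.
  apply (mod_add_cancel n d); [specialize (La i); apply Nat.mod_upper_bound; lia | apply La |].
  rewrite Nat.Div0.add_mod_idemp_l, <- Nat.add_assoc, H1, H2.
  replace (i + (j1 + j2 * (q - 1)) + j2)%nat with (i + j1 + j2 * q)%nat by nia.
  symmetry. apply (periodic_mul q a Pa).
Qed.

(** Label periods are closed under subtraction and n is one of them, so the remainder of n modulo
    the least period d would be a smaller one. Divisibility means that every trajectory arises from
    the same number n / d of labellings. *)
Lemma label_period_dvd (n q : nat) (a : nat -> nat) (d : nat) : (1 <= q)%nat -> (0 < n)%nat ->
  (forall i, (a i < n)%nat) -> (forall i, a (i + q)%nat = a i) ->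
  (0 < d)%nat -> label_period n a d -> (forall x, (0 < x < d)%nat -> ~ label_period n a x) ->
  exists c, n = (c * d)%nat.
Proof.
  intros Hq Hn La Pa Hd Ed Min.
  assert (En : label_period n a n).
  { exists 0%nat. intros i. rewrite Nat.add_0_r. replace (a i + n)%nat with (a i + 1 * n)%nat by lia.
    rewrite Nat.Div0.mod_add. apply Nat.mod_small, La. }
  assert (Red : forall c x, label_period n a (x + c * d) -> label_period n a x).
  { induction c as [| c IH]; intros x H.
    - rewrite Nat.add_0_r in H. exact H.
    - apply IH, (label_period_sub n q a _ d); auto. replace (x + c * d + d)%nat with (x + S c * d)%nat by lia. exact H. }
  exists (n / d)%nat. pose proof (Nat.div_mod_eq n d) as DM.
  assert (Hr : (n mod d < d)%nat) by (apply Nat.mod_upper_bound; lia).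
  destruct (Nat.eq_dec (n mod d) 0) as [z | nz]; [lia | exfalso].
  apply (Min (n mod d)%nat); [lia |]. apply (Red (n / d)%nat).
  replace (n mod d + n / d * d)%nat with n by lia. exact En.
Qed.

Section Family.

Variables (k : nat) (P : nat -> point) (a : list nat).
Hypothesis Hk : (3 <= k)%nat.
Hypothesis HP : right_angled k P.

Let n := (2 * k)%nat.
Let v := vert k P.
Let m := snorm k P.
Let q := length a.
Let al (i : nat) : nat := nth (i mod q) a 0%nat.
Let Hn : (6 <= n)%nat.
Proof. unfold n. lia. Qed.
Let RP : rpoly n v m (slen k P) := rpoly_of_right_angled k P Hk HP.

Variables (p t : nat -> nat -> vec3) (L : nat -> nat -> R).
Hypothesis TR : forall r, trajectory n (fun j => m (j + r)%nat) q al (p r) (t r) (L r).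

Let tau (r : nat) : list point := map (fun i => unlift (p r i)) (seq 0 q).

Lemma family_relabel (r : nat) : trajectory n m q (fun i => (al i + r) mod n)%nat (p r) (t r) (L r).
Proof. apply trajectory_relabel; [lia | apply (rp_per_m _ _ _ _ RP) | apply TR]. Qed.

Lemma family_q : (1 <= q)%nat.
Proof. apply (TR 0). Qed.

Lemma family_letter (i : nat) : (al i < n)%nat.
Proof. apply (TR 0). Qed.

Lemma family_per (i : nat) : al (i + q)%nat = al i.
Proof. apply (TR 0). Qed.

Lemma family_unique (r j : nat) (b : nat -> nat) (p' t' : nat -> vec3) (L' : nat -> R) :
  trajectory n m q b p' t' L' -> (forall i, b i = ((al (i + j) + r) mod n)%nat) ->
  forall i, p' i = p r (i + j)%nat.
Proof.
  intros T E.
  assert (Eb : b = (fun i => (al (i + j) + r) mod n)%nat) by (apply functional_extensionality, E).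
  rewrite Eb in T.
  exact (trajectory_unique n v m _ Hn RP q _ _ _ _ _ _ _ T
    (trajectory_rotate n m q j _ _ _ _ (family_relabel r))).
Qed.

Lemma family_period (r x : nat) : label_period n al x -> exists j, forall i, p (r + x) i = p r (i + j)%nat.
Proof.
  intros [j H]. exists j. apply (family_unique r j _ _ _ _ (family_relabel (r + x))).
  intros i. rewrite <- H, Nat.Div0.add_mod_idemp_l. f_equal. lia.
Qed.

Lemma family_length_period (r x : nat) : label_period n al x -> rsum q (L (r + x)) = rsum q (L r).
Proof.
  intros H. destruct (family_period r x H) as [j E].
  rewrite <- (rsum_shift q j (L r)) by apply TR. apply rsum_ext. intros i _.
  rewrite <- (traj_dist _ _ _ _ _ _ _ (TR (r + x)) i), <- (traj_dist _ _ _ _ _ _ _ (TR r) (i + j)), !E. reflexivity.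
Qed.

(** A bounce lies on exactly one side, so equal bounce points force equal letters. *)
Lemma family_same (r r' : nat) : same_traj (tau r) (tau r') ->
  exists j, forall i, ((al i + r') mod n = (al (i + j) + r) mod n)%nat.
Proof.
  intros [s E]. pose proof family_q as Hq.
  assert (Len : length (tau r) = q) by (unfold tau; rewrite length_map, length_seq; reflexivity).
  destruct (nth_rotl (tau r) s) as (j & Hj & N).
  { intros z. rewrite z in Len. simpl in Len. lia. }
  rewrite Len in Hj, N. exists j.
  assert (Pt : forall i, p r' i = p r (i + j)%nat).
  { intros i. rewrite (periodic_mod q (p r')) by apply TR. set (i' := (i mod q)%nat).
    assert (Hi : (i' < q)%nat) by (apply Nat.mod_upper_bound; lia).
    specialize (N (0, 0) i' Hi). rewrite <- E in N. unfold tau in N.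
    assert (Hij : ((i' + j) mod q < q)%nat) by (apply Nat.mod_upper_bound; lia).
    rewrite !nth_map_seq in N by assumption.
    rewrite (periodic_mod q (p r) ltac:(apply TR) (i + j)%nat).
    replace ((i + j) mod q)%nat with ((i' + j) mod q)%nat by (unfold i'; apply Nat.Div0.add_mod_idemp_l).
    rewrite <- (proj2 (unlift_disc _ (tr_hyp _ _ _ _ _ _ _ (TR r') i'))), N.
    apply unlift_disc, TR. }
  intros i.
  destruct (Nat.eq_dec ((al i + r') mod n) ((al (i + j) + r) mod n)) as [e | ne]; [exact e | exfalso].
  pose proof (tr_on _ _ _ _ _ _ _ (family_relabel r') i) as Z. cbv beta in Z. rewrite Pt in Z.
  pose proof (tr_side _ _ _ _ _ _ _ (family_relabel r) (i + j)%nat ((al i + r') mod n)%nat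
    ltac:(apply Nat.mod_upper_bound; lia) ne) as S. lra.
Qed.

Lemma family_closed (r : nat) : closed_traj k P (map (fun i => (al i + r) mod n)%nat (seq 0 q)) (tau r).
Proof. apply (trajectory_closed_traj k P Hk HP q _ _ _ _ (family_relabel r)). Qed.

Lemma undo_shift (x r : nat) : (x < n)%nat -> (((x + r) mod n + r * (n - 1)) mod n = x)%nat.
Proof.
  intros Hx. rewrite Nat.Div0.add_mod_idemp_l. replace (x + r + r * (n - 1))%nat with (x + r * n)%nat by nia.
  rewrite Nat.Div0.mod_add. apply Nat.mod_small, Hx.
Qed.

Lemma family_in_gamma (r : nat) : in_gamma k P a (tau r).
Proof.
  exists (map (fun i => (al i + r) mod n)%nat (seq 0 q)). split; [apply family_closed |].
  exists (r * (n - 1))%nat, 0%nat. unfold shift_labels, rotl. simpl skipn. simpl firstn.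
  rewrite app_nil_r. fold n. apply (nth_ext _ _ 0%nat 0%nat); rewrite !length_map, length_seq; [reflexivity |].
  intros i Hi. rewrite map_map, nth_map_seq by exact Hi. rewrite undo_shift by apply family_letter.
  unfold al. rewrite Nat.mod_small by exact Hi. reflexivity.
Qed.

Lemma family_cover (ps : list point) : in_gamma k P a ps ->
  length ps = q /\ exists r j, forall i, (i < q)%nat -> nth i ps (0, 0) = unlift (p r (i + j)%nat).
Proof.
  intros (s & C & r0 & m0 & E). pose proof family_q as Hq.
  destruct (closed_traj_trajectory k P Hk HP s ps C) as (Len & D & t' & L' & T).
  assert (Ls : length s = q).
  { apply (f_equal (@length nat)) in E. unfold shift_labels, rotl in E.
    rewrite length_map, length_app, length_skipn, length_firstn in E. fold q in E. lia. }
  rewrite Ls in *. split; [exact Len |].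
  destruct (nth_rotl a m0) as (j & Hj & N).
  { intros z. unfold q in Hq. rewrite z in Hq. simpl in Hq. lia. }
  fold q in Hj, N. exists (r0 * (n - 1))%nat, j.
  assert (F : forall i, lift (nth (i mod q) ps (0, 0)) = p (r0 * (n - 1))%nat (i + j)%nat).
  { apply (family_unique _ j _ _ _ _ T). intros i.
    assert (Hi : (i mod q < q)%nat) by (apply Nat.mod_upper_bound; lia).
    pose proof (tr_letter _ _ _ _ _ _ _ T i) as Hs. cbv beta in Hs.
    specialize (N 0%nat _ Hi). rewrite <- E in N. unfold shift_labels in N. fold n in N.
    rewrite (nth_indep _ 0%nat ((0 + r0) mod n)%nat) in N by (rewrite length_map; lia).
    rewrite (map_nth (fun x => (x + r0) mod n)%nat) in N.
    rewrite Nat.Div0.add_mod_idemp_l in N. unfold al. rewrite <- N. symmetry. apply undo_shift, Hs. }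
  intros i Hi. specialize (F i). rewrite Nat.mod_small in F by exact Hi. rewrite <- F.
  symmetry. apply unlift_lift. specialize (D i). rewrite Nat.mod_small in D by exact Hi. exact D.
Qed.

Lemma family_length (r : nat) : traj_length (tau r) = rsum q (L r).
Proof.
  pose proof family_q as Hq. unfold traj_length.
  assert (Len : length (tau r) = q) by (unfold tau; rewrite length_map, length_seq; reflexivity).
  rewrite Len, sumR_map_seq. apply rsum_ext. intros i Hi.
  assert (Hi' : (S i mod q < q)%nat) by (apply Nat.mod_upper_bound; lia).
  unfold tau. rewrite !nth_map_seq by assumption. rewrite hdist_hd.
  rewrite !(fun j => proj2 (unlift_disc _ (tr_hyp _ _ _ _ _ _ _ (TR r) j))).
  rewrite <- (periodic_mod q (p r) ltac:(apply TR) (S i)). apply (traj_dist _ _ _ _ _ _ _ (TR r)).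
Qed.

(** The shifts below the least label period d list the family without repetition. Lengths repeat
    with period d, and d divides n, so the mean over all n labellings is the mean over the
    family. *)
Lemma family_avg : avg_length k P a (rsum n (fun r => rsum q (L r)) / INR n).
Proof.
  pose proof family_q as Hq.
  destruct (least_positive (label_period n al) n) as (d & Hd & Ed & Min); [lia | |].
  { exists 0%nat. intros i. rewrite Nat.add_0_r. replace (al i + n)%nat with (al i + 1 * n)%nat by lia.
    rewrite Nat.Div0.mod_add. apply Nat.mod_small, family_letter. }
  destruct (label_period_dvd n q al d Hq ltac:(lia) family_letter family_per Hd Ed Min) as [c Hc].
  exists (map tau (seq 0 d)). rewrite !length_map, length_seq.
  split; [destruct d; [lia | discriminate] |]. split; [| split; [| split]].
  - intros ps H. apply in_map_iff in H. destruct H as (r & <- & _). apply family_in_gamma.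
  - intros ps H. destruct (family_cover ps H) as (Len & r & j & E).
    assert (Red : forall r, exists r' j', (r' < d)%nat /\ forall i, p r i = p r' (i + j')%nat).
    { clear r j E. intros r. induction r as [r IH] using lt_wf_ind.
      destruct (Nat.lt_ge_cases r d) as [h | h].
      - exists r, 0%nat. split; [exact h |]. intros i. rewrite Nat.add_0_r. reflexivity.
      - destruct (IH (r - d)%nat ltac:(lia)) as (r' & j' & Hr' & E').
        destruct (family_period (r - d) d Ed) as [j E]. replace (r - d + d)%nat with r in E by lia.
        exists r', (j + j')%nat. split; [exact Hr' |]. intros i. rewrite E, E'. f_equal. lia. }
    destruct (Red r) as (r' & j' & Hr' & E').
    exists (tau r'). split; [apply in_map, in_seq; lia |].
    assert (Len' : length (tau r') = q) by (unfold tau; rewrite length_map, length_seq; reflexivity).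
    apply (rotl_of_nth (tau r') ps (j + j') (0, 0)); [rewrite Len'; exact Len |]. rewrite Len'. intros i Hi.
    assert (Hi' : ((i + (j + j')) mod q < q)%nat) by (apply Nat.mod_upper_bound; lia).
    rewrite E by exact Hi. unfold tau. rewrite nth_map_seq by exact Hi'. f_equal.
    rewrite E', <- (periodic_mod q (p r') ltac:(apply TR)). f_equal. lia.
  - assert (Lt : forall i j, (i < j < d)%nat -> ~ exists l, forall x, ((al x + j) mod n = (al (x + l) + i) mod n)%nat).
    { intros i j Hij [l H]. apply (Min (j - i)%nat); [lia |]. exists l. intros x.
      apply (mod_add_cancel n i); [apply Nat.mod_upper_bound; lia | apply family_letter |].
      rewrite Nat.Div0.add_mod_idemp_l, <- H. f_equal. lia. }
    intros i j Hi Hj ne. rewrite !nth_map_seq by assumption. intros S. apply family_same in S.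
    destruct (Nat.lt_gt_cases i j) as [h _]. destruct (h ne) as [h1 | h1].
    + apply (Lt i j ltac:(lia) S).
    + apply (Lt j i ltac:(lia)). destruct S as [l S]. exists (l * (q - 1))%nat. intros x.
      rewrite S. replace (x + l * (q - 1) + l)%nat with (x + l * q)%nat by nia.
      rewrite (periodic_mul q al family_per l x). reflexivity.
  - rewrite map_map, (sumR_map_seq (fun r => traj_length (tau r))).
    rewrite (rsum_ext d _ (fun r => rsum q (L r))) by (intros; apply family_length).
    rewrite Hc at 1 2. rewrite rsum_period_mul, mult_INR.
    + assert (0 < INR d) by (apply lt_0_INR; lia). assert (0 < INR c) by (apply lt_0_INR; destruct c; lia).
      field. lra.
    + intros r. apply family_length_period, Ed.
Qed.

End Family.

(** * Congruence and the main theorem *)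

Definition frame_map (p e m p' e' m' x : vec3) : vec3 :=
  vadd (vscal (- mink x p) p') (vadd (vscal (mink x e) e') (vscal (mink x m) m')).

Lemma frame_map_coords (p e m p' e' m' x : vec3) : frame p' e' m' ->
  mink (frame_map p e m p' e' m' x) p' = mink x p /\
  mink (frame_map p e m p' e' m' x) e' = mink x e /\
  mink (frame_map p e m p' e' m' x) m' = mink x m.
Proof.
  intros (F1 & F2 & F3 & F4 & F5 & F6). unfold frame_map. mexp.
  rewrite (mink_comm e' p'), (mink_comm m' p'), (mink_comm m' e'), F1, F2, F3, F4, F5, F6.
  repeat split; ring.
Qed.

Lemma mink_frame_map (p e m p' e' m' x y : vec3) : frame p e m -> frame p' e' m' ->
  mink (frame_map p e m p' e' m' x) (frame_map p e m p' e' m' y) = mink x y.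
Proof.
  intros F F'. rewrite (frame_mink _ _ _ _ _ F'), (frame_mink _ _ _ x y F).
  destruct (frame_map_coords p e m p' e' m' x F') as (-> & -> & ->).
  destruct (frame_map_coords p e m p' e' m' y F') as (-> & -> & ->). reflexivity.
Qed.

Lemma frame_map_inverse (p e m p' e' m' x : vec3) : frame p e m -> frame p' e' m' ->
  frame_map p' e' m' p e m (frame_map p e m p' e' m' x) = x.
Proof.
  intros F F'. unfold frame_map at 1.
  destruct (frame_map_coords p e m p' e' m' x F') as (-> & -> & ->).
  symmetry. apply frame_expand, F.
Qed.

Lemma frame_map_linear (p e m p' e' m' x y : vec3) (a b : R) :
  frame_map p e m p' e' m' (vadd (vscal a x) (vscal b y)) =
  vadd (vscal a (frame_map p e m p' e' m' x)) (vscal b (frame_map p e m p' e' m' y)).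
Proof.
  unfold frame_map. mexp. generalize (mink x p) (mink y p) (mink x e) (mink y e) (mink x m) (mink y m).
  clear. revert p' e' m'. vring.
Qed.

Lemma frame_map_hyp (p e m p' e' m' x : vec3) : frame p e m -> frame p' e' m' -> hyp p -> hyp p' ->
  hyp x -> hyp (frame_map p e m p' e' m' x).
Proof.
  intros F F' Hp Hp' Hx. apply (hyp_of_mink_neg p' _ Hp').
  - rewrite mink_frame_map by assumption. apply Hx.
  - destruct (frame_map_coords p e m p' e' m' x F') as (-> & _). pose proof (hyp_mink x p Hx Hp). lra.
Qed.

(** One corner and the side lengths determine the polygon: the recursions for vertices and normals
    have the same coefficients in both polygons, and [A] is linear. *)
Lemma frame_map_normals (n : nat) (v m v' m' : nat -> vec3) (len : nat -> R) :
  rpoly n v m len -> rpoly n v' m' len ->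
  let A := frame_map (v 1%nat) (m 0%nat) (m 1%nat) (v' 1%nat) (m' 0%nat) (m' 1%nat) in
  forall i, A (v (S i)) = v' (S i) /\ A (m i) = m' i /\ A (m (S i)) = m' (S i).
Proof.
  intros RP RP' A. induction i as [| i (I1 & I2 & I3)].
  - destruct (rp_frame _ _ _ _ RP 0) as (F1 & F2 & F3 & F4 & F5 & F6).
    unfold A, frame_map.
    rewrite (mink_comm (m 0%nat) (v 1%nat)), (mink_comm (m 1%nat) (v 1%nat)), (mink_comm (m 1%nat) (m 0%nat)),
      F1, F2, F3, F4, F5, F6.
    generalize (v' 1%nat) (m' 0%nat) (m' 1%nat). clear. repeat split; vring.
  - split; [| split; [exact I3 |]].
    + rewrite (rp_next _ _ _ _ RP), (rp_next _ _ _ _ RP'). unfold A. rewrite frame_map_linear. fold A.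
      rewrite I1, I2. reflexivity.
    + rewrite (rp_normal_next n v m len RP), (rp_normal_next n v' m' len RP'). unfold A.
      rewrite frame_map_linear. fold A. rewrite I1, I2. reflexivity.
Qed.

Lemma region_iff (k : nat) (P : nat -> point) (z : point) : (3 <= k)%nat -> right_angled k P ->
  (region k P z <-> in_disc z /\ forall i, (i < 2 * k)%nat -> 0 <= mink (snorm k P i) (lift z)).
Proof.
  intros Hk HP. unfold region.
  assert (E : forall i, (i < 2 * k)%nat ->
    orient (P i) (P (nxt k i)) z = sinh (slen k P i) * mink (snorm k P i) (lift z)).
  { intros i Hi. destruct (lift_vertex k P Hk HP i Hi) as (E1 & E2 & _). unfold orient. rewrite E1, E2.
    unfold snorm. rewrite mink_scal_l, mink_cross.
    pose proof (sinh_positive _ (slen_pos k P Hk HP i)). field. lra. }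
  split; intros [D H]; (split; [exact D |]); intros i Hi; specialize (H i Hi); rewrite ?E in * by exact Hi;
    pose proof (sinh_positive _ (slen_pos k P Hk HP i)) as s.
  - apply (Rmult_le_reg_l (sinh (slen k P i))); [exact s | lra].
  - apply Rle_ge, Rmult_le_pos; lra.
Qed.

(** The linear map matching the frames at one vertex matches all normals, and the regions are cut
    out by the normals. *)
Lemma isometric_of_slen (k : nat) (P P' : nat -> point) : (3 <= k)%nat ->
  right_angled k P -> right_angled k P' -> (forall i, slen k P i = slen k P' i) -> isometric k P P'.
Proof.
  intros Hk HP HP' Hlen.
  pose proof (rpoly_of_right_angled k P Hk HP) as RP. pose proof (rpoly_of_right_angled k P' Hk HP') as RP'.
  replace (slen k P') with (slen k P) in RP' by (apply functional_extensionality, Hlen).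
  set (v := vert k P) in *. set (m := snorm k P) in *. set (v' := vert k P') in *. set (m' := snorm k P') in *.
  set (A := frame_map (v 1%nat) (m 0%nat) (m 1%nat) (v' 1%nat) (m' 0%nat) (m' 1%nat)).
  set (B := frame_map (v' 1%nat) (m' 0%nat) (m' 1%nat) (v 1%nat) (m 0%nat) (m 1%nat)).
  pose proof (rp_frame _ _ _ _ RP 0) as F. pose proof (rp_frame _ _ _ _ RP' 0) as F'.
  pose proof (rp_hyp _ _ _ _ RP 1) as Hv. pose proof (rp_hyp _ _ _ _ RP' 1) as Hv'.
  assert (HA : forall x, hyp x -> hyp (A x)) by (intros; apply frame_map_hyp; assumption).
  assert (HB : forall x, hyp x -> hyp (B x)) by (intros; apply frame_map_hyp; assumption).
  assert (MA : forall x y, mink (A x) (A y) = mink x y) by (intros; apply mink_frame_map; assumption).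
  assert (AB : forall x, A (B x) = x) by (intros; apply frame_map_inverse; assumption).
  assert (NA : forall i, A (m i) = m' i) by (intros i; apply (frame_map_normals _ _ _ _ _ _ RP RP')).
  set (f := fun z => unlift (A (lift z))).
  assert (Hf : forall z, in_disc z -> in_disc (f z) /\ lift (f z) = A (lift z)).
  { intros z Dz. apply unlift_disc, HA, lift_hyp, Dz. }
  exists f. split; [split |].
  - intros z Dz. apply Hf, Dz.
  - intros z w Dz Dw. rewrite !hdist_hd, (proj2 (Hf z Dz)), (proj2 (Hf w Dw)). unfold hdv. rewrite MA. reflexivity.
  - intros z. split.
    + intros R. apply (region_iff k P' z Hk HP') in R. destruct R as [Dz R].
      destruct (unlift_disc _ (HB _ (lift_hyp z Dz))) as [Dy Ey]. exists (unlift (B (lift z))). split.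
      * apply (region_iff k P _ Hk HP). split; [exact Dy |]. intros i Hi.
        rewrite Ey, <- MA, AB. fold m. rewrite NA. apply R, Hi.
      * unfold f. rewrite Ey, AB. apply unlift_lift, Dz.
    + intros (y & R & <-). apply (region_iff k P y Hk HP) in R. destruct R as [Dy R].
      destruct (Hf y Dy) as [Dz Ez]. apply (region_iff k P' _ Hk HP'). split; [exact Dz |]. intros i Hi.
      rewrite Ez. fold m'. rewrite <- NA, MA. apply R, Hi.
Qed.

Lemma regular_slen (k : nat) (P : nat -> point) : (3 <= k)%nat -> regular k P ->
  forall i, slen k P i = slen k P 0.
Proof.
  intros Hk HR.
  assert (E : forall i, slen k P i = hdist (P 0%nat) (P 1%nat)).
  { intros i. rewrite <- (HR (i mod (2 * k))%nat) by (apply Nat.mod_upper_bound; lia).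
    unfold slen, vert, nxt. rewrite hdist_hd, mod_S_mod. reflexivity. }
  intros i. rewrite !E. reflexivity.
Qed.

Lemma family_exists (k : nat) (a : list nat) (P : nat -> point) : (3 <= k)%nat ->
  billiard_sequence k a -> right_angled k P ->
  exists (p t : nat -> nat -> vec3) (L : nat -> nat -> R), forall r,
    trajectory (2 * k) (fun j => snorm k P (j + r)%nat) (length a)
      (fun i => nth (i mod length a) a 0%nat) (p r) (t r) (L r).
Proof.
  intros Hk (Q & ps & HQ & C) HP.
  destruct (closed_traj_trajectory k Q Hk HQ a ps C) as (_ & _ & t0 & L0 & T0).
  assert (X : forall r, exists y : (nat -> vec3) * (nat -> vec3) * (nat -> R),
    trajectory (2 * k) (fun j => snorm k P (j + r)%nat) (length a)
      (fun i => nth (i mod length a) a 0%nat) (fst (fst y)) (snd (fst y)) (snd y)).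
  { intros r.
    destruct (trajectory_transfer (2 * k) _ _ _ _ _ _ _ _ _ _ _ ltac:(lia)
      (rpoly_of_right_angled k Q Hk HQ) (rpoly_rotate _ _ _ _ r (rpoly_of_right_angled k P Hk HP)) T0)
      as (p & t & L & T). exists (p, t, L). exact T. }
  set (y := fun r => proj1_sig (constructive_indefinite_description _ (X r))).
  exists (fun r => fst (fst (y r))), (fun r => snd (fst (y r))), (fun r => snd (y r)).
  intros r. exact (proj2_sig (constructive_indefinite_description _ (X r))).
Qed.

Theorem theorem1p3 (k : nat) (a : list nat) (P0 P : nat -> point) :
  (3 <= k)%nat ->
  billiard_sequence k a ->
  right_angled k P0 -> regular k P0 ->
  right_angled k P ->
  exists L0 L, avg_length k P0 a L0 /\ avg_length k P a L /\
    L0 <= L /\ (L0 = L -> isometric k P P0).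
Proof.
  intros Hk HA HP0 HR HP.
  destruct (family_exists k a P0 Hk HA HP0) as (p0 & t0 & l0 & T0).
  destruct (family_exists k a P Hk HA HP) as (p & t & l & T).
  pose proof (rpoly_of_right_angled k P0 Hk HP0) as RP0. pose proof (rpoly_of_right_angled k P Hk HP) as RP.
  pose proof (regular_slen k P0 Hk HR) as Reg.
  set (n := (2 * k)%nat) in *. set (q := length a) in *. assert (Hn : (6 <= n)%nat) by (unfold n; lia).
  assert (Pos : 0 < INR n) by (apply lt_0_INR; lia).
  set (A := fun r => rsum q (l r)). set (A0 := fun r => rsum q (l0 r)).
  exists (rsum n A0 / INR n), (rsum n A / INR n).
  split; [apply (family_avg k P0 a Hk HP0 p0 t0 l0 T0) |].
  split; [apply (family_avg k P a Hk HP p t l T) |].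
  (* Each labelling of the regular polygon serves as the reference in turn; summing over r avoids
     showing that its trajectories all have the same length. *)
  assert (Main : forall r, INR n * A0 r <= rsum n A /\
    (INR n * A0 r = rsum n A -> forall i, slen k P i = slen k P0 0)).
  { intros r.
    destruct (main_inequality n Hn _ _ _ (rpoly_rotate _ _ _ _ r RP0) (fun i => eq_trans (Reg _) (eq_sym (Reg _)))
      _ _ _ RP q _ _ _ _ (T0 r) p t l (fun s _ => T s)) as [I E].
    split; [exact I |]. intros H i. rewrite (E H i). apply Reg. }
  assert (Sum : rsum n (fun r => INR n * A0 r) <= rsum n (fun _ => rsum n A)) by (apply rsum_le; intros; apply Main).
  rewrite rsum_scal, rsum_const in Sum. split.
  - apply Rmult_le_compat_r; [left; apply Rinv_0_lt_compat; exact Pos |].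
    apply (Rmult_le_reg_l (INR n)); assumption.
  - intros E.
    assert (E' : rsum n A0 = rsum n A).
    { apply (Rmult_eq_reg_r (/ INR n)); [exact E | apply Rgt_not_eq, Rinv_0_lt_compat, Pos]. }
    apply isometric_of_slen; auto. intros i. rewrite (Reg i). apply (Main 0%nat).
    apply (rsum_le_eq n (fun r => INR n * A0 r) (fun _ => rsum n A)); [intros; apply Main | | lia].
    rewrite rsum_scal, rsum_const, E'. reflexivity.
Qed.
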